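(* The core $Z$ is a nonsingular variety, and consequently the complete space of tetrahedra $\widetilde{X}$ is a nonsingular variety.
   Context: Everything is over $\mathbb{C}$. **The space of tetrahedra $X$.** Let $[4]=\{1,2,3,4\}$, let $e_1,\dots,e_4$ be the standard basis of $\mathbb{C}^4$, and $E_I=\mathrm{span}\{e_i\mid i\in I\}$ for $I\subset[4]$. Let $\mathrm{Gr}_k$ be the Grassmannian of $k$-dimensional subspaces of $\mathbb{C}^4$, let $Y=\prod_{\emptyset\subsetneq I\subsetneq[4]}\mathrm{Gr}_{|I|}$, with projections $\pi_I:Y\to\mathrm{Gr}_{|I|}$, and put $\pi_\emptyset(p)=0$, $\pi_{[4]}(p)=\mathbb{C}^4$. The group $G=\mathrm{GL}_4(\mathbb{C})$ acts diagonally on $Y$. Let $p_0\in Y$ be the point with $\pi_I(p_0)=E_I$ for all $I$, let $X^\circ=G\cdot p_0$, and let $X=\overline{X^\circ}$ (Zariski closure in $Y$). For $p\in X$, $\pi_I(p)\subset\pi_J(p)$ whenever $I\subset J$. **Hypersimplices.** For $k=1,2,3$, $\Delta_k$ is the convex hull in $\mathbb{R}^4$ of the vectors $\sum_{i\in I}\varepsilon_i$, $|I|=k$ ($\varepsilon_i$ the standard basis); its vertices are indexed by the $k$-subsets $I\subset[4]$. Let $\mathcal{E}_k$ be the set of pairs $\{I,J\}$ that are edges of $\Delta_k$ (i.e. $|I|=|J|=k$, $|I\cap J|=k-1$) and $\mathcal{E}=\mathcal{E}_1\cup\mathcal{E}_2\cup\mathcal{E}_3$. Let $\mathcal{H}$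 be the set of (vertex sets of) all faces of dimension $\ge 2$ of $\Delta_1,\Delta_2,\Delta_3$: the three $\Delta_k$ themselves and $16$ triangular faces. For $\beta\in\mathcal{H}$ let $\mathcal{E}(\beta)\subset\mathcal{E}$ be the set of edges of $\beta$. Subsets of $[4]$ are totally ordered by $\emptyset<1<2<3<4<12<13<14<23<24<34<123<124<134<234<1234$. **The variety $\widetilde{X}$.** Let $F_I\to X$ be the vector bundle whose fiber at $p$ is $\pi_I(p)$. For $\alpha=\{I,J\}\in\mathcal{E}$ with $I<J$, let $F_\alpha=F_{I\cup J}/F_{I\cap J}$ (rank $2$), $P_\alpha=\mathbb{P}(F_\alpha)$ (lines in the fibers), $E_\alpha=P_\alpha\times_X P_\alpha$, let $D_\alpha\subset E_\alpha$ be the diagonal, and let $u_\alpha:X\to E_\alpha$ be the section $p\mapsto(\pi_I(p)/\pi_{I\cap J}(p),\ \pi_J(p)/\pi_{I\cap J}(p))$. For $\beta\in\mathcal{H}$ let $E_\beta=\prod_{\alpha\in\mathcal{E}(\beta)}E_\alpha$ and $D_\beta=\prod_{\alpha\in\mathcal{E}(\beta)}D_\alpha$ (products over $X$), let $u_\beta=\prod_{\alpha\in\mathcal E(\beta)} u_\alpha$, and let $b_\beta:(E_\beta)_\#\to E_\beta$ be the blowup along $D_\beta$. Let $E_\#=\prod_{\beta\in\mathcal{H}}(E_\beta)_\#$ (product over $X$). Since $u_\beta(X^\circ)$ avoids $D_\beta$, the maps $b_\beta^{-1}\circ u_\beta$ define an embedding $X^\circ\to E_\#$; its image is $\widetilde{X}^\circ$,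 and the complete space of tetrahedra $\widetilde{X}$ is the closure of $\widetilde{X}^\circ$ in $E_\#$. **Local charts.** The flag at infinity is $V_1=E_{\{4\}}\subset V_2=E_{\{3,4\}}\subset V_3=E_{\{2,3,4\}}$. Let $U\subset X$ be the affine open set of all $p$ such that $\pi_I(p)$ is transverse to $V_k$ for all $1\le k\le3$ and all $\emptyset\ne I\subsetneq[4]$; let $U^\circ=U\cap X^\circ$, let $\widetilde{U}^\circ$ be the image of $U^\circ$ in $E_\#|_U$, and let $\widetilde{U}$ be its closure in $E_\#|_U$. For $|I|=|J|=k$ let $f_{I,J}=\pi_I^*(f_J/f_{I_0})$ be the regular function on $U$, where the $f_J$ are Plücker coordinates on $\mathrm{Gr}_k$ and $I_0=1,12,123$ for $k=1,2,3$. The flag coordinates on $U$ are $f_{1,2},f_{1,3},f_{1,4},f_{12,13},f_{12,14},f_{123,124}$. For $\alpha=\{I,J\}\in\mathcal{E}_k$ with $I<J$, the edge coordinate is $x_\alpha=f_{J,K}-f_{I,K}$, where $K=2,13,124$ for $k=1,2,3$ respectively. Let $\mathbb{A}_{op}=\mathrm{Spec}$ of the polynomial ring in the six flag coordinates, $\mathbb{A}_{\mathcal{E}}=\mathrm{Spec}\,\mathbb{C}[x_\alpha\mid\alpha\in\mathcal{E}]$, and $\mathbb{P}_\beta=\mathrm{Proj}\,\mathbb{C}[y_{\alpha,\beta}\mid\alpha\in\mathcal{E}(\beta)]$ for $\beta\in\mathcal{H}$. **The core.** There is a closed embedding $\widetilde{U}\to\mathbb{A}_{op}\times\mathbb{A}_{\mathcal{E}}\times\prod_{\beta\in\mathcal{H}}\mathbb{P}_\beta$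 which on $\widetilde{U}^\circ\cong U^\circ$ sends $p$ to (its flag coordinates, its edge coordinates $(x_\alpha(p))_{\alpha}$, the points $[x_\alpha(p)]_{\alpha\in\mathcal{E}(\beta)}\in\mathbb{P}_\beta$ for $\beta\in\mathcal{H}$). The core $Z$ is the image of the composition of this embedding with the projection to $\prod_{\beta\in\mathcal{H}}\mathbb{P}_\beta$. *)

(* Defs.v *)
From HB Require Import structures.
From mathcomp Require Import all_boot all_order all_algebra.
From mathcomp Require Import boolp classical_sets reals complex.
From mathcomp Require Import mpoly.

Set Implicit Arguments.
Unset Strict Implicit.
Unset Printing Implicit Defensive.

Import Order.TTheory GRing.Theory Num.Theory.
Local Open Scope ring_scope.
Local Open Scope classical_set_scope.

Section Noetherian.
(* The members of [closed] are the closed sets of a topology on T. *)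
Variables (T : Type) (closed : set (set T)).

Definition irreducible (S : set T) : Prop :=
  S !=set0 /\
  forall A B, closed A -> closed B -> S `<=` A `|` B -> S `<=` A \/ S `<=` B.

Definition locally_closed (S : set T) : Prop :=
  exists A B, [/\ closed A, closed B & S = A `\` B].

(* Y 0 < ... < Y d, irreducible and closed in the subspace S *)
Definition irr_chain (S : set T) (d : nat) : Prop :=
  exists Y : nat -> set T,
    (forall i, (i <= d)%N ->
       irreducible (Y i) /\ exists2 A, closed A & Y i = S `&` A) /\
    (forall i, (i < d)%N -> Y i `<` Y i.+1).

Definition has_krull_dim (S : set T) (d : nat) : Prop :=
  irr_chain S d /\ ~ irr_chain S d.+1.

End Noetherian.

Section Affine.
Variables (C : fieldType) (K : finType).
Implicit Types (S : set {ffun K -> C}) (v : {ffun K -> C})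
  (F : {mpoly C[#|K|]}).

Definition mpeval F v : C := F.@[fun i => v (enum_val i)].

Definition vanishing_ideal S : set {mpoly C[#|K|]} :=
  [set F | forall v, S v -> mpeval F v = 0].

Definition zclosure S : set {ffun K -> C} :=
  [set v | forall F, vanishing_ideal S F -> mpeval F v = 0].

Definition zclosed S : Prop := zclosure S `<=` S.

Definition tangent_space S v : set 'rV[C]_#|K| :=
  [set w | forall F, vanishing_ideal S F ->
             \sum_(i < #|K|) mpeval (F^`M(i)) v * w 0 i = 0].

(* Jacobian criterion: the kernel of the Jacobian of I(S) at v has dimension
   dim S.  Meant for irreducible S, for which dim S is the dimension at v. *)
Definition nonsingular_at S v : Prop :=
  exists W : {vspace 'rV[C]_#|K|},
    (forall w, w \in W <-> tangent_space S v w) /\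
    has_krull_dim zclosed S (\dim W).

End Affine.

(* The homogeneous coordinates are indexed by K.  If deg k = Some i, then k is
   a homogeneous coordinate of the i-th projective factor; if deg k = None, then
   k is a coordinate of the affine factor.  A point is a class, modulo the
   torus of rescalings, of vectors which are nonzero in each projective factor,
   and a set of points is represented by its multicone, the set of all
   representatives of its points. *)
Section MultiProjective.
Variables (C : fieldType) (K I : finType) (deg : K -> option I).
Implicit Types (S A : set {ffun K -> C}) (v : {ffun K -> C}).

Definition is_point v : Prop := forall i, exists2 k, deg k = Some i & v k != 0.

Definition rescale (t : I -> C) v : {ffun K -> C} :=
  [ffun k => oapp t 1 (deg k) * v k].

Definition multicone S : set {ffun K -> C} :=
  [set w | exists v t, [/\ S v, forall i, t i != 0 & w = rescale t v]].

(* Polynomials vanishing on a multicone need not be assumed homogeneous, since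
   the ideal of a multicone is multihomogeneous when C is infinite. *)
Definition mpclosure S : set {ffun K -> C} :=
  [set v | is_point v /\ zclosure (multicone S) v].

Definition mpclosed A : Prop :=
  [/\ A `<=` is_point, multicone A `<=` A & mpclosure A `<=` A].

Definition is_variety S : Prop :=
  [/\ S `<=` is_point, multicone S `<=` S, locally_closed mpclosed S
    & irreducible mpclosed S].

(* The standard affine chart in which the coordinate c i of the factor i is
   nonzero, realized as a subset of C^K by normalizing this coordinate to 1. *)
Definition affine_chart (c : I -> K) S : set {ffun K -> C} :=
  [set v | S v /\ forall i, v (c i) = 1].

Definition nonsingular S : Prop :=
  forall c : I -> K, (forall i, deg (c i) = Some i) ->
  forall v, affine_chart c S v -> nonsingular_at (affine_chart c S) v.

Definition nonsingular_variety S : Prop := is_variety S /\ nonsingular S.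

End MultiProjective.

(* 'I_4 is {0, 1, 2, 3}; s4 [:: 1; 3] is the subset {1, 3} of {1, 2, 3, 4}. *)
Definition s4 (s : seq nat) : {set 'I_4} := [set i : 'I_4 | i.+1 \in s]%SET.

Definition psub : finType :=
  {I : {set 'I_4} | (I != finset.set0) && (I != finset.setT)}.

Definition ksub (k : nat) : finType := {S : {set 'I_4} | #|S| == k}.

(* By cardinality, then lexicographically *)
Definition sub_lt (I J : {set 'I_4}) : bool :=
  (#|I| < #|J|)%N ||
  (#|I| == #|J|) &&
  (([seq val i | i <- enum I] : seqlexi nat) < [seq val i | i <- enum J])%O.

(* The edge {I, J} is represented by the pair (I, J) with I < J. *)
Definition edge : finType :=
  {x : {set 'I_4} * {set 'I_4} |
    [&& #|x.1| == #|x.2|, #|x.1 :&: x.2|.+1 == #|x.1| & sub_lt x.1 x.2]}.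

Definition lo (a : edge) : {set 'I_4} := (val a).1.
Definition hi (a : edge) : {set 'I_4} := (val a).2.
Definition level (a : edge) : nat := #|lo a|.

Section Subspaces.
Variable F : fieldType.
Implicit Types V W : {vspace 'cV[F]_4}.

Definition coord_space (I : {set 'I_4}) : {vspace 'cV[F]_4} :=
  (\sum_(i in I) <[delta_mx i 0%R]>)%VS.

(* For \dim V = #|S|, the minor of a basis of V on the rows in S; taken for all
   S of this size, these are the Pluecker coordinates of V, for one choice of
   the common scalar factor. *)
Definition plucker V (S : {set 'I_4}) : F :=
  \det (\matrix_(i < #|S|, j < #|S|) (vbasis V)`_i (enum_val j) 0).

Definition transverse V W : Prop :=
  \dim (V :&: W) = (\dim V + \dim W - 4)%N.

End Subspaces.

Section Tetrahedra.
Variable R : realType.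
Local Notation C := R[i].
Local Notation Sub := {vspace 'cV[C]_4}.
Local Notation tetra := ({set 'I_4} -> Sub).

(* Faces of the k-th hypersimplex are represented by their vertex sets, which
   are the sets of maximizers of linear forms. *)

Definition indicator (I : {set 'I_4}) : 'rV[R]_4 := \row_i (i \in I)%:R.

Definition is_face (k : nat) (b : {set {set 'I_4}}) : Prop :=
  exists c : 'I_4 -> R, forall I : {set 'I_4},
    I \in b <->
    #|I| = k /\
    forall J : {set 'I_4}, #|J| = k -> \sum_(j in J) c j <= \sum_(i in I) c i.

Definition face_dim (b : {set {set 'I_4}}) : nat :=
  \dim <<[seq indicator A - indicator B | A <- enum b, B <- enum b]>>.

Definition hface : finType :=
  {b : {set {set 'I_4}} |
    `[< exists k, [/\ (1 <= k <= 3)%N, is_face k b & (2 <= face_dim b)%N] >]}.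

Definition edge_of (b : hface) : finType :=
  {a : edge | (lo a \in val b) && (hi a \in val b)}.

(* A point of Y is a family p indexed by all subsets of [4]: the dimension
   condition forces p set0 = 0 and p setT = C^4. *)

Definition Y : set tetra :=
  [set p : tetra | forall I : {set 'I_4}, \dim (p I) = #|I|].

Definition Xo : set tetra :=
  [set p : tetra | exists2 g : 'M[C]_4, g \in unitmx &
     forall I : {set 'I_4},
       p I = (linfun (mulmx g : 'cV_4 -> 'cV_4) @: coord_space C I)%VS].

Definition KY : finType := {I : psub & ksub #|val I|}.

Definition degY (k : KY) : option psub := Some (tag k).

Definition coordY (p : tetra) : {ffun KY -> C} :=
  [ffun k : KY => plucker (p (val (tag k))) (val (tagged k))].

Definition X : set tetra :=
  [set p : tetra | Y p /\ mpclosure degY (coordY @` Xo) (coordY p)].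

(* A line in F_(I :|: J) / F_(I :&: J) is represented by its inverse image in
   F_(I :|: J), a subspace of dimension #|I| = #|J|. *)

Local Notation config b := (tetra * (edge_of b -> Sub * Sub))%type.

Definition in_pencil (p : tetra) (a : edge) (V : Sub) : Prop :=
  [/\ (p (lo a :&: hi a)%SET <= V)%VS, (V <= p (lo a :|: hi a)%SET)%VS
    & \dim V = level a].

Definition E (b : hface) : set (config b) :=
  [set e : config b | X e.1 /\
     forall a, in_pencil e.1 (val a) (e.2 a).1 /\
               in_pencil e.1 (val a) (e.2 a).2].

Definition D (b : hface) : set (config b) :=
  [set e : config b | E e /\ forall a, (e.2 a).1 = (e.2 a).2].

Definition u (b : hface) (p : tetra) : config b :=
  (p, fun a => (p (lo (val a)), p (hi (val a)))).

(* The blowup of E b along D b.  Inside E b, the ideal sheaf of D b is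
   generated by the 2 x 2 minors formed by the Pluecker coordinates of the two
   subspaces (e.2 a).1 and (e.2 a).2, for all edges a.  To give them the same
   multidegree, the minors for a are multiplied by all monomials of bidegree
   (1, 1) in the Pluecker coordinates for each of the other edges.  The blowup
   is the closure of the graph of the map to projective space which these
   generators define outside D b. *)

Definition blowup_index (b : hface) : finType :=
  (edge_of b *
   {dffun forall a : edge_of b,
      (ksub (level (val a)) * ksub (level (val a)))%type})%type.

Definition generator (b : hface) (ab : edge_of b -> Sub * Sub)
    (x : blowup_index b) : C :=
  let: (a, s) := x in
  let A a' S := plucker (ab a').1 (val S) in
  let B a' S := plucker (ab a').2 (val S) in
  (A a (s a).1 * B a (s a).2 - A a (s a).2 * B a (s a).1) *
  \prod_(a' | a' != a) (A a' (s a').1 * B a' (s a').2).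

Definition KE (b : hface) : finType :=
  {a : edge_of b & ksub (level (val a))}.

(* The coordinates of (E b)_# other than those of X: those of the first and of
   the second subspaces, then those of the exceptional projective space. *)
Definition Kfib (b : hface) : finType := (KE b + KE b + blowup_index b)%type.

Definition Ifib (b : hface) : finType := (edge_of b + edge_of b + unit)%type.

Definition degfib (b : hface) (k : Kfib b) : Ifib b :=
  match k with
  | inl (inl x) => inl (inl (tag x))
  | inl (inr x) => inl (inr (tag x))
  | inr _ => inr tt
  end.

Definition coordfib (b : hface) (ab : edge_of b -> Sub * Sub)
    (k : Kfib b) : C :=
  match k with
  | inl (inl x) => plucker (ab (tag x)).1 (val (tagged x))
  | inl (inr x) => plucker (ab (tag x)).2 (val (tagged x))
  | inr x => generator ab x
  end.

Definition KB (b : hface) : finType := (KY + Kfib b)%type.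

Definition degB (b : hface) (k : KB b) : option (psub + Ifib b)%type :=
  match k with
  | inl x => omap inl (degY x)
  | inr x => Some (inr (degfib x))
  end.

Definition coordB (b : hface) (e : config b) : {ffun KB b -> C} :=
  [ffun k => match k with
             | inl x => coordY e.1 x
             | inr x => coordfib e.2 x
             end].

Definition blowup (b : hface) : set {ffun KB b -> C} :=
  mpclosure (@degB b) (@coordB b @` (@E b `\` @D b)).

Definition Ksharp : finType := (KY + {b : hface & Kfib b})%type.

Definition Isharp : finType := (psub + {b : hface & Ifib b})%type.

Definition degsharp (k : Ksharp) : option Isharp :=
  match k with
  | inl x => omap inl (degY x)
  | inr x => Some (inr (Tagged Ifib (degfib (tagged x))))
  end.

Definition proj_blowup (b : hface) (v : {ffun Ksharp -> C}) :
    {ffun KB b -> C} :=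
  [ffun k => match k with
             | inl x => v (inl x)
             | inr x => v (inr (Tagged Kfib x))
             end].

Definition Esharp : set {ffun Ksharp -> C} :=
  [set v | is_point degsharp v /\ forall b, blowup (proj_blowup b v)].

(* On Xo, the map to (E b)_# is the inverse of the blowup map composed with u *)
Definition coordsharp (p : tetra) : {ffun Ksharp -> C} :=
  [ffun k => match k with
             | inl x => coordY p x
             | inr x => coordfib (u (tag x) p).2 (tagged x)
             end].

Definition Xtilde : set {ffun Ksharp -> C} :=
  Esharp `&` mpclosure degsharp (coordsharp @` Xo).

Definition flag_at_infinity (k : nat) : Sub :=
  coord_space C (s4 (iota (5 - k) k)).

Definition U : set tetra :=
  [set p : tetra | X p /\ forall (I : psub) k, (1 <= k <= 3)%N ->
             transverse (p (val I)) (flag_at_infinity k)].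

Definition Uo : set tetra := U `&` Xo.

Definition plucker_ratio (p : tetra) (I J : {set 'I_4}) : C :=
  plucker (p I) J / plucker (p I) (s4 (iota 1 #|I|)).

Definition flag_index : 6.-tuple ({set 'I_4} * {set 'I_4}) :=
  [tuple (s4 [:: 1], s4 [:: 2]); (s4 [:: 1], s4 [:: 3]);
         (s4 [:: 1], s4 [:: 4]); (s4 [:: 1; 2], s4 [:: 1; 3]);
         (s4 [:: 1; 2], s4 [:: 1; 4]); (s4 [:: 1; 2; 3], s4 [:: 1; 2; 4])]%N.

Definition flag_coord (p : tetra) (i : 'I_6) : C :=
  plucker_ratio p (tnth flag_index i).1 (tnth flag_index i).2.

Definition edge_coord (p : tetra) (a : edge) : C :=
  let K := nth finset.set0 [:: s4 [:: 2]; s4 [:: 1; 3]; s4 [:: 1; 2; 4]]%N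
             (level a).-1 in
  plucker_ratio p (hi a) K - plucker_ratio p (lo a) K.

Definition Kcore : finType := {b : hface & edge_of b}.

Definition degcore (k : Kcore) : option hface := Some (tag k).

Definition Kchart : finType := ('I_6 + edge + Kcore)%type.

Definition degchart (k : Kchart) : option hface :=
  match k with inl _ => None | inr x => degcore x end.

Definition coordchart (p : tetra) : {ffun Kchart -> C} :=
  [ffun k => match k with
             | inl (inl i) => flag_coord p i
             | inl (inr a) => edge_coord p a
             | inr x => edge_coord p (val (tagged x))
             end].

(* The image of the closed embedding of the closure of Uo in the product of
   the affine spaces and the projective spaces P_b: the image of a closed
   embedding is the closure of the image of a dense subset. *)
Definition Utilde_image : set {ffun Kchart -> C} :=
  mpclosure degchart (coordchart @` Uo).

Definition core : set {ffun Kcore -> C} :=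
  [set [ffun k => v (inr k)] | v in Utilde_image].

End Tetrahedra.

(* Main.v *)
From HB Require Import structures.
From mathcomp Require Import all_boot all_order all_fingroup all_algebra.
From mathcomp Require Import boolp classical_sets reals complex.
From mathcomp Require Import mpoly ring zify.
Require Import Defs.

Set Implicit Arguments.
Unset Strict Implicit.
Unset Printing Implicit Defensive.

Import Order.TTheory GRing.Theory Num.Theory.
Local Open Scope ring_scope.

(** * Dual numbers *)

Record dual (C : Type) := Dual { std : C; eps : C }.

Section DualNumbers.
Variable C : fieldType.
Local Notation D := (dual C).
Implicit Types x y z : D.

Definition dual_pair x := (std x, eps x).
Definition pair_dual (p : C * C) := Dual p.1 p.2.
Lemma dual_pairK : cancel dual_pair pair_dual. Proof. by case. Qed.
HB.instance Definition _ := Choice.copy D (can_type dual_pairK).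

Definition dual_add x y := Dual (std x + std y) (eps x + eps y).
Definition dual_opp x := Dual (- std x) (- eps x).
Definition dual_mul x y :=
  Dual (std x * std y) (std x * eps y + eps x * std y).

Lemma dual_eqP x y : std x = std y -> eps x = eps y -> x = y.
Proof. by case: x y => [a b] [c d] /= -> ->. Qed.

Lemma dual_addA : associative dual_add.
Proof. by move=> x y z; apply: dual_eqP; rewrite /= addrA. Qed.
Lemma dual_addC : commutative dual_add.
Proof. by move=> x y; apply: dual_eqP; rewrite /= addrC. Qed.
Lemma dual_add0 : left_id (Dual 0 0) dual_add.
Proof. by move=> x; apply: dual_eqP; rewrite /= add0r. Qed.
Lemma dual_addN : left_inverse (Dual 0 0) dual_opp dual_add.
Proof. by move=> x; apply: dual_eqP; rewrite /= addNr. Qed.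
HB.instance Definition _ :=
  GRing.isZmodule.Build D dual_addA dual_addC dual_add0 dual_addN.

Lemma dual_mulA : associative dual_mul.
Proof. by move=> x y z; apply: dual_eqP => /=; ring. Qed.
Lemma dual_mulC : commutative dual_mul.
Proof. by move=> x y; apply: dual_eqP => /=; ring. Qed.
Lemma dual_mul1 : left_id (Dual 1 0) dual_mul.
Proof. by move=> x; apply: dual_eqP => /=; ring. Qed.
Lemma dual_mulDl : left_distributive dual_mul +%R.
Proof. by move=> x y z; apply: dual_eqP => /=; ring. Qed.
Lemma dual_oner_neq0 : Dual 1 0 != 0 :> D.
Proof. by apply/eqP => -[/eqP]; rewrite oner_eq0. Qed.
HB.instance Definition _ := GRing.Zmodule_isComNzRing.Build D
  dual_mulA dual_mulC dual_mul1 dual_mulDl dual_oner_neq0.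

Definition inj (c : C) : D := Dual c 0.

Lemma stdD x y : std (x + y) = std x + std y. Proof. by []. Qed.
Lemma stdN x : std (- x) = - std x. Proof. by []. Qed.
Lemma stdM x y : std (x * y) = std x * std y. Proof. by []. Qed.
Lemma epsD x y : eps (x + y) = eps x + eps y. Proof. by []. Qed.
Lemma epsN x : eps (- x) = - eps x. Proof. by []. Qed.
Lemma epsM x y : eps (x * y) = std x * eps y + eps x * std y.
Proof. by []. Qed.

Lemma inj_additive : zmod_morphism inj.
Proof. by move=> x y; apply: dual_eqP; rewrite /= ?subr0. Qed.
Lemma inj_multiplicative : monoid_morphism inj.
Proof.
by split=> // x y; apply: dual_eqP; rewrite //= mulr0 mul0r addr0.
Qed.
HB.instance Definition _ := GRing.isZmodMorphism.Build C D inj inj_additive.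
HB.instance Definition _ :=
  GRing.isMonoidMorphism.Build C D inj inj_multiplicative.

Lemma std_additive : zmod_morphism (@std C : D -> C).
Proof. by []. Qed.
Lemma std_multiplicative : monoid_morphism (@std C : D -> C).
Proof. by []. Qed.
HB.instance Definition _ := GRing.isZmodMorphism.Build D C _ std_additive.
HB.instance Definition _ :=
  GRing.isMonoidMorphism.Build D C _ std_multiplicative.
Lemma eps_additive : zmod_morphism (@eps C : D -> C).
Proof. by []. Qed.
HB.instance Definition _ := GRing.isZmodMorphism.Build D C _ eps_additive.

Definition dinv x : D := Dual (std x)^-1 (- eps x / std x ^+ 2).

Lemma mul_dinv x : std x != 0 -> x * dinv x = 1.
Proof. by move=> nz; apply: dual_eqP => /=; field. Qed.

Lemma dual_cancel (a b : D) : std a != 0 -> a * b = 0 -> b = 0.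
Proof.
by move=> nz h; rewrite -[b]mul1r -(mul_dinv nz) mulrAC h mul0r.
Qed.

End DualNumbers.

(** * Polynomials in variables indexed by a finite type *)

Section Poly.
Variables (C : numFieldType) (K : finType).
Local Notation pol := {mpoly C[#|K|]}.
Local Notation vec := {ffun K -> C}.
Implicit Types (F G : pol) (v w : vec).

Definition pX (k : K) : pol := 'X_(enum_rank k).

Definition pevf v F := mpeval F v.

Lemma mpeval_additive v : zmod_morphism (pevf v).
Proof. by move=> F G; rewrite /pevf /mpeval mevalB. Qed.
Lemma mpeval_multiplicative v : monoid_morphism (pevf v).
Proof.
by split=> [|F G]; rewrite /pevf /mpeval ?meval1 // mevalM.
Qed.
HB.instance Definition _ v :=
  GRing.isZmodMorphism.Build pol C (pevf v) (mpeval_additive v).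
HB.instance Definition _ v :=
  GRing.isMonoidMorphism.Build pol C (pevf v)
    (mpeval_multiplicative v).

Definition pev v : {rmorphism pol -> C} := pevf v.

Lemma pevE F v : mpeval F v = pev v F. Proof. by []. Qed.
Lemma pevC v c : pev v c%:MP = c.
Proof. by rewrite /pev /= /pevf /mpeval mevalC. Qed.
Lemma pevX v k : pev v (pX k) = v k.
Proof. by rewrite /pev /= /pevf /mpeval /pX mevalXU enum_rankK. Qed.

Definition dvec v w : {ffun K -> dual C} := [ffun k => Dual (v k) (w k)].

Definition devf (V : {ffun K -> dual C}) F : dual C :=
  let v := [ffun k => std (V k)] in
  Dual (mpeval F v)
    (\sum_(i < #|K|) mpeval (F^`M(i)) v * eps (V (enum_val i))).

Lemma devf_additive V : zmod_morphism (devf V).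
Proof.
move=> F G; apply: dual_eqP; rewrite /= ?pevE ?rmorphB //.
by rewrite -sumrB; apply: eq_bigr => i _; rewrite mderivB !pevE rmorphB mulrBl.
Qed.
Lemma devf_multiplicative V : monoid_morphism (devf V).
Proof.
split=> [|F G]; apply: dual_eqP; rewrite /= ?pevE ?rmorph1 ?rmorphM //.
  by rewrite big1 // => i _; rewrite mderivC pevE rmorph0 mul0r.
rewrite mulr_sumr mulr_suml -big_split; apply: eq_bigr => i _ /=.
by rewrite mderivM !pevE rmorphD !rmorphM /=; ring.
Qed.
HB.instance Definition _ V :=
  GRing.isZmodMorphism.Build pol (dual C) (devf V) (devf_additive V).
HB.instance Definition _ V :=
  GRing.isMonoidMorphism.Build pol (dual C) (devf V) (devf_multiplicative V).

Definition dev V : {rmorphism pol -> dual C} := devf V.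

Lemma devC V c : dev V c%:MP = inj c.
Proof.
apply: dual_eqP; rewrite /= ?pevE ?pevC //.
by rewrite big1 // => i _; rewrite mderivC pevE rmorph0 mul0r.
Qed.

Lemma devX V k : dev V (pX k) = V k.
Proof.
apply: dual_eqP; rewrite /= ?pevE ?pevX ?ffunE //.
rewrite (bigD1 (enum_rank k)) //= big1 ?addr0 => [|i ne].
  rewrite /pX mderivX mnmE eqxx scale1r enum_rankK.
  have -> : (U_(enum_rank k) - U_(enum_rank k) = 0)%MM.
    by apply/mnmP => j; rewrite mnmBE subnn mnm0E.
  by rewrite mpolyX0 pevE rmorph1 mul1r.
by rewrite /pX mderivX mnmE eq_sym (negPf ne) scale0r pevE rmorph0 mul0r.
Qed.

Lemma std_dev V F : std (dev V F) = mpeval F [ffun k => std (V k)].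
Proof. by []. Qed.

Lemma eps_dev v w F :
  eps (dev (dvec v w) F) =
  \sum_(i < #|K|) mpeval (F^`M(i)) v * w (enum_val i).
Proof.
rewrite /dev /= /devf /=.
have -> : [ffun k => std (dvec v w k)] = v.
  by apply/ffunP => k; rewrite !ffunE.
by apply: eq_bigr => i _; rewrite ffunE.
Qed.

Lemma pol_ind (P : pol -> Prop) :
  (forall c, P c%:MP) -> (forall k, P (pX k)) ->
  (forall F G, P F -> P G -> P (F + G)) ->
  (forall F G, P F -> P G -> P (F * G)) -> forall F, P F.
Proof.
move=> PC PX PD PM F; rewrite (mpolyE F).
apply: (big_ind P) => [||m _]; [by rewrite -mpolyC0| exact: PD|].
rewrite -mul_mpolyC; apply: (PM) => //; rewrite mpolyXE_id.
apply: (big_ind P) => [||i _]; [by rewrite -mpolyC1 | exact: PM|].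
move: (m i) => n; rewrite -(enum_valK i); elim: n => [|n IH]; first by rewrite expr0 -mpolyC1.
by rewrite exprS; apply: (PM) IH; apply: PX.
Qed.

(* A nonzero polynomial on a line is a univariate polynomial. *)
Definition on_line (x y : vec) : {rmorphism pol -> {poly C}} :=
  mmap polyC (fun i => (x (enum_val i))%:P
                        + 'X * (y (enum_val i) - x (enum_val i))%:P).

Definition line_pt (x y : vec) (t : C) : vec := [ffun k => x k + t * (y k - x k)].

Lemma on_lineE x y F t : (on_line x y F).[t] = mpeval F (line_pt x y t).
Proof.
elim/pol_ind: F => [c|k|F G IF IG|F G IF IG].
- by rewrite /on_line /= mmapC hornerC pevE pevC.
- rewrite /on_line /= /pX mmapX mmap1U enum_rankK pevE pevX ffunE.
  by rewrite !hornerE.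
- by rewrite rmorphD hornerD IF IG !pevE rmorphD.
- by rewrite rmorphM hornerM IF IG !pevE rmorphM.
Qed.

Lemma poly_nonroot (p : {poly C}) : p != 0 -> exists t, p.[t] != 0.
Proof.
move=> p0; apply: contrapT => nt.
have allr : all (root p) [seq (i%:R : C) | i <- iota 0 (size p)].
  apply/allP => _ /mapP [i _ ->]; apply/rootP/eqP/negPn/negP => h.
  by apply: nt; exists i%:R.
have un : uniq [seq (i%:R : C) | i <- iota 0 (size p)].
  rewrite map_inj_uniq ?iota_uniq // => i j /eqP.
  by rewrite eqr_nat => /eqP.
by have := max_poly_roots p0 allr un; rewrite size_map size_iota ltnn.
Qed.

Lemma line_nonzero F G x y : mpeval F x != 0 -> mpeval G y != 0 ->
  exists t, mpeval F (line_pt x y t) != 0 /\ mpeval G (line_pt x y t) != 0.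
Proof.
move=> Fx Gy.
have e0 : line_pt x y 0 = x by apply/ffunP => k; rewrite ffunE mul0r addr0.
have e1 : line_pt x y 1 = y by apply/ffunP => k; rewrite ffunE mul1r addrC subrK.
have p0 : on_line x y F != 0.
  by apply: contraNneq Fx => h; rewrite -e0 -on_lineE h horner0.
have q0 : on_line x y G != 0.
  by apply: contraNneq Gy => h; rewrite -e1 -on_lineE h horner0.
have [t] := poly_nonroot (mulf_neq0 p0 q0); rewrite hornerM mulf_eq0 negb_or.
by rewrite !on_lineE => /andP [? ?]; exists t.
Qed.

Lemma mul_nonzero F G x y : mpeval F x != 0 -> mpeval G y != 0 ->
  exists z, mpeval F z != 0 /\ mpeval G z != 0.
Proof. by move=> h1 h2; have [t] := line_nonzero h1 h2; exists (line_pt x y t). Qed.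

Lemma prod_nonzero (T : finType) (F : T -> pol) :
  (forall t, exists x, mpeval (F t) x != 0) ->
  exists x, forall t, mpeval (F t) x != 0.
Proof.
move=> h; have : exists x, mpeval (\prod_(t <- enum T) F t) x != 0.
  elim: (enum T) => [|t s [x IH]].
    by exists 0; rewrite big_nil pevE rmorph1 oner_neq0.
  have [y hy] := h t; have [z [h1 h2]] := mul_nonzero hy IH.
  by exists z; rewrite big_cons pevE rmorphM mulf_neq0.
move=> [x]; rewrite big_enum /= pevE rmorph_prod => /prodf_neq0 hx.
by exists x => t; apply: hx.
Qed.

End Poly.

Section Clear.
Variables (C : numFieldType) (K J : finType).

(** A common denominator can be cleared uniformly for all evaluations: in C,
    in the dual numbers, and in polynomial rings. *)
Lemma clear_denominators (P : K -> {mpoly C[#|J|]}) (Q : {mpoly C[#|J|]})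
    (F : {mpoly C[#|K|]}) :
  exists N (G : {mpoly C[#|J|]}),
    forall (A : comNzRingType) (e : {rmorphism {mpoly C[#|J|]} -> A})
      (e' : {rmorphism {mpoly C[#|K|]} -> A}),
    (forall c, e' c%:MP = e c%:MP) ->
    (forall k, e (P k) = e Q * e' (pX C k)) ->
    e G = e Q ^+ N * e' F.
Proof.
elim/pol_ind: F => [c|k|F G [N [F' hF]] [M [G' hG]]|F G [N [F' hF]] [M [G' hG]]].
- by exists 0%N, c%:MP => A e e' hc _; rewrite mul1r hc.
- by exists 1%N, (P k) => A e e' _ ->; rewrite expr1.
- exists (N + M)%N, (Q ^+ M * F' + Q ^+ N * G') => A e e' hc hk.
  rewrite rmorphD !rmorphM !rmorphXn (hF _ _ _ hc hk) (hG _ _ _ hc hk) rmorphD.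
  by rewrite exprD /=; ring.
- exists (N + M)%N, (F' * G') => A e e' hc hk.
  rewrite !rmorphM (hF _ _ _ hc hk) (hG _ _ _ hc hk).
  by rewrite exprD /=; ring.
Qed.

End Clear.

Local Open Scope classical_set_scope.

(** * Affine closed sets *)

Section Closed.
Variables (C : numFieldType) (K : finType).
Local Notation pol := {mpoly C[#|K|]}.
Local Notation vec := {ffun K -> C}.
Implicit Types (F G : pol) (v w : vec) (A S : set vec).

Definition zeros F : set vec := [set v | mpeval F v = 0].

Lemma zclosed_zeros F : zclosed (zeros F).
Proof. by move=> v; apply. Qed.

Lemma sub_zclosure S : S `<=` zclosure S.
Proof. by move=> v Sv F; apply. Qed.

Lemma zclosureS A S : A `<=` S -> zclosure A `<=` zclosure S.
Proof. by move=> AS v Av F IF; apply: Av => w /AS; apply: IF. Qed.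

Lemma zclosureK S : zclosed (zclosure S).
Proof. by move=> v h F IF; apply: h => w; apply. Qed.

Lemma zclosed_separate A v : zclosed A -> ~ A v ->
  exists2 F, vanishing_ideal A F & mpeval F v != 0.
Proof.
move=> cA nAv; apply: contrapT => h; apply/nAv/cA => F IF.
by apply: contrapT => /eqP nz; apply: h; exists F.
Qed.

Lemma irreducible_cancel S F G y : irreducible (@zclosed C K) S ->
  S y -> mpeval F y != 0 -> (forall v, S v -> mpeval (F * G) v = 0) ->
  forall v, S v -> mpeval G v = 0.
Proof.
move=> [_ irr] Sy Fy FG.
have [|h|//] := irr _ _ (@zclosed_zeros F) (@zclosed_zeros G).
  move=> v /FG; rewrite pevE rmorphM => /eqP; rewrite mulf_eq0.
  by case/orP => /eqP ?; [left|right].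
by move: Fy; rewrite (h _ Sy) eqxx.
Qed.

End Closed.

(** * Krull dimension of parametrized sets *)

Section Monomials.
Variables (C : numFieldType) (K : finType) (N : nat).
Local Notation pol := {mpoly C[#|K|]}.

(* Exponent vectors of length j with entries smaller than N *)
Fixpoint Expo (j : nat) : finType :=
  if j is j'.+1 then (Expo j' * 'I_N)%type else unit.

Lemma card_Expo j : #|Expo j| = (N ^ j)%N.
Proof.
elim: j => [|j IH]; first by rewrite card_unit.
by rewrite card_prod IH card_ord expnSr.
Qed.

Fixpoint mono (f : nat -> pol) (j : nat) : Expo j -> pol :=
  if j is j'.+1 then fun m => mono f m.1 * f j' ^+ m.2 else fun=> 1.

(** Functions that successively cut down an irreducible set are algebraically
    independent: a relation between them on Y j.+1, divided by the highest
    possible power of f j, restricts to a relation on Y j. *)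
Lemma chain_independent (f : nat -> pol) (Y : nat -> set {ffun K -> C}) n :
  (forall i, (i <= n)%N -> irreducible (@zclosed C K) (Y i)) ->
  (forall i, (i < n)%N -> Y i `<=` Y i.+1) ->
  (forall i, (i < n)%N -> forall y, Y i y -> mpeval (f i) y = 0) ->
  (forall i, (i < n)%N -> exists2 y, Y i.+1 y & mpeval (f i) y != 0) ->
  forall j, (j <= n)%N -> forall c : Expo j -> C,
  (forall y, Y j y -> \sum_m c m * mpeval (mono f m) y = 0) ->
  forall m, c m = 0.
Proof.
move=> irr sub f0 fn; elim=> [|j IH] jn c hc.
  have [[y Yy] _] := irr 0%N jn => -[]; have := hc y Yy.
  rewrite (bigD1 tt) //= big1; last by case.
  by rewrite pevE rmorph1 mulr1 addr0.
have lejn := ltnW jn.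
suff H r : forall s : 'I_N, (s < r)%N -> forall u, c (u, s) = 0.
  by move=> [u s]; apply: (H s.+1).
elim: r => // r IHr s; rewrite ltnS leq_eqVlt => /orP [/eqP sr|]; last exact: IHr.
have [y Yy fy] := fn _ jn.
pose G := \sum_(m : Expo j.+1 | (r <= m.2)%N)
            c m *: (mono f m.1 * f j ^+ (m.2 - r)).
have hG : forall v, Y j.+1 v -> mpeval (f j ^+ r * G) v = 0.
  move=> v /hc <-; rewrite pevE mulr_sumr rmorph_sum /= big_mkcond /=.
  apply: eq_bigr => -[u t] _ /=; case: leqP => rt.
    rewrite -scalerAr -mul_mpolyC rmorphM pevC mulrCA -exprD subnKC //.
  by rewrite (IHr t rt) mul0r.
have frY : mpeval (f j ^+ r) y != 0 by rewrite pevE rmorphXn expf_neq0.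
have G0 := irreducible_cancel (irr _ jn) Yy frY hG.
move=> u; apply: (IH lejn (fun u => c (u, s))) => v Yv {u}.
rewrite -[RHS](G0 v (sub _ jn v Yv)) pevE rmorph_sum /=.
transitivity (\sum_(u : Expo j) \sum_(t < N | (r <= t)%N)
    pev v (c (u, t) *: (mono f u * f j ^+ (t - r)))); last first.
  by rewrite pair_big /=; apply: eq_big => -[].
apply: eq_bigr => u _; rewrite (bigD1 s) ?sr //= big1 ?addr0 => [|t /andP [rt ts]].
  by rewrite -sr subnn expr0 mulr1 -mul_mpolyC rmorphM pevC.
have rt' : (r < t)%N by rewrite ltn_neqAle rt -sr eq_sym ts.
rewrite -mul_mpolyC !rmorphM rmorphXn -[pev v (f j)]/(mpeval _ _) f0 //.
by rewrite expr0n subn_eq0 leqNgt rt' /= !mulr0.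
Qed.

End Monomials.

Section Degree.
Variables (C : numFieldType) (n : nat).
Implicit Types F G : {mpoly C[n]}.

Definition deg_le F D := (msize F <= D.+1)%N.

Lemma deg_leW F D E : (D <= E)%N -> deg_le F D -> deg_le F E.
Proof. by move=> DE h; apply: (leq_trans h). Qed.

Lemma deg_le1 : deg_le 1 0.
Proof. by rewrite /deg_le msize1. Qed.

Lemma deg_leM F G D E : deg_le F D -> deg_le G E -> deg_le (F * G) (D + E).
Proof.
move=> hF hG; have [->|F0] := eqVneq F 0; first by rewrite mul0r /deg_le msize0.
have [->|G0] := eqVneq G 0; first by rewrite mulr0 /deg_le msize0.
rewrite /deg_le msizeM // -(leq_add2r 1) !addn1 prednK; last first.
  by rewrite addn_gt0 lt0n msize_poly_eq0 F0.
by rewrite (leq_trans (leq_add hF hG)) // addnS addSn.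
Qed.

Lemma deg_leX F D k : deg_le F D -> deg_le (F ^+ k) (k * D).
Proof.
move=> h; elim: k => [|k IH]; first by rewrite expr0 deg_le1.
by rewrite exprS mulSn deg_leM.
Qed.

(** The polynomials of degree at most D form a space of dimension at most
    D.+1 ^ n. *)
Lemma deg_le_dependent (T : finType) (F : T -> {mpoly C[n]}) D :
  (forall t, deg_le (F t) D) -> (D.+1 ^ n < #|T|)%N ->
  exists2 c : T -> C, exists t, c t != 0 & \sum_t c t *: F t = 0.
Proof.
move=> hF ltT.
pose M := \matrix_(i < #|T|, m < #|{: 'X_{1..n < D.+1}}|)
   (F (enum_val i))@_(enum_val m : 'X_{1..n < D.+1}).
have cM : (#|{: 'X_{1..n < D.+1}}| <= D.+1 ^ n)%N.
  pose g (m : 'X_{1..n < D.+1}) : {ffun 'I_n -> 'I_D.+1} :=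
    [ffun i => inord (bmnm m i)].
  have -> : (D.+1 ^ n)%N = #|{: {ffun 'I_n -> 'I_D.+1}}|.
    by rewrite card_ffun !card_ord.
  apply: (@leq_card _ _ g) => m1 m2 /ffunP e; apply/eqP; rewrite bmeqP.
  apply/eqP/mnmP => i; have := e i; rewrite !ffunE => /(congr1 val) /=.
  have lt (m : 'X_{1..n < D.+1}) : (bmnm m i < D.+1)%N.
    apply: leq_ltn_trans (bmdeg m); rewrite mdegE (bigD1 i) //=.
    exact: leq_addr.
  by rewrite !inordK ?lt.
have rk : (\rank M < #|T|)%N.
  by apply: leq_ltn_trans (rank_leq_col M) (leq_ltn_trans cM ltT).
have /rowV0Pn [u] : kermx M != 0.
  by rewrite -mxrank_eq0 mxrank_ker subn_eq0 -ltnNge.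
move=> /sub_kermxP uM u0.
exists (fun t => u 0 (enum_rank t)).
  have [i ui] : exists i, u 0 i != 0.
    apply: contrapT => h; move/eqP: u0; apply; apply/rowP => i.
    by rewrite mxE; apply/eqP/negPn/negP => ?; apply: h; exists i.
  by exists (enum_val i); rewrite enum_valK.
apply/mpolyP => m; rewrite mcoeff0 raddf_sum /=.
have [lt|ge] := ltnP (mdeg m) D.+1; last first.
  rewrite big1 // => t _; rewrite mcoeffZ memN_msupp_eq0 ?mulr0 //.
  by apply: msize_mdeg_ge; apply: leq_trans (hF t) ge.
have /rowP/(_ (enum_rank (BMultinom lt))) := uM.
rewrite !mxE => e; rewrite -[RHS]e [RHS](reindex enum_rank) /=; last first.
  by apply: onW_bij; apply: enum_rank_bij.
by apply: eq_bigr => t _; rewrite mcoeffZ !mxE !enum_rankK.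
Qed.

End Degree.

Section DualVanish.
Variables (C : numFieldType) (K : finType).
Local Notation pol := {mpoly C[#|K|]}.

Lemma dev_line (x w : {ffun K -> C}) (F : pol) :
  let p := on_line x [ffun k => x k + w k] F in
  dev (dvec x w) F = Dual p.[0] p^`().[0].
Proof.
elim/pol_ind: F => [c|k|F G IF IG|F G IF IG] /=.
- by rewrite devC /on_line /= mmapC derivC !hornerC.
- rewrite devX ffunE /on_line /= /pX mmapX mmap1U enum_rankK ffunE.
  rewrite derivD derivM derivX !derivC !hornerE.
  by apply: dual_eqP => /=; ring.
- by rewrite !rmorphD IF IG /= derivD !hornerD.
- rewrite !rmorphM IF IG /= derivM !hornerE.
  by apply: dual_eqP => //=; rewrite addrC.
Qed.

Lemma dev_vanish (F : pol) : (forall x, mpeval F x = 0) ->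
  forall X, dev X F = 0.
Proof.
move=> F0 X; have -> : X = dvec [ffun k => std (X k)] [ffun k => eps (X k)].
  by apply/ffunP => k; rewrite !ffunE; case: (X k).
rewrite dev_line /=; set p := on_line _ _ _.
have -> : p = 0.
  apply/eqP/negPn/negP => /poly_nonroot [t]; rewrite on_lineE F0 eqxx //.
by rewrite deriv0 horner0.
Qed.

End DualVanish.

Section Parametrized.
Variables (C : numFieldType) (K : finType) (d : nat).
Local Notation pol := {mpoly C[#|K|]}.
Local Notation par := {mpoly C[#|'I_d|]}.
Local Notation vec := {ffun K -> C}.
Implicit Types (F G : pol) (v w : vec) (A : set vec) (x : {ffun 'I_d -> C}).

Variables (S : set vec) (P : K -> par) (Q H : par).
Hypothesis HQ : forall x, mpeval H x != 0 -> mpeval Q x != 0.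

Definition ratpt x : vec := [ffun k => mpeval (P k) x / mpeval Q x].

Hypothesis ratptS : forall x, mpeval H x != 0 -> S (ratpt x).
Hypothesis dominant : forall F,
  (forall x, mpeval H x != 0 -> mpeval F (ratpt x) = 0) ->
  forall v, S v -> mpeval F v = 0.

Lemma param_pullback F : exists N (G : par),
  (forall x, mpeval Q x != 0 ->
     mpeval G x = mpeval Q x ^+ N * mpeval F (ratpt x)) /\
  (forall X (V : {ffun K -> dual C}), (forall k, dev X (P k) = dev X Q * V k) ->
     dev X G = dev X Q ^+ N * dev V F).
Proof.
have [N [G hG]] := clear_denominators P Q F; exists N, G; split.
  move=> x Qx; apply: (hG C (pev x) (pev (ratpt x))) => [c|k].
    by rewrite !pevC.
  by rewrite pevX ffunE mulrC -pevE -pevE divfK.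
move=> X V hV; apply: (hG (dual C) (dev X) (dev V)) => [c|k].
  by rewrite !devC.
by rewrite devX hV.
Qed.

(** Algebraically independent functions on S pull back to algebraically
    independent functions in d variables. *)
Lemma no_long_chain : ~ irr_chain (@zclosed C K) S d.+1.
Proof.
move=> [Y [irrY ltY]].
have sep i : (i < d.+1)%N -> exists F, (forall y, Y i y -> mpeval F y = 0) /\
    exists2 y, Y i.+1 y & mpeval F y != 0.
  move=> lti; have [_ /existsNP [y /not_implyP [Yy nYy]]] := ltY i lti.
  have [_ [A cA YA]] := irrY i (ltnW lti).
  have [_ [B cB YB]] := irrY i.+1 lti.
  have [|F IF Fy] := @zclosed_separate _ _ A y cA.
    by move=> Ay; apply: nYy; rewrite YA; split=> //; move: Yy; rewrite YB => -[].
  exists F; split; last by exists y.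
  by move=> z; rewrite YA => -[_ /IF].
have [f hf] : exists f : nat -> pol, forall i, (i < d.+1)%N ->
   (forall y, Y i y -> mpeval (f i) y = 0) /\
    exists2 y, Y i.+1 y & mpeval (f i) y != 0.
  have ex i : exists F, (i < d.+1)%N -> (forall y, Y i y -> mpeval F y = 0) /\
    exists2 y, Y i.+1 y & mpeval F y != 0.
    by case: (ltnP i d.+1) => [/sep [F hF]|_]; [exists F|exists 0].
  by have [f hf] := choice ex; exists f.
have [g hg] : exists g : nat -> nat * par, forall i x, mpeval Q x != 0 ->
    mpeval (g i).2 x = mpeval Q x ^+ (g i).1 * mpeval (f i) (ratpt x).
  have ex i : exists G : nat * par, forall x, mpeval Q x != 0 ->
      mpeval G.2 x = mpeval Q x ^+ G.1 * mpeval (f i) (ratpt x).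
    by have [n [G [hG _]]] := param_pullback (f i); exists (n, G).
  by have [g hg] := choice ex; exists g.
pose n := (\max_(i < d.+1) (g i).1)%N.
pose q := Q ^+ n; pose h i := (g i).2 * Q ^+ (n - (g i).1).
have qE x : mpeval q x = mpeval Q x ^+ n by rewrite !pevE rmorphXn.
have hh i x : (i < d.+1)%N -> mpeval Q x != 0 ->
    mpeval (h i) x = mpeval q x * mpeval (f i) (ratpt x).
  move=> lti Qx; rewrite qE [LHS]pevE rmorphM rmorphXn -!pevE hg //.
  by rewrite mulrAC -exprD subnKC // (leq_bigmax (Ordinal lti)).
pose e := maxn (msize q) (\max_(i < d.+1) msize (h i))%N.
have dq : deg_le q e by rewrite /deg_le leqW // leq_maxl.
have dh i : (i < d.+1)%N -> deg_le (h i) e.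
  move=> lti; rewrite /deg_le leqW // leq_max; apply/orP; right.
  exact: (@leq_bigmax _ (fun i : 'I_d.+1 => msize (h i)) (Ordinal lti)).
pose c := (d.+1 * e).+1; have [N NE] : exists N, N = (c ^ d)%N by exists (c ^ d)%N.
pose hom := fix hom (j : nat) : Expo N.+1 j -> par :=
  if j is j'.+1 then fun m => hom j' m.1 * (h j' ^+ m.2 * q ^+ (N - m.2))
  else fun=> 1.
have hom_deg j : (j <= d.+1)%N -> forall m : Expo N.+1 j,
    deg_le (hom j m) (j * (N * e)).
  elim: j => [_ m|j IH ltj m] /=; first exact: deg_le1.
  rewrite mulSn addnC; apply: deg_leM; first exact: IH (ltnW ltj) _.
  have lt2 : (m.2 <= N)%N by rewrite -ltnS ltn_ord.
  rewrite -[in X in deg_le _ X](subnKC lt2) mulnDl.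
  by apply: deg_leM; apply: deg_leX => //; apply: dh.
have hom_val j x : (j <= d.+1)%N -> mpeval Q x != 0 -> forall m : Expo N.+1 j,
    mpeval (hom j m) x =
    mpeval q x ^+ (j * N) * mpeval (mono f m) (ratpt x).
  move=> + Qx; elim: j => [_ m|j IH ltj m] /=.
    by rewrite !pevE !rmorph1 mulr1.
  have lt2 : (m.2 <= N)%N by rewrite -ltnS ltn_ord.
  rewrite !pevE !rmorphM !rmorphXn -!pevE (IH (ltnW ltj)) hh // exprMn.
  rewrite mulSn addnC exprD -[in X in _ = _ * X * _](subnKC lt2) exprD.
  by rewrite -!qE; ring.
have [] := @deg_le_dependent C #|'I_d| (Expo N.+1 d.+1) (hom d.+1)
    (d.+1 * (N * e)).
- exact: hom_deg.
- rewrite card_Expo card_ord; apply: (@leq_ltn_trans ((c * N.+1) ^ d)).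
    have leq_e a b k : (a <= b -> a ^ k <= b ^ k)%N.
      by case: k => // k; rewrite leq_exp2r.
    apply: leq_e; have -> : (d.+1 * (N * e) = d.+1 * e * N)%N.
      by rewrite -mulnA [(e * N)%N]mulnC.
    rewrite /c mulSn; apply: (@leq_add 1 _ N.+1) => //.
    by rewrite leq_mul2l leqnSn orbT.
  by rewrite expnMn expnSr mulnC ltn_pmul2l ?expn_gt0 // NE.
move=> a [t at0] rel; move/eqP: at0; apply.
apply: (chain_independent (fun i hi => (irrY i hi).1) (fun i hi => (ltY i hi).1)
  (fun i hi => (hf i hi).1) (fun i hi => (hf i hi).2) (leqnn _)).
move=> y Yy; have [_ [A _ YA]] := irrY _ (leqnn d.+1).
have Sy : S y by move: Yy; rewrite YA => -[].
have E v : mpeval (\sum_m a m *: mono f m) v = \sum_m a m * mpeval (mono f m) v.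
  rewrite pevE rmorph_sum /=; apply: eq_bigr => m _.
  by rewrite -mul_mpolyC rmorphM pevC.
rewrite -E; apply: dominant Sy => x Hx; have Qx := HQ Hx.
have q0 : mpeval q x ^+ (d.+1 * N) != 0.
  by rewrite expf_neq0 // qE expf_neq0.
apply: (mulfI q0); rewrite mulr0 E mulr_sumr.
have := congr1 (pev x) rel; rewrite rmorph0 rmorph_sum /= => {2}<-.
apply: eq_bigr => m _.
have -> : pev x (a m *: hom d.+1 m) = a m * mpeval (hom d.+1 m) x.
  by rewrite -mul_mpolyC rmorphM pevC.
by rewrite hom_val // mulrCA.
Qed.

Variables (kk kk' : 'I_d -> K).
Hypothesis coord : forall x, mpeval H x != 0 -> forall i,
  ratpt x (kk i) = x i * ratpt x (kk' i) /\ ratpt x (kk' i) != 0.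
Variable o : {ffun 'I_d -> C}.
Hypothesis Ho : mpeval H o != 0.

Definition flag_pts (j : nat) : set {ffun 'I_d -> C} :=
  [set x | mpeval H x != 0 /\ forall i : 'I_d, (j <= i)%N -> x i = o i].

Lemma irreducible_flag j :
  irreducible (@zclosed C K) (S `&` zclosure (ratpt @` flag_pts j)).
Proof.
have img x : flag_pts j x -> (S `&` zclosure (ratpt @` flag_pts j)) (ratpt x).
  by move=> Lx; split; [apply: ratptS; case: Lx|apply: sub_zclosure; exists x].
split; first by exists (ratpt o); apply: img.
move=> A B cA cB AB.
have key (T : set vec) : zclosed T -> ~ (S `&` zclosure (ratpt @` flag_pts j) `<=` T) ->
    exists F x, [/\ vanishing_ideal T F, flag_pts j x & mpeval F (ratpt x) != 0].
  move=> cT nT; apply: contrapT => h; apply: nT => v [Sv cv]; apply: (cT).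
  apply: (zclosureS _ cv) => _ [x Lx <-]; apply: contrapT => nTx.
  by have [F IF Fx] := zclosed_separate cT nTx; apply: h; exists F, x.
apply: contrapT => /not_orP [/(key _ cA) [F [x [IF Lx Fx]]] /(key _ cB) [G [y [IG Ly Gy]]]].
have [N [F' [hF _]]] := param_pullback F; have [M [G' [hG _]]] := param_pullback G.
have x1 : mpeval (H * F') x != 0.
  have [Hx _] := Lx; rewrite pevE rmorphM -!pevE mulf_neq0 // hF ?HQ //.
  by rewrite mulf_neq0 ?expf_neq0 // HQ.
have y1 : mpeval G' y != 0.
  by have [Hy _] := Ly; rewrite hG ?HQ // mulf_neq0 ?expf_neq0 // HQ.
have [t []] := line_nonzero x1 y1; set z := line_pt x y t.
rewrite {1}pevE rmorphM -!pevE mulf_eq0 negb_or => /andP [Hz F'z] G'z.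
have Lz : flag_pts j z.
  split=> // i ji; have [_ hx] := Lx; have [_ hy] := Ly.
  by rewrite ffunE hx // hy // subrr mulr0 addr0.
have [Az|Bz] := AB _ (img _ Lz).
  by move: F'z; rewrite hF ?HQ // IF // mulr0 eqxx.
by move: G'z; rewrite hG ?HQ // IG // mulr0 eqxx.
Qed.

Lemma long_chain : irr_chain (@zclosed C K) S d.
Proof.
exists (fun j => S `&` zclosure (ratpt @` flag_pts j)); split.
  move=> j _; split; first exact: irreducible_flag.
  by exists (zclosure (ratpt @` flag_pts j)) => //; apply: zclosureK.
move=> j jd; pose i := Ordinal jd.
split.
  move=> v [Sv cv]; split=> //; apply: (zclosureS _ cv) => _ [x [Hx Lx] <-].
  by exists x => //; split=> // l jl; apply: Lx; apply: ltnW.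
pose e : {ffun 'I_d -> C} := [ffun l => o l + (l == i)%:R].
have e1 : mpeval (pX C i - (o i)%:MP) e != 0.
  by rewrite pevE rmorphB /= -/(pev e) pevC pevX ffunE eqxx addrC addKr oner_neq0.
have [t []] := line_nonzero Ho e1; set x := line_pt o e t => Hx.
rewrite pevE rmorphB pevC pevX subr_eq0 => xi.
move=> /(_ (ratpt x)) []; first split; first exact: ratptS.
  apply: sub_zclosure; exists x => //; split=> // l jl.
  rewrite !ffunE (negPf (_ : l != i)) ?addr0 ?subrr ?mulr0 ?addr0 //.
  by apply: contraTneq jl => ->; rewrite -ltnNge /=.
move=> _ /(_ (pX C (kk i) - (o i)%:MP * pX C (kk' i))) h.
have [e2 nz] := coord Hx i.
have /eqP : mpeval (pX C (kk i) - (o i)%:MP * pX C (kk' i)) (ratpt x) = 0.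
  apply: h => _ [y [Hy Ly] <-]; have [ey _] := coord Hy i.
  by rewrite pevE rmorphB rmorphM pevC !pevX ey Ly // subrr.
rewrite pevE rmorphB rmorphM pevC !pevX e2 -mulrBl mulf_eq0 (negPf nz) orbF.
by rewrite subr_eq0 (negPf xi).
Qed.

Definition differential F v : 'rV[C]_#|K| := \row_i mpeval (F^`M(i)) v.

Lemma tangent_differentialP T v z :
  tangent_space T v z <-> forall F, vanishing_ideal T F -> differential F v *m z^T = 0.
Proof.
have E F : (differential F v *m z^T) 0 0 = \sum_(i < #|K|) mpeval F^`M(i) v * z 0 i.
  by rewrite mxE; apply: eq_bigr => i _; rewrite !mxE.
split=> h F IF; first by apply/rowP => i; rewrite !ord1 E h // mxE.
by rewrite -E h // mxE.
Qed.

(** The derivatives of the parametrization at a generic point are d independent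
    tangent vectors. *)
Lemma generic_tangent x : mpeval H x != 0 ->
  exists2 B : 'M[C]_(d, #|K|), row_free B &
    forall F, vanishing_ideal S F -> differential F (ratpt x) *m B^T = 0.
Proof.
move=> Hx; have Qx := HQ Hx.
pose X j := dvec x [ffun i => (i == j)%:R].
have sX j (F : par) : std (dev (X j) F) = mpeval F x.
  by rewrite std_dev; congr mpeval; apply/ffunP => i; rewrite !ffunE.
pose V j : {ffun K -> dual C} := [ffun k => dev (X j) (P k) * dinv (dev (X j) Q)].
have hV j k : dev (X j) (P k) = dev (X j) Q * V j k.
  by rewrite ffunE mulrCA mul_dinv ?sX // mulr1.
have sV j k : std (V j k) = ratpt x k by rewrite !ffunE /= -!std_dev !sX.
have VE j : V j = dvec (ratpt x) [ffun k => eps (V j k)].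
  by apply/ffunP => k; rewrite /dvec ffunE -(sV j) ffunE; case: (V j k).
have tan j F : vanishing_ideal S F -> dev (V j) F = 0.
  move=> IF; have [N [G [hG1 hG2]]] := param_pullback F.
  have : dev (X j) (H * G) = 0.
    apply: dev_vanish => y; rewrite pevE rmorphM -!pevE.
    have [->|Hy] := eqVneq (mpeval H y) 0; first by rewrite mul0r.
    by rewrite hG1 ?HQ // IF ?mulr0 //; apply: ratptS.
  rewrite rmorphM => /dual_cancel; rewrite sX => /(_ Hx).
  by rewrite (hG2 _ _ (hV j)) => /dual_cancel; rewrite rmorphXn /= -std_dev sX expf_neq0 //; apply.
have crd j i : V j (kk i) = X j i * V j (kk' i).
  have : dev (X j) (H * (P (kk i) - pX C i * P (kk' i))) = 0.
    apply: dev_vanish => y; rewrite pevE rmorphM rmorphB rmorphM pevX -!pevE.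
    have [->|Hy] := eqVneq (mpeval H y) 0; first by rewrite mul0r.
    have [e _] := coord Hy i; move: e; rewrite !ffunE mulrA => /divIf ->.
      by rewrite subrr mulr0.
    exact: HQ.
  rewrite rmorphM => /dual_cancel; rewrite sX => /(_ Hx).
  rewrite rmorphB rmorphM devX !hV mulrCA -mulrBr => /dual_cancel.
  by rewrite sX => /(_ Qx) /eqP; rewrite subr_eq0 => /eqP.
exists (\matrix_(j, l) eps (V j (enum_val l))); last first.
  move=> F IF; apply/rowP => j; rewrite mxE [RHS]mxE -[RHS]/(eps (0 : dual C)).
  rewrite -(tan j F IF) [in RHS]VE eps_dev; apply: eq_bigr => l _.
  by rewrite !mxE ffunE.
apply/row_freeP.
exists (\matrix_(l, i) (((l == enum_rank (kk i))%:R
         - x i * (l == enum_rank (kk' i))%:R) / ratpt x (kk' i))).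
apply/matrixP => j i; rewrite !mxE.
have [_ nz] := coord Hx i.
transitivity ((eps (V j (kk i)) - x i * eps (V j (kk' i))) / ratpt x (kk' i)).
  under eq_bigr do rewrite !mxE mulrA mulrBr mulrCA.
  rewrite -mulr_suml sumrB -mulr_sumr; congr ((_ - _ * _) / _).
    rewrite (bigD1 (enum_rank (kk i))) //= eqxx mulr1 enum_rankK big1 ?addr0 //.
    by move=> l /negPf ->; rewrite mulr0.
  rewrite (bigD1 (enum_rank (kk' i))) //= eqxx mulr1 enum_rankK big1 ?addr0 //.
  by move=> l /negPf ->; rewrite mulr0.
rewrite crd epsM sV ![X j i]ffunE /= addrAC subrr add0r.
by rewrite mulfK // ffunE eq_sym.
Qed.

(** The rank of finitely many gradients is lower semicontinuous, so S has
    everywhere at least as many tangent directions as at a generic point. *)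
Lemma nonsingular_at_param v : S v ->
  (exists B : 'M[C]_(#|K|, d), forall z, tangent_space S v z ->
     z *m B = 0 -> z = 0) ->
  nonsingular_at S v.
Proof.
move=> Sv [B hB].
pose indep r := exists2 Fs : 'I_r -> pol, forall i, vanishing_ideal S (Fs i) &
   row_free (\matrix_(i < r) differential (Fs i) v).
have ex0 : exists r, `[< indep r >].
  exists 0%N; apply/asboolP; exists (fun=> 0) => [[] //|].
  by rewrite /row_free -leqn0 rank_leq_row.
have ub r : `[< indep r >] -> (r <= #|K|)%N.
  by move=> /asboolP [Fs _ /eqP <-]; apply: rank_leq_col.
case: (ex_maxnP ex0 ub) => r /asboolP [Fs IFs free] maxr.
set J := \matrix_(i < r) differential (Fs i) v in free.
have spanJ F : vanishing_ideal S F -> (differential F v <= J)%MS.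
  move=> IF; apply: contrapT => /negP nsub.
  suff : (r.+1 <= r)%N by rewrite ltnn.
  apply: maxr; apply/asboolP.
  exists (fun i => if unlift ord_max i is Some j then Fs j else F).
    by move=> i; case: unlift.
  set J' := \matrix_i _.
  have sJ : (J <= J')%MS.
    apply/row_subP => i; rewrite rowK.
    have -> : differential (Fs i) v = row (lift ord_max i) J' by rewrite rowK liftK.
    exact: row_sub.
  have sF : (differential F v <= J')%MS.
    have -> : differential F v = row ord_max J' by rewrite rowK unlift_none.
    exact: row_sub.
  have lt : (\rank J < \rank J')%N.
    by apply: rank_ltmx; rewrite /ltmx sJ /=; apply: contra nsub; apply: submx_trans.
  by rewrite /row_free eqn_leq rank_leq_row /=; rewrite (eqP free) in lt.
pose f : 'Hom('rV[C]_#|K|, 'rV[C]_r) := linfun (mulmxr J^T).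
have fE z : f z = z *m J^T by rewrite lfunE.
have tanP z : z \in lker f <-> tangent_space S v z.
  rewrite memv_ker fE; split=> [/eqP h|/tangent_differentialP h].
    apply/tangent_differentialP => F /spanJ /submxP [D ->].
    by rewrite -mulmxA -[J]trmxK -trmx_mul h trmx0 mulmx0.
  apply/eqP/trmx_inj; rewrite trmx_mul trmxK trmx0; apply/row_matrixP => i.
  by rewrite row_mul rowK h // row0.
have dimW : (\dim (lker f) + r)%N = #|K|.
  have := limg_ker_dim f fullv; rewrite capfv dimvf dim_matrix mul1r => e.
  apply: etrans e; congr (_ + _)%N; have -> : (f @: fullv)%VS = fullv.
    apply/eqP; rewrite eqEsubv subvf /=; apply/subvP => y _.
    have /row_freeP [E JE] := free.
    have -> : y = f (y *m E^T) by rewrite fE -mulmxA -trmx_mul JE trmx1 mulmx1.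
    exact: memv_img (memvf _).
  by rewrite dimvf dim_matrix mul1r.
have le_d : (\dim (lker f) <= d)%N.
  pose g : 'Hom('rV[C]_#|K|, 'rV[C]_d) := linfun (mulmxr B).
  have := limg_ker_dim g (lker f).
  have -> : (lker f :&: lker g)%VS = 0%VS.
    apply/eqP; rewrite -subv0; apply/subvP => z; rewrite memv_cap => /andP [wf].
    rewrite memv_ker lfunE /= => /eqP wB; rewrite memv0; apply/eqP/hB => //.
    exact/tanP.
  rewrite dimv0 add0n => <-; apply: leq_trans (dimvS (subvf _)) _.
  by rewrite dimvf dim_matrix mul1r.
have ge_d : (d <= \dim (lker f))%N.
  have /row_freeP [E JE] := free.
  pose Jp := \matrix_(i < r, l < r) \sum_(m < #|K|) ((Fs i)^`M(m) * (E m l)%:MP).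
  have JpE u : map_mx (pev u) Jp = (\matrix_(i < r) differential (Fs i) u) *m E.
    apply/matrixP => i l; rewrite !mxE rmorph_sum; apply: eq_bigr => m _.
    by rewrite rmorphM pevC !mxE.
  have [x Hx nz] : exists2 x, mpeval H x != 0 & mpeval (\det Jp) (ratpt x) != 0.
    apply: contrapT => h; have /eqP : mpeval (\det Jp) v = 0.
      apply: dominant Sv => x Hx; apply/eqP/negPn/negP => nz.
      by apply: h; exists x.
    by rewrite pevE -det_map_mx JpE -/J JE det1 oner_eq0.
  have [B' freeB' tB'] := generic_tangent Hx.
  set J' := \matrix_(i < r) differential (Fs i) (ratpt x).
  have rJ' : \rank J' = r.
    apply/eqP; apply/row_freeP.
    have uJ : J' *m E \in unitmx.
      by rewrite unitmxE unitfE -JpE det_map_mx.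
    by exists (E *m invmx (J' *m E)); rewrite mulmxA mulmxV.
  have JB : J' *m B'^T = 0.
    by apply/row_matrixP => i; rewrite row_mul rowK tB' // row0.
  have := mulmx0_rank_max JB; rewrite rJ' mxrank_tr (eqP freeB').
  by rewrite addnC => h; rewrite -(leq_add2r r) dimW.
exists (lker f); split=> //.
have -> : \dim (lker f) = d by apply/eqP; rewrite eqn_leq le_d.
split; [exact: long_chain|exact: no_long_chain].
Qed.

End Parametrized.

(** Substitution of polynomials, at the points with values in C and in the dual
    numbers. *)
Lemma compose_pol (C : numFieldType) (K J : finType) (P : K -> {mpoly C[#|J|]})
    (F : {mpoly C[#|K|]}) : exists G : {mpoly C[#|J|]},
  (forall y, pev y G = pev [ffun k => pev y (P k)] F) /\
  (forall V, dev V G = dev [ffun k => dev V (P k)] F).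
Proof.
have [N [G hG]] := clear_denominators P 1 F; exists G; split=> [y|V].
  have := hG C (pev y) (pev [ffun k => pev y (P k)]); rewrite rmorph1 expr1n mul1r; apply=> [c|k].
    by rewrite !pevC.
  by rewrite pevX ffunE mul1r.
have := hG (dual C) (dev V) (dev [ffun k => dev V (P k)]).
rewrite rmorph1 expr1n mul1r; apply=> [c|k]; first by rewrite !devC.
by rewrite devX ffunE mul1r.
Qed.

Lemma pol_comp (C : numFieldType) (K J : finType) (P : K -> {mpoly C[#|J|]})
    (F : {mpoly C[#|K|]}) :
  exists G : {mpoly C[#|J|]}, forall x,
    mpeval G x = mpeval F [ffun k => mpeval (P k) x].
Proof. by have [G [hG _]] := compose_pol P F; exists G. Qed.

(** * Multiprojective closed sets *)

Section MultiProjectiveClosure.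
Variables (C : numFieldType) (K I : finType) (deg : K -> option I).
Local Notation vec := {ffun K -> C}.
Implicit Types (M A : set vec) (v w : vec) (t : I -> C).

Lemma rescale1 v : rescale deg (fun=> 1) v = v.
Proof. by apply/ffunP => k; rewrite ffunE; case: (deg k) => [i|] /=; rewrite mul1r. Qed.

Lemma rescaleM t t' v :
  rescale deg t (rescale deg t' v) = rescale deg (fun i => t i * t' i) v.
Proof.
apply/ffunP => k; rewrite !ffunE mulrA.
by case: (deg k) => [i|] //=; rewrite mul1r.
Qed.

Lemma sub_multicone M : M `<=` multicone deg M.
Proof.
move=> v Mv; exists v, (fun=> 1); split=> // [i|]; first exact: oner_neq0.
by rewrite rescale1.
Qed.

Lemma multiconeM M : multicone deg (multicone deg M) `<=` multicone deg M.
Proof.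
move=> _ [_ [t [[v [t' [Mv t'0 ->]]] t0 ->]]]; rewrite rescaleM.
by exists v, (fun i => t i * t' i); split=> // i; rewrite mulf_neq0.
Qed.

Lemma multiconeS M A : M `<=` A -> multicone deg M `<=` multicone deg A.
Proof. by move=> MA v [w [t [/MA Aw t0 ->]]]; exists w, t. Qed.

Lemma is_point_rescale t v : (forall i, t i != 0) ->
  is_point deg v -> is_point deg (rescale deg t v).
Proof.
move=> t0 pv i; have [k dk vk] := pv i; exists k => //.
by rewrite ffunE dk /= mulf_neq0.
Qed.

Lemma is_point_multicone M : M `<=` is_point deg -> multicone deg M `<=` is_point deg.
Proof. by move=> Mp v [w [t [/Mp pw t0 ->]]]; apply: is_point_rescale. Qed.

Lemma mpclosure_multicone M : multicone deg (mpclosure deg M) `<=` mpclosure deg M.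
Proof.
move=> _ [v [t [[pv cv] t0 ->]]]; split; first exact: is_point_rescale.
move=> F IF.
have [G hG] := pol_comp (fun k => (oapp t 1 (deg k))%:MP * pX C k) F.
have E w : mpeval G w = mpeval F (rescale deg t w).
  rewrite hG; congr mpeval; apply/ffunP => k.
  by rewrite !ffunE pevE rmorphM pevC pevX.
rewrite -E; apply: cv => w Mw; rewrite E; apply: IF; apply: multiconeM.
by exists w, t.
Qed.

Lemma mpclosed_mpclosure M : mpclosed deg (mpclosure deg M).
Proof.
split; [by move=> v []|exact: mpclosure_multicone|].
move=> v [pv cv]; split=> // F IF; apply: cv => w /mpclosure_multicone [_].
exact.
Qed.

Lemma mpclosed0 : mpclosed deg (set0 : set vec).
Proof.
split=> //; first by move=> v [w [t []]].
move=> v [_ /(_ 1) h]; have /eqP : mpeval 1 v = 0.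
  by apply: h => w [? [? []]].
by rewrite pevE rmorph1 oner_eq0.
Qed.

Lemma sub_mpclosure M : M `<=` is_point deg -> multicone deg M `<=` mpclosure deg M.
Proof.
by move=> Mp v Mv; split; [apply: (is_point_multicone Mp)|apply: sub_zclosure].
Qed.

End MultiProjectiveClosure.

Section MultiProjective.
Variables (C : numFieldType) (K I : finType) (deg : K -> option I) (dg : K -> I).
Hypothesis degE : forall k, deg k = Some (dg k).
Local Notation vec := {ffun K -> C}.
Local Notation pol := {mpoly C[#|K|]}.
Implicit Types (F G : pol) (v w y : vec) (t : I -> C).

Lemma rescaleE t v k : rescale deg t v k = t (dg k) * v k.
Proof. by rewrite ffunE degE. Qed.

Variable M : set vec.

(** Points with coordinates in the dual numbers of the multicone over the
    closure of M. *)
Definition dual_point (V : {ffun K -> dual C}) : Prop :=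
  forall F, vanishing_ideal (multicone deg M) F -> dev V F = 0.

Definition normalized (c : I -> K) : set vec :=
  [set y | multicone deg M y /\ forall i, y (c i) = 1].

Section Normalize.
Variable c : I -> K.
Hypothesis dgc : forall i, dg (c i) = i.

Definition chart_den : pol := \prod_i pX C (c i).
Definition chart_num (k : K) : pol := pX C k * \prod_(i | i != dg k) pX C (c i).

Lemma normalize y : multicone deg M y -> (forall i, y (c i) != 0) ->
  normalized c [ffun k => y k / y (c (dg k))].
Proof.
move=> My y0; split; last by move=> i; rewrite ffunE dgc divff.
apply: multiconeM; exists y, (fun i => (y (c i))^-1); split=> //.
  by move=> i; rewrite invr_eq0.
by apply/ffunP => k; rewrite rescaleE ffunE mulrC.
Qed.

(** A polynomial on an affine chart becomes a polynomial on the multicone after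
    clearing denominators. *)
Lemma homogenize F : exists N G,
  (forall y, (forall i, y (c i) != 0) -> mpeval G y =
     mpeval chart_den y ^+ N * mpeval F [ffun k => y k / y (c (dg k))]) /\
  (forall V : {ffun K -> dual C}, (forall i, std (V (c i)) != 0) -> dev V G =
     dev V chart_den ^+ N * dev [ffun k => V k * dinv (V (c (dg k)))] F).
Proof.
have [N [G hG]] := clear_denominators chart_num chart_den F; exists N, G.
split=> [y y0|V V0].
  apply: (hG C (pev y) (pev _)) => [a|k]; first by rewrite !pevC.
  rewrite pevX ffunE /chart_num /chart_den rmorphM !rmorph_prod pevX.
  rewrite [in RHS](bigD1 (dg k)) //= pevX.
  by rewrite [RHS]mulrC mulrA divfK.
apply: (hG (dual C) (dev V) (dev _)) => [a|k]; first by rewrite !devC.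
rewrite devX ffunE /chart_num /chart_den rmorphM !rmorph_prod devX.
rewrite [in RHS](bigD1 (dg k)) //= devX.
by rewrite [RHS]mulrC mulrA -[_ * dinv _ * _]mulrA [dinv _ * _]mulrC mul_dinv ?mulr1.
Qed.

Lemma chart_den_neq0 y :
  (mpeval chart_den y != 0) <-> forall i, y (c i) != 0.
Proof.
rewrite pevE rmorph_prod /=; split=> [/prodf_neq0 h i|h].
  by rewrite -[y _]pevX; apply: h.
by apply/prodf_neq0 => i _; rewrite -[pevf _ _]/(pev _ _) pevX.
Qed.

Lemma homogenize_vanish F : vanishing_ideal (normalized c) F ->
  exists N G, vanishing_ideal (multicone deg M) (G * chart_den) /\
  (forall y, (forall i, y (c i) != 0) -> mpeval G y =
     mpeval chart_den y ^+ N * mpeval F [ffun k => y k / y (c (dg k))]) /\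
  (forall V : {ffun K -> dual C}, (forall i, std (V (c i)) != 0) -> dev V G =
     dev V chart_den ^+ N * dev [ffun k => V k * dinv (V (c (dg k)))] F).
Proof.
move=> IF; have [N [G [hG1 hG2]]] := homogenize F; exists N, G; split=> //.
move=> y My; rewrite pevE rmorphM -!pevE.
have [->|/chart_den_neq0 y0] := eqVneq (mpeval chart_den y) 0; first by rewrite mulr0.
by rewrite hG1 // IF ?mulr0 ?mul0r //; apply: normalize.
Qed.

Lemma dual_point_normalize V F : dual_point V ->
  (forall i, std (V (c i)) != 0) -> vanishing_ideal (normalized c) F ->
  dev [ffun k => V k * dinv (V (c (dg k)))] F = 0.
Proof.
move=> dV V0 /homogenize_vanish [N [G [IG [_ hG]]]].
have := dV _ IG; rewrite rmorphM mulrC => /dual_cancel.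
have Q0 : std (dev V chart_den) != 0.
  by rewrite std_dev; apply/chart_den_neq0 => i; rewrite ffunE.
move=> /(_ Q0); rewrite hG // => /dual_cancel; apply.
by rewrite rmorphXn expf_neq0.
Qed.

End Normalize.

Variable d : nat.
Local Notation par := {mpoly C[#|'I_d|]}.
Variables (phi : K -> par) (H : par) (o : {ffun 'I_d -> C}) (kk kk' : 'I_d -> K).
Implicit Types x : {ffun 'I_d -> C}.

Definition polpt x : vec := [ffun k => mpeval (phi k) x].

Let N := polpt @` [set x | mpeval H x != 0].

Hypothesis M_point : M `<=` is_point deg.
Hypothesis polptM : forall x, mpeval H x != 0 -> multicone deg M (polpt x).
Hypothesis dense : vanishing_ideal (multicone deg N) `<=`
                   vanishing_ideal (multicone deg M).
Hypothesis kkE : forall i, dg (kk i) = dg (kk' i).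
Hypothesis coordE : forall x, mpeval H x != 0 -> forall i,
  polpt x (kk i) = x i * polpt x (kk' i) /\ polpt x (kk' i) != 0.
Hypothesis Ho : mpeval H o != 0.

Let S := mpclosure deg M.

Let MS : multicone deg M `<=` S.
Proof. exact: sub_mpclosure. Qed.

Lemma irreducible_closure : irreducible (mpclosed deg) S.
Proof.
split; first by exists (polpt o); apply: MS; apply: polptM.
move=> A B cA cB AB.
pose J : finType := (I + 'I_d)%type.
pose pt (z : {ffun J -> C}) : vec :=
  rescale deg (fun i => z (inl i)) (polpt [ffun l => z (inr l)]).
have lift F : exists G : {mpoly C[#|J|]}, forall z, mpeval G z = mpeval F (pt z).
  have [phi' hphi] : exists phi' : K -> {mpoly C[#|J|]}, forall k z,
      mpeval (phi' k) z = mpeval (phi k) [ffun l => z (inr l)].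
    have ex k : exists G : {mpoly C[#|J|]}, forall z,
        mpeval G z = mpeval (phi k) [ffun l => z (inr l)].
      have [G hG] := pol_comp (fun l : 'I_d => pX C (inr l : J)) (phi k).
      exists G => z; rewrite hG; congr mpeval; apply/ffunP => l.
      by rewrite !ffunE pevE pevX.
    by have [f hf] := choice ex; exists f.
  have [G hG] := pol_comp (fun k => pX C (inl (dg k) : J) * phi' k) F.
  exists G => z; rewrite hG; congr mpeval; apply/ffunP => k.
  by rewrite ffunE rescaleE pevE rmorphM pevX -pevE hphi ffunE.
have [H' hH] : exists G : {mpoly C[#|J|]}, forall z,
    mpeval G z = mpeval H [ffun l => z (inr l)].
  have [G hG] := pol_comp (fun l : 'I_d => pX C (inr l : J)) H.
  exists G => z; rewrite hG; congr mpeval; apply/ffunP => l.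
  by rewrite !ffunE pevE pevX.
pose T : {mpoly C[#|J|]} := \prod_(i : I) pX C (inl i : J).
have key (Z : set vec) : mpclosed deg Z -> ~ (S `<=` Z) ->
    exists F x t, [/\ vanishing_ideal Z F, mpeval H x != 0, forall i, t i != 0
      & mpeval F (rescale deg t (polpt x)) != 0].
  move=> [_ Tc cT] nT; apply: contrapT => h; apply: nT => v [pv cv]; apply: cT.
  split=> // F IF; apply: cv; apply: dense => _ [_ [t [[x Hx <-] t0 ->]]].
  apply: contrapT => /eqP nz; apply: h; exists F, x, t; split=> //.
  by move=> w Zw; apply/IF/sub_multicone.
apply: contrapT => /not_orP [/(key _ cA) [F [x [t [IF Hx t0 Fx]]]]].
move=> /(key _ cB) [G [y [s [IG Hy s0 Gy]]]].
have [F' hF] := lift F; have [G' hG] := lift G.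
pose zx : {ffun J -> C} := [ffun j => match j with inl i => t i | inr l => x l end].
pose zy : {ffun J -> C} := [ffun j => match j with inl i => s i | inr l => y l end].
have ptx : pt zx = rescale deg t (polpt x).
  rewrite /pt; have -> : [ffun l => zx (inr l)] = x by apply/ffunP => l; rewrite !ffunE.
  by apply/ffunP => k; rewrite !rescaleE ffunE.
have pty : pt zy = rescale deg s (polpt y).
  rewrite /pt; have -> : [ffun l => zy (inr l)] = y by apply/ffunP => l; rewrite !ffunE.
  by apply/ffunP => k; rewrite !rescaleE ffunE.
have x1 : mpeval (F' * (H' * T)) zx != 0.
  rewrite pevE !rmorphM -!pevE hF ptx hH !mulf_neq0 //.
    by have -> : [ffun l => zx (inr l)] = x by apply/ffunP => l; rewrite !ffunE.
  rewrite pevE rmorph_prod; apply/prodf_neq0 => i _.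
  by rewrite -[pev _ _]/(pev zx _) pevX ffunE.
have y1 : mpeval G' zy != 0 by rewrite hG pty.
have [z []] := mul_nonzero x1 y1.
rewrite {1}pevE !rmorphM -!pevE hF hG hH !mulf_eq0 !negb_or.
move=> /andP [Fz /andP [Hz Tz]] Gz.
have Sz : S (pt z).
  apply: MS; apply: multiconeM; exists (polpt [ffun l => z (inr l)]), (fun i => z (inl i)).
  split=> //; first exact: polptM.
  move=> i; move: Tz; rewrite pevE rmorph_prod => /prodf_neq0 /(_ i isT).
  by rewrite -[pev _ _]/(pev z _) pevX.
by case: (AB _ Sz) => h; [move: Fz; rewrite IF|move: Gz; rewrite IG] => //; rewrite eqxx.
Qed.

Hypothesis tangent_bound : forall v, S v -> exists B : 'M[C]_(#|K|, d),
  forall V : {ffun K -> dual C}, (forall k, std (V k) = v k) -> dual_point V ->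
  (\row_i eps (V (enum_val i))) *m B = 0 ->
  forall k k', dg k = dg k' -> V k * inj (v k') = V k' * inj (v k).

(** The criterion behind both parts of the theorem: the closure of a family
    with d independent parameters is nonsingular as soon as d linear
    conditions force every dual point to be a rescaling of its standard
    part. *)
Theorem nonsingular_variety_closure : nonsingular_variety deg S.
Proof.
split; first split.
- by move=> v [].
- exact: mpclosure_multicone.
- exists S, set0; split; last by rewrite setD0.
    exact: mpclosed_mpclosure.
  exact: mpclosed0.
- exact: irreducible_closure.
move=> c degc v [Sv cv].
have dgc i : dg (c i) = i by have := degc i; rewrite degE => -[].
pose Q : par := \prod_i phi (c i).
pose P k : par := phi k * \prod_(i | i != dg k) phi (c i).
have QE x : (mpeval Q x != 0) <-> forall i, polpt x (c i) != 0.
  rewrite pevE rmorph_prod /=; split=> [/prodf_neq0 h i|h].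
    by rewrite ffunE; apply: h.
  by apply/prodf_neq0 => i _; move: (h i); rewrite ffunE.
have ptE x k : mpeval Q x != 0 -> ratpt P Q x k = polpt x k / polpt x (c (dg k)).
  move=> Qx; rewrite !ffunE /P /Q; rewrite /Q in Qx.
  move: Qx; rewrite (bigD1 (dg k)) //= !pevE !rmorphM mulf_eq0 negb_or => /andP [h1 h2].
  by rewrite invfM mulrACA divff ?mulr1.
have Hden : vanishing_ideal (multicone deg M) (chart_den c) -> False.
  by case: Sv => _ h /h; apply/eqP/chart_den_neq0 => i; rewrite cv oner_neq0.
have [o' Ho'] : exists o', mpeval (H * Q) o' != 0.
  apply: contrapT => no; apply: Hden; apply: dense => _ [_ [t [[x Hx <-] t0 ->]]].
  apply/eqP/negPn/negP => /chart_den_neq0 h; apply: no; exists x.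
  rewrite pevE rmorphM -!pevE mulf_neq0 //; apply/QE => i.
  by have := h i; rewrite rescaleE mulf_eq0 negb_or => /andP [].
have HQ2 x : mpeval (H * Q) x != 0 -> mpeval H x != 0 /\ mpeval Q x != 0.
  by rewrite pevE rmorphM -!pevE mulf_eq0 negb_or => /andP.
apply: (@nonsingular_at_param C K d _ P Q (H * Q) _ _ _ kk kk' _ o') => //.
- by move=> x /HQ2 [].
- move=> x /HQ2 [Hx Qx].
  have -> : ratpt P Q x = [ffun k => polpt x k / polpt x (c (dg k))].
    by apply/ffunP => k; rewrite ptE // [RHS]ffunE.
  have [|h1 h2] := normalize dgc (polptM Hx); first exact/QE.
  by split; [apply: MS|].
- move=> F F0 w [[_ cw] w1].
  have [n [G [hG _]]] := homogenize c F.
  have /eqP : mpeval (G * chart_den c) w = 0.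
    apply: cw; apply: dense => _ [_ [t [[x Hx <-] t0 ->]]].
    rewrite pevE rmorphM -!pevE; set y := rescale _ _ _.
    have [->|/chart_den_neq0 y0] := eqVneq (mpeval (chart_den c) y) 0.
      by rewrite mulr0.
    have Qx : mpeval Q x != 0.
      by apply/QE => i; have := y0 i; rewrite rescaleE mulf_eq0 negb_or => /andP [].
    rewrite hG // (_ : [ffun k => y k / y (c (dg k))] = ratpt P Q x).
      by rewrite F0 ?mulr0 ?mul0r // pevE rmorphM mulf_neq0.
    apply/ffunP => k; rewrite ffunE ptE // !rescaleE dgc invfM mulrACA.
    by rewrite divff ?mul1r.
  rewrite pevE rmorphM -!pevE hG => [|i]; last by rewrite w1 oner_neq0.
  rewrite (_ : [ffun k => w k / w (c (dg k))] = w); last first.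
    by apply/ffunP => k; rewrite ffunE w1 divr1.
  have nz : mpeval (chart_den c) w != 0.
    by apply/chart_den_neq0 => i; rewrite w1 oner_neq0.
  by rewrite !mulf_eq0 (negPf nz) orbF (negPf (expf_neq0 _ nz)) => /eqP.
- move=> x /HQ2 [Hx Qx] i; rewrite !ptE // kkE; have [-> nz] := coordE Hx i.
  by rewrite mulrA mulf_neq0 // invr_eq0; move/QE: Qx; apply.
have [B hB] := tangent_bound Sv; exists B => z /tangent_differentialP tz zB.
pose V : {ffun K -> dual C} := dvec v [ffun k => z 0 (enum_rank k)].
have devV F : vanishing_ideal (affine_chart c S) F -> dev V F = 0.
  move=> IF; apply: dual_eqP.
    rewrite std_dev; have -> : [ffun k => std (V k)] = v.
      by apply/ffunP => k; rewrite !ffunE.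
    exact: IF.
  rewrite eps_dev; have /rowP/(_ 0) := tz F IF; rewrite [X in _ = X]mxE => e.
  apply: etrans e; rewrite mxE; apply: eq_bigr => i _.
  by rewrite !mxE ffunE enum_valK.
have Vc i : V (c i) = 1.
  apply/eqP; rewrite -subr_eq0 -[V _]devX -(rmorph1 (dev V)) -rmorphB; apply/eqP.
  by apply: devV => w [_ w1]; rewrite pevE rmorphB rmorph1 pevX w1 subrr.
have prop : forall k k', dg k = dg k' -> V k * inj (v k') = V k' * inj (v k).
  apply: hB.
  - by move=> k; rewrite ffunE.
  - by move=> F IF; apply: devV => w [[_ cw] _]; apply: cw.
  - rewrite -[RHS]zB; congr (_ *m _); apply/rowP => i.
    by rewrite mxE !ffunE enum_valK.
apply/rowP => i; rewrite mxE; have := prop (enum_val i) (c (dg (enum_val i))).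
rewrite dgc cv Vc mulr1 mul1r => /(_ erefl) /(congr1 (@eps C)).
by rewrite !ffunE enum_valK.
Qed.

End MultiProjective.

Local Close Scope classical_set_scope.

(** * Proportional triples *)

Definition prop3 (A : nzRingType) (x y z x' y' z' : A) : Prop :=
  (y - x) * (z' - x') = (z - x) * (y' - x').

Section Triples.
Variable C : fieldType.
Local Notation D := (dual C).
Implicit Types (u e : C) (x y z f g h : D).

Definition aff u e z := eps z = u * std z + e.

Definition nc3 (x y z : C) := (x != y) || (x != z).

Definition mnr x y z : C :=
  (eps z - eps x) * (std y - std x) - (eps y - eps x) * (std z - std x).

Lemma prop3_nc (x y z x' y' z' : C) : prop3 x y z x' y' z' ->
  nc3 x' y' z' -> x != y -> x' != y'.
Proof.
rewrite /prop3 /nc3 => h nc xy; apply: contraTneq nc => e; rewrite e eqxx /=.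
move/eqP: h; rewrite e subrr mulr0 mulf_eq0 subr_eq0 eq_sym (negPf xy) /=.
by rewrite subr_eq0 eq_sym => ->.
Qed.

Lemma affine2 x y : std x != std y -> exists u e, aff u e x /\ aff u e y.
Proof.
rewrite -subr_eq0 => nz; exists ((eps x - eps y) / (std x - std y)).
exists (eps x - (eps x - eps y) / (std x - std y) * std x).
by rewrite /aff; split; field.
Qed.

(** A block is rescaled along a proportional triple as soon as it is rescaled
    at two vertices which the other block separates. *)
Lemma extend_affine u e u' e' fx fy fz gx gy gz :
  prop3 fx fy fz gx gy gz -> aff u e fx -> aff u e fy ->
  aff u' e' gx -> aff u' e' gy -> aff u' e' gz -> std gx != std gy ->
  aff u e fz.
Proof.
rewrite /aff => h hx hy kx ky kz nz.
have h0 := congr1 (@std C) h; have h1 := congr1 (@eps C) h.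
move: h0 h1; rewrite !stdM !epsM !(stdD, stdN, epsD, epsN) hx hy kx ky kz.
set L := (X in X = _ -> _); set R := (X in _ = X -> _) => LR.
set EL := (X in X = _ -> _); set ER := (X in _ = X -> _) => ELR.
have nz' : std gy - std gx != 0 by rewrite subr_eq0 eq_sym.
apply/eqP; rewrite -subr_eq0 -(mulIr_eq0 _ (mulIf nz')).
have -> : (eps fz - (u * std fz + e)) * (std gy - std gx) =
  (ER - EL) + (u + u') * (L - R) by rewrite /ER /EL /L /R; ring.
by rewrite ELR LR !subrr mulr0 addr0.
Qed.

Lemma prop3C (A : comNzRingType) (x y z x' y' z' : A) :
  prop3 x y z x' y' z' -> prop3 x' y' z' x y z.
Proof. by rewrite /prop3 => h; rewrite mulrC -h mulrC. Qed.

Lemma transfer_affine u e fx fy fz gx gy gz : prop3 fx fy fz gx gy gz ->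
  aff u e fx -> aff u e fy -> aff u e fz ->
  nc3 (std fx) (std fy) (std fz) -> nc3 (std gx) (std gy) (std gz) ->
  exists u' e', [/\ aff u' e' gx, aff u' e' gy & aff u' e' gz].
Proof.
move=> h hx hy hz ncf ncg.
have h0 : prop3 (std fx) (std fy) (std fz) (std gx) (std gy) (std gz).
  exact: (congr1 (@std C) h).
case/orP: ncf => nef.
  have neg := prop3_nc h0 ncg nef.
  have [u' [e' [kx ky]]] := affine2 neg; exists u', e'; split=> //.
  exact: (extend_affine (prop3C h) kx ky hx hy hz).
have s : prop3 fx fz fy gx gz gy by rewrite /prop3 -h.
have s0 : prop3 (std fx) (std fz) (std fy) (std gx) (std gz) (std gy).
  by rewrite /prop3 -h0.
have neg : std gx != std gz by apply: (prop3_nc s0) nef; rewrite /nc3 orbC.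
have [u' [e' [kx kz]]] := affine2 neg; exists u', e'; split=> //.
exact: (extend_affine (prop3C s) kx kz hx hz hy).
Qed.

Lemma minor_affine x y z : mnr x y z = 0 -> nc3 (std x) (std y) (std z) ->
  exists u e, [/\ aff u e x, aff u e y & aff u e z].
Proof.
rewrite /mnr => m nc.
case/orP: nc => ne.
  have [u [e [hx hy]]] := affine2 ne; exists u, e; split=> //.
  rewrite /aff in hx hy *; move: m; rewrite hx hy => /eqP.
  have -> : (eps z - (u * std x + e)) * (std y - std x) -
    (u * std y + e - (u * std x + e)) * (std z - std x) =
    (eps z - (u * std z + e)) * (std y - std x) by ring.
  by rewrite mulf_eq0 !subr_eq0 [std y == _]eq_sym (negPf ne) orbF => /eqP.
have [u [e [hx hz]]] := affine2 ne; exists u, e; split=> //.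
rewrite /aff in hx hz *; move: m; rewrite hx hz => /eqP.
have -> : (u * std z + e - (u * std x + e)) * (std y - std x) -
    (eps y - (u * std x + e)) * (std z - std x) =
    (u * std y + e - eps y) * (std z - std x) by ring.
by rewrite mulf_eq0 !subr_eq0 [std z == _]eq_sym (negPf ne) orbF => /eqP.
Qed.

End Triples.

(** * Rigidity of the core *)

Notation u4 i j k l := (uniq [:: i; j; k; l] : bool) (only parsing).

Ltac uniq4 := match goal with
  | H : is_true (uniq [:: _; _; _; _]) |- _ =>
    move: H; rewrite /= ?inE ?negb_or ?andbT => H;
    repeat match goal with
      | H' : is_true (_ && _) |- _ => case/andP: H'; intros
      end;
    repeat (apply/andP; split);
    try assumption; try done; rewrite eq_sym; assumption
  end.

Lemma uniq4_mem (i j k l x : 'I_4) : uniq [:: i; j; k; l] ->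
  [\/ x = i, x = j, x = k | x = l].
Proof.
move=> U; have : x \in [:: i; j; k; l].
  apply: contraT => xn; have U5 : uniq [:: x; i; j; k; l] by rewrite /= in U *; rewrite xn.
  by have := max_card (mem [:: x; i; j; k; l]); rewrite (card_uniqP U5) card_ord.
by rewrite !inE => /or4P [] /eqP ->; [constructor 1|constructor 2|constructor 3|constructor 4].
Qed.

Lemma notin_seq (s : seq 'I_4) : (size s < 4)%N -> exists l, l \notin s.
Proof.
move=> lt; apply: contrapT => h.
have e : #|s| = #|'I_4|.
  apply: eq_card => x; rewrite [RHS]inE; apply: contrapT => hx.
  by apply: h; exists x; apply/negP.
by have := card_size s; rewrite e card_ord leqNgt lt.
Qed.

Lemma uniq4_ex (i j k : 'I_4) : uniq [:: i; j; k] -> exists l, uniq [:: i; j; k; l].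
Proof.
move=> U; have [//|l hl] := @notin_seq [:: i; j; k].
exists l; move: U hl; rewrite /= !inE !negb_or !andbT.
move=> /andP [/andP [-> ->] ->] /and3P [h1 h2 h3].
by rewrite /= ![_ == l]eq_sym h1 h2 h3.
Qed.

Lemma uniq4_ex2 (i j : 'I_4) : i != j -> exists k l, uniq [:: i; j; k; l].
Proof.
move=> ij; have [//|k hk] := @notin_seq [:: i; j].
have [|l hl] := @uniq4_ex i j k; last by exists k, l.
move: hk; rewrite /= !inE !negb_or => /andP [h1 h2].
by rewrite ij ![_ == k]eq_sym h1 h2.
Qed.

Lemma uniq4_ex3 (i : 'I_4) : exists j k l, uniq [:: i; j; k; l].
Proof.
have [j ij] : exists j : 'I_4, i != j.
  by case: (eqVneq i ord0) => [->|n]; [exists ord_max|exists ord0].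
by have [k [l h]] := uniq4_ex2 ij; exists j, k, l.
Qed.

(** Potentials of the coordinates of a point of the core, whose differences are
    the coordinates.  In terms of a tetrahedron with points (1, a, b, c), ca i
    is the value of a at the vertex i, cS i j the slope of b against a on the
    edge ij, and ct i the slope of c against b on the plane opposite to i; the
    triangle cq l records the points other than l, which in the plane agrees
    with the triangle of the slopes of the three edges opposite to them, and
    the triangle cr l records the edges at l, which agrees with that of the
    planes through l. *)
Record core_data (A : Type) := CoreData {
  ca : 'I_4 -> A; cq : 'I_4 -> 'I_4 -> A; cS : 'I_4 -> 'I_4 -> A;
  cr : 'I_4 -> 'I_4 -> A; ct : 'I_4 -> A }.

Definition core_rel (A : nzRingType) (X : core_data A) : Prop :=
  (forall i j, cS X i j = cS X j i) /\
  forall i j k l, uniq [:: i; j; k; l] ->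
  [/\ prop3 (ca X i) (ca X j) (ca X k) (cq X l i) (cq X l j) (cq X l k),
      prop3 (cq X l i) (cq X l j) (cq X l k) (cS X j k) (cS X i k) (cS X i j),
      prop3 (cS X l i) (cS X l j) (cS X l k) (cr X l i) (cr X l j) (cr X l k),
      prop3 (cr X l i) (cr X l j) (cr X l k) (ct X i) (ct X j) (ct X k) &
      (cr X i j - cr X i k) * (cq X i k - cq X i l) * (cS X i l - cS X l k) =
      (cr X i l - cr X i k) * (cq X i k - cq X i j) * (cS X i j - cS X j k)].

Section Rigidity.
Variable C : fieldType.
Local Notation D := (dual C).

Definition all_affine (X : core_data D) : Prop :=
  [/\ exists u e, forall i, aff u e (ca X i),
      forall l, exists u e, forall i, i != l -> aff u e (cq X l i),
      exists u e, forall i j, i != j -> aff u e (cS X i j),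
      forall l, exists u e, forall i, i != l -> aff u e (cr X l i) &
      exists u e, forall i, aff u e (ct X i)].

(** The linear conditions, one for each triple of vertices of a block. *)
Inductive condition :=
  | CondA of 'I_4 & 'I_4 & 'I_4
  | CondQ of 'I_4 & 'I_4 & 'I_4 & 'I_4
  | CondS of 'I_4 * 'I_4 & 'I_4 * 'I_4 & 'I_4 * 'I_4
  | CondR of 'I_4 & 'I_4 & 'I_4 & 'I_4.

Definition holds (X : core_data D) (m : condition) : Prop := match m with
  | CondA i j k => mnr (ca X i) (ca X j) (ca X k) = 0
  | CondQ l i j k => mnr (cq X l i) (cq X l j) (cq X l k) = 0
  | CondS i j k => mnr (cS X i.1 i.2) (cS X j.1 j.2) (cS X k.1 k.2) = 0
  | CondR l i j k => mnr (cr X l i) (cr X l j) (cr X l k) = 0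
  end.

Definition lifts (X : core_data D) (X0 : core_data C) : Prop :=
  [/\ forall i, std (ca X i) = ca X0 i,
      forall l i, std (cq X l i) = cq X0 l i,
      forall i j, std (cS X i j) = cS X0 i j,
      forall l i, std (cr X l i) = cr X0 l i &
      forall i, std (ct X i) = ct X0 i].

Definition nondegenerate (X0 : core_data C) : Prop :=
  [/\ exists i j, ca X0 i != ca X0 j,
      forall i j k l, uniq [:: i; j; k; l] ->
        nc3 (cq X0 l i) (cq X0 l j) (cq X0 l k),
      exists i j i' j', [/\ i != j, i' != j' & cS X0 i j != cS X0 i' j'],
      forall i j k l, uniq [:: i; j; k; l] ->
        nc3 (cr X0 l i) (cr X0 l j) (cr X0 l k) &
      exists i j, ct X0 i != ct X0 j].

Definition rigid (X0 : core_data C) : Prop :=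
  exists m : condition * condition * condition,
  forall X, lifts X X0 -> core_rel X ->
    holds X m.1.1 -> holds X m.1.2 -> holds X m.2 -> all_affine X.

Variable X0 : core_data C.
Hypothesis rel0 : core_rel X0.
Hypothesis nd0 : nondegenerate X0.

Local Notation a0 := (ca X0).
Local Notation q0 := (cq X0).
Local Notation S0 := (cS X0).
Local Notation r0 := (cr X0).
Local Notation t0 := (ct X0).

(** Near a point where all the slopes of the edges but one agree, coordinates
    are one of the remaining slopes and the positions of the points and of the
    planes. *)
Lemma rigid_edge_oriented i j k l : uniq [:: i; j; k; l] ->
  S0 i j = S0 i l -> S0 i k = S0 i l -> S0 j l = S0 i l -> S0 k l = S0 i l ->
  S0 j k != S0 i l -> a0 l != a0 k -> t0 k != t0 l -> rigid X0.
Proof.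
move=> U Sij Sik Sjl Skl Sjk akl tkl.
have [Ssym0 R0] := rel0; have [_ ncq _ ncr _] := nd0.
have Sjk' : S0 i l != S0 j k by rewrite eq_sym.
have qlik : q0 l i != q0 l k.
  have [|_ h _ _ _] := R0 i k j l; first by uniq4.
  apply: (prop3_nc (prop3C h)); first by apply: ncq; uniq4.
  by rewrite ![S0 k j]Ssym0 Sij.
have qljk : q0 l j = q0 l k.
  have [|_ h _ _ _] := R0 j k i l; first by uniq4.
  apply/eqP/negPn/negP => ne.
  have nc : nc3 (S0 k i) (S0 j i) (S0 j k).
    by rewrite /nc3 ![S0 _ i]Ssym0 Sik Sjk' orbT.
  by have := prop3_nc h nc ne; rewrite ![S0 _ i]Ssym0 Sij Sik eqxx.
have ajk : a0 j = a0 k.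
  have [|h _ _ _ _] := R0 j k i l; first by uniq4.
  apply/eqP/negPn/negP => ne.
  have nc : nc3 (q0 l j) (q0 l k) (q0 l i) by apply: ncq; uniq4.
  by have := prop3_nc h nc ne; rewrite qljk eqxx.
have qijk : q0 i j = q0 i k.
  have [|_ h _ _ _] := R0 j k l i; first by uniq4.
  apply/eqP/negPn/negP => ne.
  have nc : nc3 (S0 k l) (S0 j l) (S0 j k) by rewrite /nc3 Skl Sjk' orbT.
  by have := prop3_nc h nc ne; rewrite Sjl Skl eqxx.
have qijl : q0 i j != q0 i l.
  have nc : nc3 (q0 i j) (q0 i l) (q0 i k) by apply: ncq; uniq4.
  by move: nc; rewrite /nc3 qijk eqxx ?orbF.
have rjil : r0 j i = r0 j l.
  have [|_ _ h _ _] := R0 i l k j; first by uniq4.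
  apply/eqP/negPn/negP => ne.
  have nc : nc3 (S0 j i) (S0 j l) (S0 j k) by rewrite /nc3 [S0 j i]Ssym0 Sij Sjk' orbT.
  by have := prop3_nc (prop3C h) nc ne; rewrite [S0 j i]Ssym0 Sij Sjl eqxx.
have rjik : r0 j i != r0 j k.
  have nc : nc3 (r0 j i) (r0 j l) (r0 j k) by apply: ncr; uniq4.
  by move: nc; rewrite /nc3 rjil eqxx ?orbF.
have rkil : r0 k i = r0 k l.
  have [|_ _ h _ _] := R0 i l j k; first by uniq4.
  apply/eqP/negPn/negP => ne.
  have nc : nc3 (S0 k i) (S0 k l) (S0 k j).
    by rewrite /nc3 [S0 k i]Ssym0 Sik [S0 k j]Ssym0 Sjk' orbT.
  by have := prop3_nc (prop3C h) nc ne; rewrite [S0 k i]Ssym0 Sik Skl eqxx.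
have rkij : r0 k i != r0 k j.
  have nc : nc3 (r0 k i) (r0 k l) (r0 k j) by apply: ncr; uniq4.
  by move: nc; rewrite /nc3 rkil eqxx ?orbF.
have til : t0 i = t0 l.
  have [|_ _ _ h _] := R0 i l k j; first by uniq4.
  apply/eqP/negPn/negP => ne.
  have nc : nc3 (r0 j i) (r0 j l) (r0 j k) by apply: ncr; uniq4.
  by have := prop3_nc (prop3C h) nc ne; rewrite rjil eqxx.
have qjkl : q0 j k != q0 j l.
  have [|h _ _ _ _] := R0 k l i j; first by uniq4.
  by apply: (prop3_nc h); [apply: ncq; uniq4|rewrite eq_sym].
have qkjl : q0 k j != q0 k l.
  have [|h _ _ _ _] := R0 j l i k; first by uniq4.
  by apply: (prop3_nc h); [apply: ncq; uniq4|rewrite ajk eq_sym].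
have rikl : r0 i k != r0 i l.
  have [|_ _ _ h _] := R0 k l j i; first by uniq4.
  by apply: (prop3_nc (prop3C h)); [apply: ncr; uniq4|].
have rlki : r0 l k != r0 l i.
  have [|_ _ _ h _] := R0 k i j l; first by uniq4.
  by apply: (prop3_nc (prop3C h)); [apply: ncr; uniq4|rewrite til].
exists (CondQ j i k l, CondR i j k l, CondS (i, l) (j, k) (i, k)).
move=> X [La Lq LS Lr Lt] [Ssym R] /= mq mr mS.
have ncj : nc3 (std (cq X j i)) (std (cq X j k)) (std (cq X j l)).
  by rewrite !Lq; apply: ncq; uniq4.
have nci : nc3 (std (cr X i j)) (std (cr X i k)) (std (cr X i l)).
  by rewrite !Lr; apply: ncr; uniq4.
have [u1 [e1 [qji qjk qjl]]] := minor_affine mq ncj.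
have [u2 [e2 [rij rik ril]]] := minor_affine mr nci.
have [u3 [e3 [Ail Ajk Aik]]] : exists u e, [/\ aff u e (cS X i l), aff u e (cS X j k) & aff u e (cS X i k)].
  by apply: minor_affine mS _; rewrite !LS /nc3 eq_sym Sjk.
have Akl : aff u3 e3 (cS X k l).
  have [|_ h _ _ _] := R k l i j; first by uniq4.
  apply: (extend_affine (prop3C h) _ _ qjk qjl qji); rewrite ?Lq //.
    by rewrite Ssym.
  by rewrite Ssym.
have Aij : aff u3 e3 (cS X i j).
  have [|_ _ h _ _] := R l k j i; first by uniq4.
  by apply: (extend_affine h Ail Aik ril rik rij); rewrite !Lr eq_sym.
have [u4 [e4 [qli qlk]]] : exists u e, aff u e (cq X l i) /\ aff u e (cq X l k).
  by apply: affine2; rewrite !Lq.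
have qlj : aff u4 e4 (cq X l j).
  have [|_ h _ _ _] := R i k j l; first by uniq4.
  apply: (extend_affine h qli qlk); rewrite ?(Ssym k j).
  - exact: Ajk.
  - exact: Aij.
  - exact: Aik.
  - by rewrite !LS Sij.
have [u5 [e5 [ak al]]] : exists u e, aff u e (ca X k) /\ aff u e (ca X l).
  by apply: affine2; rewrite !La eq_sym.
have ai : aff u5 e5 (ca X i).
  have [|h _ _ _ _] := R k l i j; first by uniq4.
  by apply: (extend_affine h ak al qjk qjl qji); rewrite !Lq.
have aj : aff u5 e5 (ca X j).
  have [|h _ _ _ _] := R i k j l; first by uniq4.
  by apply: (extend_affine h ai ak qli qlk qlj); rewrite !Lq.
have [u6 [e6 [qkj qkl]]] : exists u e, aff u e (cq X k j) /\ aff u e (cq X k l).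
  by apply: affine2; rewrite !Lq.
have qki : aff u6 e6 (cq X k i).
  have [|h _ _ _ _] := R j l i k; first by uniq4.
  by apply: (extend_affine (prop3C h) qkj qkl aj al ai); rewrite !La ajk eq_sym.
have Ajl : aff u3 e3 (cS X j l).
  have [|_ h _ _ _] := R j l i k; first by uniq4.
  apply: (extend_affine (prop3C h) _ _ qkj qkl qki); rewrite ?Lq //.
    by rewrite Ssym.
  by rewrite Ssym.
have [u7 [e7 [qij qil]]] : exists u e, aff u e (cq X i j) /\ aff u e (cq X i l).
  by apply: affine2; rewrite !Lq.
have qik : aff u7 e7 (cq X i k).
  have [|_ h _ _ _] := R j l k i; first by uniq4.
  apply: (extend_affine h qij qil); rewrite ?(Ssym l k).
  - exact: Akl.
  - exact: Ajk.
  - exact: Ajl.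
  - by rewrite !LS Skl eq_sym.
have [u8 [e8 [rji rjk]]] : exists u e, aff u e (cr X j i) /\ aff u e (cr X j k).
  by apply: affine2; rewrite !Lr.
have rjl : aff u8 e8 (cr X j l).
  have [|_ _ h _ _] := R i k l j; first by uniq4.
  apply: (extend_affine (prop3C h) rji rjk); rewrite ?(Ssym j i) //.
  - exact: Aij.
  - exact: Ajk.
  - exact: Ajl.
  - by rewrite !LS Sij eq_sym.
have [u9 [e9 [rki rkj]]] : exists u e, aff u e (cr X k i) /\ aff u e (cr X k j).
  by apply: affine2; rewrite !Lr.
have rkl : aff u9 e9 (cr X k l).
  have [|_ _ h _ _] := R i j l k; first by uniq4.
  apply: (extend_affine (prop3C h) rki rkj); rewrite ?(Ssym k i) ?(Ssym k j).
  - exact: Aik.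
  - exact: Ajk.
  - exact: Akl.
  - by rewrite !LS Sik eq_sym.
have [u10 [e10 [tk tl]]] : exists u e, aff u e (ct X k) /\ aff u e (ct X l).
  by apply: affine2; rewrite !Lt.
have tj : aff u10 e10 (ct X j).
  have [|_ _ _ h _] := R k l j i; first by uniq4.
  by apply: (extend_affine (prop3C h) tk tl rik ril rij); rewrite !Lr.
have ti : aff u10 e10 (ct X i).
  have [|_ _ _ h _] := R k l i j; first by uniq4.
  apply: (extend_affine (prop3C h) tk tl rjk rjl rji); rewrite !Lr.
  by rewrite -rjil eq_sym.
have [u11 [e11 [rlk rli]]] : exists u e, aff u e (cr X l k) /\ aff u e (cr X l i).
  by apply: affine2; rewrite !Lr.
have rlj : aff u11 e11 (cr X l j).
  have [|_ _ _ h _] := R k i j l; first by uniq4.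
  by apply: (extend_affine h rlk rli tk ti tj); rewrite !Lt til.
split.
- by exists u5, e5 => x; case: (uniq4_mem x U) => ->.
- move=> y; case: (uniq4_mem y U) => ->; [exists u7, e7|exists u1, e1|exists u6, e6|exists u4, e4];
  by move=> x; case: (uniq4_mem x U) => ->; rewrite ?eqxx.
- exists u3, e3 => x y; case: (uniq4_mem x U) => ->; case: (uniq4_mem y U) => ->;
  by rewrite ?eqxx // 1?Ssym.
- move=> y; case: (uniq4_mem y U) => ->; [exists u2, e2|exists u8, e8|exists u9, e9|exists u11, e11];
  by move=> x; case: (uniq4_mem x U) => ->; rewrite ?eqxx.
- by exists u10, e10 => x; case: (uniq4_mem x U) => ->.
Qed.

Lemma edge_positions i j k l : uniq [:: i; j; k; l] ->
  S0 i j = S0 i l -> S0 i k = S0 i l -> S0 j l = S0 i l -> S0 k l = S0 i l ->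
  S0 j k != S0 i l -> a0 j = a0 k /\ t0 i = t0 l.
Proof.
move=> U Sij Sik Sjl Skl Sjk.
have [Ssym0 R0] := rel0; have [_ ncq _ ncr _] := nd0.
have Sjk' : S0 i l != S0 j k by rewrite eq_sym.
split; apply/eqP/negPn/negP => ne.
  have [|h h' _ _ _] := R0 j k i l; first by uniq4.
  have neq : q0 l j != q0 l k by apply: (prop3_nc h) ne; apply: ncq; uniq4.
  have nc : nc3 (S0 k i) (S0 j i) (S0 j k).
    by rewrite /nc3 ![S0 _ i]Ssym0 Sik Sjk' orbT.
  by have := prop3_nc h' nc neq; rewrite ![S0 _ i]Ssym0 Sij Sik eqxx.
have [|_ _ h' h _] := R0 i l k j; first by uniq4.
have ner : r0 j i != r0 j l by apply: (prop3_nc (prop3C h)) ne; apply: ncr; uniq4.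
have nc : nc3 (S0 j i) (S0 j l) (S0 j k) by rewrite /nc3 [S0 j i]Ssym0 Sij Sjk' orbT.
by have := prop3_nc (prop3C h') nc ner; rewrite [S0 j i]Ssym0 Sij Sjl eqxx.
Qed.

Lemma rigid_edge i j k l : uniq [:: i; j; k; l] ->
  S0 i j = S0 i l -> S0 i k = S0 i l -> S0 j l = S0 i l -> S0 k l = S0 i l ->
  S0 j k != S0 i l -> rigid X0.
Proof.
move=> U Sij Sik Sjl Skl Sjk; have [ajk til] := edge_positions U Sij Sik Sjl Skl Sjk.
have [Ssym0 _] := rel0; have [[x [y axy]] _ _ _ [x' [y' txy]]] := nd0.
have sli := Ssym0 l i.
have ha : a0 l != a0 k \/ a0 i != a0 k.
  have [e1|] := eqVneq (a0 l) (a0 k); last by left.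
  have [e2|] := eqVneq (a0 i) (a0 k); last by right.
  by move: axy; case: (uniq4_mem x U) => ->; case: (uniq4_mem y U) => ->;
     rewrite ?e1 ?e2 ?ajk eqxx.
have ht : t0 k != t0 l \/ t0 j != t0 l.
  have [e1|] := eqVneq (t0 k) (t0 l); last by left.
  have [e2|] := eqVneq (t0 j) (t0 l); last by right.
  by move: txy; case: (uniq4_mem x' U) => ->; case: (uniq4_mem y' U) => ->;
     rewrite ?e1 ?e2 ?til eqxx.
case: ha => ha; case: ht => ht.
- exact: (rigid_edge_oriented U).
- by apply: (@rigid_edge_oriented i k j l); rewrite ?ajk ?[S0 k j]Ssym0 //; uniq4.
- apply: (@rigid_edge_oriented l j k i); rewrite ?til ?sli //; try uniq4;
  by rewrite [LHS]Ssym0.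
- apply: (@rigid_edge_oriented l k j i); rewrite ?til ?ajk ?sli ?[S0 k j]Ssym0 //;
  try uniq4; by rewrite [LHS]Ssym0.
Qed.

Lemma affine_unique u e u' e' (x y : D) : aff u e x -> aff u e y ->
  aff u' e' x -> aff u' e' y -> std x != std y -> u = u' /\ e = e'.
Proof.
rewrite /aff => hx hy hx' hy' ne.
have eu : u = u'.
  apply: (mulIf (_ : std x - std y != 0)); first by rewrite subr_eq0.
  have -> : u * (std x - std y) = (u * std x + e) - (u * std y + e) by ring.
  by rewrite -hx -hy hx' hy'; ring.
by split=> //; apply: (addrI (u * std x)); rewrite -hx hx' eu.
Qed.

Definition affine_points (X : core_data D) : Prop :=
  (exists u e, forall i, aff u e (ca X i)) /\
  forall l, exists u e, forall i, i != l -> aff u e (cq X l i).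

Lemma transfer_points X u e l : lifts X X0 -> core_rel X ->
  (forall i, aff u e (ca X i)) ->
  (forall i j k, uniq [:: i; j; k; l] -> nc3 (a0 i) (a0 j) (a0 k)) ->
  exists u' e', forall i, i != l -> aff u' e' (cq X l i).
Proof.
move=> [La Lq LS Lr Lt] [Ssym R] ha nca; have [_ ncq _ _ _] := nd0.
have [i [j [k U]]] := uniq4_ex3 l.
have U' : uniq [:: i; j; k; l] by uniq4.
have [h _ _ _ _] := R _ _ _ _ U'.
have na : nc3 (std (ca X i)) (std (ca X j)) (std (ca X k)) by rewrite !La nca.
have nq : nc3 (std (cq X l i)) (std (cq X l j)) (std (cq X l k)).
  by rewrite !Lq ncq.
have [u' [e' [h1 h2 h3]]] := transfer_affine h (ha i) (ha j) (ha k) na nq.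
by exists u', e' => x; case: (uniq4_mem x U) => ->; rewrite ?eqxx.
Qed.

Lemma two_conditions_cluster i j k l : uniq [:: i; j; k; l] ->
  a0 j = a0 k -> a0 k = a0 l -> q0 i j != q0 i k ->
  exists m1 m2, forall X, lifts X X0 -> core_rel X ->
    holds X m1 -> holds X m2 -> affine_points X.
Proof.
move=> U ajk akl qjk; have [[x [y axy]] ncq _ _ _] := nd0.
have aij : a0 i != a0 j.
  apply: contraNneq axy => e; apply/eqP.
  by case: (uniq4_mem x U) => ->; case: (uniq4_mem y U) => ->;
     rewrite ?e ?ajk ?akl.
exists (CondQ i j k l), (CondA i j k) => X LX RX /= mq ma.
have [La Lq LS Lr Lt] := LX; have [Ssym R] := RX.
have nq : nc3 (std (cq X i j)) (std (cq X i k)) (std (cq X i l)).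
  by rewrite !Lq; apply: ncq; uniq4.
have [u1 [e1 [qij qik qil]]] := minor_affine mq nq.
have na : nc3 (std (ca X i)) (std (ca X j)) (std (ca X k)) by rewrite !La /nc3 aij.
have [u [e [ai aj ak]]] := minor_affine ma na.
have al : aff u e (ca X l).
  have [|h _ _ _ _] := R j k l i; first by uniq4.
  by apply: (extend_affine h aj ak qij qik qil); rewrite !Lq.
have aA x' : aff u e (ca X x') by case: (uniq4_mem x' U) => ->.
split; first by exists u, e.
move=> m; have [->|mi] := eqVneq m i.
  by exists u1, e1 => x'; case: (uniq4_mem x' U) => ->; rewrite ?eqxx.
apply: (transfer_points LX RX aA) => x1 x2 x3 Um.
have P z : z != i -> a0 z = a0 j.
  by case: (uniq4_mem z U) => ->; rewrite ?eqxx -?akl -?ajk.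
have [x1i|n1] := eqVneq x1 i.
  rewrite /nc3 x1i (P x2) ?aij //; rewrite -x1i eq_sym; uniq4.
rewrite /nc3 (P x1) //; have [->|n2] := eqVneq x2 i; first by rewrite eq_sym aij.
have [->|n3] := eqVneq x3 i; first by rewrite [_ == a0 i]eq_sym aij orbT.
by case: (uniq4_mem i Um) => e'; move: n1 n2 n3 mi; rewrite e' eqxx.
Qed.

(** Positions of the points and the four triangles of points form the blowup
    of the projective plane in four points, so two conditions determine them. *)
Lemma two_conditions : exists m1 m2, forall X, lifts X X0 -> core_rel X ->
  holds X m1 -> holds X m2 -> affine_points X.
Proof.
have [[i [j aij]] ncq _ _ _] := nd0.
case: (EM (exists i j k l, [/\ uniq [:: i; j; k; l], a0 j = a0 k & a0 k = a0 l])).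
  move=> [{aij}i [{}j [k [l [U ajk akl]]]]].
  have nq : nc3 (q0 i j) (q0 i k) (q0 i l) by apply: ncq; uniq4.
  case/orP: nq => h; first exact: (two_conditions_cluster U ajk akl h).
  apply: (@two_conditions_cluster i j l k) => //; [uniq4|by rewrite ajk].
have nij : i != j by apply: contraNneq aij => ->.
move=> nocl; have [k [l U]] := uniq4_ex2 nij.
have nca m i' j' k' : uniq [:: i'; j'; k'; m] -> nc3 (a0 i') (a0 j') (a0 k').
  move=> U'; apply: contrapT => /negP; rewrite /nc3 negb_or !negbK.
  move=> /andP [/eqP e1 /eqP e2]; apply: nocl; exists m, i', j', k'.
  by split=> //; [uniq4|rewrite -e1].
exists (CondA i j k), (CondA i j l) => X LX RX /= m1 m2.
have [La Lq LS Lr Lt] := LX.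
have nA z : nc3 (std (ca X i)) (std (ca X j)) (std (ca X z)) by rewrite !La /nc3 aij.
have [u [e [ai aj ak]]] := minor_affine m1 (nA k).
have [u' [e' [ai' aj' al]]] := minor_affine m2 (nA l).
have [|eu ee] := affine_unique ai aj ai' aj'; first by rewrite !La.
have aA x : aff u e (ca X x).
  by case: (uniq4_mem x U) => -> //; rewrite eu ee.
split; first by exists u, e.
by move=> m; apply: (transfer_points LX RX aA) => ? ? ?; apply: nca.
Qed.

Lemma prop3_eq (x y z x' y' z' : C) : prop3 x y z x' y' z' ->
  x = y -> x' != y' -> x = z.
Proof.
rewrite /prop3 => h e ne; move/eqP: h; rewrite e subrr mul0r eq_sym mulf_eq0.
by rewrite !subr_eq0 [y' == _]eq_sym (negPf ne) orbF => /eqP.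
Qed.

Lemma third_condition_oriented i j k l x x' y y' : uniq [:: i; j; k; l] ->
  (x, x') = (i, j) \/ (x, x') = (j, i) -> (y, y') = (i, j) \/ (y, y') = (j, i) ->
  q0 i k != q0 i l -> q0 k l != q0 k x -> q0 l k != q0 l y ->
  exists m, forall X, lifts X X0 -> core_rel X -> affine_points X -> holds X m ->
    exists u e, forall i j, i != j -> aff u e (cS X i j).
Proof.
move=> U hx hy qikl qklx qlky.
have [Ssym0 R0] := rel0; have [_ ncq [p [p' [q [q' [hp hq ncS]]]]] _ _] := nd0.
have Ux : uniq [:: l; x; x'; k] by case: hx => -[-> ->]; uniq4.
have Uy : uniq [:: k; y; y'; l] by case: hy => -[-> ->]; uniq4.
have nc : nc3 (S0 i j) (S0 l x') (S0 k y').
  apply: contraNT ncS; rewrite /nc3 negb_or !negbK => /andP [/eqP e1 /eqP e2].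
  have Sx : S0 x x' = S0 i j by case: hx => -[-> ->] //; rewrite Ssym0.
  have Sy : S0 y y' = S0 i j by case: hy => -[-> ->] //; rewrite Ssym0.
  have e3 : S0 i j = S0 l x.
    have [_ h _ _ _] := R0 _ _ _ _ Ux; rewrite -Sx.
    by apply: (prop3_eq (prop3C h)); rewrite ?Sx.
  have e4 : S0 i j = S0 k y.
    have [_ h _ _ _] := R0 _ _ _ _ Uy; rewrite -Sy.
    by apply: (prop3_eq (prop3C h)); rewrite ?Sy.
  have eli : S0 l i = S0 i j by case: hx e1 e3 => -[-> ->]; congruence.
  have elj : S0 l j = S0 i j by case: hx e1 e3 => -[-> ->]; congruence.
  have eki : S0 k i = S0 i j by case: hy e2 e4 => -[-> ->]; congruence.
  have ekj : S0 k j = S0 i j by case: hy e2 e4 => -[-> ->]; congruence.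
  have ekl : S0 k l = S0 i j.
    have [|_ h _ _ _] := R0 k l j i; first by uniq4.
    rewrite -elj; apply/esym/(prop3_eq (prop3C h)) => //.
    by rewrite elj ekj.
  have eqs := (eki, eli, ekj, elj, ekl, Ssym0 j i, Ssym0 i k, Ssym0 i l, Ssym0 j k,
    Ssym0 j l, Ssym0 l k).
  have all z w : z != w -> S0 z w = S0 i j.
    case: (uniq4_mem z U) => ->; case: (uniq4_mem w U) => ->; rewrite ?eqxx // => _;
    rewrite ?eqs //.
  by rewrite !all.
exists (CondS (i, j) (l, x') (k, y')) => X [La Lq LS Lr Lt] [Ssym R] [[ua [ea ha]] hq'] /= m.
have [u [e [Aij Alx' Aky']]] : exists u e, [/\ aff u e (cS X i j), aff u e (cS X l x') & aff u e (cS X k y')].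
  by apply: minor_affine m _; rewrite !LS.
have Axx : aff u e (cS X x x') by case: hx => -[-> ->] //; rewrite Ssym.
have Ayy : aff u e (cS X y y') by case: hy => -[-> ->] //; rewrite Ssym.
have Alx : aff u e (cS X l x).
  have [_ h _ _ _] := R _ _ _ _ Ux; have [uk [ek hk]] := hq' k.
  have k1 : aff uk ek (cq X k l) by apply: hk; uniq4.
  have k2 : aff uk ek (cq X k x) by apply: hk; uniq4.
  have k3 : aff uk ek (cq X k x') by apply: hk; uniq4.
  by apply: (extend_affine (prop3C h) Axx Alx' k1 k2 k3); rewrite !Lq.
have Aky : aff u e (cS X k y).
  have [_ h _ _ _] := R _ _ _ _ Uy; have [uk [ek hk]] := hq' l.
  have k1 : aff uk ek (cq X l k) by apply: hk; uniq4.
  have k2 : aff uk ek (cq X l y) by apply: hk; uniq4.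
  have k3 : aff uk ek (cq X l y') by apply: hk; uniq4.
  by apply: (extend_affine (prop3C h) Ayy Aky' k1 k2 k3); rewrite !Lq.
have [Ali Alj] : aff u e (cS X l i) /\ aff u e (cS X l j).
  by case: hx Alx' Alx => -[-> ->].
have [Aki Akj] : aff u e (cS X k i) /\ aff u e (cS X k j).
  by case: hy Aky' Aky => -[-> ->].
have Akl : aff u e (cS X k l).
  have [|_ h _ _ _] := R k l j i; first by uniq4.
  have [ui [ei hi]] := hq' i.
  have k1 : aff ui ei (cq X i k) by apply: hi; uniq4.
  have k2 : aff ui ei (cq X i l) by apply: hi; uniq4.
  have k3 : aff ui ei (cq X i j) by apply: hi; uniq4.
  by apply: (extend_affine (prop3C h) Alj Akj k1 k2 k3); rewrite !Lq.
exists u, e => z w.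
by case: (uniq4_mem z U) => ->; case: (uniq4_mem w U) => ->; rewrite ?eqxx // => _; rewrite 1?Ssym.
Qed.

(** The slopes are determined by their multiples on two of the triangles of
    edges opposite to points, and hence by one more condition. *)
Lemma third_condition : exists m, forall X, lifts X X0 -> core_rel X ->
  affine_points X -> holds X m ->
  exists u e, forall i j, i != j -> aff u e (cS X i j).
Proof.
have [_ ncq _ _ _] := nd0.
have [i [j [k [l [U qikl]]]]] : exists i j k l, uniq [:: i; j; k; l] /\ q0 i k != q0 i l.
  have [j' [k' [l' U']]] := uniq4_ex3 ord0.
  have nq : nc3 (q0 ord0 j') (q0 ord0 k') (q0 ord0 l') by apply: ncq; uniq4.
  case/orP: nq => h; first by exists ord0, l', j', k'; split=> //; uniq4.
  by exists ord0, k', j', l'; split=> //; uniq4.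
have nk : nc3 (q0 k l) (q0 k i) (q0 k j) by apply: ncq; uniq4.
have nl : nc3 (q0 l k) (q0 l i) (q0 l j) by apply: ncq; uniq4.
case/orP: nk => hk; case/orP: nl => hl.
- apply: (@third_condition_oriented i j k l i j i j U _ _ qikl hk hl); auto.
- apply: (@third_condition_oriented i j k l i j j i U _ _ qikl hk hl); auto.
- apply: (@third_condition_oriented i j k l j i i j U _ _ qikl hk hl); auto.
- apply: (@third_condition_oriented i j k l j i j i U _ _ qikl hk hl); auto.
Qed.

Lemma affine_planes X i j k l : uniq [:: i; j; k; l] -> lifts X X0 -> core_rel X ->
  (forall m, m != i -> exists u e, forall n, n != m -> aff u e (cr X m n)) ->
  nc3 (t0 i) (t0 k) (t0 l) -> exists u e, forall m, aff u e (ct X m).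
Proof.
move=> U [La Lq LS Lr Lt] [Ssym R] hr nt; have [_ _ _ ncr _] := nd0.
have jm : j != i by uniq4.
have [uj [ej hj]] := hr j jm.
have rji : aff uj ej (cr X j i) by apply: hj; uniq4.
have rjk : aff uj ej (cr X j k) by apply: hj; uniq4.
have rjl : aff uj ej (cr X j l) by apply: hj; uniq4.
have nr : nc3 (std (cr X j i)) (std (cr X j k)) (std (cr X j l)).
  by rewrite !Lr; apply: ncr; uniq4.
have nt' : nc3 (std (ct X i)) (std (ct X k)) (std (ct X l)) by rewrite !Lt.
have [|_ _ _ h _] := R i k l j; first by uniq4.
have [u [e [ti tk tl]]] := transfer_affine h rji rjk rjl nr nt'.
have tj : aff u e (ct X j).
  case/orP: nt => ne.
    have lm : l != i by uniq4.
    have [ul [el hl]] := hr l lm.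
    have rli : aff ul el (cr X l i) by apply: hl; uniq4.
    have rlk : aff ul el (cr X l k) by apply: hl; uniq4.
    have rlj : aff ul el (cr X l j) by apply: hl; uniq4.
    have [|_ _ _ h' _] := R i k j l; first by uniq4.
    have [_ /(_ i k j l) R0] := rel0; have [|_ _ _ h0 _] := R0; first by uniq4.
    apply: (extend_affine (prop3C h') ti tk rli rlk rlj); rewrite !Lr.
    by apply: (prop3_nc (prop3C h0)) ne; apply: ncr; uniq4.
  have km : k != i by uniq4.
  have [uk [ek hk]] := hr k km.
  have rki : aff uk ek (cr X k i) by apply: hk; uniq4.
  have rkl : aff uk ek (cr X k l) by apply: hk; uniq4.
  have rkj : aff uk ek (cr X k j) by apply: hk; uniq4.
  have [|_ _ _ h' _] := R i l j k; first by uniq4.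
  have [_ /(_ i l j k) R0] := rel0; have [|_ _ _ h0 _] := R0; first by uniq4.
  apply: (extend_affine (prop3C h') ti tl rki rkl rkj); rewrite !Lr.
  by apply: (prop3_nc (prop3C h0)) ne; apply: ncr; uniq4.
by exists u, e => m; case: (uniq4_mem m U) => ->.
Qed.

(** If neither the slopes of the edges at i nor the positions of the other
    planes distinguish anything, then the two remaining triangles at i are
    tied to each other by the relation of degree three. *)
Lemma affine_star X i j k l : uniq [:: i; j; k; l] -> lifts X X0 -> core_rel X ->
  affine_points X -> (exists u e, forall i j, i != j -> aff u e (cS X i j)) ->
  nc3 (S0 j i) (S0 j k) (S0 j l) -> nc3 (S0 k i) (S0 k j) (S0 k l) ->
  (exists u e, forall m, aff u e (ct X m)) ->
  exists u e, forall n, n != i -> aff u e (cr X i n).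
Proof.
move=> U [La Lq LS Lr Lt] [Ssym R] [_ hq] [u [e hS]] ncj nck [ut [et ht]].
have [Ssym0 R0] := rel0; have [_ ncq _ ncr [x [y txy]]] := nd0.
have nr : nc3 (std (cr X i j)) (std (cr X i k)) (std (cr X i l)).
  by rewrite !Lr; apply: ncr; uniq4.
suff [u' [e' [h1 h2 h3]]] : exists u' e', [/\ aff u' e' (cr X i j),
    aff u' e' (cr X i k) & aff u' e' (cr X i l)].
  by exists u', e' => z; case: (uniq4_mem z U) => ->; rewrite ?eqxx.
case: (boolP (nc3 (S0 i j) (S0 i k) (S0 i l))) => ncS.
  have Aij : aff u e (cS X i j) by apply: hS; uniq4.
  have Aik : aff u e (cS X i k) by apply: hS; uniq4.
  have Ail : aff u e (cS X i l) by apply: hS; uniq4.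
  have [|_ _ h _ _] := R j k l i; first by uniq4.
  by apply: (transfer_affine h Aij Aik Ail _ nr); rewrite !LS.
case: (boolP (nc3 (t0 j) (t0 k) (t0 l))) => nct.
  have [|_ _ _ h _] := R j k l i; first by uniq4.
  by apply: (transfer_affine (prop3C h) (ht j) (ht k) (ht l) _ nr); rewrite !Lt.
move: ncS nct; rewrite /nc3 !negb_or !negbK.
move=> /andP [/eqP Sjk /eqP Sjl] /andP [/eqP tjk /eqP tjl].
have tij : t0 i != t0 j.
  apply: contraNneq txy => eij.
  by case: (uniq4_mem x U) => ->; case: (uniq4_mem y U) => ->; rewrite ?eij -?tjk -?tjl.
have eqj : S0 j k = S0 j l.
  have [|_ _ h h' _] := R0 k l i j; first by uniq4.
  apply/eqP/negPn/negP => ne.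
  have nr' : nc3 (r0 j k) (r0 j l) (r0 j i) by apply: ncr; uniq4.
  have ner := prop3_nc h nr' ne.
  have := prop3_eq (prop3C h'); rewrite -tjk => /(_ tjl ner) e1.
  by move: tij; rewrite -e1 eqxx.
have eqk : S0 k j = S0 k l.
  have [|_ _ h h' _] := R0 j l i k; first by uniq4.
  apply/eqP/negPn/negP => ne.
  have nr' : nc3 (r0 k j) (r0 k l) (r0 k i) by apply: ncr; uniq4.
  have ner := prop3_nc h nr' ne.
  have e1 := prop3_eq (prop3C h') tjl ner.
  by move: tij; rewrite -e1 eqxx.
have neM : S0 i j != S0 j k.
  by move: ncj; rewrite /nc3 [S0 j i]Ssym0 -eqj orbb.
pose M := cS X i j - cS X j k.
have ME : cS X i l - cS X l k = M.
  have Aij : aff u e (cS X i j) by apply: hS; uniq4.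
  have Ajk : aff u e (cS X j k) by apply: hS; uniq4.
  have Ail : aff u e (cS X i l) by apply: hS; uniq4.
  have Alk : aff u e (cS X l k) by apply: hS; uniq4.
  have e1 : std (cS X i l) = std (cS X i j) by rewrite !LS.
  have e2 : std (cS X l k) = std (cS X j k) by rewrite !LS Ssym0 -eqk Ssym0.
  apply: dual_eqP; rewrite /= ?e1 ?e2 //.
  by rewrite Aij Ajk Ail Alk e1 e2.
have h : prop3 (cq X i k) (cq X i j) (cq X i l) (cr X i k) (cr X i j) (cr X i l).
  have [|_ _ _ _] := R i j k l; first by uniq4.
  rewrite ME -/M => /eqP; rewrite -subr_eq0 -mulrBl mulrC => /eqP /dual_cancel hh.
  have /hh /eqP : std M != 0 by rewrite /M /= !LS subr_eq0.
  rewrite subr_eq0 => /eqP h; rewrite /prop3.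
  rewrite -(opprB (cq X i k) (cq X i j)) -(opprB (cq X i k) (cq X i l)) !mulNr.
  by rewrite [(cq X i k - cq X i j) * _]mulrC -h mulrC.
have [ui [ei hi]] := hq i.
have qk : aff ui ei (cq X i k) by apply: hi; uniq4.
have qj : aff ui ei (cq X i j) by apply: hi; uniq4.
have ql : aff ui ei (cq X i l) by apply: hi; uniq4.
have nq : nc3 (std (cq X i k)) (std (cq X i j)) (std (cq X i l)).
  by rewrite !Lq; apply: ncq; uniq4.
have nr' : nc3 (std (cr X i k)) (std (cr X i j)) (std (cr X i l)).
  by rewrite !Lr; apply: ncr; uniq4.
by have [u' [e' [h1 h2 h3]]] := transfer_affine h qk qj ql nq nr'; exists u', e'.
Qed.

Theorem core_rigid : rigid X0.
Proof.
have [Ssym0 R0] := rel0; have [_ ncq [p [p' [q [q' [hp hq ncS]]]]] ncr [x [y txy]]] := nd0.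
pose edge_type i j k l := [/\ uniq [:: i; j; k; l], S0 i j = S0 i l, S0 i k = S0 i l,
  S0 j l = S0 i l & S0 k l = S0 i l].
case: (EM (exists i j k l, edge_type i j k l)) => [[i [j [k [l [U e1 e2 e3 e4]]]]]|gen].
  have [e5|ne] := eqVneq (S0 j k) (S0 i l); last exact: (rigid_edge U).
  have all z w : z != w -> S0 z w = S0 i l.
    have eqs := (e1, e2, e3, e4, e5, Ssym0 j i, Ssym0 k i, Ssym0 l i, Ssym0 l j,
      Ssym0 k j, Ssym0 l k).
    case: (uniq4_mem z U) => ->; case: (uniq4_mem w U) => ->; rewrite ?eqxx // => _;
    by rewrite ?eqs.
  by move: ncS; rewrite !all // eqxx.
have [m1 [m2 H12]] := two_conditions; have [m3 H3] := third_condition.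
exists (m1, m2, m3) => X LX RX h1 h2 h3.
have hp' := H12 X LX RX h1 h2; have hS := H3 X LX RX hp' h3.
have [La Lq LS Lr Lt] := LX; have [Ssym R] := RX; have [ha hq'] := hp'.
have [i star] : exists i, forall a b c m, uniq [:: a; b; c; m] -> m != i ->
    nc3 (S0 m a) (S0 m b) (S0 m c).
  case: (EM (exists i a b c, uniq [:: a; b; c; i] /\ ~~ nc3 (S0 i a) (S0 i b) (S0 i c))).
    move=> [i [a [b [c [U nc]]]]]; exists i => a' b' c' m U' mi.
    apply: contrapT => /negP; move: nc; rewrite /nc3 !negb_or !negbK.
    move=> /andP [/eqP eab /eqP eac] /andP [/eqP eab' /eqP eac'].
    have Si z : z != i -> S0 i z = S0 i a.
      by case: (uniq4_mem z U) => ->; rewrite ?eqxx // -?eab -?eac.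
    have Sm z : z != m -> S0 m z = S0 m a'.
      by case: (uniq4_mem z U') => ->; rewrite ?eqxx // -?eab' -?eac'.
    have [z [w V]] := uniq4_ex2 mi; apply: gen; exists i, z, w, m.
    have e : S0 m a' = S0 i m by rewrite -(Sm i) ?[S0 m i]Ssym0 // eq_sym.
    split; first by uniq4.
    - by rewrite !Si //; uniq4.
    - by rewrite !Si //; uniq4.
    - by rewrite Ssym0 Sm //; uniq4.
    - by rewrite Ssym0 Sm //; uniq4.
  move=> all; exists ord0 => a b c m U _; apply: contrapT => /negP nc.
  by apply: all; exists m, a, b, c.
have [j [k [l U]]] := uniq4_ex3 i.
have hr m : m != i -> exists u e, forall n, n != m -> aff u e (cr X m n).
  move=> mi; have [a [b [c V]]] := uniq4_ex3 m.
  have [u [e he]] := hS.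
  have Aa : aff u e (cS X m a) by apply: he; uniq4.
  have Ab : aff u e (cS X m b) by apply: he; uniq4.
  have Ac : aff u e (cS X m c) by apply: he; uniq4.
  have nS : nc3 (std (cS X m a)) (std (cS X m b)) (std (cS X m c)).
    by rewrite !LS; apply: star => //; uniq4.
  have nr : nc3 (std (cr X m a)) (std (cr X m b)) (std (cr X m c)).
    by rewrite !Lr; apply: ncr; uniq4.
  have [|_ _ h _ _] := R a b c m; first by uniq4.
  have [u' [e' [g1 g2 g3]]] := transfer_affine h Aa Ab Ac nS nr.
  by exists u', e' => z; case: (uniq4_mem z V) => ->; rewrite ?eqxx.
have ht : exists u e, forall m, aff u e (ct X m).
  case: (boolP (nc3 (t0 i) (t0 k) (t0 l))) => n1.
    exact: (affine_planes U).
  case: (boolP (nc3 (t0 i) (t0 j) (t0 l))) => n2.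
    by apply: (@affine_planes X i k j l) => //; uniq4.
  case: (boolP (nc3 (t0 i) (t0 k) (t0 j))) => n3.
    by apply: (@affine_planes X i l k j) => //; uniq4.
  move: n1 n2 n3; rewrite /nc3 !negb_or !negbK => /andP [/eqP e1 /eqP e2].
  move=> /andP [/eqP e3 _] _; move: txy.
  by case: (uniq4_mem x U) => ->; case: (uniq4_mem y U) => ->;
    rewrite -?e1 -?e2 -?e3 eqxx.
have hri : exists u e, forall n, n != i -> aff u e (cr X i n).
  by apply: (affine_star U LX RX hp' hS _ _ ht); apply: star; uniq4.
split=> // m; have [->//|mi] := eqVneq m i; exact: hr.
Qed.

End Rigidity.

(** * Minors *)

Lemma dffun_distr (R : comNzRingType) (T : finType) (T_ : T -> finType)
    (f : forall a, T_ a -> R) :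
  \sum_(s : {dffun forall a, T_ a}) \prod_a f a (s a) = \prod_a \sum_(x : T_ a) f a x.
Proof.
rewrite (reindex (@dffun_of_fprod T T_)) /=; last first.
  exact/onW_bij/dffun_of_fprod_bij.
pose P a : {ffun T_ a -> R} := [ffun x => f a x].
transitivity (\sum_(t : fprod T_) \prod_(a in T) P a (t a)).
  by apply: eq_bigr => t _; apply: eq_bigr => a _; rewrite !ffunE.
rewrite big_fprod -(bigA_distr_big_dep (fun a => tagged_with T_ a)
  (fun a => untag 0 (P a))) /=.
apply: eq_bigr => a _; rewrite -(big_tag (fun a => P a) a).
by apply: eq_bigr => x _; rewrite ffunE.
Qed.

Section Minors.
Variable R : comNzRingType.
Implicit Types (g h : 'M[R]_4) (S T I : {set 'I_4}).

Definition nminor n g (s t : seq 'I_4) : R :=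
  \det (\matrix_(x < n, y < n) g (nth ord0 s y) (nth ord0 t x)).

Definition minor g S I : R := nminor #|S| g (enum S) (enum I).

Lemma minorE n g S I : #|S| = n -> minor g S I = nminor n g (enum S) (enum I).
Proof. by move=> <-. Qed.

Lemma det_mx22 (M : 'M[R]_2) : \det M = M 0 0 * M 1 1 - M 0 1 * M 1 0.
Proof.
rewrite (expand_det_row _ 0) !big_ord_recl big_ord0 addr0 /cofactor.
rewrite !det_mx11 !mxE /= expr0 expr1 mul1r mulN1r mulrN.
by congr (_ * M _ _ - M _ _ * M _ _); apply: val_inj.
Qed.

Lemma det_mx33 (M : 'M[R]_3) : let m i j := M (inord i) (inord j) in
  \det M = m 0 0 * (m 1 1 * m 2 2 - m 1 2 * m 2 1)
         - m 0 1 * (m 1 0 * m 2 2 - m 1 2 * m 2 0)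
         + m 0 2 * (m 1 0 * m 2 1 - m 1 1 * m 2 0).
Proof.
move=> m; rewrite (expand_det_row _ 0) !big_ord_recl big_ord0 addr0 /cofactor.
rewrite !det_mx22 !mxE /= expr0 expr1 mul1r.
have E i j : M i j = m i j by rewrite /m !inord_val.
rewrite !E /=; rewrite /bump /=; ring.
Qed.

Lemma cauchy_binet k (A : 'M[R]_(k, 4)) (B : 'M[R]_(4, k)) :
  \det (A *m B) = \sum_(T : {set 'I_4} | #|T| == k)
    \det (\matrix_(x < k, y < k) A x (nth ord0 (enum T) y)) *
    \det (\matrix_(x < k, y < k) B (nth ord0 (enum T) x) y).
Proof.
pose F := {ffun 'I_k -> 'I_4}.
pose term (f : F) := \prod_i A i (f i) * \det (\matrix_(x < k, y < k) B (f x) y).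
have -> : \det (A *m B) = \sum_(f : F) term f.
  pose AB (s : 'S_k) i j := A i j * B j (s i).
  transitivity (\sum_(f : F) \sum_(s : 'S_k) (-1) ^+ s * \prod_i AB s i (f i)).
    rewrite exchange_big; apply: eq_bigr => /= s _; rewrite -big_distrr /=.
    congr (_ * _); rewrite -(bigA_distr_bigA (AB s)) /=.
    by apply: eq_bigr => x _; rewrite mxE.
  apply: eq_bigr => f _; rewrite /term mulrC big_distrl /=; apply: eq_bigr => s _.
  rewrite big_split /= -mulrA; congr (_ * _); rewrite mulrC.
  by congr (_ * _); apply: eq_bigr => x _; rewrite mxE.
rewrite (bigID (fun f : F => injectiveb f)) /= addrC big1 ?add0r => [|f Uf]; last first.
  case/injectivePn: Uf => i1 [i2 Di12 Ef12]; rewrite /term.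
  by rewrite (determinant_alternate Di12) ?mulr0 //= => j; rewrite !mxE Ef12.
rewrite (partition_big (fun f : F => f @: [set: 'I_k])%SET (fun T => #|T| == k)) /=; last first.
  by move=> f /injectiveP fi; rewrite card_imset // cardsT card_ord.
apply: eq_bigr => T /eqP kT.
have szT : size (enum T) = k by rewrite -cardE.
pose fs (s : 'S_k) : F := [ffun x => nth ord0 (enum T) (s x)].
pose sf (f : F) : 'S_k :=
  insubd (1%g : 'S_k) [ffun x => odflt x (insub (index (f x) (enum T)))].
have val_sf (f : F) : injectiveb f -> (f @: [set: 'I_k])%SET = T ->
    forall x, val (sf f x) = index (f x) (enum T).
  move=> /injectiveP fi fT; have mem (x : 'I_k) : f x \in enum T.
    by rewrite mem_enum -fT imset_f.
  have val_in (x : 'I_k) : val (odflt x (insub (index (f x) (enum T)) : option 'I_k)) = index (f x) (enum T).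
    have lt : (index (f x) (enum T) < k)%N.
      by move: (mem x); rewrite -index_mem szT.
    by rewrite (insubT (fun n => (n < k)%N) lt).
  move=> x; rewrite -val_in /sf -[in LHS]pvalE val_insubd.
  rewrite ifT ?ffunE //; apply/injectiveP => y z; rewrite !ffunE.
  move/(congr1 val); rewrite !val_in => /(congr1 (nth ord0 (enum T))).
  by rewrite !nth_index // => /fi.
rewrite (reindex_onto fs sf) /=; last first.
  move=> f /andP [fi /eqP fT]; apply/ffunP => x; rewrite ffunE val_sf //.
  by rewrite nth_index // mem_enum -fT imset_f.
have fs_inj s : injective (fs s).
  move=> x y; rewrite !ffunE => /eqP; rewrite nth_uniq ?szT ?enum_uniq //.
  by move=> /eqP /val_inj /perm_inj.
have fsT s : (fs s @: [set: 'I_k])%SET = T.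
  apply/eqP; rewrite eqEcard (card_imset _ (@fs_inj s)) cardsT card_ord kT leqnn andbT.
  apply/fintype.subsetP => _ /imsetP [x _ ->]; rewrite ffunE -mem_enum mem_nth //.
  by rewrite szT.
rewrite (eq_bigl xpredT) => [|s]; last first.
  rewrite fsT eqxx andbT; have inj : injectiveb (fs s) by apply/injectiveP.
  rewrite inj /=; apply/eqP/permP => x; apply: val_inj.
  by rewrite val_sf // ffunE index_uniq ?szT ?enum_uniq.
rewrite big_distrl /=; apply: eq_bigr => s _; rewrite /term.
set M := \matrix_(x, y) B (nth _ _ _) _.
have -> : \matrix_(x < k, y < k) B (fs s x) y = row_perm s M.
  by apply/matrixP => x y; rewrite !mxE ffunE.
rewrite row_permE det_mulmx det_perm mulrCA mulrA; congr (_ * _ * _).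
by apply: eq_bigr => x _; rewrite mxE ffunE.
Qed.

Lemma minorM h g S I : #|S| = #|I| ->
  minor (h *m g) S I = \sum_(T : {set 'I_4} | #|T| == #|I|) minor h S T * minor g T I.
Proof.
move=> SI; pose k := #|I|.
pose A : 'M_(k, 4) := \matrix_(x, c) g c (nth ord0 (enum I) x).
pose B : 'M_(4, k) := \matrix_(c, y) h (nth ord0 (enum S) y) c.
have -> : minor (h *m g) S I = \det (A *m B).
  rewrite (minorE _ _ SI); congr (\det _); apply/matrixP => x y; rewrite !mxE.
  by apply: eq_bigr => c _; rewrite !mxE mulrC.
rewrite cauchy_binet; apply: eq_bigr => T /eqP kT.
rewrite (minorE _ _ SI) (minorE _ _ kT) mulrC.
by congr (_ * _); congr (\det _); apply/matrixP => x y; rewrite !mxE.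
Qed.

Lemma minor1 S T : #|S| = #|T| -> minor 1%:M S T = (S == T)%:R.
Proof.
move=> ST; have [->|ne] := eqVneq S T.
  rewrite (minorE _ _ (erefl #|T|)) -[RHS](det1 R #|T|); congr (\det _).
  apply/matrixP => x y; rewrite !mxE nth_uniq ?enum_uniq // -?cardE ?ltn_ord //.
  by rewrite eq_sym.
have [x xT xS] : exists2 x, x \in T & x \notin S.
  apply/fintype.subsetPn; apply: contra ne => sTS; rewrite eq_sym eqEcard sTS ST leqnn //.
have lt : (index x (enum T) < #|T|)%N by rewrite cardE index_mem mem_enum.
rewrite (minorE _ _ ST) /nminor.
rewrite (expand_det_row _ (Ordinal lt)) big1 // => y _; rewrite !mxE /=.
rewrite nth_index ?mem_enum //.
have yS : nth ord0 (enum S) y \in S by rewrite -mem_enum mem_nth // -cardE ST ltn_ord.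
by case: eqP => [e|]; [rewrite e (negPf xS) in yS|rewrite mul0r].
Qed.

Lemma minor_perm (s : seq 'I_4) I : uniq s -> (I = [set x in s])%SET ->
  exists c : R, (c * c = 1) /\
  forall g S, #|S| = #|I| -> minor g S I = c * nminor (size s) g (enum S) s.
Proof.
move=> us ->; have sz : #|[set x in s]%SET| = size s by rewrite cardsE; apply/card_uniqP.
have pe : perm_eq (enum [set x in s]%SET) s.
  apply: uniq_perm => //; first exact: enum_uniq.
  by move=> x; rewrite mem_enum inE.
have /tuple_permP [p hp] : perm_eq (enum [set x in s]%SET) (in_tuple s) by [].
exists ((-1) ^+ p); split; first by rewrite -expr2 sqrr_sign.
move=> g S SI; rewrite (minorE _ _ (etrans SI sz)) hp /nminor.
set M := (X in _ = _ * \det X).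
have -> : \matrix_(x < size s, y < size s) g (nth ord0 (enum S) y)
    (nth ord0 [tuple tnth (in_tuple s) (p i) | i < size s] x) = row_perm p M.
  apply/matrixP => x y; rewrite !mxE; congr (g _ _).
  by rewrite -tnth_nth tnth_mktuple (tnth_nth ord0).
by rewrite row_permE det_mulmx det_perm.
Qed.

End Minors.

Lemma map_minor (R R' : comNzRingType) (f : {rmorphism R -> R'}) (g : 'M[R]_4) S I :
  f (minor g S I) = minor (map_mx f g) S I.
Proof.
rewrite /minor /nminor -det_map_mx; congr (\det _).
by apply/matrixP => x y; rewrite !mxE.
Qed.

(** * Explicit minors *)

Definition o0 : 'I_4 := @Ordinal 4 0 isT.
Definition o1 : 'I_4 := @Ordinal 4 1 isT.
Definition o2 : 'I_4 := @Ordinal 4 2 isT.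
Definition o3 : 'I_4 := @Ordinal 4 3 isT.

Lemma enum4 : enum 'I_4 = [:: o0; o1; o2; o3].
Proof. by apply: (inj_map val_inj); rewrite val_enum_ord. Qed.

Lemma enum_set4 (S : {set 'I_4}) : enum S = [seq i <- [:: o0; o1; o2; o3] | i \in S].
Proof. by rewrite -enum4 [enum (mem (pred_of_argType _))]enumT {1}/enum_mem. Qed.

Lemma enum_s4 s : enum (s4 s) = [seq i : 'I_4 <- [:: o0; o1; o2; o3] | i.+1 \in s].
Proof. by rewrite enum_set4; apply: eq_filter => i; rewrite inE. Qed.

Section Explicit.
Variable R : comNzRingType.
Implicit Type g : 'M[R]_4.

Definition m1 g (r a : 'I_4) := g r a.
Definition m2 g (r s a b : 'I_4) := g r a * g s b - g r b * g s a.
Definition m3 g (r s t a b c : 'I_4) :=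
  g r a * m2 g s t b c - g r b * m2 g s t a c + g r c * m2 g s t a b.

Lemma nminor1 g r a : nminor 1 g [:: r] [:: a] = m1 g r a.
Proof. by rewrite /nminor det_mx11 mxE. Qed.

Lemma nminor2 g r s a b : nminor 2 g [:: r; s] [:: a; b] = m2 g r s a b.
Proof. by rewrite /nminor det_mx22 !mxE /= /m2; ring. Qed.

Lemma nminor3 g r s t a b c :
  nminor 3 g [:: r; s; t] [:: a; b; c] = m3 g r s t a b c.
Proof.
rewrite /nminor det_mx33 !mxE !inordK //= /m3 /m2; ring.
Qed.

End Explicit.

(** * Subspaces spanned by columns *)

Section Columns.
Variable F : fieldType.
Implicit Types (I J S : {set 'I_4}) (e b : 'cV[F]_4) (g : 'M[F]_4).

Lemma coord_spaceP I e :
  reflect (forall i, i \notin I -> e i 0 = 0) (e \in coord_space F I).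
Proof.
apply: (iffP idP) => [/memv_sumP [v hv ->] i iI|h].
  rewrite summxE big1 // => j jI; have /vlineP [c ->] := hv j jI.
  rewrite !mxE eqxx andbT (negPf (_ : i != j)) ?mulr0 //.
  by apply: contraNneq iI => ->.
have -> : e = \sum_(i in I) e i 0 *: delta_mx i 0.
  apply/colP => i; rewrite summxE; have [iI|iI] := boolP (i \in I).
    rewrite (bigD1 i) //= big1 ?addr0 => [|j /andP [_ ji]].
      by rewrite !mxE !eqxx mulr1.
    by rewrite !mxE eqxx andbT eq_sym (negPf ji) mulr0.
  rewrite big1 => [|j jI]; first exact: h.
  rewrite !mxE eqxx andbT (negPf (_ : i != j)) ?mulr0 //.
  by apply: contraNneq iI => ->.
by apply: memv_sumr => i _; apply/memvZ/memv_line.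
Qed.

Lemma dim_coord_space I : \dim (coord_space F I) = #|I|.
Proof.
have le J : (\dim (coord_space F J) <= #|J|)%N.
  apply: leq_trans (dimv_leq_sum _ _ _) _.
  by rewrite -sum1_card; apply: leq_sum => i _; rewrite dim_vline; case: eqP.
have full : (coord_space F I + coord_space F (~: I))%VS = fullv.
  apply/eqP; rewrite eqEsubv subvf /=; apply/subvP => e _.
  have -> : e = \col_i (if i \in I then e i 0 else 0) + \col_i (if i \in I then 0 else e i 0).
    by apply/colP => i; rewrite !mxE; case: ifP; rewrite ?addr0 ?add0r.
  apply: memv_add; apply/coord_spaceP => i iI; rewrite mxE.
    by rewrite (negPf iI).
  by move: iI; rewrite inE negbK => ->.
apply/eqP; rewrite eqn_leq le /= -(leq_add2r #|~: I|) cardsC card_ord.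
have := dimv_add_leqif (coord_space F I) (coord_space F (~: I)).
rewrite full dimvf dim_matrix => -[+ _]; rewrite mulr1 => h.
by apply: leq_trans h _; rewrite leq_add2l le.
Qed.

Definition gsp g I : {vspace 'cV[F]_4} :=
  (linfun (mulmx g : 'cV_4 -> 'cV_4) @: coord_space F I)%VS.

Lemma mem_gsp g I b : g \in unitmx ->
  reflect (forall i, i \notin I -> (invmx g *m b) i 0 = 0) (b \in gsp g I).
Proof.
move=> gu; apply: (iffP memv_imgP) => [[e /coord_spaceP he ->] i iI|h].
  by rewrite lfunE /= mulKmx // he.
by exists (invmx g *m b); [apply/coord_spaceP|rewrite lfunE /= mulKVmx].
Qed.

Lemma dim_gsp g I : g \in unitmx -> \dim (gsp g I) = #|I|.
Proof.
move=> gu; rewrite limg_dim_eq ?dim_coord_space //.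
apply/eqP; rewrite -subv0; apply/subvP => e; rewrite memv_cap => /andP [_].
rewrite memv_ker lfunE /= memv0 => /eqP h.
by rewrite -(mulKmx gu e) h mulmx0.
Qed.

Lemma gspS g I J : I \subset J -> (gsp g I <= gsp g J)%VS.
Proof.
move=> IJ; apply: limgS; apply/subvP => e /coord_spaceP h.
by apply/coord_spaceP => i iJ; apply/h; apply: contra iJ; apply: (fintype.subsetP IJ).
Qed.

Lemma gsp_inj g I J : g \in unitmx -> gsp g I = gsp g J -> I = J.
Proof.
move=> gu; wlog suff W : I J / gsp g I = gsp g J -> I \subset J.
  by move=> e; apply/eqP; rewrite finset.eqEsubset !W.
move=> e; apply/fintype.subsetP => i iI; apply: contraT => iJ.
have : g *m delta_mx i 0 \in gsp g I.
  apply/(mem_gsp _ _ gu) => j jI; rewrite mulKmx // !mxE eqxx andbT.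
  by case: eqP jI => // ->; rewrite iI.
rewrite e => /(mem_gsp _ _ gu) /(_ i iJ); rewrite mulKmx // !mxE !eqxx => /eqP.
by rewrite oner_eq0.
Qed.

Lemma pluckerE n (V : {vspace 'cV[F]_4}) S : #|S| = n ->
  plucker V S = \det (\matrix_(x < n, y < n) (vbasis V)`_x (nth ord0 (enum S) y) 0).
Proof.
move=> <-; congr (\det _); apply/matrixP => x y.
by rewrite !mxE (enum_val_nth ord0).
Qed.

Lemma plucker_gsp g I : g \in unitmx -> exists2 c : F, c != 0 &
  forall S, #|S| = #|I| -> plucker (gsp g I) S = c * minor g S I.
Proof.
move=> gu; set V := gsp g I; pose n := #|I|.
pose B : 'M[F]_n :=
  \matrix_(x, y) (invmx g *m (vbasis V)`_x) (nth ord0 (enum I) y) 0.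
have dV : \dim V = n by rewrite dim_gsp.
have bV (x : 'I_n) : (vbasis V)`_x \in V.
  by apply/vbasis_mem/mem_nth; rewrite size_tuple dV.
have outI x i : i \notin I -> (invmx g *m (vbasis V)`_x) i 0 = 0.
  have [lt|ge] := ltnP x n; first by have /(mem_gsp _ _ gu) := bV (Ordinal lt); apply.
  by rewrite nth_default ?size_tuple ?dV // mulmx0 mxE.
have expand (f : 'I_4 -> F) : (forall i, i \notin I -> f i = 0) ->
    \sum_i f i = \sum_(y < n) f (nth ord0 (enum I) y).
  move=> hf; rewrite (bigID (mem I)) /= [X in _ + X]big1 ?addr0 //.
  rewrite -big_enum /= (big_nth ord0) -cardE big_mkord //.
exists (\det B).
  rewrite -unitfE -unitmxE -row_free_unit -kermx_eq0; apply/rowV0P => c /sub_kermxP cB.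
  pose cc (i : nat) : F := if insub i is Some x then c 0 (x : 'I_n) else 0.
  have ccE (x : 'I_n) : cc x = c 0 x by rewrite /cc valK.
  have := basis_free (vbasisP V); move/freeP/(_ (fun x => cc x)) => fr.
  apply/rowP => x; rewrite mxE -ccE.
  have ltx : (x < \dim V)%N by rewrite dV.
  apply: (fr _ (Ordinal ltx)).
  have -> : \sum_(i < \dim V) cc i *: (vbasis V)`_i = \sum_(i < n) c 0 i *: (vbasis V)`_i.
    have sumE k l (f : nat -> 'cV[F]_4) : k = l -> \sum_(i < k) f i = \sum_(i < l) f i.
      by move=> ->.
    rewrite (sumE _ _ (fun i => cc i *: (vbasis V)`_i) dV).
    by apply: eq_bigr => i _; rewrite ccE.
  set s := \sum_(i < n) _; rewrite -(mulKVmx gu s) (_ : invmx g *m s = 0) ?mulmx0 //.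
  apply/colP => i; rewrite [RHS]mxE.
  rewrite mulmx_sumr summxE; have [iI|iI] := boolP (i \in I); last first.
    by rewrite big1 // => y _; rewrite -scalemxAr mxE outI // mulr0.
  have lti : (index i (enum I) < n)%N by rewrite /n cardE index_mem mem_enum.
  move/rowP/(_ (Ordinal lti)): cB; rewrite !mxE => {2}<-.
  apply: eq_bigr => y _; rewrite -scalemxAr !mxE /= nth_index ?mem_enum //.
move=> S SI; rewrite (pluckerE _ SI) (minorE _ _ SI) /nminor -det_mulmx.
congr (\det _); apply/matrixP => x y; rewrite !mxE.
rewrite -{1}[(vbasis V)`_x](mulKVmx gu) mxE expand => [|i iI].
  by apply: eq_bigr => z _; rewrite !mxE mulrC.
by rewrite outI // mulr0.
Qed.

Lemma nth_I0 m y : (m <= 4)%N -> (y < m)%N ->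
  val (nth ord0 (enum (s4 (iota 1 m))) y) = y.
Proof. by rewrite enum_s4; move: m y => [|[|[|[|[|m]]]]] [|[|[|[|y]]]]. Qed.

Lemma card_I0 m : (m <= 4)%N -> #|s4 (iota 1 m)| = m.
Proof. by rewrite cardE enum_s4; move: m => [|[|[|[|[|m]]]]]. Qed.

Lemma card_le4 I : (#|I| <= 4)%N.
Proof. by rewrite -[X in (_ <= X)%N](card_ord 4) max_card. Qed.

Lemma flag_mem k e : (k <= 4)%N ->
  reflect (forall r : 'I_4, (r < 4 - k)%N -> e r 0 = 0)
    (e \in coord_space F (s4 (iota (5 - k) k))).
Proof.
move=> k4; apply: (iffP (coord_spaceP _ _)) => h r hr; apply: h.
  by rewrite inE mem_iota (subSn k4) ltnS leqNgt hr.
move: hr; rewrite inE mem_iota (subSn k4) addSn subnK // !ltnS.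
rewrite -[(r <= 3)%N]/(r < 4)%N ltn_ord andbT.
by rewrite -ltnNge.
Qed.

(** The leading Pluecker coordinate of a subspace vanishes exactly when the
    subspace meets its complementary member of the flag at infinity. *)
Lemma minor_flag g I : g \in unitmx ->
  reflect (gsp g I :&: coord_space F (s4 (iota (5 - (4 - #|I|)) (4 - #|I|))) = 0)%VS
    (minor g (s4 (iota 1 #|I|)) I != 0).
Proof.
move=> gu; set m := #|I|; have m4 : (m <= 4)%N := card_le4 I.
have cI0 := card_I0 m4; rewrite (minorE _ _ cI0) /nminor; set M := \matrix_(x, y) _.
have flagP e := flag_mem e (leq_subr m 4).
have km : (4 - (4 - m) = m)%N by rewrite subKn.
have ME (f : 'cV[F]_4) : (forall i, i \notin I -> f i 0 = 0) ->
    forall y : 'I_m, ((\row_x f (nth ord0 (enum I) x) 0) *m M) 0 y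
      = (g *m f) (nth ord0 (enum (s4 (iota 1 m))) y) 0.
  move=> hf y; rewrite [RHS]mxE (bigID (mem I)) /= [X in _ + X]big1 ?addr0; last first.
    by move=> i iI; rewrite hf // mulr0.
  rewrite -big_enum /= (big_nth ord0) -cardE big_mkord mxE.
  by apply: eq_bigr => x _; rewrite !mxE mulrC.
have nthr (r : 'I_4) (lt : (r < m)%N) : nth ord0 (enum (s4 (iota 1 m))) (Ordinal lt) = r.
  by apply: val_inj; rewrite nth_I0.
rewrite -unitfE -unitmxE -row_free_unit -kermx_eq0.
apply: (iffP idP) => [/eqP ker|cap].
  apply/eqP; rewrite -subv0; apply/subvP => b; rewrite memv_cap memv0.
  move=> /andP [/(mem_gsp _ _ gu) hb /flagP]; rewrite km => bk.
  set f := invmx g *m b in hb.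
  have bf : b = g *m f by rewrite mulKVmx.
  have : (\row_x f (nth ord0 (enum I) x) 0 <= kermx M)%MS.
    apply/sub_kermxP/rowP => y; rewrite ME // [RHS]mxE -bf; apply: bk.
    by rewrite nth_I0.
  rewrite ker submx0 => /eqP f0.
  suff -> : b = 0 by []. 
  rewrite bf; have -> : f = 0; last by rewrite mulmx0.
  apply/colP => i; rewrite [RHS]mxE; have [iI|iI] := boolP (i \in I); last exact: hb.
  have lti : (index i (enum I) < m)%N by rewrite /m cardE index_mem mem_enum.
  move/rowP/(_ (Ordinal lti)): f0; rewrite !mxE /= nth_index ?mem_enum //.
apply: contraT => /rowV0Pn [c /sub_kermxP cM c0].
pose f : 'cV[F]_4 := \col_i (if insub (index i (enum I)) is Some x then c 0 x else 0).
have fout i : i \notin I -> f i 0 = 0.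
  move=> iI; rewrite mxE insubN // -leqNgt /m cardE memNindex ?mem_enum //.
have fin : \row_x f (nth ord0 (enum I) x) 0 = c.
  apply/rowP => x; rewrite !mxE index_uniq ?enum_uniq -?cardE //.
  by rewrite insubT //= => lt; congr (c 0 _); apply: val_inj.
have : g *m f \in (gsp g I :&: coord_space F (s4 (iota (5 - (4 - m)) (4 - m))))%VS.
  rewrite memv_cap; apply/andP; split.
    by apply/(mem_gsp _ _ gu) => i iI; rewrite mulKmx // fout.
  apply/flagP => r; rewrite km => lt.
  by rewrite -(nthr r lt) -ME // fin cM mxE.
rewrite cap memv0 => /eqP gf; move: c0.
rewrite -fin (_ : f = 0) ?eqxx //; last by rewrite -(mulKmx gu f) gf mulmx0.
by case/negP; apply/eqP/rowP => x; rewrite !mxE.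
Qed.

Lemma transverse_flag g I : g \in unitmx -> minor g (s4 (iota 1 #|I|)) I != 0 ->
  forall k, (k <= 4)%N -> transverse (gsp g I) (coord_space F (s4 (iota (5 - k) k))).
Proof.
move=> gu /(minor_flag _ gu) cap k k4; rewrite /transverse.
set m := #|I| in cap *; have m4 : (m <= 4)%N := card_le4 I.
have card_flag l : (l <= 4)%N -> #|s4 (iota (5 - l) l)| = l.
  by rewrite cardE enum_s4; move: l => [|[|[|[|[|l]]]]].
have flagS l l' : (l <= l')%N -> (l' <= 4)%N -> 
    (coord_space F (s4 (iota (5 - l) l)) <= coord_space F (s4 (iota (5 - l') l')))%VS.
  move=> ll l4; apply/subvP => e /(flag_mem _ (leq_trans ll l4)) h.
  apply/(flag_mem _ l4) => r hr; apply: h; apply: leq_trans hr _.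
  exact: leq_sub2l.
rewrite dim_gsp // dim_coord_space card_flag //.
have [le|gt] := leqP k (4 - m).
  have -> : (m + k - 4 = 0)%N by apply/eqP; rewrite subn_eq0 -leq_subRL // addnC.
  apply/eqP; rewrite dimv_eq0 -subv0 -cap; apply: capvS => //.
  by apply: flagS => //; apply: leq_subr.
have full : (gsp g I + coord_space F (s4 (iota (5 - k) k)))%VS = fullv.
  have e4 : \dim (gsp g I + coord_space F (s4 (iota (5 - (4 - m)) (4 - m)))) = 4%N.
    have := dimv_sum_cap (gsp g I) (coord_space F (s4 (iota (5 - (4 - m)) (4 - m)))).
    rewrite cap dimv0 addn0 dim_gsp // dim_coord_space card_flag ?leq_subr //.
    by rewrite -/m subnKC.
  apply/eqP; rewrite eqEdim subvf /= dimvf dim_matrix mulr1.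
  apply: (@leq_trans (\dim (gsp g I + coord_space F (s4 (iota (5 - (4 - m)) (4 - m)))))).
    by rewrite e4.
  by apply/dimvS/addvS => //; apply: flagS => //; apply: ltnW.
have := dimv_sum_cap (gsp g I) (coord_space F (s4 (iota (5 - k) k))).
rewrite full dimvf dim_matrix mulr1 dim_gsp // dim_coord_space card_flag // => <-.
by rewrite addKn.
Qed.

End Columns.

(** * Faces of hypersimplices *)

Section Faces.
Variable R : realType.
Implicit Types (P Q S I J : {set 'I_4}) (b : {set {set 'I_4}}).

Definition face (k : nat) P Q : {set {set 'I_4}} :=
  [set S : {set 'I_4} | [&& #|S| == k, P \subset S & S \subset P :|: Q]]%SET.

Lemma in_face k P Q S :
  (S \in face k P Q) = [&& #|S| == k, P \subset S & S \subset P :|: Q].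
Proof. by rewrite inE. Qed.

(* The excess of the maximal weight over the weight of I *)
Lemma weight_gap (c : 'I_4 -> R) P I :
  \sum_(i in P) c i - \sum_(i in I) c i =
  \sum_(i in P :\: I) c i + \sum_(i in I :\: P) - c i.
Proof.
rewrite [X in X - _](big_setID I) [X in _ - X](big_setID P) /= [(I :&: P)%SET]finset.setIC.
by rewrite sumrN; ring.
Qed.

Lemma weight_face (c : 'I_4 -> R) P Q I :
  (forall i, i \in P -> 0 < c i) -> (forall i, (i \in Q) = (c i == 0)) ->
  (forall i, i \notin P :|: Q -> c i < 0) ->
  (\sum_(i in I) c i <= \sum_(i in P) c i) /\
  ((\sum_(i in P) c i <= \sum_(i in I) c i) = (P \subset I) && (I \subset P :|: Q)).
Proof.
move=> cP cQ cN.
have g1 i : i \in P :\: I -> 0 <= c i by rewrite inE => /andP [_ /cP /ltW].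
have g2 i : i \in I :\: P -> 0 <= - c i.
  rewrite inE oppr_ge0 => /andP [iP iI]; have [iQ|iQ] := boolP (i \in Q).
    by move: iQ; rewrite cQ => /eqP ->.
  by apply/ltW/cN; rewrite inE negb_or iP.
have s1 : 0 <= \sum_(i in P :\: I) c i by apply: sumr_ge0 => i /g1.
have s2 : 0 <= \sum_(i in I :\: P) - c i by apply: sumr_ge0 => i /g2.
split; first by rewrite -subr_ge0 weight_gap addr_ge0.
rewrite -subr_le0 weight_gap; apply/idP/andP => [h|[PI IPQ]].
  have : \sum_(i in P :\: I) c i + \sum_(i in I :\: P) - c i == 0.
    by rewrite eq_le h addr_ge0.
  rewrite paddr_eq0 // => /andP [/eqP z1 /eqP z2].
  have h1 := psumr_eq0P (fun i hi => g1 i hi) z1.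
  have h2 := psumr_eq0P (fun i hi => g2 i hi) z2.
  split; apply/fintype.subsetP => i hi.
    apply: contraT => iI; have iD : i \in P :\: I by rewrite inE iI.
    by have := cP i hi; rewrite h1 // ltxx.
  rewrite inE; have [//|iP] := boolP (i \in P); rewrite cQ.
  have iD : i \in I :\: P by rewrite inE iP.
  by have /eqP := h2 i iD; rewrite oppr_eq0.
rewrite (eqP (_ : P :\: I == finset.set0)); last by rewrite finset.setD_eq0.
rewrite big_set0 add0r sumr_le0 // => i; rewrite inE => /andP [iP iI].
have : i \in Q by have := fintype.subsetP IPQ i iI; rewrite inE (negPf iP).
by rewrite cQ => /eqP ->; rewrite oppr0.
Qed.

Lemma is_face_face k P Q I0 : I0 \in face k P Q -> [disjoint P & Q] ->
  is_face R k (face k P Q).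
Proof.
rewrite in_face => /and3P [/eqP k0 P0 Q0] dPQ.
pose c i : R := if i \in P then 1 else if i \in Q then 0 else -1.
have [cP cQ cN] : [/\ forall i, i \in P -> 0 < c i, forall i, (i \in Q) = (c i == 0)
    & forall i, i \notin P :|: Q -> c i < 0].
  split=> i; rewrite /c.
  - by move=> ->; rewrite ltr01.
  - have [iP|_] := boolP (i \in P).
      by rewrite oner_eq0; apply: disjointFr dPQ iP.
    by case: (i \in Q); rewrite ?eqxx // oppr_eq0 oner_eq0.
  - by rewrite inE negb_or => /andP [/negPf -> /negPf ->]; rewrite ltrN10.
have W I := weight_face I cP cQ cN.
exists c => I; rewrite in_face; split.
  move=> /and3P [/eqP kI PI IQ]; split=> // J kJ.
  have [h1 _] := W J; have [_ h2] := W I; apply: le_trans h1 _.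
  by rewrite h2 PI IQ.
move=> [kI mI]; rewrite kI eqxx /=; have [_ <-] := W I.
by apply: le_trans (mI I0 k0); have [_ ->] := W I0; rewrite P0.
Qed.

Lemma face_dim_ge2 b (A B D : {set 'I_4}) x y : A \in b -> B \in b -> D \in b ->
  (x \in A) = (x \in D) -> (x \in A) != (x \in B) ->
  (y \in A) = (y \in B) -> (y \in A) != (y \in D) -> (2 <= face_dim R b)%N.
Proof.
move=> Ab Bb Db xAD xAB yAB yAD; rewrite /face_dim; set s := [seq _ | A <- _, B <- _].
pose d1 := indicator R A - indicator R B; pose d2 := indicator R A - indicator R D.
have in1 : d1 \in s by apply/allpairsP; exists (A, B); rewrite !mem_enum.
have in2 : d2 \in s by apply/allpairsP; exists (A, D); rewrite !mem_enum.
have fr : free [:: d1; d2].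
  apply/(@freeP _ _ _ [tuple d1; d2]) => k; rewrite !big_ord_recl big_ord0 addr0 /= => e.
  have ex := congr1 (fun w : 'rV_4 => w 0 x) e.
  have ey := congr1 (fun w : 'rV_4 => w 0 y) e.
  move: ex ey; rewrite !mxE xAD yAB !subrr !mulr0 addr0 add0r -xAD -yAB.
  have nz (p q : bool) (z : R) : p != q -> z * (p%:R - q%:R) = 0 -> z = 0.
    case: p q => [] [] // _; rewrite ?subr0 ?mulr1 // sub0r mulrN1 => /eqP.
    by rewrite oppr_eq0 => /eqP.
  move=> /(nz _ _ _ xAB) k0 /(nz _ _ _ yAD) k1 i.
  by have [->|ne] := eqVneq i ord0; [|rewrite (_ : i = lift ord0 ord0) //;
    apply: val_inj; case: i ne => [[|[|n]] lt]].
have e2 : \dim <<[:: d1; d2]>> = 2%N by move: fr; rewrite /free => /eqP.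
apply: (@leq_trans (\dim <<[:: d1; d2]>>)); first by rewrite e2.
apply/dimvS/span_subvP => w; rewrite !inE => /orP [] /eqP ->; exact: memv_span.
Qed.

Lemma face_dim_card b : (2 <= face_dim R b)%N -> (3 <= #|b|)%N.
Proof.
rewrite /face_dim cardE; have eb : b = b by [].
case: (enum b) => [|A [|B [|D s]]] //=.
- by rewrite span_nil dimv0.
- by rewrite subrr span_seq1 dim_vline eqxx.
set v := span _ => h; suff : (v <= <[indicator R A - indicator R B]>)%VS.
  move/dimvS => le; have := leq_trans h le; rewrite dim_vline.
  by case: (_ == 0).
apply/span_subvP => w; rewrite !inE !subrr => /or4P [] /eqP ->; rewrite ?mem0v ?memv_line //.
by rewrite -opprB memvN memv_line.
Qed.

(** A face consists of the k-subsets between P, where the weight is above a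
    threshold, and the union of P and Q, where Q is the set of weights equal
    to the threshold. *)
Lemma is_faceP k b : (1 <= k <= 3)%N -> b != finset.set0 -> is_face R k b ->
  exists P Q, [disjoint P & Q] /\ b = face k P Q.
Proof.
move=> /andP [k1 k3] /finset.set0Pn [I0 I0b] [c hc].
have [k0 max0] := (hc I0).1 I0b.
have exch i j : i \in I0 -> j \notin I0 -> c j <= c i.
  move=> iI jI; have ne : i != j by apply: contraNneq jI => <-.
  have := max0 (j |: (I0 :\ i))%SET; rewrite cardsU1 !inE negb_and negbK jI orbT.
  rewrite -k0 (cardsD1 i I0) iI => /(_ erefl).
  rewrite big_setU1 ?inE ?negb_and ?jI ?orbT //= [X in _ <= X](big_setD1 i) //=.
  by rewrite lerD2r.
have [j0 j0I] : exists j, j \notin I0.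
  have [//|j hj] := @notin_seq (enum I0); first by rewrite -cardE k0.
  by exists j; rewrite mem_enum in hj.
have [j1 j1I j1max] : exists2 j, j \notin I0 & forall i, i \notin I0 -> c i <= c j.
  case: (Order.TotalTheory.arg_maxP c (P := fun j => j \notin I0) j0I) => j hj hmax.
  by exists j.
pose th := c j1; pose P := [set i | th < c i]%SET; pose Q := [set i | c i == th]%SET.
exists P, Q; split.
  rewrite -finset.setI_eq0; apply/eqP/finset.setP => i; rewrite !inE.
  by case: eqP => [->|]; rewrite ?ltxx ?andbF.
have [cP cQ cN] : [/\ forall i, i \in P -> 0 < c i - th,
    forall i, (i \in Q) = (c i - th == 0) & forall i, i \notin P :|: Q -> c i - th < 0].
  split=> i; rewrite !inE ?subr_gt0 ?subr_eq0 // negb_or -leNgt => /andP [h1 h2].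
  by rewrite subr_lt0 lt_neqAle h1 h2.
have W I := weight_face I cP cQ cN.
have shift I : #|I| = k -> \sum_(i in I) (c i - th) = \sum_(i in I) c i - th *+ k.
  by move=> kI; rewrite sumrB sumr_const kI.
have PI0 : P \subset I0.
  by apply/fintype.subsetP => i; rewrite inE => lt; apply: contraLR lt => /j1max; rewrite -leNgt.
have I0Q : I0 \subset P :|: Q.
  apply/fintype.subsetP => i iI; have := exch i j1 iI j1I.
  by rewrite !inE le_eqVlt eq_sym orbC.
have top : \sum_(i in P) (c i - th) <= \sum_(i in I0) (c i - th).
  by have [_ ->] := W I0; rewrite PI0 I0Q.
apply/finset.setP => I; rewrite in_face; apply/idP/and3P => [Ib|[/eqP kI PI IQ]].
  have [kI maxI] := (hc I).1 Ib; have [_ e] := W I.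
  suff h : (P \subset I) && (I \subset P :|: Q) by case/andP: h; split=> //; apply/eqP.
  rewrite -e; apply: le_trans top _.
  by rewrite !shift // lerD2r; apply: maxI.
apply/(hc I).2; split=> // J kJ; have [h1 _] := W J; have [_ e] := W I.
have : \sum_(i in J) (c i - th) <= \sum_(i in I) (c i - th).
  by apply: le_trans h1 _; rewrite e PI IQ.
by rewrite !shift // lerD2r.
Qed.

Lemma card_face k P Q : [disjoint P & Q] ->
  (#|face k P Q| <= 'C(#|Q|, k - #|P|))%N.
Proof.
move=> dPQ; rewrite -cards_draws.
have inj : {in face k P Q &, injective (fun S => S :&: Q)%SET}.
  move=> S S'; rewrite !in_face => /and3P [_ PS SQ] /and3P [_ PS' SQ'] e.
  apply/finset.setP => i; have [iP|iP] := boolP (i \in P).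
    by rewrite (fintype.subsetP PS) ?(fintype.subsetP PS').
  have [iQ|iQ] := boolP (i \in Q).
    by have /finset.setP /(_ i) := e; rewrite !inE iQ !andbT.
  have out S1 : S1 \subset P :|: Q -> i \notin S1.
    by move=> /fintype.subsetP h; apply/negP => /h; rewrite inE (negPf iP) (negPf iQ).
  by rewrite (negPf (out _ SQ)) (negPf (out _ SQ')).
rewrite -(card_in_imset inj); apply/subset_leq_card/fintype.subsetP => _ /imsetP [S + ->].
rewrite in_face inE => /and3P [/eqP kS PS SQ]; rewrite subsetIr /= -kS.
rewrite -(cardsID P S) (finset.setIidPr PS) addKn; apply/eqP; congr #|pred_of_set _|.
apply/finset.setP => i; rewrite !inE; have [iP|iP] := boolP (i \in P).
  by rewrite (disjointFr dPQ iP) andbF.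
have [iS|//] := boolP (i \in S); have := fintype.subsetP SQ i iS.
by rewrite inE (negPf iP) /= => ->.
Qed.

Lemma hface_cases (b : hface R) :
  [\/ exists2 k, (1 <= k <= 3)%N & val b = face k finset.set0 finset.setT,
      exists l, exists2 k, (1 <= k <= 2)%N & val b = face k finset.set0 (~: [set l]) |
      exists i, exists2 k, (2 <= k <= 3)%N & val b = face k [set i] (~: [set i])]%SET.
Proof.
case: b => b /= /asboolP [k [k13 fb /face_dim_card b3]].
have [|P [Q [dPQ eb]]] := is_faceP k13 _ fb.
  by rewrite -card_gt0; apply: leq_trans b3.
have := leq_trans b3 (eq_leq (congr1 (fun b : {set {set 'I_4}} => #|b|) eb)).
move=> /leq_trans /(_ (card_face k dPQ)) C3.
have PQ4 : (#|P| + #|Q| <= 4)%N.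
  rewrite -cardsUI; have /eqP -> : P :&: Q == finset.set0 by rewrite finset.setI_eq0.
  by rewrite cards0 addn0 card_le4.
have small q m : (q < 3)%N -> ('C(q, m) <= 2)%N.
  by case: q m => [|[|[|q]]] [|[|[|m]]] // _; rewrite bin_small.
have q3 : (2 < #|Q|)%N.
  by rewrite ltnNge; apply/negP => q2; move: C3; rewrite leqNgt ltnS small.
have m0 : (0 < k - #|P|)%N.
  by rewrite lt0n; apply: contraTneq C3 => ->; rewrite bin0.
have mq : (k - #|P| < #|Q|)%N.
  rewrite ltnNge; apply/negP; rewrite leq_eqVlt => /orP [/eqP e|lt].
    by move: C3; rewrite -e binn.
  by move: C3; rewrite bin_small.
case: (posnP #|P|) => [/eqP|p0].
  rewrite cards_eq0 => /eqP P0; move: m0 mq PQ4; rewrite eb P0 cards0 subn0 add0n => m0 mq PQ4.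
  have [q4|nq4] := eqVneq #|Q| 4%N.
    constructor 1; exists k => //; congr face; apply/eqP.
    by rewrite eqEcard finset.subsetT cardsT card_ord q4.
  constructor 2; have q3' : #|Q| = 3%N.
    by apply/eqP; rewrite eqn_leq q3 andbT -ltnS ltn_neqAle nq4.
  have /cards1P [l hl] : #|~: Q| == 1%N.
    by rewrite -(eqn_add2l #|Q|) cardsC card_ord q3'.
  exists l, k; first by rewrite m0 -ltnS -q3'.
  by congr face; rewrite -hl finset.setCK.
have q3' : #|Q| = 3%N.
  by apply/eqP; rewrite eqn_leq q3 andbT -(leq_add2l 1) (leq_trans _ PQ4) // leq_add2r.
have p1 : #|P| = 1%N.
  by move: p0 PQ4; rewrite q3' addn3; case: #|P| => [|[|]].
constructor 3; move/eqP/cards1P: (p1) => [i Pi]; exists i, k.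
  by move: m0 mq; rewrite p1 q3'; case: (k) => [|[|[|[|]]]].
rewrite eb Pi; congr face; apply/eqP; rewrite eqEcard q3' cardsC1 card_ord andbT.
by apply/fintype.subsetP => j jQ; rewrite !inE; apply: contraTneq jQ => ->;
  rewrite (disjointFr dPQ) // Pi set11.
Qed.

End Faces.

Implicit Types (I J S T : {set 'I_4}).

(** * Edges and potentials *)

Definition adj I J := (#|I| == #|J|) && (#|I :&: J|.+1 == #|I|).

Lemma adjC I J : adj I J = adj J I.
Proof. by rewrite /adj finset.setIC eq_sym; case: eqP => //= ->. Qed.

Lemma adj_neq I J : adj I J -> I != J.
Proof.
move=> /andP [_ h]; apply: contraTneq h => ->; rewrite finset.setIid.
by rewrite eqn_leq ltnn.
Qed.

Lemma sub_lt_asym I J : sub_lt I J -> ~~ sub_lt J I.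
Proof.
rewrite /sub_lt => /orP [lt|/andP [/eqP e lt]]; rewrite negb_or.
  by rewrite -leqNgt ltnW //= negb_and gtn_eqF.
rewrite e ltnn eqxx /=; by rewrite -leNgt ltW.
Qed.

Lemma sub_lt_total I J : #|I| = #|J| -> I != J -> sub_lt I J || sub_lt J I.
Proof.
move=> e ne; rewrite /sub_lt e !ltnn !eqxx /= -neq_lt.
apply: contra ne => /eqP /(inj_map val_inj) h; apply/eqP/finset.setP => i.
by rewrite -mem_enum h mem_enum.
Qed.

Lemma edge_adj (a : edge) : adj (lo a) (hi a).
Proof. by case: a => -[I J] /= h; rewrite /adj /lo /hi /=; case/and3P: h => -> ->. Qed.

Lemma edge_lt (a : edge) : sub_lt (lo a) (hi a).
Proof. by case: a => -[I J] h; case/and3P: (h). Qed.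

Lemma lo_hi (a : edge) : (lo a, hi a) = val a.
Proof. by rewrite /lo /hi -surjective_pairing. Qed.

Section Potentials.
Variable R : realType.
Variable C : numFieldType.
Local Notation K := (Kcore R).
Implicit Types (b : {set {set 'I_4}}) (beta : hface R).

Definition edge_poly b I J : {mpoly C[#|K|]} :=
  if insub b : option (hface R) is Some beta then
    if insub (I, J) : option edge is Some a then
      if insub a : option (edge_of beta) is Some e
      then pX C (Tagged (@edge_of R) e) else 0
    else 0
  else 0.

Definition diff_poly b I J := edge_poly b I J - edge_poly b J I.

Lemma edge_polyE (k : K) :
  edge_poly (val (tag k)) (lo (val (tagged k))) (hi (val (tagged k))) = pX C k.
Proof.
by case: k => beta e /=; rewrite /edge_poly valK lo_hi !valK.
Qed.

Lemma edge_poly_rev (k : K) :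
  edge_poly (val (tag k)) (hi (val (tagged k))) (lo (val (tagged k))) = 0.
Proof.
case: k => beta e /=; rewrite /edge_poly valK insubN //.
by rewrite !negb_and (negPf (sub_lt_asym (edge_lt (val e)))) !orbT.
Qed.

Lemma edge_ex beta I J : adj I J -> I \in val beta -> J \in val beta ->
  exists2 e : edge_of beta, (lo (val e), hi (val e)) = (I, J) \/
    (lo (val e), hi (val e)) = (J, I) & True.
Proof.
move=> aIJ Ib Jb.
have mk I' J' : adj I' J' -> sub_lt I' J' -> I' \in val beta -> J' \in val beta ->
    exists e : edge_of beta, (lo (val e), hi (val e)) = (I', J').
  move=> /andP [h1 h2] h3 h4 h5.
  have hE : [&& #|(I', J').1| == #|(I', J').2|, #|(I', J').1 :&: (I', J').2|.+1 == #|(I', J').1|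
      & sub_lt (I', J').1 (I', J').2] by rewrite /= h1 h2 h3.
  pose a : edge := Sub (I', J') hE.
  have hB : (lo a \in val beta) && (hi a \in val beta) by rewrite /lo /hi /= h4 h5.
  by exists (Sub a hB : edge_of beta).
have [/eqP e _] := andP aIJ.
case/orP: (sub_lt_total e (adj_neq aIJ)) => lt.
  by have [x hx] := mk I J aIJ lt Ib Jb; exists x => //; left.
by rewrite adjC in aIJ; have [x hx] := mk J I aIJ lt Jb Ib; exists x => //; right.
Qed.

(** A point whose coordinates on each face are the differences of one function
    of the vertices, up to a scalar. *)
Definition gradient (th : hface R -> C) (X : {set 'I_4} -> C) (y : {ffun K -> C}) :=
  forall k : K, y k = th (tag k) * (X (hi (val (tagged k))) - X (lo (val (tagged k)))).

Definition adjq I J := (I == J) || adj I J.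

Lemma pev_diff th X y beta I J : gradient th X y ->
  adjq I J -> I \in val beta -> J \in val beta ->
  pev y (diff_poly (val beta) I J) = th beta * (X J - X I).
Proof.
move=> gy /orP [/eqP ->|aIJ] Ib Jb.
  by rewrite /diff_poly !subrr rmorph0 mulr0.
have [e he _] := edge_ex aIJ Ib Jb; pose k : K := Tagged (@edge_of R) e.
have E := edge_polyE k; have E' := edge_poly_rev k; have gk := gy k.
rewrite /= in E E' gk.
rewrite /diff_poly rmorphB; case: he => -[eI eJ]; rewrite -eI -eJ E E' rmorph0 pevX gk.
  by rewrite subr0.
by rewrite sub0r -mulrN opprB.
Qed.

Definition base b : {set 'I_4} := odflt finset.set0 [pick I in b].
Definition mid b J : {set 'I_4} :=
  odflt (base b) [pick M in b | adjq (base b) M && adjq M J].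

(* A path of length two from the base vertex *)
Definition pot_poly b J : {mpoly C[#|K|]} :=
  diff_poly b (base b) (mid b J) + diff_poly b (mid b J) J.

Lemma adj_bridge (k : nat) P Q I J : I \in face k P Q -> J \in face k P Q ->
  exists M, [&& M \in face k P Q, adjq I M & adjq M J].
Proof.
move=> hI hJ; have [aq|naq] := boolP (adjq I J).
  by exists I; rewrite hI aq /adjq eqxx.
move: (hI) (hJ); rewrite !in_face => /and3P [/eqP kI PI IQ] /and3P [/eqP kJ PJ JQ].
move: naq; rewrite /adjq /adj negb_or kI kJ eqxx /= => /andP [ne ncard].
have cU := cardsUI I J; rewrite kI kJ in cU.
have leU := card_le4 (I :|: J).
have lt : (#|I :&: J| < k)%N.
  rewrite ltn_neqAle -{2}kI subset_leq_card ?finset.subsetIl // andbT.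
  apply: contra ne => /eqP e; apply/eqP.
  have e1 : I :&: J = I by apply/eqP; rewrite eqEcard finset.subsetIl kI e leqnn.
  have e2 : I :&: J = J by apply/eqP; rewrite eqEcard finset.subsetIr kJ e leqnn.
  by rewrite -e1 e2.
have lt2 : (#|I :&: J| < k.-1)%N by move: lt ncard; move: #|I :&: J| => n; lia.
have [k2 i0 u4] : [/\ k = 2%N, #|I :&: J| = 0%N & #|I :|: J| = 4%N].
  by move: lt2 cU leU {kI kJ IQ JQ lt hI hJ ncard}; move: #|I :&: J| #|I :|: J| => n m *; split; lia.
have [x xI] : exists x, x \in I by apply/finset.set0Pn; rewrite -card_gt0 kI k2.
have [y yJ] : exists y, y \in J by apply/finset.set0Pn; rewrite -card_gt0 kJ k2.
have IJ0 : I :&: J = finset.set0 by apply/eqP; rewrite -cards_eq0 i0.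
have xJ : x \notin J.
  by apply/negP => h; have : x \in I :&: J; [rewrite inE xI|rewrite IJ0 inE].
have yI : y \notin I.
  by apply/negP => h; have : y \in I :&: J; [rewrite inE h|rewrite IJ0 inE].
have xy : x != y by apply: contraNneq xJ => ->.
have P0 : P = finset.set0.
  by apply/eqP; rewrite -finset.subset0 -IJ0 finset.subsetI PI PJ.
have QT : P :|: Q = finset.setT.
  apply/eqP; rewrite -finset.subTset -(_ : I :|: J = finset.setT).
    by rewrite finset.subUset IQ JQ.
  by apply/eqP; rewrite eqEcard finset.subsetT cardsT card_ord u4.
exists [set x; y]%SET; rewrite in_face cards2 xy k2 P0 finset.sub0set -P0 QT finset.subsetT /=.
have IM : I :&: [set x; y]%SET = [set x]%SET.
  apply/finset.setP => z; rewrite !inE; case: (eqVneq z x) => [->|zx]; first by rewrite xI.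
  by case: (eqVneq z y) => [->|]; rewrite ?(negPf yI) ?andbF.
have MJ : [set x; y]%SET :&: J = [set y]%SET.
  apply/finset.setP => z; rewrite !inE; case: (eqVneq z y) => [->|zx]; first by rewrite yJ orbT.
  by case: (eqVneq z x) => [->|]; rewrite ?(negPf xJ) ?andbF.
by rewrite /adjq /adj IM MJ !cards1 ?cards2 ?xy ?kI ?kJ ?k2 ?eqxx ?orbT.
Qed.

Lemma hface_face beta : exists k P Q, val beta = face k P Q.
Proof.
by case: (hface_cases beta) => [[k _ e]|[l [k _ e]]|[i [k _ e]]];
  rewrite e; do 3 eexists.
Qed.

Lemma base_in beta J : J \in val beta -> base (val beta) \in val beta.
Proof. by rewrite /base => Jb; case: pickP => [I //|/(_ J)]; rewrite Jb. Qed.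

Lemma mid_in beta J : J \in val beta -> [&& mid (val beta) J \in val beta,
  adjq (base (val beta)) (mid (val beta) J) & adjq (mid (val beta) J) J].
Proof.
move=> Jb; rewrite /mid; case: pickP => [M //|no].
have [k [P [Q e]]] := hface_face beta.
have Bb := base_in Jb.
have [||M /and3P [h1 h2 h3]] := @adj_bridge k P Q (base (val beta)) J.
- by rewrite -e.
- by rewrite -e.
by have := no M; rewrite e h1 -e h2 h3.
Qed.

Lemma pev_pot th X y beta J : gradient th X y -> J \in val beta ->
  pev y (pot_poly (val beta) J) = th beta * (X J - X (base (val beta))).
Proof.
move=> gy Jb; have /and3P [h1 h2 h3] := mid_in Jb; have hB := base_in Jb.
by rewrite /pot_poly rmorphD !(pev_diff gy) //; ring.
Qed.

End Potentials.

(** * Affine coordinates of tetrahedra *)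

Definition I0 (n : nat) : {set 'I_4} := s4 (iota 1 n).
Definition K0 (n : nat) : {set 'I_4} :=
  nth finset.set0 [:: s4 [:: 2]; s4 [:: 1; 3]; s4 [:: 1; 2; 4]]%N n.-1.

Section Coordinates.
Variable A : comNzRingType.
Implicit Type g : 'M[A]_4.

Definition den g I := minor g (I0 #|I|) I.
Definition num g I := minor g (K0 #|I|) I.

Definition m4 g (a b c d : 'I_4) :=
  g o3 d * m3 g o0 o1 o2 a b c - g o3 c * m3 g o0 o1 o2 a b d
  + g o3 b * m3 g o0 o1 o2 a c d - g o3 a * m3 g o0 o1 o2 b c d.

Lemma nminor4 g a b c d : nminor 4 g [:: o0; o1; o2; o3] [:: a; b; c; d] = m4 g a b c d.
Proof.
rewrite /nminor (expand_det_row _ ord0) !big_ord_recl big_ord0 addr0 /cofactor.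
rewrite !det_mx33 !mxE /= /bump /= !inordK //= /m4 /m3 /m2.
by rewrite !exprS expr0; ring.
Qed.

Lemma cards_seq (s : seq 'I_4) : uniq s -> #|[set x in s]%SET| = size s.
Proof. by move=> us; rewrite cardsE; apply/card_uniqP. Qed.

Lemma set_seq1 (i : 'I_4) : [set i]%SET = [set x in [:: i]]%SET.
Proof. by apply/finset.setP => x; rewrite !inE. Qed.
Lemma set_seq2 (i j : 'I_4) : [set i; j]%SET = [set x in [:: i; j]]%SET.
Proof. by apply/finset.setP => x; rewrite !inE. Qed.
Lemma set_seq3 (i j k : 'I_4) : [set i; j; k]%SET = [set x in [:: i; j; k]]%SET.
Proof. by apply/finset.setP => x; rewrite !inE orbA. Qed.

Lemma minor_set1 g S i : #|S| = 1%N -> minor g S [set i]%SET = nminor 1 g (enum S) [:: i].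
Proof. by move=> h; rewrite (minorE _ _ h) enum_set1. Qed.

Lemma minor_set2 (i j : 'I_4) : uniq [:: i; j] -> exists c : A, c * c = 1 /\
  forall g S, #|S| = 2%N -> minor g S [set i; j]%SET = c * nminor 2 g (enum S) [:: i; j].
Proof.
move=> U; have [c [hc h]] := minor_perm A U (set_seq2 i j).
by exists c; split=> // g S hS; apply: h; rewrite set_seq2 cards_seq.
Qed.

Lemma minor_set3 (i j k : 'I_4) : uniq [:: i; j; k] -> exists c : A, c * c = 1 /\
  forall g S, #|S| = 3%N ->
    minor g S [set i; j; k]%SET = c * nminor 3 g (enum S) [:: i; j; k].
Proof.
move=> U; have [c [hc h]] := minor_perm A U (set_seq3 i j k).
by exists c; split=> // g S hS; apply: h; rewrite set_seq3 cards_seq.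
Qed.

Lemma uniq4_setT (i j k l : 'I_4) : uniq [:: i; j; k; l] ->
  [set x in [:: i; j; k; l]]%SET = finset.setT.
Proof.
move=> U; apply/finset.setP => x; rewrite !inE.
by case: (uniq4_mem x U) => ->; rewrite eqxx ?orbT.
Qed.

Lemma det_m4 g (i j k l : 'I_4) : uniq [:: i; j; k; l] -> exists c : A, c * c = 1 /\
  \det g = c * m4 g i j k l.
Proof.
move=> U; have [c [hc h]] := minor_perm A U (esym (uniq4_setT U)).
exists c; split=> //; have := h g finset.setT erefl.
rewrite (_ : enum finset.setT = [:: o0; o1; o2; o3]) ?nminor4 //; last first.
  by rewrite enum_set4 /= !inE.
move=> <-; rewrite (minorE (n := 4)) ?cardsT ?card_ord // /nminor -det_tr; congr (\det _).
apply/matrixP => x y; rewrite !mxE.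
have e (z : 'I_4) : nth ord0 (enum [set: 'I_4]%SET) z = z.
  rewrite enum_set4 /= !inE /=; apply: val_inj.
  by case: z => [[|[|[|[|]]]]].
by rewrite !e.
Qed.

End Coordinates.

Lemma uniq4_neq (i j k l : 'I_4) : uniq [:: i; j; k; l] ->
  (((i == j) = false) * ((i == k) = false) * ((i == l) = false) *
  ((j == i) = false) * ((j == k) = false) * ((j == l) = false) *
  ((k == i) = false) * ((k == j) = false) * ((k == l) = false) *
  ((l == i) = false) * ((l == j) = false) * ((l == k) = false))%type.
Proof. by move=> U; do !split; apply: negbTE; uniq4. Qed.

Lemma setC_uniq1 (i j k l : 'I_4) : uniq [:: i; j; k; l] ->
  (~: [set l] = [set i; j; k])%SET.
Proof.
move=> U; apply/finset.setP => x; rewrite !inE.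
by case: (uniq4_mem x U) => ->; rewrite ?eqxx ?(uniq4_neq U).
Qed.

Lemma setC_uniq2 (i j k l : 'I_4) : uniq [:: i; j; k; l] ->
  (~: [set l; i] = [set j; k])%SET.
Proof.
move=> U; apply/finset.setP => x; rewrite !inE.
by case: (uniq4_mem x U) => ->; rewrite ?eqxx ?(uniq4_neq U).
Qed.

Lemma card_set_uniq2 (i j k l : 'I_4) : uniq [:: i; j; k; l] -> #|[set i; j]%SET| = 2%N.
Proof. by move=> U; rewrite cards2 (uniq4_neq U). Qed.

Lemma card_set_uniq3 (i j k l : 'I_4) : uniq [:: i; j; k; l] -> #|[set i; j; k]%SET| = 3%N.
Proof. by move=> U; rewrite -(setC_uniq1 U) cardsC1 card_ord. Qed.

Lemma enum_I0 n : (n <= 4)%N -> enum (I0 n) = take n [:: o0; o1; o2; o3].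
Proof. by rewrite /I0 enum_s4; move: n => [|[|[|[|[|n]]]]]. Qed.

Lemma card_K0 n : (0 < n < 4)%N -> #|K0 n| = n.
Proof. by rewrite /K0 cardE; move: n => [|[|[|[|n]]]] //= _; rewrite enum_s4. Qed.

Inductive adj_spec : {set 'I_4} -> {set 'I_4} -> Prop :=
  | Adj1 i j k l of uniq [:: i; j; k; l] : adj_spec [set i] [set j]
  | Adj2 i j k l of uniq [:: i; j; k; l] : adj_spec [set i; j] [set i; k]
  | Adj3 i j k l of uniq [:: i; j; k; l] : adj_spec [set i; j; k] [set i; j; l].

Lemma adjP I J : #|I| = #|J| -> #|I :&: J|.+1 = #|I| -> (#|I| < 4)%N -> adj_spec I J.
Proof.
move=> cIJ cI lt3.
have cD : #|I :\: J| = 1%N.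
  by apply/eqP; rewrite -(eqn_add2l #|I :&: J|) cardsID addn1 cI.
have cD' : #|J :\: I| = 1%N.
  by apply/eqP; rewrite -(eqn_add2l #|J :&: I|) cardsID addn1 finset.setIC cI cIJ.
have [x hx] := cards1P (introT eqP cD); have [y hy] := cards1P (introT eqP cD').
have IE : I = x |: (I :&: J) by rewrite -hx finset.setUC finset.setID.
have JE : J = y |: (I :&: J) by rewrite -hy finset.setUC finset.setIC finset.setID.
have xM : x \notin I :&: J.
  have : x \in I :\: J by rewrite hx inE.
  by rewrite !inE => /andP [/negPf -> _]; rewrite andbF.
have yM : y \notin I :&: J.
  have : y \in J :\: I by rewrite hy inE.
  by rewrite !inE => /andP [/negPf -> _].
have xy : x != y.
  have h1 : x \in I :\: J by rewrite hx inE.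
  have h2 : y \in J :\: I by rewrite hy inE.
  apply: contraTneq h1 => ->; move: h2; rewrite !inE => /andP [_ ->]; exact: isT.
have cM : (#|I :&: J| < 3)%N by rewrite -ltnS cI.
move: IE JE xM yM cM; move: (I :&: J) => M -> -> xM yM cM.
case: (posnP #|M|) => [/eqP|M0].
  rewrite cards_eq0 => /eqP ->; rewrite !finset.setU0.
  by have [k [l U]] := uniq4_ex2 xy; apply: (Adj1 U).
have [M1|M1] := eqVneq #|M| 1%N.
  have [m hm] := cards1P (introT eqP M1); move: xM yM; rewrite hm !inE => xm ym.
  have [|l U] := @uniq4_ex m x y; first by rewrite /= !inE negb_or ![m == _]eq_sym xm ym xy.
  by rewrite ![_ |: [set m]]finset.setUC; apply: (Adj2 U).
have /cards2P [m [n [mn hm]]] : #|M| == 2%N.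
  by move: cM M0 M1; case: #|M| => [|[|[|]]].
move: xM yM; rewrite hm !inE !negb_or => /andP [xm xn] /andP [ym yn].
rewrite ![_ |: [set m; n]]finset.setUC; apply: Adj3.
by rewrite /= !inE !negb_or mn ![m == _]eq_sym ![n == _]eq_sym xm ym xn yn xy.
Qed.

Section Affine.
Variable F : fieldType.
Implicit Types g : 'M[F]_4.

Definition aff_coord g I : F := num g I / den g I.

(* All the subspaces are transverse to the flag at infinity *)
Definition regular g := forall I, I != finset.set0 -> I != finset.setT -> den g I != 0.

Lemma sq1_neq0 (c : F) : c * c = 1 -> c != 0.
Proof. by move=> h; apply: contra_eq_neq h => ->; rewrite mul0r eq_sym oner_eq0. Qed.

Lemma coord1 g i : ((den g [set i]%SET = g o0 i) * (num g [set i]%SET = g o1 i))%type.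
Proof.
rewrite /den /num cards1 !minor_set1 ?card_I0 ?card_K0 //.
by rewrite enum_I0 // /K0 enum_s4 /= !nminor1.
Qed.

Lemma coord2 g i j k l : uniq [:: i; j; k; l] -> exists2 c : F, c != 0 &
  ((den g [set i; j]%SET = (c * m2 g o0 o1 i j)%R) *
   (num g [set i; j]%SET = (c * m2 g o0 o2 i j)%R))%type.
Proof.
move=> U; have [|c [hc h]] := minor_set2 F (i := i) (j := j).
  by rewrite /= inE (uniq4_neq U).
exists c; first exact: sq1_neq0.
rewrite /den /num (card_set_uniq2 U) !h ?card_I0 ?card_K0 //.
by rewrite enum_I0 // /K0 enum_s4 /= !nminor2.
Qed.

Lemma coord3 g i j k l : uniq [:: i; j; k; l] -> exists2 c : F, c != 0 &
  ((den g [set i; j; k]%SET = (c * m3 g o0 o1 o2 i j k)%R) *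
   (num g [set i; j; k]%SET = (c * m3 g o0 o1 o3 i j k)%R))%type.
Proof.
move=> U; have [|c [hc h]] := minor_set3 F (i := i) (j := j) (k := k).
  by rewrite /= !inE !(uniq4_neq U).
exists c; first exact: sq1_neq0.
rewrite /den /num (card_set_uniq3 U) !h ?card_I0 ?card_K0 //.
by rewrite enum_I0 // /K0 enum_s4 /= !nminor3.
Qed.

Lemma aff1 g i : aff_coord g [set i]%SET = g o1 i / g o0 i.
Proof. by rewrite /aff_coord !coord1. Qed.

Lemma aff2 g i j k l : uniq [:: i; j; k; l] ->
  aff_coord g [set i; j]%SET = m2 g o0 o2 i j / m2 g o0 o1 i j.
Proof.
move=> U; have [c c0 h] := coord2 g U; rewrite /aff_coord !h.
by rewrite -mulf_div divff // mul1r.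
Qed.

Lemma aff3 g i j k l : uniq [:: i; j; k; l] ->
  aff_coord g [set i; j; k]%SET = m3 g o0 o1 o3 i j k / m3 g o0 o1 o2 i j k.
Proof.
move=> U; have [c c0 h] := coord3 g U; rewrite /aff_coord !h.
by rewrite -mulf_div divff // mul1r.
Qed.

Lemma set_proper n I : #|I| = n -> (0 < n < 4)%N -> (I != finset.set0) && (I != finset.setT).
Proof.
move=> e /andP [n0 n4]; rewrite -card_gt0 e n0 /=.
by apply: contraTneq n4 => eT; rewrite -e eT cardsT card_ord.
Qed.

Section Regular.
Variable g : 'M[F]_4.
Hypothesis reg : regular g.
Variables i j k l : 'I_4.
Hypothesis U : uniq [:: i; j; k; l].

Lemma reg1 : g o0 i != 0.
Proof.
have := @reg [set i]%SET; rewrite coord1; case/andP: (set_proper (cards1 i) isT) => h1 h2.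
by apply.
Qed.

Lemma reg2 : m2 g o0 o1 i j != 0.
Proof.
case/andP: (set_proper (card_set_uniq2 U) isT) => h1 h2.
have := reg h1 h2; have [c c0 h] := coord2 g U; rewrite h.
by rewrite mulf_eq0 negb_or => /andP [].
Qed.

Lemma reg3 : m3 g o0 o1 o2 i j k != 0.
Proof.
case/andP: (set_proper (card_set_uniq3 U) isT) => h1 h2.
have := reg h1 h2; have [c c0 h] := coord3 g U; rewrite h.
by rewrite mulf_eq0 negb_or => /andP [].
Qed.

End Regular.

Section Differences.
Variable g : 'M[F]_4.
Hypothesis reg : regular g.
Local Notation X := (aff_coord g).

Lemma diff1 i j k l : uniq [:: i; j; k; l] ->
  X [set j]%SET - X [set i]%SET = m2 g o0 o1 i j / (g o0 i * g o0 j).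
Proof.
move=> U; rewrite !aff1 /m2; have h1 := reg1 reg i; have h2 := reg1 reg j.
by field; rewrite h1 h2.
Qed.

Lemma diff2 i j k l : uniq [:: i; j; k; l] ->
  X [set i; k]%SET - X [set i; j]%SET =
  g o0 i * m3 g o0 o1 o2 i j k / (m2 g o0 o1 i j * m2 g o0 o1 i k).
Proof.
move=> U; have U' : uniq [:: i; k; j; l] by uniq4.
rewrite (aff2 g U) (aff2 g U'); have h1 := reg2 reg U; have h2 := reg2 reg U'.
by rewrite /m3; rewrite /m2 in h1 h2 *; field; rewrite h1 h2.
Qed.

Lemma diff3 i j k l : uniq [:: i; j; k; l] ->
  X [set i; j; l]%SET - X [set i; j; k]%SET =
  m2 g o0 o1 i j * m4 g i j k l / (m3 g o0 o1 o2 i j k * m3 g o0 o1 o2 i j l).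
Proof.
move=> U; have U' : uniq [:: i; j; l; k] by uniq4.
rewrite (aff3 g U) (aff3 g U'); have h1 := reg3 reg U; have h2 := reg3 reg U'.
have -> : m2 g o0 o1 i j * m4 g i j k l =
    m3 g o0 o1 o3 i j l * m3 g o0 o1 o2 i j k - m3 g o0 o1 o3 i j k * m3 g o0 o1 o2 i j l.
  by rewrite /m4 /m3 /m2; ring.
by field; rewrite h1 h2.
Qed.

Lemma det_uniq4_neq0 i j k l : uniq [:: i; j; k; l] -> g \in unitmx -> m4 g i j k l != 0.
Proof.
move=> U; rewrite unitmxE unitfE; have [c [_ ->]] := det_m4 g U.
by rewrite mulf_eq0 negb_or => /andP [].
Qed.

Lemma aff_coord_neq I J : g \in unitmx -> (#|I| < 4)%N ->
  #|I| = #|J| -> #|I :&: J|.+1 = #|I| -> X I != X J.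
Proof.
move=> gu lt cIJ cI; rewrite eq_sym -subr_eq0.
case: (adjP cIJ cI lt) => i j k l U.
- by rewrite (diff1 U) mulf_neq0 ?invr_eq0 ?mulf_neq0 ?(reg2 reg U) ?reg1.
- have U' : uniq [:: i; k; j; l] by uniq4.
  rewrite (diff2 U) mulf_neq0 ?invr_eq0 ?mulf_neq0 ?(reg2 reg U) ?(reg2 reg U') //.
  by rewrite reg1. by rewrite (reg3 reg U).
- have U' : uniq [:: i; j; l; k] by uniq4.
  rewrite (diff3 U) mulf_neq0 ?invr_eq0 ?mulf_neq0 ?(reg2 reg U) ?(reg3 reg U)
    ?(reg3 reg U') //.
  exact: det_uniq4_neq0.
Qed.

Lemma m2C a b : m2 g o0 o1 b a = - m2 g o0 o1 a b.
Proof. by rewrite /m2; ring. Qed.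

Lemma m3C a b c : (m3 g o0 o1 o2 b a c = - m3 g o0 o1 o2 a b c) *
                  (m3 g o0 o1 o2 a c b = - m3 g o0 o1 o2 a b c).
Proof. by split; rewrite /m3 /m2; ring. Qed.

Lemma triangle_points i j k l : uniq [:: i; j; k; l] ->
  prop3 (X [set i]%SET) (X [set j]%SET) (X [set k]%SET)
        (X [set j; k]%SET) (X [set i; k]%SET) (X [set i; j]%SET).
Proof.
move=> U; rewrite /prop3.
have [Uji Uki] : uniq [:: j; k; i; l] /\ uniq [:: k; j; i; l] by split; uniq4.
have Uik : uniq [:: i; k; j; l] by uniq4.
rewrite (diff1 U) (diff1 Uik).
have := diff2 Uji; rewrite ![[set j; _]%SET]finset.setUC => h1.
have := diff2 Uki; rewrite ![[set k; _]%SET]finset.setUC => h2.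
rewrite ![[set j; k]%SET]finset.setUC in h1 h2 *; rewrite {}h1 {}h2.
have n1 := reg2 reg U; have n2 := reg2 reg Uji; have n3 := reg2 reg Uik.
rewrite ![m2 _ _ _ j i]m2C ![m2 _ _ _ k j]m2C ![m2 _ _ _ k i]m2C.
rewrite (m3C j k i).1; field.
by rewrite ?oppr_eq0 ?reg1 ?n1 ?n2 ?n3.
Qed.

Lemma star_planes i j k l : uniq [:: i; j; k; l] ->
  prop3 (X [set l; i]%SET) (X [set l; j]%SET) (X [set l; k]%SET)
        (X (~: [set i])%SET) (X (~: [set j])%SET) (X (~: [set k])%SET).
Proof.
move=> U; rewrite /prop3.
have [U1 U2] : uniq [:: l; i; j; k] /\ uniq [:: l; i; k; j] by split; uniq4.
have [U3 U4] : uniq [:: j; l; k; i] /\ uniq [:: k; l; j; i] by split; uniq4.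
have [U5 U6] : uniq [:: j; l; i; k] /\ uniq [:: k; l; i; j] by split; uniq4.
rewrite (diff2 U1) (diff2 U2) (setC_uniq1 U5) (setC_uniq1 U6).
rewrite {1}(setC_uniq1 U3) (setC_uniq1 U4) (diff3 U3) (diff3 U4).
have n1 := reg2 reg U1; have n2 := reg2 reg U3; have n3 := reg2 reg U4.
have n4 := reg3 reg U1; have n5 := reg3 reg U2; have n6 := reg3 reg U3.
have -> : m4 g k l j i = - m4 g j l k i by rewrite /m4 /m3 /m2; ring.
have e1 : m3 g o0 o1 o2 j l i = m3 g o0 o1 o2 l i j by rewrite /m3 /m2; ring.
have e2 : m3 g o0 o1 o2 k l i = m3 g o0 o1 o2 l i k by rewrite /m3 /m2; ring.
have e3 : m3 g o0 o1 o2 k l j = - m3 g o0 o1 o2 j l k by rewrite /m3 /m2; ring.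
rewrite e1 e2 e3 [m2 _ _ _ l j]m2C [m2 _ _ _ l k]m2C; field.
by rewrite ?oppr_eq0 ?n1 ?n2 ?n3 ?n4 ?n5 ?n6.
Qed.

Lemma degree_three i j k l : uniq [:: i; j; k; l] ->
  (X [set i; j]%SET - X [set i; k]%SET) * (X [set k]%SET - X [set l]%SET) *
    (X [set i; l]%SET - X [set l; k]%SET) =
  (X [set i; l]%SET - X [set i; k]%SET) * (X [set k]%SET - X [set j]%SET) *
    (X [set i; j]%SET - X [set j; k]%SET).
Proof.
move=> U.
have [U1 U2] : uniq [:: i; k; j; l] /\ uniq [:: i; k; l; j] by split; uniq4.
have [U3 U4] : uniq [:: l; k; i; j] /\ uniq [:: j; k; i; l] by split; uniq4.
rewrite (diff2 U1) (diff2 U2) (diff1 U3) (diff1 U4).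
have := diff2 U3; rewrite [[set l; i]%SET]finset.setUC => ->.
have := diff2 U4; rewrite [[set j; i]%SET]finset.setUC => ->.
have n1 := reg2 reg U; have n2 := reg2 reg U1; have n3 := reg2 reg U3.
have n4 := reg2 reg U4; have n5 : m2 g o0 o1 i l != 0 by apply: (@reg2 g reg i l j k); uniq4.
have e1 : m3 g o0 o1 o2 l k i = m3 g o0 o1 o2 i l k by rewrite /m3 /m2; ring.
have e2 : m3 g o0 o1 o2 i k l = - m3 g o0 o1 o2 i l k by rewrite /m3 /m2; ring.
have e3 : m3 g o0 o1 o2 i k j = - m3 g o0 o1 o2 j k i by rewrite /m3 /m2; ring.
rewrite e1 e2 e3 [m2 _ _ _ l i]m2C [m2 _ _ _ j i]m2C; field.
by rewrite ?oppr_eq0 ?reg1 ?n1 ?n2 ?n3 ?n4 ?n5.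
Qed.

End Differences.
End Affine.

(** * Generic matrices *)

Section GenericMatrix.
Variable C : numFieldType.
Local Notation J16 := ('I_4 * 'I_4)%type.

Definition mat16 (z : {ffun J16 -> C}) : 'M[C]_4 := \matrix_(i, j) z (i, j).
Definition vec16 (g : 'M[C]_4) : {ffun J16 -> C} := [ffun p => g p.1 p.2].
Definition gen16 : 'M[{mpoly C[#|{: J16}|]}]_4 := \matrix_(i, j) pX C ((i, j) : J16).

Lemma vec16K g : mat16 (vec16 g) = g.
Proof. by apply/matrixP => i j; rewrite mxE ffunE. Qed.

Lemma pev_gen16 z : map_mx (pev z) gen16 = mat16 z.
Proof. by apply/matrixP => i j; rewrite !mxE pevX. Qed.

(** A general change of coordinates makes the leading coordinate of finitely
    many nonzero vectors in exterior powers nonzero. *)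
Lemma generic_frame (v : {set 'I_4} -> {set 'I_4} -> C) :
  (forall I, exists2 T : {set 'I_4}, #|T| = #|I| & v I T != 0) ->
  exists2 h : 'M[C]_4, h \in unitmx &
    forall I, \sum_(T : {set 'I_4} | #|T| == #|I|) minor h (I0 #|I|) T * v I T != 0.
Proof.
move=> hv.
pose p (o : option {set 'I_4}) := match o with
  | Some J => \sum_(T : {set 'I_4} | #|T| == #|J|) minor gen16 (I0 #|J|) T * (v J T)%:MP
  | None => \det gen16 end.
have pE z I : pev z (p (Some I)) =
    \sum_(T : {set 'I_4} | #|T| == #|I|) minor (mat16 z) (I0 #|I|) T * v I T.
  rewrite /p rmorph_sum; apply: eq_bigr => T _.
  by rewrite rmorphM pevC map_minor pev_gen16.
have [|z hz] := @prod_nonzero C _ _ p.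
  case=> [I|]; last first.
    exists (vec16 1%:M); rewrite pevE -det_map_mx pev_gen16 vec16K det1.
    exact: oner_neq0.
  have [T0 cT vT] := hv I.
  pose h : 'M[C]_4 := \matrix_(r, c) (c == nth ord0 (enum T0) r)%:R.
  exists (vec16 h); rewrite pevE pE vec16K (bigD1 T0) ?cT //= big1 ?addr0.
    suff -> : minor h (I0 #|I|) T0 = 1 by rewrite mul1r.
    rewrite -[RHS](_ : minor (1%:M : 'M[C]_4) T0 T0 = 1); last by rewrite minor1 ?eqxx.
    rewrite (minorE (n := #|I|)) ?card_I0 ?card_le4 // (minorE _ _ cT).
    congr (\det _); apply/matrixP => x y; rewrite !mxE eq_sym.
    by rewrite [val (nth _ _ _)]nth_I0 ?card_le4.
  move=> T /andP [/eqP cT' ne].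
  suff -> : minor h (I0 #|I|) T = 0 by rewrite mul0r.
  have e0 : minor (1%:M : 'M[C]_4) T0 T = 0 by rewrite minor1 ?cT ?cT' // eq_sym (negPf ne).
  rewrite -[RHS]e0 (minorE (n := #|I|)) ?card_I0 ?card_le4 // (minorE _ _ cT).
  congr (\det _); apply/matrixP => x y; rewrite !mxE eq_sym.
  by rewrite [val (nth _ _ _)]nth_I0 ?card_le4.
exists (mat16 z).
  by rewrite unitmxE unitfE -pev_gen16 det_map_mx; apply: (hz None).
by move=> I; rewrite -pE; apply: (hz (Some I)).
Qed.

Lemma regular_exists : exists2 g : 'M[C]_4, g \in unitmx & regular g.
Proof.
have [|h hu hI] := generic_frame (v := fun I T => (T == I)%:R).
  by move=> I; exists I; rewrite ?eqxx ?oner_neq0.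
exists h => // I _ _; have := hI I; rewrite (bigD1 I) //= eqxx mulr1 big1 ?addr0 //.
by move=> T /andP [_ /negPf ->]; rewrite mulr0.
Qed.

End GenericMatrix.

Lemma card1_set I : #|I| = 1%N -> exists i j k l, uniq [:: i; j; k; l] /\ I = [set i]%SET.
Proof.
move/eqP/cards1P => [i ->]; have [j [k [l U]]] := uniq4_ex3 i.
by exists i, j, k, l.
Qed.

Lemma card2_set I : #|I| = 2%N -> exists i j k l, uniq [:: i; j; k; l] /\ I = [set i; j]%SET.
Proof.
move/eqP/cards2P => [i [j [ij ->]]]; have [k [l U]] := uniq4_ex2 ij.
by exists i, j, k, l.
Qed.

Lemma card3_set I : #|I| = 3%N -> exists i j k l, uniq [:: i; j; k; l] /\ I = [set i; j; k]%SET.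
Proof.
move=> c3; have /eqP/cards1P [l hl] : #|~: I| = 1%N.
  by apply/eqP; rewrite -(eqn_add2l #|I|) cardsC card_ord c3.
have [i [j [k U]]] := uniq4_ex3 l; exists i, j, k, l.
have U' : uniq [:: i; j; k; l] by uniq4.
by split=> //; rewrite -(setC_uniq1 U') -hl finset.setCK.
Qed.

Lemma card_proper I : I != finset.set0 -> I != finset.setT ->
  [\/ #|I| = 1%N, #|I| = 2%N | #|I| = 3%N].
Proof.
rewrite -card_gt0 => h0 hT; have : (#|I| < 4)%N.
  rewrite ltn_neqAle card_le4 andbT; apply: contra hT => /eqP e.
  by rewrite eqEcard finset.subsetT cardsT card_ord e.
by case: #|I| h0 => [|[|[|[|]]]] // _ _; [constructor 1|constructor 2|constructor 3].
Qed.

(** * Normal form under the Borel group of the flag at infinity *)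

Section Triangular.
Variable F : fieldType.
Variables (g M : 'M[F]_4) (d : 'I_4 -> F).
Variables (a00 a10 a11 a20 a21 a22 a30 a31 a32 a33 : F).
Hypothesis M0 : forall a, M o0 a = d a * (a00 * g o0 a).
Hypothesis M1 : forall a, M o1 a = d a * (a10 * g o0 a + a11 * g o1 a).
Hypothesis M2 : forall a, M o2 a = d a * (a20 * g o0 a + a21 * g o1 a + a22 * g o2 a).
Hypothesis M3 : forall a,
  M o3 a = d a * (a30 * g o0 a + a31 * g o1 a + a32 * g o2 a + a33 * g o3 a).
Hypothesis nz : [/\ a00 != 0, a11 != 0, a22 != 0 & a33 != 0].
Hypothesis d0 : forall a, d a != 0.
Hypothesis reg : regular g.

Let e01 i j : m2 M o0 o1 i j = d i * d j * a00 * a11 * m2 g o0 o1 i j.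
Proof. by rewrite /m2 !M0 !M1; ring. Qed.
Let e02 i j : m2 M o0 o2 i j =
  d i * d j * a00 * (a21 * m2 g o0 o1 i j + a22 * m2 g o0 o2 i j).
Proof. by rewrite /m2 !M0 !M2; ring. Qed.
Let e012 i j k : m3 M o0 o1 o2 i j k =
  d i * d j * d k * a00 * a11 * a22 * m3 g o0 o1 o2 i j k.
Proof. by rewrite /m3 /m2 !M0 !M1 !M2; ring. Qed.
Let e013 i j k : m3 M o0 o1 o3 i j k =
  d i * d j * d k * a00 * a11 * (a32 * m3 g o0 o1 o2 i j k + a33 * m3 g o0 o1 o3 i j k).
Proof. by rewrite /m3 /m2 !M0 !M1 !M3; ring. Qed.
Let e0123 i j k l : m4 M i j k l =
  d i * d j * d k * d l * a00 * a11 * a22 * a33 * m4 g i j k l.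
Proof.
rewrite /m4 !e012 !M3 /m3 /m2; ring.
Qed.

Lemma triangular_unit : g \in unitmx -> M \in unitmx.
Proof.
have [j [k [l U]]] := uniq4_ex3 ord0; move=> gu.
rewrite unitmxE unitfE; have [c [hc ->]] := det_m4 M U.
have [n0 n1 n2 n3] := nz.
rewrite e0123 mulf_neq0 ?(sq1_neq0 hc) //.
by rewrite !mulf_neq0 // (det_uniq4_neq0 U gu).
Qed.

Lemma triangular_regular : regular M.
Proof.
have [n0 n1 n2 n3] := nz.
move=> I I0' IT; case: (card_proper I0' IT) => cI.
- have [i [j [k [l [U ->]]]]] := card1_set cI.
  by rewrite coord1 M0 !mulf_neq0 // reg1.
- have [i [j [k [l [U ->]]]]] := card2_set cI; have [c c0 h] := coord2 M U.
  by rewrite h e01 !mulf_neq0 // (reg2 reg U).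
- have [i [j [k [l [U ->]]]]] := card3_set cI; have [c c0 h] := coord3 M U.
  by rewrite h e012 !mulf_neq0 // (reg3 reg U).
Qed.

Lemma triangular_aff : exists al be : nat -> F, (forall n, al n != 0) /\
  forall I, I != finset.set0 -> I != finset.setT ->
    aff_coord M I = al #|I| * aff_coord g I + be #|I|.
Proof.
have [n0 n1 n2 n3] := nz.
exists (fun n => nth (a11 / a00) [:: a11 / a00; a11 / a00; a22 / a11; a33 / a22] n).
exists (fun n => nth 0 [:: 0; a10 / a00; a21 / a11; a32 / a22] n); split.
  by move=> [|[|[|[|n]]]] /=; rewrite ?mulf_neq0 ?invr_eq0 // nth_nil mulf_neq0 ?invr_eq0.
move=> I I0' IT; case: (card_proper I0' IT) => cI.
- have [i [j [k [l [U e]]]]] := card1_set cI; rewrite cI e !aff1 M0 M1 /=.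
  by have h := reg1 reg i; field; rewrite n0 d0 h.
- have [i [j [k [l [U e]]]]] := card2_set cI.
  rewrite cI e (aff2 M U) (aff2 g U) e01 e02 /=.
  by have h := reg2 reg U; field; rewrite n0 n1 !d0 h.
- have [i [j [k [l [U e]]]]] := card3_set cI.
  rewrite cI e (aff3 M U) (aff3 g U) e012 e013 /=.
  by have h := reg3 reg U; field; rewrite n0 n1 n2 !d0 h.
Qed.

End Triangular.

(** The tetrahedra with points (1, a, b, c) for a = (0, 1, p, q),
    b = (0, 0, p, s q) and c = (0, 0, 0, 1) *)
Definition core_slice (A : comNzRingType) (p q s : A) : 'M[A]_4 :=
  \matrix_(r, c) nth 0 (nth [::] [:: [:: 1; 1; 1; 1]; [:: 0; 1; p; q];
    [:: 0; 0; p; s * q]; [:: 0; 0; 0; 1]] r) c.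

Lemma all_o (P : 'I_4 -> Prop) : P o0 -> P o1 -> P o2 -> P o3 -> forall i, P i.
Proof.
move=> h0 h1 h2 h3 [[|[|[|[|]]]] // lt].
- by rewrite (_ : Ordinal lt = o0) //; apply: val_inj.
- by rewrite (_ : Ordinal lt = o1) //; apply: val_inj.
- by rewrite (_ : Ordinal lt = o2) //; apply: val_inj.
- by rewrite (_ : Ordinal lt = o3) //; apply: val_inj.
Qed.

Lemma core_normal_form (F : fieldType) (g : 'M[F]_4) : g \in unitmx -> regular g ->
  exists p q s, let M := core_slice p q s in [/\ M \in unitmx, regular M &
    exists al be : nat -> F, (forall n, al n != 0) /\
    forall I, I != finset.set0 -> I != finset.setT ->
      aff_coord M I = al #|I| * aff_coord g I + be #|I| ].
Proof.
move=> gu reg; have U : uniq [:: o0; o1; o2; o3] by [].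
pose k1 := g o0 o1 / m2 g o0 o1 o0 o1.
pose p := m2 g o0 o1 o0 o2 * k1 / g o0 o2.
pose q := m2 g o0 o1 o0 o3 * k1 / g o0 o3.
pose k2 := p * g o0 o2 / m3 g o0 o1 o2 o0 o1 o2.
pose s := m3 g o0 o1 o2 o0 o1 o3 * k2 / (g o0 o3 * q).
pose k3 := g o0 o3 / m4 g o0 o1 o2 o3.
have r := reg1 reg.
have n01 := reg2 reg U.
have n02 : m2 g o0 o1 o0 o2 != 0 by apply: (@reg2 _ g reg o0 o2 o1 o3).
have n03 : m2 g o0 o1 o0 o3 != 0 by apply: (@reg2 _ g reg o0 o3 o1 o2).
have n012 := reg3 reg U.
have n4 := det_uniq4_neq0 U gu.
have k10 : k1 != 0 by rewrite mulf_neq0 ?invr_eq0.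
have p0 : p != 0 by rewrite !mulf_neq0 ?invr_eq0.
have q0 : q != 0 by rewrite !mulf_neq0 ?invr_eq0.
have k20 : k2 != 0 by rewrite !mulf_neq0 ?invr_eq0.
have k30 : k3 != 0 by rewrite !mulf_neq0 ?invr_eq0.
exists p, q, s => M.
pose d a := (g o0 a)^-1.
have d0 a : d a != 0 by rewrite invr_eq0 r.
(* The rows are the minors of the first columns of g and one more column *)
have M0 a : M o0 a = d a * (1 * g o0 a).
  by elim/all_o: a; rewrite mxE /= mul1r /d mulVf ?r.
have M1 a : M o1 a = d a * (- (k1 * g o1 o0) * g o0 a + k1 * g o0 o0 * g o1 a).
  transitivity (d a * (k1 * m2 g o0 o1 o0 a)); last by rewrite /m2; ring.
  elim/all_o: a; rewrite mxE /= /d.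
  - by rewrite /m2 mulrC subrr mulr0 mul0r.
  - by rewrite /k1; field; rewrite n01 r.
  - by rewrite /p; field; rewrite r.
  - by rewrite /q; field; rewrite r.
have M2 a : M o2 a = d a * (k2 * m2 g o1 o2 o0 o1 * g o0 a
    + - (k2 * m2 g o0 o2 o0 o1) * g o1 a + k2 * m2 g o0 o1 o0 o1 * g o2 a).
  transitivity (d a * (k2 * m3 g o0 o1 o2 o0 o1 a)); last by rewrite /m3 /m2; ring.
  elim/all_o: a; rewrite mxE /= /d.
  - by rewrite (_ : m3 _ _ _ _ _ _ _ = 0) ?mulr0 //; rewrite /m3 /m2; ring.
  - by rewrite (_ : m3 _ _ _ _ _ _ _ = 0) ?mulr0 //; rewrite /m3 /m2; ring.
  - by rewrite /k2; field; rewrite n012 r.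
  - by rewrite /s; field; rewrite q0 r.
have M3 a : M o3 a = d a * (- (k3 * m3 g o1 o2 o3 o0 o1 o2) * g o0 a
    + k3 * m3 g o0 o2 o3 o0 o1 o2 * g o1 a + - (k3 * m3 g o0 o1 o3 o0 o1 o2) * g o2 a
    + k3 * m3 g o0 o1 o2 o0 o1 o2 * g o3 a).
  transitivity (d a * (k3 * m4 g o0 o1 o2 a)); last by rewrite /m4 /m3 /m2; ring.
  elim/all_o: a; rewrite mxE /= /d.
  - by rewrite (_ : m4 _ _ _ _ _ = 0) ?mulr0 //; rewrite /m4 /m3 /m2; ring.
  - by rewrite (_ : m4 _ _ _ _ _ = 0) ?mulr0 //; rewrite /m4 /m3 /m2; ring.
  - by rewrite (_ : m4 _ _ _ _ _ = 0) ?mulr0 //; rewrite /m4 /m3 /m2; ring.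
  - by rewrite /k3; field; rewrite n4 r.
have nz : [/\ (1 : F) != 0, k1 * g o0 o0 != 0, k2 * m2 g o0 o1 o0 o1 != 0 &
    k3 * m3 g o0 o1 o2 o0 o1 o2 != 0].
  by split; [exact: oner_neq0 | | |]; apply: mulf_neq0 => //; exact: r.
split.
- exact: (triangular_unit M0 M1 M2 M3 nz d0 gu).
- exact: (triangular_regular M0 M1 M2 nz d0 reg).
- exact: (triangular_aff M0 M1 M2 M3 nz d0 reg).
Qed.

(** * The relations of the core *)

Definition map_core (A B : Type) (f : A -> B) (Y : core_data A) : core_data B :=
  CoreData (fun i => f (ca Y i)) (fun l i => f (cq Y l i)) (fun i j => f (cS Y i j))
           (fun l i => f (cr Y l i)) (fun i => f (ct Y i)).

Lemma rel_transfer (P A B : comNzRingType) (T : Type) (Y : core_data P)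
    (e : {rmorphism P -> A}) (f : T -> {rmorphism P -> B}) :
  (forall F G, (forall t, f t F = f t G) -> e F = e G) ->
  (forall t, core_rel (map_core (f t) Y)) -> core_rel (map_core e Y).
Proof.
move=> ef h; split=> [i j|i j k l U]; first by apply: ef => t; apply: (h t).1.
split; rewrite /prop3 /= -?rmorphB -?rmorphM; apply: ef => t;
  have [h1 h2 h3 h4 h5] := (h t).2 i j k l U; by rewrite !(rmorphM, rmorphB).
Qed.

Lemma prop3_transfer (P A B : comNzRingType) (T : Type)
    (e : {rmorphism P -> A}) (f : T -> {rmorphism P -> B}) (x y z x' y' z' : P) :
  (forall F G, (forall t, f t F = f t G) -> e F = e G) ->
  (forall t, prop3 (f t x) (f t y) (f t z) (f t x') (f t y') (f t z')) ->
  prop3 (e x) (e y) (e z) (e x') (e y') (e z').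
Proof.
move=> ef h; rewrite /prop3 -!rmorphB -!rmorphM; apply: ef => t.
by rewrite !rmorphM !rmorphB; apply: h.
Qed.

Lemma uniq4_omit (i j k l x : 'I_4) : uniq [:: i; j; k; l] -> l != x ->
  [\/ x = i, x = j | x = k].
Proof.
by move=> U lx; case: (uniq4_mem x U) lx => ->; rewrite ?eqxx // => _;
  [constructor 1|constructor 2|constructor 3].
Qed.

Lemma transfer_block (C : fieldType) (q s : 'I_4 -> dual C) (q0 s0 : 'I_4 -> C)
    (i j k l : 'I_4) : uniq [:: i; j; k; l] ->
  (forall x, std (q x) = q0 x) -> (forall x, std (s x) = s0 x) ->
  prop3 (q i) (q j) (q k) (s i) (s j) (s k) ->
  nc3 (q0 i) (q0 j) (q0 k) -> nc3 (s0 i) (s0 j) (s0 k) ->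
  (exists u e, forall x, x != l -> aff u e (q x)) ->
  exists u e, forall x, l != x -> aff u e (s x).
Proof.
move=> U qE sE rel; rewrite -!qE -!sE => ncq ncs [u [e h]]; have N := uniq4_neq U.
have [hi hj hk] : [/\ aff u e (q i), aff u e (q j) & aff u e (q k)].
  by split; apply: h; rewrite N.
have [u' [e' [hi' hj' hk']]] := transfer_affine rel hi hj hk ncq ncs.
by exists u', e' => x lx; case: (uniq4_omit U lx) => ->.
Qed.

Section MinorPolynomial.
Variables (C : numFieldType) (K : finType).
Local Notation pol := {mpoly C[#|K|]}.
Implicit Types (v : {ffun K -> C}) (V : {ffun K -> dual C}) (F G H : pol).

Definition mnr_poly v F G H : pol :=
  (pev v G - pev v F)%:MP * (H - F) - (pev v H - pev v F)%:MP * (G - F).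

Lemma std_pev V v F : (forall k, std (V k) = v k) -> std (dev V F) = pev v F.
Proof. by move=> h; rewrite std_dev -pevE; congr mpeval; apply/ffunP => k; rewrite ffunE. Qed.

Lemma mnr_polyE V v F G H : (forall k, std (V k) = v k) ->
  eps (dev V (mnr_poly v F G H)) = mnr (dev V F) (dev V G) (dev V H).
Proof.
move=> h; rewrite /mnr_poly -(std_pev F h) -(std_pev G h) -(std_pev H h).
have lin c F1 F2 : eps (dev V (c%:MP * (F1 - F2))) = c * (eps (dev V F1) - eps (dev V F2)).
  by rewrite (rmorphM (dev V)) devC (rmorphB (dev V)) epsM /= mul0r addr0.
rewrite (rmorphB (dev V)) epsD epsN !lin; move: (dev V F) (dev V G) (dev V H) => a b c.
by rewrite /mnr; ring.
Qed.

End MinorPolynomial.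

Section Core.
Variable R : realType.
Variable C : numFieldType.
Local Notation K := (Kcore R).
Local Notation pol := {mpoly C[#|K|]}.
Implicit Types (beta : hface R) (y v : {ffun K -> C}) (V : {ffun K -> dual C}) (F G H : pol).

Definition simplex (k : nat) : {set {set 'I_4}} := face k finset.set0 finset.setT.
Definition omit (k : nat) (l : 'I_4) : {set {set 'I_4}} :=
  face k finset.set0 (~: [set l])%SET.
Definition star (k : nat) (i : 'I_4) : {set {set 'I_4}} :=
  face k [set i]%SET (~: [set i])%SET.

Lemma in_simplex k I : (I \in simplex k) = (#|I| == k).
Proof. by rewrite in_face finset.sub0set finset.set0U finset.subsetT !andbT. Qed.

Lemma in_omit k l I : (I \in omit k l) = (#|I| == k) && (l \notin I).
Proof.
rewrite in_face finset.sub0set finset.set0U /=; congr (_ && _).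
by rewrite finset.subsetC finset.sub1set inE.
Qed.

Lemma in_star k i I : (I \in star k i) = (#|I| == k) && (i \in I).
Proof. by rewrite in_face finset.sub1set finset.setUCr finset.subsetT andbT. Qed.

Lemma hface_make k (P Q A B D : {set 'I_4}) x z : (1 <= k <= 3)%N -> [disjoint P & Q] ->
  A \in face k P Q -> B \in face k P Q -> D \in face k P Q ->
  (x \in A) = (x \in D) -> (x \in A) != (x \in B) ->
  (z \in A) = (z \in B) -> (z \in A) != (z \in D) ->
  exists beta, val beta = face k P Q.
Proof.
move=> k13 dPQ hA hB hD h1 h2 h3 h4.
have hf : `[< exists k', [/\ (1 <= k' <= 3)%N, is_face R k' (face k P Q) &
    (2 <= face_dim R (face k P Q))%N] >].
  apply/asboolP; exists k; split=> //; first exact: is_face_face hA dPQ.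
  exact: (face_dim_ge2 R hA hB hD h1 h2 h3 h4).
by exists (Sub (face k P Q) hf).
Qed.

Lemma hface_simplex k : (1 <= k <= 3)%N -> exists beta, val beta = simplex k.
Proof.
move=> k13; have d0 : [disjoint (finset.set0 : {set 'I_4}) & (finset.setT : {set 'I_4})].
  by rewrite -finset.setI_eq0 finset.set0I.
have U : uniq [:: o0; o1; o2; o3] by [].
have : k \in [:: 1; 2; 3]%N by move: k13 => /andP []; case: k => [|[|[|[|]]]].
rewrite !inE => /or3P [] /eqP ->.
- by apply: (@hface_make 1 _ _ [set o0]%SET [set o1]%SET [set o2]%SET o1 o2);
    rewrite ?in_simplex ?cards1 ?inE.
- by apply: (@hface_make 2 _ _ [set o0; o3]%SET [set o1; o3]%SET [set o2; o3]%SET o1 o2);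
    rewrite ?in_simplex ?cards2 ?inE.
- by apply: (@hface_make 3 _ _ (~: [set o0])%SET (~: [set o1])%SET (~: [set o2])%SET o1 o2);
    rewrite ?in_simplex ?cardsC1 ?card_ord ?inE.
Qed.

Lemma hface_omit k l : (1 <= k <= 2)%N -> exists beta, val beta = omit k l.
Proof.
move=> k12; have dl : [disjoint (finset.set0 : {set 'I_4}) & (~: [set l])%SET].
  by rewrite -finset.setI_eq0 finset.set0I.
have [i [j [m U]]] := uniq4_ex3 l.
have : k \in [:: 1; 2]%N by move: k12 => /andP []; case: k => [|[|[|]]].
rewrite !inE => /orP [] /eqP ->.
- apply: (@hface_make 1 _ _ [set i]%SET [set j]%SET [set m]%SET j m) => //;
    rewrite ?in_omit ?cards1 ?inE ?(uniq4_neq U) ?eqxx //.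
- apply: (@hface_make 2 _ _ [set j; m]%SET [set i; m]%SET [set i; j]%SET j m) => //;
    rewrite ?in_omit ?cards2 ?inE ?(uniq4_neq U) ?eqxx //.
Qed.

Lemma hface_star k i : (2 <= k <= 3)%N -> exists beta, val beta = star k i.
Proof.
move=> k12; have dl : [disjoint [set i]%SET & (~: [set i])%SET].
  by rewrite -finset.setI_eq0 finset.setICr.
have [l [j [m U]]] := uniq4_ex3 i.
have : k \in [:: 2; 3]%N by move: k12 => /andP []; case: k => [|[|[|[|]]]].
rewrite !inE => /orP [] /eqP ->.
- apply: (@hface_make 2 _ _ [set i; l]%SET [set i; j]%SET [set i; m]%SET j m) => //;
    rewrite ?in_star ?cards2 ?inE ?(uniq4_neq U) ?eqxx //.
- apply: (@hface_make 3 _ _ (~: [set l])%SET (~: [set j])%SET (~: [set m])%SET j m) => //;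
    rewrite ?in_star ?cardsC1 ?card_ord ?inE ?(uniq4_neq U) ?eqxx //.
Qed.

Definition grad (g : 'M[C]_4) : {ffun K -> C} :=
  [ffun k : K => aff_coord g (hi (val (tagged k))) - aff_coord g (lo (val (tagged k)))].

Definition grads : set {ffun K -> C} :=
  [set y | exists g, [/\ g \in unitmx, regular g & y = grad g]]%classic.

Local Notation cone := (multicone (@degcore R) grads).

Lemma coneP y : cone y -> exists g th, [/\ g \in unitmx, regular g,
  (forall beta, th beta != 0) & gradient th (aff_coord g) y].
Proof.
move=> [_ [t [[g [gu rg ->]] t0 ->]]]; exists g, t; split=> // k.
by rewrite !ffunE.
Qed.

Definition core_of (A : Type) (e : pol -> A) : core_data A := CoreData
  (fun i => e (pot_poly R C (simplex 1) [set i]%SET))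
  (fun l i => e (pot_poly R C (omit 1 l) [set i]%SET))
  (fun i j => e (pot_poly R C (simplex 2) [set i; j]%SET))
  (fun l i => e (pot_poly R C (star 2 l) [set l; i]%SET))
  (fun j => e (pot_poly R C (simplex 3) (~: [set j])%SET)).

Lemma prop3_lin (A : comNzRingType) (x y z x' y' z' t a t' a' : A) :
  prop3 x y z x' y' z' ->
  prop3 (t * (x - a)) (t * (y - a)) (t * (z - a))
        (t' * (x' - a')) (t' * (y' - a')) (t' * (z' - a')).
Proof.
rewrite /prop3 => h; transitivity (t * t' * ((y - x) * (z' - x'))); first by ring.
by rewrite h; ring.
Qed.

Lemma prop3_id (A : comNzRingType) (x y z : A) : prop3 x y z x y z.
Proof. by rewrite /prop3 mulrC. Qed.

Lemma pot_value beta b th X y J : gradient th X y -> val beta = b -> J \in b ->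
  pev y (pot_poly R C b J) = th beta * (X J - X (base b)).
Proof. by move=> gy e Jb; rewrite -e; apply: pev_pot; rewrite // e. Qed.

(* The values at the vertices are affine functions of those of a tetrahedron *)
Definition affine_image (X : {set 'I_4} -> C) (Y : core_data C) : Prop :=
  [/\ exists t a, forall i, ca Y i = t * (X [set i]%SET - a),
      forall l, exists t a, forall i, l != i -> cq Y l i = t * (X [set i]%SET - a),
      exists t a, forall i j, i != j -> cS Y i j = t * (X [set i; j]%SET - a),
      forall l, exists t a, forall i, l != i -> cr Y l i = t * (X [set l; i]%SET - a) &
      exists t a, forall i, ct Y i = t * (X (~: [set i])%SET - a)].

Lemma affine_image_rel g Y : regular g -> affine_image (aff_coord g) Y ->
  (forall i j, cS Y i j = cS Y j i) -> core_rel Y.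
Proof.
move=> rg [[ta [aa a_]] q_ [tS [aS S_]] r_ [tt [at_ t_]]] sym; split=> // i j k l U.
have N := uniq4_neq U; have [tql [aql ql]] := q_ l; have [tqi [aqi qi]] := q_ i.
have [trl [arl rl]] := r_ l; have [tri [ari ri]] := r_ i.
rewrite !a_ !t_ !S_ ?N // !ql ?N // !qi ?N // !rl ?N // !ri ?N //.
split; try apply: prop3_lin.
- exact: prop3_id.
- exact: triangle_points U.
- exact: prop3_id.
- exact: star_planes U.
have := degree_three rg U; set X := aff_coord g => h.
transitivity (tri * tqi * tS * ((X [set i; j]%SET - X [set i; k]%SET) *
  (X [set k]%SET - X [set l]%SET) * (X [set i; l]%SET - X [set l; k]%SET))); first by ring.
by rewrite h; ring.
Qed.

Lemma gradient_image th X y : gradient th X y -> affine_image X (core_of (pev y)).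
Proof.
move=> gy; split.
- have [b e] := hface_simplex (k := 1) isT; exists (th b), (X (base (simplex 1))) => i.
  by apply: (pot_value gy e); rewrite in_simplex cards1.
- move=> l; have [b e] := hface_omit (k := 1) l isT.
  exists (th b), (X (base (omit 1 l))) => i li.
  by apply: (pot_value gy e); rewrite in_omit cards1 inE.
- have [b e] := hface_simplex (k := 2) isT; exists (th b), (X (base (simplex 2))) => i j ij.
  by apply: (pot_value gy e); rewrite in_simplex cards2 ij.
- move=> l; have [b e] := hface_star (k := 2) l isT.
  exists (th b), (X (base (star 2 l))) => i li.
  by apply: (pot_value gy e); rewrite in_star cards2 li !inE eqxx.
- have [b e] := hface_simplex (k := 3) isT; exists (th b), (X (base (simplex 3))) => i.
  by apply: (pot_value gy e); rewrite in_simplex cardsC1 card_ord.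
Qed.

Lemma cone_rel y : cone y -> core_rel (core_of (pev y)).
Proof.
move=> /coneP [g [th [gu rg th0 gy]]].
apply: (affine_image_rel rg (gradient_image gy)) => i j.
by rewrite /core_of /= [[set i; j]%SET]finset.setUC.
Qed.

Local Notation dual_core := (dual_point (@degcore R) grads).

Lemma dual_eq (V : {ffun K -> dual C}) (F G : pol) : dual_core V ->
  (forall y, cone y -> pev y F = pev y G) -> dev V F = dev V G.
Proof.
move=> dV h; apply/eqP; rewrite -subr_eq0 -rmorphB; apply/eqP/dV => y cy.
by rewrite pevE rmorphB h // subrr.
Qed.

Lemma dual_prop3 V F1 F2 F3 G1 G2 G3 : dual_core V ->
  (forall y, cone y -> prop3 (pev y F1) (pev y F2) (pev y F3)
                             (pev y G1) (pev y G2) (pev y G3)) ->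
  prop3 (dev V F1) (dev V F2) (dev V F3) (dev V G1) (dev V G2) (dev V G3).
Proof.
move=> dV h; apply: (@prop3_transfer _ _ _ {y | cone y} (dev V) (fun z => pev (sval z))).
  by move=> F G hFG; apply: (dual_eq dV) => y cy; apply: (hFG (exist _ y cy)).
by case=> y cy; apply: h.
Qed.

Lemma dual_rel V : dual_core V -> core_rel (core_of (dev V)).
Proof.
move=> dV; rewrite -[core_of _]/(map_core (dev V) (core_of (fun F : pol => F))).
apply: (@rel_transfer _ _ _ {y | cone y} (core_of (fun F => F)) (dev V)
  (fun z => pev (sval z))) => [F G h|[y cy]]; last exact: cone_rel.
by apply: (dual_eq dV) => y cy; apply: (h (exist _ y cy)).
Qed.

(** * Vertices of the faces *)

Lemma in_simplex1 I : I \in simplex 1 -> exists i, I = [set i]%SET.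
Proof. by rewrite in_simplex => /cards1P. Qed.

Lemma in_simplex2 I : I \in simplex 2 -> exists i j, i != j /\ I = [set i; j]%SET.
Proof. by rewrite in_simplex => /cards2P [i [j [ij ->]]]; exists i, j. Qed.

Lemma in_simplex3 I : I \in simplex 3 -> exists i, I = (~: [set i])%SET.
Proof.
rewrite in_simplex => /eqP /card3_set [i [j [k [l [U ->]]]]].
by exists l; rewrite (setC_uniq1 U).
Qed.

Lemma in_omit1 l I : I \in omit 1 l -> exists2 i, l != i & I = [set i]%SET.
Proof. by rewrite in_omit => /andP [/cards1P [i ->]]; rewrite inE; exists i. Qed.

Lemma in_omit2 l I : I \in omit 2 l -> exists2 i, l != i & I = (~: [set l; i])%SET.
Proof.
rewrite in_omit => /andP [/eqP /card2_set [i [j [k [m [U ->]]]]]].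
rewrite !inE negb_or => /andP [li lj].
case: (uniq4_mem l U) li lj => -> li lj; rewrite ?eqxx // in li lj.
  exists m; first by uniq4.
  by rewrite (@setC_uniq2 m i j k) //; uniq4.
exists k; first by uniq4.
by rewrite (@setC_uniq2 k i j m) //; uniq4.
Qed.

Lemma in_star2 l I : I \in star 2 l -> exists2 i, l != i & I = [set l; i]%SET.
Proof.
rewrite in_star => /andP [/eqP /card2_set [i [j [k [m [U ->]]]]]].
rewrite !inE => /orP [] /eqP ->; [exists j|exists i] => //; try by uniq4.
by rewrite finset.setUC.
Qed.

Lemma in_star3 i I : I \in star 3 i -> exists2 j, i != j & I = (~: [set j])%SET.
Proof.
rewrite in_star => /andP [/eqP /card3_set [j [k [l [m [U ->]]]]]].
rewrite -(setC_uniq1 U) !inE => im; exists m => //.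
Qed.

(** * Tangent vectors of the core *)

Lemma edge_in beta (e : edge_of beta) : lo (val e) \in val beta /\ hi (val e) \in val beta.
Proof. by case: e => a /= /andP. Qed.

Lemma edge_cone y (k : K) : cone y -> let b := val (tag k) in
  pev y (pX C k) = pev y (pot_poly R C b (hi (val (tagged k)))
                          - pot_poly R C b (lo (val (tagged k)))).
Proof.
move=> /coneP [g [th [_ _ _ gy]]] /=; rewrite pevX gy rmorphB.
have [hl hh] := @edge_in (tag k) (tagged k); rewrite !(pev_pot gy) //; ring.
Qed.

Lemma omit_cone y i j k l : uniq [:: i; j; k; l] -> cone y ->
  let q x := pev y (pot_poly R C (omit 1 l) [set x]%SET) in
  let s x := pev y (pot_poly R C (omit 2 l) (~: [set l; x])%SET) in
  prop3 (q i) (q j) (q k) (s i) (s j) (s k).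
Proof.
move=> U /coneP [g [th [_ rg _ gy]]] q s; have N := uniq4_neq U.
have [b e] := hface_omit (k := 1) l isT; have [b' e'] := hface_omit (k := 2) l isT.
have qE x : l != x -> q x = th b * (aff_coord g [set x]%SET - aff_coord g (base (omit 1 l))).
  by move=> lx; apply: (pot_value gy e); rewrite in_omit cards1 inE.
have sE x : l != x -> s x = th b' * (aff_coord g (~: [set l; x])%SET
    - aff_coord g (base (omit 2 l))).
  move=> lx; apply: (pot_value gy e'); rewrite in_omit !inE eqxx andbT.
  by rewrite -(eqn_add2l #|[set l; x]%SET|) cardsC cards2 lx card_ord.
clearbody q s; rewrite !qE ?N // !sE ?N //; apply: prop3_lin.
have [U1 U2] : uniq [:: j; i; k; l] /\ uniq [:: k; i; j; l] by split; uniq4.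
rewrite (setC_uniq2 U) (setC_uniq2 U1) (setC_uniq2 U2).
exact: triangle_points U.
Qed.

Lemma star_cone y i j k l : uniq [:: i; j; k; l] -> cone y ->
  let r x := pev y (pot_poly R C (star 2 l) [set l; x]%SET) in
  let t x := pev y (pot_poly R C (star 3 l) (~: [set x])%SET) in
  prop3 (r i) (r j) (r k) (t i) (t j) (t k).
Proof.
move=> U /coneP [g [th [_ rg _ gy]]] r t; have N := uniq4_neq U.
have [b e] := hface_star (k := 2) l isT; have [b' e'] := hface_star (k := 3) l isT.
have rE x : l != x -> r x = th b * (aff_coord g [set l; x]%SET - aff_coord g (base (star 2 l))).
  by move=> lx; apply: (pot_value gy e); rewrite in_star cards2 lx !inE eqxx.
have tE x : l != x -> t x = th b' * (aff_coord g (~: [set x])%SET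
    - aff_coord g (base (star 3 l))).
  by move=> lx; apply: (pot_value gy e'); rewrite in_star cardsC1 card_ord !inE.
clearbody r t; rewrite !rE ?N // !tE ?N //; apply: prop3_lin; exact: star_planes U.
Qed.

Definition cond_poly v (m : condition) : pol :=
  let Y := core_of (fun F => F) in match m with
  | CondA i j k => mnr_poly v (ca Y i) (ca Y j) (ca Y k)
  | CondQ l i j k => mnr_poly v (cq Y l i) (cq Y l j) (cq Y l k)
  | CondS i j k => mnr_poly v (cS Y i.1 i.2) (cS Y j.1 j.2) (cS Y k.1 k.2)
  | CondR l i j k => mnr_poly v (cr Y l i) (cr Y l j) (cr Y l k)
  end.

Lemma cond_polyP V v m : (forall k, std (V k) = v k) ->
  eps (dev V (cond_poly v m)) = 0 -> holds (core_of (dev V)) m.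
Proof. by move=> h; case: m => *; rewrite /= -(mnr_polyE _ _ _ h). Qed.

Section Tangent.
Variable v : {ffun K -> C}.
Hypothesis v_point : is_point (@degcore R) v.
Hypothesis v_closure : zclosure cone v.

Lemma closure_eq F G : (forall y, cone y -> pev y F = pev y G) -> pev v F = pev v G.
Proof.
move=> h; apply/eqP; rewrite -subr_eq0 -rmorphB; apply/eqP/v_closure => y cy.
by rewrite pevE rmorphB h // subrr.
Qed.

Lemma closure_rel : core_rel (core_of (pev v)).
Proof.
rewrite -[core_of _]/(map_core (pev v) (core_of (fun F : pol => F))).
apply: (@rel_transfer _ _ _ {y | cone y} (core_of (fun F => F)) (pev v)
  (fun z => pev (sval z))) => [F G h|[y cy]]; last exact: cone_rel.
by apply: closure_eq => y cy; apply: (h (exist _ y cy)).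
Qed.

Lemma block_nonconst b beta : val beta = b -> exists I J, [/\ I \in b, J \in b
  & pev v (pot_poly R C b I) != pev v (pot_poly R C b J)].
Proof.
move=> <-; have [k [tk] nz] := v_point beta; rewrite -tk.
have [hl hh] := @edge_in (tag k) (tagged k).
exists (hi (val (tagged k))), (lo (val (tagged k))); split=> //.
by rewrite -subr_eq0 -rmorphB -(closure_eq (fun y => edge_cone k (y := y))) pevX.
Qed.

Lemma nc3_of (x y z : C) (P : C -> Prop) : (forall w, P w -> [\/ w = x, w = y | w = z]) ->
  forall a b, P a -> P b -> a != b -> nc3 x y z.
Proof.
move=> h a b /h ha /h hb ab.
rewrite /nc3 -negb_and; apply: contra ab => /andP [/eqP exy /eqP exz].
by apply/eqP; move: ha hb; rewrite -exy -exz => -[] -> [] ->.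
Qed.

Lemma block_nc3 b beta (x y z : {set 'I_4}) : val beta = b ->
  (forall I, I \in b -> [\/ I = x, I = y | I = z]) ->
  nc3 (pev v (pot_poly R C b x)) (pev v (pot_poly R C b y)) (pev v (pot_poly R C b z)).
Proof.
move=> e h; have [I [J [Ib Jb ne]]] := block_nonconst e.
apply: (@nc3_of _ _ _ (fun w => exists2 I, I \in b & w = pev v (pot_poly R C b I)) _
  _ _ _ _ ne); [|by exists I|by exists J].
by move=> _ [L /h [] -> ->]; [constructor 1|constructor 2|constructor 3].
Qed.

Lemma closure_nondegenerate : nondegenerate (core_of (pev v)).
Proof.
split.
- have [b e] := hface_simplex (k := 1) isT; have [I [J [/in_simplex1 [i ->]]]] := block_nonconst e.
  by move=> /in_simplex1 [j ->]; exists i, j.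
- move=> i j k l U; have [b e] := hface_omit (k := 1) l isT; apply: (block_nc3 e) => I.
  by move=> /in_omit1 [x lx ->]; case: (uniq4_omit U lx) => ->;
    [constructor 1|constructor 2|constructor 3].
- have [b e] := hface_simplex (k := 2) isT.
  have [I [J [/in_simplex2 [i [j [ij ->]]]]]] := block_nonconst e.
  by move=> /in_simplex2 [i' [j' [ij' ->]]]; exists i, j, i', j'.
- move=> i j k l U; have [b e] := hface_star (k := 2) l isT; apply: (block_nc3 e) => I.
  by move=> /in_star2 [x lx ->]; case: (uniq4_omit U lx) => ->;
    [constructor 1|constructor 2|constructor 3].
- have [b e] := hface_simplex (k := 3) isT; have [I [J [/in_simplex3 [i ->]]]] := block_nonconst e.
  by move=> /in_simplex3 [j ->]; exists i, j.
Qed.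

Lemma omit_block V l : dual_core V -> (forall k, std (V k) = v k) ->
  (exists u e, forall i, i != l -> aff u e (dev V (pot_poly R C (omit 1 l) [set i]%SET))) ->
  exists u e, forall I, I \in omit 2 l -> aff u e (dev V (pot_poly R C (omit 2 l) I)).
Proof.
move=> dV lV h; have [i [j [k U]]] := uniq4_ex3 l.
have U' : uniq [:: i; j; k; l] by uniq4.
have [b eb] := hface_omit (k := 1) l isT; have [b' eb'] := hface_omit (k := 2) l isT.
have [||| u [e h']] := @transfer_block _
  (fun i => dev V (pot_poly R C (omit 1 l) [set i]%SET))
  (fun i => dev V (pot_poly R C (omit 2 l) (~: [set l; i])%SET)) _ _ i j k l U' (fun i => std_pev _ lV) (fun i => std_pev _ lV) _ _ _ h.
- by apply: (dual_prop3 dV) => y; apply: omit_cone.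
- apply: (block_nc3 eb) => I.
  by move=> /in_omit1 [x lx ->]; case: (uniq4_omit U' lx) => ->;
    [constructor 1|constructor 2|constructor 3].
- apply: (block_nc3 eb') => I.
  by move=> /in_omit2 [x lx ->]; case: (uniq4_omit U' lx) => ->;
    [constructor 1|constructor 2|constructor 3].
by exists u, e => I /in_omit2 [x lx ->]; apply: h'.
Qed.

Lemma star_block V l : dual_core V -> (forall k, std (V k) = v k) ->
  (exists u e, forall i, i != l -> aff u e (dev V (pot_poly R C (star 2 l) [set l; i]%SET))) ->
  exists u e, forall I, I \in star 3 l -> aff u e (dev V (pot_poly R C (star 3 l) I)).
Proof.
move=> dV lV h; have [i [j [k U]]] := uniq4_ex3 l.
have U' : uniq [:: i; j; k; l] by uniq4.
have [b eb] := hface_star (k := 2) l isT; have [b' eb'] := hface_star (k := 3) l isT.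
have [||| u [e h']] := @transfer_block _
  (fun i => dev V (pot_poly R C (star 2 l) [set l; i]%SET))
  (fun i => dev V (pot_poly R C (star 3 l) (~: [set i])%SET)) _ _ i j k l U' (fun i => std_pev _ lV) (fun i => std_pev _ lV) _ _ _ h.
- by apply: (dual_prop3 dV) => y; apply: star_cone.
- apply: (block_nc3 eb) => I.
  by move=> /in_star2 [x lx ->]; case: (uniq4_omit U' lx) => ->;
    [constructor 1|constructor 2|constructor 3].
- apply: (block_nc3 eb') => I.
  by move=> /in_star3 [x lx ->]; case: (uniq4_omit U' lx) => ->;
    [constructor 1|constructor 2|constructor 3].
by exists u, e => I /in_star3 [x lx ->]; apply: h'.
Qed.

Lemma affine_blocks V : dual_core V -> (forall k, std (V k) = v k) ->
  all_affine (core_of (dev V)) -> forall beta, exists u e, forall I,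
    I \in val beta -> aff u e (dev V (pot_poly R C (val beta) I)).
Proof.
move=> dV lV [[ua [ea ha]] hq [uS [eS hS]] hr [ut [et ht]]] beta.
case: (hface_cases beta) => [[k]|[l [k]]|[l [k]]] k13 ->.
- rewrite -/(simplex k); case: k k13 => [|[|[|[|k]]]] // _.
  + by exists ua, ea => I /in_simplex1 [i ->]; apply: ha.
  + by exists uS, eS => I /in_simplex2 [i [j [ij ->]]]; apply: hS.
  + by exists ut, et => I /in_simplex3 [i ->]; apply: ht.
- rewrite -/(omit k l); case: k k13 => [|[|[|k]]] // _.
    have [u [e h]] := hq l; exists u, e => I /in_omit1 [i li ->].
    by apply: h; rewrite eq_sym.
  exact: omit_block (hq l).
rewrite -/(star k l); case: k k13 => [|[|[|[|k]]]] // _.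
  have [u [e h]] := hr l; exists u, e => I /in_star2 [i li ->].
  by apply: h; rewrite eq_sym.
exact: star_block (hr l).
Qed.

Lemma core_tangent : exists P : 'I_3 -> pol, forall V : {ffun K -> dual C},
  (forall k, std (V k) = v k) -> dual_core V -> (forall i, eps (dev V (P i)) = 0) ->
  forall k k' : K, tag k = tag k' -> V k * inj (v k') = V k' * inj (v k).
Proof.
have [m hm] := core_rigid closure_rel closure_nondegenerate.
exists (fun i => cond_poly v (nth m.2 [:: m.1.1; m.1.2] i)) => V lV dV h k k' kk'.
have aff_all : all_affine (core_of (dev V)).
  apply: hm; [by split=> *; apply: std_pev|exact: dual_rel| | |].
  - exact: (cond_polyP lV (h (@Ordinal 3 0 isT))).
  - exact: (cond_polyP lV (h (@Ordinal 3 1 isT))).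
  - exact: (cond_polyP lV (h (@Ordinal 3 2 isT))).
have [u [e hu]] := affine_blocks dV lV aff_all (tag k).
have val_of (l : K) : tag l = tag k -> V l = inj (v l) * Dual 1 u.
  move=> lk; have [hl hh] := @edge_in (tag l) (tagged l).
  have := dual_eq dV (fun y => edge_cone l (y := y)); rewrite devX rmorphB.
  have := hu (lo (val (tagged l))); have := hu (hi (val (tagged l))).
  rewrite -lk => /(_ hh) + /(_ hl); move: (dev V _) (dev V _) => x z; rewrite /aff => ex ez eV.
  apply: dual_eqP; first by rewrite lV /= mulr1.
  by rewrite /= mul0r addr0 -lV eV /= ex ez; ring.
by rewrite (val_of k) // (val_of k') // mulrAC [in RHS]mulrAC [inj _ * inj _]mulrC.
Qed.

End Tangent.

End Core.

(** * The chart in coordinates *)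

Lemma minor_diag (A : comNzRingType) (d : 'I_4 -> A) (g : 'M[A]_4) S I :
  minor (\matrix_(i, j) (d i * g i j)) S I = \prod_(i in S) d i * minor g S I.
Proof.
rewrite /minor /nminor -big_enum /= (big_nth ord0) -cardE big_mkord.
pose D : 'rV_#|S| := \row_x d (nth ord0 (enum S) x).
transitivity (\det ((\matrix_(x < #|S|, y < #|S|)
    g (nth ord0 (enum S) y) (nth ord0 (enum I) x)) *m diag_mx D)).
  by congr (\det _); apply/matrixP => x y; rewrite mul_mx_diag !mxE mulrC.
by rewrite det_mulmx det_diag mulrC; congr (_ * _); apply: eq_bigr => x _; rewrite mxE.
Qed.

Lemma minor_neq0 (F : fieldType) (g : 'M[F]_4) I : g \in unitmx ->
  exists2 S : {set 'I_4}, #|S| = #|I| & minor g S I != 0.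
Proof.
move=> gu; apply: contrapT => no.
have := minorM (invmx g) g (erefl #|I|); rewrite mulVmx // minor1 // eqxx big1.
  by move/eqP; rewrite oner_eq0.
move=> T /eqP cT; have [->|nz] := eqVneq (minor g T I) 0; first by rewrite mulr0.
by case: no; exists T.
Qed.

Section Chart.
Variable R : realType.
Local Notation C := R[i].
Local Notation K := (Kcore R).
Implicit Types (p : {set 'I_4} -> {vspace 'cV[C]_4}) (g : 'M[C]_4).

Lemma XoP p : Xo p <-> exists2 g, g \in unitmx & p = gsp g.
Proof.
split=> [[g gu h]|[g gu ->]]; exists g => //.
by apply/funext.
Qed.

Lemma coordY_point p : Xo p -> is_point (@degY) (coordY p).
Proof.
move=> /XoP [g gu ->] I; have [S /eqP cS nz] := minor_neq0 (val I) gu.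
have [c c0 h] := plucker_gsp (val I) gu.
exists (Tagged (fun I : psub => ksub #|val I|) (Sub S cS : ksub #|val I|)) => //.
by rewrite ffunE /= h ?mulf_neq0 //; apply/eqP.
Qed.

Lemma UoP p : Uo p <-> exists g, [/\ g \in unitmx, regular g & p = gsp g].
Proof.
split=> [[[_ tr] /XoP [g gu pE]]|[g [gu rg pE]]].
  exists g; split=> // I n0 nT; rewrite /den /I0.
  apply/(minor_flag _ gu)/eqP; rewrite -dimv_eq0.
  have hI : (I != finset.set0) && (I != finset.setT) by rewrite n0.
  have k13 : (1 <= 4 - #|I| <= 3)%N by case: (card_proper n0 nT) => ->.
  have := tr (Sub I hI) _ k13; rewrite /transverse pE /flag_at_infinity /=.
  rewrite dim_gsp // dim_coord_space => ->.
  rewrite [#|s4 _|]cardE enum_s4; by case: (card_proper n0 nT) => ->.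
have Xop : Xo p by apply/XoP; exists g.
split=> //; split.
  split=> [I|]; first by rewrite pE dim_gsp.
  apply: sub_mpclosure => [_ [q Xq <-]|]; first exact: coordY_point.
  by apply: sub_multicone; exists p.
move=> I k /andP [_ k3]; rewrite pE; apply: transverse_flag => //; last exact: leq_trans k3 _.
by case: I => I /= /andP [n0 nT]; apply: rg.
Qed.

Lemma plucker_ratio_gsp g I J : g \in unitmx -> #|J| = #|I| ->
  plucker_ratio (gsp g) I J = minor g J I / den g I.
Proof.
move=> gu e; have [c c0 h] := plucker_gsp I gu.
rewrite /plucker_ratio !h ?card_I0 ?card_le4 // invfM mulrACA divff //; exact: mul1r.
Qed.

Lemma edge_props (a : edge) : [/\ #|hi a| = #|lo a|, lo a != finset.set0,
  lo a != finset.setT, hi a != finset.set0 & hi a != finset.setT].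
Proof.
have /andP [/eqP e /eqP c] := edge_adj a; have ne := adj_neq (edge_adj a).
have l0 : (0 < #|lo a|)%N by rewrite -c.
have lT : (#|lo a| < 4)%N.
  rewrite ltn_neqAle card_le4 andbT; apply: contra ne => /eqP e4.
  have full I : #|I| = 4%N -> I = finset.setT.
    by move=> cI; apply/eqP; rewrite eqEcard finset.subsetT cardsT card_ord cI.
  by rewrite (full _ e4) (full (hi a)) // -e.
have pr I : #|I| = #|lo a| -> (I != finset.set0) /\ (I != finset.setT).
  by move=> cI; apply/andP; apply: (set_proper cI); rewrite l0 lT.
by have [h1 h2] := pr (lo a) erefl; have [h3 h4] := pr (hi a) (esym e); split.
Qed.

Lemma edge_card (a : edge) : (0 < #|lo a| < 4)%N.
Proof. by have [_ n0 nT _ _] := edge_props a; case: (card_proper n0 nT) => ->. Qed.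

Lemma edge_coord_gsp g (a : edge) : g \in unitmx ->
  edge_coord (gsp g) a = aff_coord g (hi a) - aff_coord g (lo a).
Proof.
move=> gu; have [e _ _ _ _] := edge_props a; have c := card_K0 (edge_card a).
by rewrite /edge_coord -[nth _ _ _]/(K0 (level a)) !plucker_ratio_gsp ?/level ?c ?e // /aff_coord /num e.
Qed.

(** * The core as a closure *)

Local Notation cone := (multicone (@degcore R) (@grads R C)).

Lemma grad_edge_neq g (a : edge) : g \in unitmx -> regular g ->
  aff_coord g (hi a) - aff_coord g (lo a) != 0.
Proof.
move=> gu rg; have /andP [/eqP e /eqP c] := edge_adj a.
have /andP [_ lt] := edge_card a.
by rewrite subr_eq0 eq_sym; apply: (aff_coord_neq rg).
Qed.

Lemma hface_edge (b : hface R) : exists e : edge_of b, True.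
Proof.
have b3 : (3 <= #|val b|)%N.
  by case: b => b /= /asboolP [k [_ _]]; apply: face_dim_card.
have [J Jb ne] : exists2 J, J \in val b & J != base (val b).
  apply: contrapT => no; move: b3; rewrite leqNgt ltnS; apply/negP/negPn.
  have sub : val b \subset [set base (val b)]%SET.
    apply/fintype.subsetP => J Jb; rewrite inE; apply: contraT => ne.
    by case: no; exists J.
  by apply: leq_trans (subset_leq_card sub) _; rewrite cards1.
have Bb := base_in Jb; have /and3P [Mb h1 h2] := mid_in Jb.
have [I [I' [Ib Ib' aIJ]]] : exists I I', [/\ I \in val b, I' \in val b & adj I I'].
  case/orP: h1 => [/eqP eM|aM]; last by exists (base (val b)), (mid (val b) J).
  exists (mid (val b) J), J; split=> //; case/orP: h2 => // /eqP eM'.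
  by rewrite -eM' -eM eqxx in ne.
by have [e _ _] := edge_ex aIJ Ib Ib'; exists e.
Qed.

Lemma grads_point : (@grads R C `<=` is_point (@degcore R))%classic.
Proof.
move=> _ [g [gu rg ->]] b; have [e _] := hface_edge b.
by exists (Tagged (@edge_of R) e) => //; rewrite ffunE /= grad_edge_neq.
Qed.

End Chart.

(** A family of points which is polynomial in a parameter, and which satisfies
    a polynomial equation for the nonzero parameters, satisfies it at zero. *)
Lemma limit_at_zero (C : numFieldType) (K : finType) (F : {mpoly C[#|K|]})
    (w : {ffun K -> C}) (e : K -> nat) :
  (forall t, t != 0 -> mpeval F [ffun k => t ^+ e k * w k] = 0) ->
  mpeval F [ffun k => 0 ^+ e k * w k] = 0.
Proof.
move=> h; have [G hG] := pol_comp (fun k => pX C tt ^+ e k * (w k)%:MP) F.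
have hG' (z : {ffun unit -> C}) : mpeval G z = mpeval F [ffun k => z tt ^+ e k * w k].
  rewrite hG; congr mpeval; apply/ffunP => k.
  by rewrite !ffunE pevE rmorphM rmorphXn pevX pevC.
have := hG' [ffun=> 0]; rewrite (_ : [ffun k => _] = [ffun k => 0 ^+ e k * w k]); last first.
  by apply/ffunP => k; rewrite !ffunE.
move=> <-; apply/eqP/negPn/negP => G0.
have X1 : mpeval (pX C tt) [ffun=> 1] != 0 by rewrite pevE pevX ffunE oner_neq0.
have [z [Gz Xz]] := mul_nonzero G0 X1.
by move: Gz; rewrite hG' h ?eqxx //; move: Xz; rewrite pevE pevX.
Qed.

Definition weight I : nat := \sum_(i in I) i.

Section Core.
Variable R : realType.
Local Notation C := R[i].
Local Notation K := (Kcore R).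
Implicit Types (g : 'M[C]_4) (t : C).
Local Notation cone := (multicone (@degcore R) (@grads R C)).

Definition torus t g : 'M[C]_4 := \matrix_(i, j) (t ^+ i * g i j).

Lemma minor_torus t g S I : minor (torus t g) S I = t ^+ weight S * minor g S I.
Proof. by rewrite minor_diag /weight prodrXr. Qed.

Lemma torus_unit t g : t != 0 -> g \in unitmx -> torus t g \in unitmx.
Proof.
move=> t0; rewrite !unitmxE !unitfE.
rewrite (_ : torus t g = diag_mx (\row_i t ^+ i) *m g); last first.
  by apply/matrixP => i j; rewrite mul_diag_mx !mxE.
rewrite det_mulmx det_diag; apply: mulf_neq0; apply/prodf_neq0 => i _.
by rewrite mxE expf_neq0.
Qed.

Lemma torus_regular t g : t != 0 -> regular g -> regular (torus t g).
Proof. by move=> t0 rg I n0 nT; rewrite /den minor_torus mulf_neq0 ?expf_neq0 ?rg. Qed.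

Lemma torus_ratio t g J I e : t != 0 -> weight J = (weight (I0 #|I|) + e)%N ->
  minor (torus t g) J I / den (torus t g) I = t ^+ e * (minor g J I / den g I).
Proof.
move=> t0 h; rewrite /den !minor_torus h exprD -mulrA -mulf_div divff ?mul1r ?mulrA //.
exact: expf_neq0.
Qed.

Lemma weight_s4 (s : seq nat) :
  weight (s4 s) = (\sum_(i <- [:: o0; o1; o2; o3] | i.+1 \in s) i)%N.
Proof. by rewrite /weight -big_enum /= enum_s4 big_filter. Qed.

Lemma torus_aff t g I : t != 0 -> I != finset.set0 -> I != finset.setT ->
  aff_coord (torus t g) I = t * aff_coord g I.
Proof.
move=> t0 n0 nT; rewrite -[t in RHS]expr1; apply: torus_ratio => //.
by case: (card_proper n0 nT) => ->; rewrite /K0 /I0 /= !weight_s4 !big_cons !big_nil.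
Qed.

(* The order of vanishing of the flag coordinates at the fixed point of the
   one-parameter group of diagonal matrices *)
Definition flag_weight (i : 'I_6) : nat := nth 0%N [:: 1; 2; 3; 1; 2; 1]%N i.

Lemma torus_flag t g (i : 'I_6) : t != 0 -> g \in unitmx ->
  flag_coord (gsp (torus t g)) i = t ^+ flag_weight i * flag_coord (gsp g) i.
Proof.
move=> t0 gu; have c1 : #|s4 [:: 1%N]| = 1%N by rewrite cardE enum_s4.
have c2 : #|s4 [:: 1; 2]%N| = 2%N by rewrite cardE enum_s4.
have c3 : #|s4 [:: 1; 2; 3]%N| = 3%N by rewrite cardE enum_s4.
have tu := torus_unit t0 gu.
case: i => [[|[|[|[|[|[|]]]]]]] // lt; rewrite /flag_coord (tnth_nth (finset.set0, finset.set0)) /=;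
  rewrite !plucker_ratio_gsp //; try (by rewrite !cardE !enum_s4);
  apply: torus_ratio => //; rewrite ?c1 ?c2 ?c3 /I0 !weight_s4 !big_cons !big_nil //.
Qed.

Definition zero_chart (w : {ffun K -> C}) : {ffun Kchart R -> C} :=
  [ffun k => match k with inl _ => 0 | inr x => w x end].

Definition chart_weight (k : Kchart R) : nat := match k with
  | inl (inl i) => flag_weight i | inl (inr _) => 1%N | inr _ => 0%N end.

(* The closure of the chart contains the product of the fixed point of the
   torus with the core *)
Lemma cone_in_chart (F : {mpoly C[#|Kchart R|]}) y : cone y ->
  vanishing_ideal (multicone (@degchart R) (@coordchart R @` @Uo R)%classic) F ->
  mpeval F (zero_chart y) = 0.
Proof.
move=> [_ [th [[g [gu rg ->]] th0 ->]]] IF.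
pose w : {ffun Kchart R -> C} := [ffun k => match k with
  | inr x => th (tag x) * coordchart (gsp g) (inr x) | _ => coordchart (gsp g) k end].
have -> : zero_chart (rescale (@degcore R) th (grad R g)) = [ffun k => 0 ^+ chart_weight k * w k].
  apply/ffunP => -[[i|a]|x]; rewrite !ffunE /=.
  - by case: i => [[|[|[|[|[|[|]]]]]]] // lt; rewrite exprS !mul0r.
  - by rewrite expr1 mul0r.
  - by rewrite expr0 mul1r edge_coord_gsp.
apply: limit_at_zero => t t0; apply: IF.
exists (coordchart (gsp (torus t g))), (fun b => th b * t^-1).
have tu := torus_unit t0 gu; split.
- exists (gsp (torus t g)); last reflexivity.
  apply/UoP; exists (torus t g); split; [exact: tu| |reflexivity].
  exact: torus_regular.
- by move=> b; rewrite mulf_neq0 ?invr_eq0.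
have edgeE a : edge_coord (gsp (torus t g)) a = t * edge_coord (gsp g) a.
  have [_ n0 nT n0' nT'] := edge_props a.
  by rewrite !edge_coord_gsp // !torus_aff // mulrBr.
apply/ffunP => -[[i|a]|x]; rewrite !ffunE /=.
- by rewrite mul1r torus_flag.
- by rewrite mul1r expr1 edgeE.
- by rewrite expr0 mul1r edgeE mulrA divfK.
Qed.

Lemma core_closure : @core R = mpclosure (@degcore R) (@grads R C).
Proof.
apply/seteqP; split=> [_ [v [pv cv] <-]|w [pw cw]].
  split=> [b|F IF].
    by have [[[i|a]|x] // [e] nz] := pv b; exists x; rewrite ?ffunE // -e.
  have [G hG] := pol_comp (fun k : K => pX C (inr k : Kchart R)) F.
  have -> : [ffun k => v (inr k)] = [ffun k : K => mpeval (pX C (inr k : Kchart R)) v].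
    by apply/ffunP => k; rewrite !ffunE pevE pevX.
  rewrite -hG; apply: cv => _ [_ [th [[p Up <-] th0 ->]]].
  rewrite hG; apply: IF; have [g [gu rg pE]] := (UoP p).1 Up.
  exists (grad R g), th; split=> //; first by exists g.
  apply/ffunP => k; rewrite !ffunE pevE pevX !ffunE /= pE.
  by rewrite edge_coord_gsp.
exists (zero_chart w); last by apply/ffunP => k; rewrite !ffunE.
split=> [b|F IF].
  by have [x e nz] := pw b; exists (inr x); rewrite ?ffunE.
have [G hG] := pol_comp (fun k : Kchart R =>
  match k with inl _ => 0 | inr x => pX C x end) F.
have GE y : mpeval G y = mpeval F (zero_chart y).
  rewrite hG; congr mpeval; apply/ffunP => -[k|x]; rewrite !ffunE pevE ?rmorph0 //.
  by rewrite pevX.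
by rewrite -GE; apply: cw => y cy; rewrite GE; apply: cone_in_chart.
Qed.

End Core.

(** * The core is nonsingular *)

Definition proper_set I := (I != finset.set0) && (I != finset.setT).

Definition common_den (A : comNzRingType) (g : 'M[A]_4) : A :=
  \prod_(J | proper_set J) den g J.

Definition cleared (A : comNzRingType) (g : 'M[A]_4) I : A :=
  num g I * \prod_(J | proper_set J && (J != I)) den g J.

Lemma clearedE (F : fieldType) (g : 'M[F]_4) I : proper_set I -> den g I != 0 ->
  cleared g I = common_den g * aff_coord g I.
Proof.
by move=> pI nz; rewrite /common_den (bigD1 I) //= /cleared /aff_coord mulrAC mulrCA divff ?mulr1.
Qed.

Lemma common_den_neq0 (F : fieldType) (g : 'M[F]_4) : common_den g != 0 <-> regular g.
Proof.
rewrite /regular; split=> [/prodf_neq0 h I n0 nT|h]; first by apply: h; rewrite /proper_set n0.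
by apply/prodf_neq0 => I /andP [n0 nT]; apply: h.
Qed.

Section MapDen.
Variables (A B : comNzRingType) (f : {rmorphism A -> B}) (g : 'M[A]_4).

Lemma map_den I : f (den g I) = den (map_mx f g) I.
Proof. exact: map_minor. Qed.

Lemma map_common_den : f (common_den g) = common_den (map_mx f g).
Proof. by rewrite rmorph_prod; apply: eq_bigr => I _; apply: map_den. Qed.

Lemma map_cleared I : f (cleared g I) = cleared (map_mx f g) I.
Proof.
rewrite rmorphM rmorph_prod; congr (_ * _); first exact: map_minor.
by apply: eq_bigr => J _; apply: map_den.
Qed.

Lemma map_core_slice p q s : map_mx f (core_slice p q s) = core_slice (f p) (f q) (f s).
Proof.
apply/matrixP => i j; rewrite !mxE.
by elim/all_o: i; elim/all_o: j; rewrite /= ?rmorphM ?rmorph0 ?rmorph1.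
Qed.

End MapDen.

Lemma all_o3 (P : 'I_3 -> Prop) :
  P (inord 0) -> P (inord 1) -> P (inord 2) -> forall i, P i.
Proof.
move=> h0 h1 h2 [[|[|[|]]] // lt].
- by rewrite (_ : Ordinal lt = inord 0) //; apply: val_inj; rewrite /= inordK.
- by rewrite (_ : Ordinal lt = inord 1) //; apply: val_inj; rewrite /= inordK.
- by rewrite (_ : Ordinal lt = inord 2) //; apply: val_inj; rewrite /= inordK.
Qed.

(** The infinitesimal part of the value of a polynomial is a linear function of
    the infinitesimal parts of the coordinates. *)
Lemma functionals_matrix (C : numFieldType) (K : finType) d (v : {ffun K -> C})
    (P : 'I_d -> {mpoly C[#|K|]}) : exists B : 'M[C]_(#|K|, d),
  forall V : {ffun K -> dual C}, (forall k, std (V k) = v k) ->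
  forall i, eps (dev V (P i)) = ((\row_i eps (V (enum_val i))) *m B) 0 i.
Proof.
exists (\matrix_(k, i) mpeval (P i)^`M(k) v) => V lV i.
have -> : V = dvec v [ffun k => eps (V k)].
  by apply/ffunP => k; rewrite !ffunE; apply: dual_eqP; rewrite /= ?lV.
rewrite eps_dev mxE; apply: eq_bigr => k _.
by rewrite !mxE !ffunE mulrC.
Qed.

Lemma scale_back (F : fieldType) (t D a x z : F) : D != 0 -> a != 0 -> z = a * x ->
  t * x = t * (D * a)^-1 * (D * z).
Proof. by move=> D0 a0 ->; field; rewrite D0 a0. Qed.

Section Slice.
Variable C : numFieldType.
Local Notation par := {mpoly C[#|'I_3|]}.
Implicit Types (x : {ffun 'I_3 -> C}) (g : 'M[C]_4).

Definition slice_var (i : nat) : par := pX C (inord i : 'I_3).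
Definition generic_slice : 'M[par]_4 :=
  core_slice (slice_var 0) (slice_var 1) (slice_var 2).
Definition slice_at x : 'M[C]_4 :=
  core_slice (x (inord 0)) (x (inord 1)) (x (inord 2)).

Lemma pev_slice x : map_mx (pev x) generic_slice = slice_at x.
Proof. by rewrite map_core_slice /slice_var !pevX. Qed.

Definition slice_open : par := common_den generic_slice * \det generic_slice.

Lemma slice_openP x : mpeval slice_open x != 0 <->
  regular (slice_at x) /\ slice_at x \in unitmx.
Proof.
rewrite pevE rmorphM -det_map_mx map_common_den pev_slice mulf_eq0 negb_or.
by rewrite unitmxE unitfE; split=> [/andP [/common_den_neq0]|[/common_den_neq0 -> ->]].
Qed.

Lemma slice_diff x I J : regular (slice_at x) -> proper_set I -> proper_set J ->
  pev x (cleared generic_slice I - cleared generic_slice J) =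
  common_den (slice_at x) * (aff_coord (slice_at x) I - aff_coord (slice_at x) J).
Proof.
move=> rg pI pJ; have E L : pev x (cleared generic_slice L) = cleared (slice_at x) L.
  by rewrite -pev_slice; apply: map_cleared.
rewrite mulrBr (rmorphB (pev x)) !E; by rewrite !clearedE //; case/andP: pI => n0 nT; case/andP: pJ => n0' nT'; apply: rg.
Qed.

Lemma slice_normal g : g \in unitmx -> regular g ->
  exists x (al : nat -> C), [/\ mpeval slice_open x != 0, forall n, al n != 0 &
    forall I J, proper_set I -> proper_set J -> #|I| = #|J| ->
      aff_coord (slice_at x) I - aff_coord (slice_at x) J =
      al #|J| * (aff_coord g I - aff_coord g J)].
Proof.
move=> gu rg; have [p [q [s [Mu Mr [al [be [al0 h]]]]]]] := core_normal_form gu rg.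
exists [ffun i : 'I_3 => nth 0 [:: p; q; s] i], al.
have -> : slice_at [ffun i : 'I_3 => nth 0 [:: p; q; s] i] = core_slice p q s.
  by rewrite /slice_at !ffunE !inordK.
split=> //.
  apply/slice_openP; rewrite /slice_at !ffunE !inordK //.
by move=> I J /andP [n0 nT] /andP [n0' nT'] e; rewrite !h // e; ring.
Qed.

End Slice.

Section Core.
Variable R : realType.
Local Notation C := R[i].
Local Notation K := (Kcore R).
Local Notation par := {mpoly C[#|'I_3|]}.
Implicit Types (x : {ffun 'I_3 -> C}) (g : 'M[C]_4).

Definition slice_coord (k : K) : par :=
  cleared (generic_slice C) (hi (val (tagged k))) - cleared (generic_slice C) (lo (val (tagged k))).

Lemma vertex_proper (beta : hface R) (e : edge_of beta) :
  proper_set (hi (val e)) /\ proper_set (lo (val e)).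
Proof. by have [_ n0 nT n0' nT'] := edge_props (val e); rewrite /proper_set n0 n0'. Qed.

Lemma slice_pt x : mpeval (slice_open C) x != 0 ->
  polpt slice_coord x = rescale (@degcore R) (fun=> common_den (slice_at x)) (grad R (slice_at x)).
Proof.
move=> /slice_openP [rg _]; apply/ffunP => -[beta e]; rewrite !ffunE /= pevE.
by have [h1 h2] := vertex_proper e; apply: slice_diff.
Qed.

Local Notation cone := (multicone (@degcore R) (@grads R C)).

Lemma slice_cone x : mpeval (slice_open C) x != 0 -> cone (polpt slice_coord x).
Proof.
move=> Hx; rewrite slice_pt //; have [rg gu] := (slice_openP x).1 Hx.
exists (grad R (slice_at x)), (fun=> common_den (slice_at x)); split=> //.
  by exists (slice_at x).
by move=> _; apply/common_den_neq0.
Qed.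

(* Vertices of one face have the same number of elements *)
Definition rank_of (beta : hface R) : nat := #|base (val beta)|.

Lemma rank_of_mem (beta : hface R) I : I \in val beta -> #|I| = rank_of beta.
Proof.
move=> Ib; have Bb := base_in Ib; have [k [P [Q e]]] := hface_face beta.
move: Ib Bb; rewrite /rank_of e !in_face => /and3P [/eqP -> _ _] /and3P [/eqP h _ _].
by rewrite h.
Qed.

Lemma slice_dense y : cone y -> multicone (@degcore R)
  (polpt slice_coord @` [set x | mpeval (slice_open C) x != 0])%classic y.
Proof.
move=> [_ [t [[g [gu rg ->]] t0 ->]]].
have [x [al [Hx al0 h]]] := slice_normal gu rg.
have [rx ux] := (slice_openP x).1 Hx.
have D0 : common_den (slice_at x) != 0 by apply/common_den_neq0.
exists (polpt slice_coord x),
  (fun b => t b * (common_den (slice_at x) * al (rank_of b))^-1); split.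
- by exists x.
- by move=> b; rewrite mulf_neq0 ?invr_eq0 ?mulf_neq0.
rewrite slice_pt //; apply/ffunP => -[beta e].
have [h1 h2] := vertex_proper e; have [hl hh] := edge_in e.
have := h _ _ h1 h2 (etrans (rank_of_mem hh) (esym (rank_of_mem hl))).
rewrite (rank_of_mem hl) => E; rewrite 2!ffunE [RHS]ffunE [rescale _ _ _ _]ffunE [grad _ _ _]ffunE /=.
exact: scale_back D0 (al0 _) E.
Qed.

Lemma edge_make (beta : hface R) I J : adj I J -> sub_lt I J ->
  I \in val beta -> J \in val beta -> exists k : K,
  [/\ tag k = beta, lo (val (tagged k)) = I & hi (val (tagged k)) = J].
Proof.
move=> aIJ lt Ib Jb; have [e he _] := edge_ex aIJ Ib Jb.
exists (Tagged (@edge_of R) e) => /=; case: he => -[e1 e2]; first by split.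
by have := sub_lt_asym (edge_lt (val e)); rewrite e1 e2 lt.
Qed.

Lemma slice_ratio (i : 'I_3) (beta : hface R) L H1 H2 :
  adj L H1 -> adj L H2 -> sub_lt L H1 -> sub_lt L H2 ->
  L \in val beta -> H1 \in val beta -> H2 \in val beta ->
  (forall x, regular (slice_at x) ->
    aff_coord (slice_at x) H1 - aff_coord (slice_at x) L = x i /\
    aff_coord (slice_at x) H2 - aff_coord (slice_at x) L = 1) ->
  exists kk : K * K, tag kk.1 = tag kk.2 /\ forall x, mpeval (slice_open C) x != 0 ->
    polpt slice_coord x kk.1 = x i * polpt slice_coord x kk.2 /\
    polpt slice_coord x kk.2 != 0.
Proof.
move=> a1 a2 lt1 lt2 Lb H1b H2b h.
have [k [tk lk hk]] := edge_make a1 lt1 Lb H1b.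
have [k' [tk' lk' hk']] := edge_make a2 lt2 Lb H2b.
exists (k, k') => /=; split; first by rewrite tk tk'.
move=> x Hx; have [rx _] := (slice_openP x).1 Hx; have [h1 h2] := h x rx.
have D0 : common_den (slice_at x) != 0 by apply/common_den_neq0.
rewrite slice_pt // [_ k]ffunE [_ k']ffunE [grad _ _ k]ffunE [grad _ _ k']ffunE /=.
by rewrite lk hk lk' hk' h1 h2 mulr1 mulrC.
Qed.

Lemma slice_ratios (i : 'I_3) :
  exists kk : K * K, tag kk.1 = tag kk.2 /\ forall x, mpeval (slice_open C) x != 0 ->
    polpt slice_coord x kk.1 = x i * polpt slice_coord x kk.2 /\
    polpt slice_coord x kk.2 != 0.
Proof.
have [b1 e1] := hface_simplex R (k := 1) isT.
have [b2 e2] := hface_simplex R (k := 2) isT.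
have U1 : uniq [:: o0; o1; o2; o3] by [].
have U2 : uniq [:: o0; o2; o1; o3] by [].
have U3 : uniq [:: o0; o3; o1; o2] by [].
have single (j : 'I_4) : j != o0 -> adj [set o0] [set j].
  move=> ne; rewrite /adj !cards1 (_ : _ :&: _ = finset.set0) ?cards0 //.
  by apply/finset.setP => z; rewrite !inE; case: eqP => // ->; rewrite eq_sym (negPf ne).
have pair (j : 'I_4) : j != o0 -> j != o1 -> adj [set o0; o1] [set o0; j].
  move=> n0 n1; rewrite /adj !cards2 [o0 == j]eq_sym n0 (_ : _ :&: _ = [set o0]%SET) ?cards1 //.
  apply/finset.setP => z; rewrite !inE; case: (eqVneq z o0) => //= _.
  by case: eqP => // ->; rewrite eq_sym (negPf n1).
have lt1 (j : 'I_4) : j != o0 -> sub_lt [set o0] [set j].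
  by elim/all_o: j => // _; rewrite /sub_lt !cards1 !enum_set1.
have lt2 (j : 'I_4) : j != o0 -> j != o1 -> sub_lt [set o0; o1] [set o0; j].
  by elim/all_o: j => // _ _; rewrite /sub_lt !cards2 !enum_set4 /= !inE.
elim/all_o3: i.
- apply: (@slice_ratio _ b1 [set o0] [set o2] [set o1]); rewrite ?e1 ?in_simplex ?cards1 ?single ?lt1 //.
  by move=> x rx; rewrite !aff1 !mxE /= !divr1 !subr0.
- apply: (@slice_ratio _ b1 [set o0] [set o3] [set o1]); rewrite ?e1 ?in_simplex ?cards1 ?single ?lt1 //.
  by move=> x rx; rewrite !aff1 !mxE /= !divr1 !subr0.
apply: (@slice_ratio _ b2 [set o0; o1] [set o0; o3] [set o0; o2]);
  rewrite ?e2 ?in_simplex ?cards2 ?pair ?lt2 //.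
move=> x rx; have := reg2 rx U2; have := reg2 rx U3.
rewrite (aff2 _ U1) (aff2 _ U2) (aff2 _ U3) /m2 !mxE /=.
rewrite !(mul1r, mul0r, mulr0, mulr1, subr0, sub0r) => h2 h3.
by rewrite divff // mulfK.
Qed.

Theorem core_nonsingular : nonsingular_variety (@degcore R) (@core R).
Proof.
rewrite core_closure; have [f hf] := choice slice_ratios.
have [g gu rg] := regular_exists C; have [o [_ [Ho _ _]]] := slice_normal gu rg.
apply: (@nonsingular_variety_closure _ _ _ _ (@tag _ _) _ _ 3 slice_coord (slice_open C) o
  (fun i => (f i).1) (fun i => (f i).2)) => //.
- exact: grads_point.
- exact: slice_cone.
- move=> F IF y /slice_dense; exact: IF.
- by move=> i; case: (hf i).
- by move=> x Hx i; case: (hf i) => _; apply.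
move=> v [pv cv]; have [P hP] := core_tangent pv cv.
have [B hB] := functionals_matrix v P; exists B => V lV dV VB.
by apply: hP => // i; rewrite (hB V lV) VB mxE.
Qed.

End Core.

(** * Wedges of tensors *)

Section Tensor.
Variables (A : comNzRingType) (E : finType) (X_ : E -> finType).
Local Notation Index := {dffun forall a : E, (X_ a * X_ a)%type}.
Implicit Types (a : E) (s : Index).

Definition tensor (p q : forall a, X_ a -> A) s : A := \prod_a (p a (s a).1 * q a (s a).2).

Definition swap a s : Index := [ffun a' => if a' == a then ((s a').2, (s a').1) else s a'].

Lemma swapK a : involutive (swap a).
Proof.
move=> s; apply/ffunP => a'; rewrite !ffunE; case: eqP => // _.
by case: (s a').
Qed.

Definition wedge (p q : forall a, X_ a -> A) a s : A := tensor p q s - tensor p q (swap a s).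

Lemma wedgeE p q a s : wedge p q a s =
  (p a (s a).1 * q a (s a).2 - p a (s a).2 * q a (s a).1) *
  \prod_(a' | a' != a) (p a' (s a').1 * q a' (s a').2).
Proof.
rewrite /wedge /tensor (bigD1 a) //= [in X in _ - X](bigD1 a) //= ffunE eqxx /=.
rewrite mulrBl; congr (_ - _ * _); apply: eq_bigr => a' ne.
by rewrite ffunE (negPf ne).
Qed.

Lemma wedge_one p q (x y : forall a, X_ a) a :
  (forall a, p a (x a) = 1) -> (forall a, q a (y a) = 1) -> p a (y a) = 0 ->
  wedge p q a [ffun a' => (x a', y a')] = 1.
Proof.
move=> px qy py; rewrite wedgeE big1 => [|a' _]; rewrite !ffunE /= px qy.
  by rewrite py mul0r subr0 !mulr1.
by rewrite mulr1.
Qed.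

Lemma tensor_scale p q p' q' (c d : E -> A) s :
  (forall a x, p' a x = c a * p a x) -> (forall a x, q' a x = d a * q a x) ->
  tensor p' q' s = \prod_a (c a * d a) * tensor p q s.
Proof.
move=> hp hq; rewrite /tensor -big_split; apply: eq_bigr => a _ /=.
by rewrite hp hq mulrACA.
Qed.

Lemma wedge_scale p q p' q' (c d : E -> A) a s :
  (forall a x, p' a x = c a * p a x) -> (forall a x, q' a x = d a * q a x) ->
  wedge p' q' a s = \prod_a (c a * d a) * wedge p q a s.
Proof. by move=> hp hq; rewrite /wedge !(tensor_scale _ hp hq) mulrBr. Qed.

(** The action of a family of matrices on tensors *)
Definition tact (m : forall a, X_ a -> X_ a -> A) s s' : A :=
  \prod_a (m a (s a).1 (s' a).1 * m a (s a).2 (s' a).2).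

Lemma tact_swap m a s s' : tact m s (swap a s') = tact m (swap a s) s'.
Proof.
apply: eq_bigr => a' _; rewrite !ffunE; case: eqP => //= _; exact: mulrC.
Qed.

Lemma tensor_act m p q p' q' s :
  (forall a x, p' a x = \sum_y m a x y * p a y) ->
  (forall a x, q' a x = \sum_y m a x y * q a y) ->
  tensor p' q' s = \sum_s' tact m s s' * tensor p q s'.
Proof.
move=> hp hq; under eq_bigr do rewrite -big_split /=.
rewrite (dffun_distr (fun a (t : X_ a * X_ a) =>
  m a (s a).1 t.1 * m a (s a).2 t.2 * (p a t.1 * q a t.2))).
apply: eq_bigr => a _; rewrite hp hq big_distrlr pair_big /=; apply: eq_bigr => t _.
by rewrite mulrACA.
Qed.

Lemma wedge_act m p q p' q' a s :
  (forall a x, p' a x = \sum_y m a x y * p a y) ->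
  (forall a x, q' a x = \sum_y m a x y * q a y) ->
  wedge p' q' a s = \sum_s' tact m s s' * wedge p q a s'.
Proof.
move=> hp hq; rewrite /wedge !(tensor_act _ hp hq).
under [RHS]eq_bigr do rewrite mulrBr.
rewrite sumrB; congr (_ - _); rewrite (reindex_inj (inv_inj (swapK a))) /=.
by apply: eq_bigr => s' _; rewrite tact_swap swapK.
Qed.

Lemma tact_inv m m' s1 s2 :
  (forall a x y, \sum_z m' a x z * m a z y = (x == y)%:R) ->
  \sum_s' tact m' s1 s' * tact m s' s2 = (s1 == s2)%:R.
Proof.
move=> h; under eq_bigr do rewrite -big_split /=.
rewrite (dffun_distr (fun a (t : X_ a * X_ a) =>
  m' a (s1 a).1 t.1 * m' a (s1 a).2 t.2 * (m a t.1 (s2 a).1 * m a t.2 (s2 a).2))).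
transitivity (\prod_a (((s1 a).1 == (s2 a).1)%:R * ((s1 a).2 == (s2 a).2)%:R : A)).
  apply: eq_bigr => a' _; rewrite -!h big_distrlr pair_big /=.
  by apply: eq_bigr => t _; rewrite mulrACA.
have [->|ne] := eqVneq s1 s2; first by rewrite big1 // => a' _; rewrite !eqxx mulr1.
have [a' ne'] : exists a', s1 a' != s2 a'.
  apply: contrapT => no; case/eqP: ne; apply/ffunP => a'; apply: contrapT => /eqP ne'.
  by apply: no; exists a'.
rewrite (bigD1 a') //= -natrM mulnb.
by move: ne'; case: (s1 a') (s2 a') => x y [z t]; rewrite xpair_eqE /= => /negPf ->; rewrite mul0r.
Qed.

End Tensor.

Lemma sum_inv (A : comNzRingType) (T : finType) (m m' : T -> T -> A) (f : T -> A) x :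
  (forall x y, \sum_z m' x z * m z y = (x == y)%:R) ->
  \sum_y m' x y * (\sum_z m y z * f z) = f x.
Proof.
move=> h; under eq_bigr do rewrite mulr_sumr; rewrite exchange_big /= (bigD1 x) //= [X in _ + X]big1 ?addr0.
  under eq_bigr do rewrite mulrA.
  by rewrite -mulr_suml h eqxx mul1r.
move=> y ne; under eq_bigr do rewrite mulrA.
by rewrite -mulr_suml h eq_sym (negPf ne) mul0r.
Qed.

Section TensorMorphism.
Variables (A B : comNzRingType) (f : {rmorphism A -> B}) (E : finType) (X_ : E -> finType).

Lemma wedge_morph (p q : forall a : E, X_ a -> A) a s : f (wedge p q a s) =
  wedge (fun a x => f (p a x)) (fun a x => f (q a x)) a s.
Proof.
have tE s' : f (tensor p q s') = tensor (fun a x => f (p a x)) (fun a x => f (q a x)) s'.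
  by rewrite rmorph_prod; apply: eq_bigr => a' _; rewrite rmorphM.
by rewrite rmorphB !tE.
Qed.

Lemma tact_morph (m : forall a : E, X_ a -> X_ a -> A) s s' :
  f (tact m s s') = tact (fun a x y => f (m a x y)) s s'.
Proof. by rewrite rmorph_prod; apply: eq_bigr => a _; rewrite rmorphM. Qed.

End TensorMorphism.

(** * Coordinates of complete tetrahedra *)

Lemma sum_ksub (A : comNzRingType) n (F : {set 'I_4} -> A) :
  \sum_(T : ksub n) F (val T) = \sum_(T : {set 'I_4} | #|T| == n) F T.
Proof.
rewrite [RHS](reindex_omap (val : ksub n -> _) insub) /=; last first.
  by move=> T cT; rewrite insubT.
by apply: eq_bigl => T; rewrite valK (eqP (valP T)) !eqxx.
Qed.

Lemma ksub_act (A : comNzRingType) (m w w' : {set 'I_4} -> {set 'I_4} -> A) J n (x : ksub n) :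
  (forall I S, #|S| = #|I| ->
    w' I S = \sum_(T : {set 'I_4} | #|T| == #|I|) m S T * w I T) -> n = #|J| ->
  w' J (val x) = \sum_(y : ksub n) m (val x) (val y) * w J (val y).
Proof.
move=> h e; have cx : #|val x| = #|J| by rewrite -e; apply/eqP/(valP x).
by rewrite (h _ _ cx) -e -(sum_ksub n (fun T => m (val x) T * w J T)).
Qed.

Lemma sum_ksub_inv (A : comNzRingType) (m m' : {set 'I_4} -> {set 'I_4} -> A) n (x y : ksub n) :
  (forall S T, #|S| = #|T| ->
     \sum_(U : {set 'I_4} | #|U| == #|S|) m' S U * m U T = (S == T)%:R) ->
  \sum_(z : ksub n) m' (val x) (val z) * m (val z) (val y) = (x == y)%:R.
Proof.
move=> h; rewrite (sum_ksub n (fun U => m' (val x) U * m U (val y))).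
have cx : #|val x| = n by apply/eqP/(valP x).
have cy : #|val y| = n by apply/eqP/(valP y).
have := h (val x) (val y); rewrite cx cy val_eqE => <- //.
Qed.

Section Sharp.
Variable R : realType.
Local Notation K := (Ksharp R).
Implicit Types (b : hface R).

Definition X_ b (a : edge_of b) : finType := ksub (level (val a)).
Definition sindex b : finType := {dffun forall a : edge_of b, (X_ a * X_ a)%type}.

Definition kY (I : psub) (x : ksub #|val I|) : K :=
  inl (Tagged (fun I : psub => ksub #|val I|) x).
Definition kfib b (x : Kfib b) : K := inr (Tagged (@Kfib R) x).
Definition kE1 b (a : edge_of b) (x : X_ a) : K := kfib (inl (inl (Tagged (@X_ b) x))).
Definition kE2 b (a : edge_of b) (x : X_ a) : K := kfib (inl (inr (Tagged (@X_ b) x))).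
Definition kB b (a : edge_of b) (s : sindex b) : K := kfib (inr (a, s)).

Lemma K_ind (P : K -> Prop) :
  (forall x z, P (@kY x z)) -> (forall b a z, P (@kE1 b a z)) ->
  (forall b a z, P (@kE2 b a z)) -> (forall b a s, P (@kB b a s)) -> forall k, P k.
Proof.
move=> h1 h2 h3 h4 [[I S]|[b [[[a S]|[a S]]|[a s]]]];
  [exact: h1|exact: h2|exact: h3|exact: h4].
Qed.

Definition dgs (k : K) : Isharp R := match k with
  | inl x => inl (tag x)
  | inr x => inr (Tagged (@Ifib R) (degfib (tagged x)))
  end.

Lemma degsharpE k : degsharp k = Some (dgs k).
Proof. by case: k. Qed.

Lemma Tagged_inj b (x y : Ifib b) :
  inr (Tagged (@Ifib R) x) = inr (Tagged (@Ifib R) y) :> Isharp R -> x = y.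
Proof.
move=> e; pose f (i : Isharp R) : Ifib b :=
  if i is inr z then tagged_as (Tagged (@Ifib R) x) z else x.
by have := congr1 f e; rewrite /f !tagged_asE.
Qed.

Lemma kE1_of b (a : edge_of b) (P : K -> Prop) k :
  dgs k = inr (Tagged (@Ifib R) (inl (inl a) : Ifib b)) -> P k -> exists x : X_ a, P (kE1 x).
Proof.
pose is1 (i : Isharp R) : bool :=
  if i is inr x then if tagged x is inl (inl _) then true else false else false.
elim/K_ind: k => [J x|b' a' x|b' a' x|b' a' s] e.
- by have := congr1 is1 e.
- have e' : b' = b := congr1 (fun i : Isharp R => if i is inr x then tag x else b) e.
  move: a' x e; rewrite e' => a' x e.
  have E : inl (inl a') = inl (inl a) :> Ifib b := Tagged_inj e.
  have ea : a' = a := congr1 (fun z : Ifib b => if z is inl (inl w) then w else a) E.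
  by move: x {e}; rewrite ea => x Px; exists x.
- by have := congr1 is1 e.
by have := congr1 is1 e.
Qed.

Lemma kE2_of b (a : edge_of b) (P : K -> Prop) k :
  dgs k = inr (Tagged (@Ifib R) (inl (inr a) : Ifib b)) -> P k -> exists x : X_ a, P (kE2 x).
Proof.
pose is2 (i : Isharp R) : bool :=
  if i is inr x then if tagged x is inl (inr _) then true else false else false.
elim/K_ind: k => [J x|b' a' x|b' a' x|b' a' s] e.
- by have := congr1 is2 e.
- by have := congr1 is2 e.
- have e' : b' = b := congr1 (fun i : Isharp R => if i is inr x then tag x else b) e.
  move: a' x e; rewrite e' => a' x e.
  have E : inl (inr a') = inl (inr a) :> Ifib b := Tagged_inj e.
  have ea : a' = a := congr1 (fun z : Ifib b => if z is inl (inr w) then w else a) E.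
  by move: x {e}; rewrite ea => x Px; exists x.
by have := congr1 is2 e.
Qed.

Lemma card_lo b (a : edge_of b) (x : X_ a) : #|val x| = #|lo (val a)|.
Proof. exact/eqP/(valP x). Qed.

Lemma card_hi b (a : edge_of b) (x : X_ a) : #|val x| = #|hi (val a)|.
Proof. by rewrite card_lo; have [] := edge_props (val a). Qed.

Section Coordinates.
Variable A : comNzRingType.
Implicit Types (w : {set 'I_4} -> {set 'I_4} -> A).

Definition wlo b w (a : edge_of b) (x : X_ a) : A := w (lo (val a)) (val x).
Definition whi b w (a : edge_of b) (x : X_ a) : A := w (hi (val a)) (val x).

(** The coordinates of a tetrahedron with Pluecker coordinates w I *)
Definition sharp w (k : K) : A := match k with
  | inl x => w (val (tag x)) (val (tagged x))
  | inr x => match tagged x with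
    | inl (inl y) => wlo w (tagged y)
    | inl (inr y) => whi w (tagged y)
    | inr y => wedge (@wlo (tag x) w) (@whi (tag x) w) y.1 y.2
    end
  end.

Definition scal (c : {set 'I_4} -> A) (i : Isharp R) : A := match i with
  | inl J => c (val J)
  | inr x => match tagged x with
    | inl (inl a) => c (lo (val a))
    | inl (inr a) => c (hi (val a))
    | inr _ => \prod_(a : edge_of (tag x)) (c (lo (val a)) * c (hi (val a)))
    end
  end.

Lemma sharpB w b (a : edge_of b) (s : sindex b) :
  sharp w (kB a s) = wedge (@wlo b w) (@whi b w) a s.
Proof. by []. Qed.

Lemma sharp_scale w w' c k :
  (forall I S, proper_set I -> #|S| = #|I| -> w' I S = c I * w I S) ->
  sharp w' k = scal c (dgs k) * sharp w k.
Proof.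
move=> h; elim/K_ind: k => [J x|b a x|b a x|b a s].
- by apply: h; [apply: (valP J)|apply/eqP/(valP x)].
- exact: h (vertex_proper a).2 (card_lo x).
- exact: h (vertex_proper a).1 (card_hi x).
by apply: wedge_scale => a' x; apply: h;
  [exact: (vertex_proper a').2|apply: card_lo|exact: (vertex_proper a').1|apply: card_hi].
Qed.

(** The action of a matrix with compound matrices m *)
Definition mX b (m : {set 'I_4} -> {set 'I_4} -> A) (a : edge_of b) (x y : X_ a) : A :=
  m (val x) (val y).

Definition rho (m : {set 'I_4} -> {set 'I_4} -> A) (v : K -> A) (k : K) : A := match k with
  | inl x => \sum_(T : ksub #|val (tag x)|) m (val (tagged x)) (val T) * v (kY T)
  | inr x => match tagged x with
    | inl (inl y) => \sum_(z : X_ (tag y)) mX m (tagged y) z * v (kE1 z)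
    | inl (inr y) => \sum_(z : X_ (tag y)) mX m (tagged y) z * v (kE2 z)
    | inr y => \sum_(s' : sindex (tag x)) tact (@mX (tag x) m) y.2 s' * v (kB y.1 s')
    end
  end.

Lemma rhoY m v (J : psub) (x : ksub #|val J|) : rho m v (kY x) =
  \sum_(y : ksub #|val J|) m (val x) (val y) * v (kY y).
Proof. by []. Qed.
Lemma rhoE1 m v b (a : edge_of b) (x : X_ a) : rho m v (kE1 x) =
  \sum_(z : X_ a) mX m x z * v (kE1 z).
Proof. by []. Qed.
Lemma rhoE2 m v b (a : edge_of b) (x : X_ a) : rho m v (kE2 x) =
  \sum_(z : X_ a) mX m x z * v (kE2 z).
Proof. by []. Qed.
Lemma rhoB m v b (a : edge_of b) (s : sindex b) : rho m v (kB a s) =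
  \sum_(s' : sindex b) tact (@mX b m) s s' * v (kB a s').
Proof. by []. Qed.

Lemma rho_sharp m w w' k :
  (forall I S, #|S| = #|I| ->
    w' I S = \sum_(T : {set 'I_4} | #|T| == #|I|) m S T * w I T) ->
  sharp w' k = rho m (sharp w) k.
Proof.
move=> h.
have hlo b (a : edge_of b) (x : X_ a) : wlo w' x = \sum_(z : X_ a) mX m x z * wlo w z.
  exact: ksub_act.
have hhi b (a : edge_of b) (x : X_ a) : whi w' x = \sum_(z : X_ a) mX m x z * whi w z.
  by apply: ksub_act => //; have [-> _ _ _ _] := edge_props (val a).
elim/K_ind: k => [J x|b a x|b a x|b a s].
- by rewrite rhoY; apply: ksub_act.
- by rewrite rhoE1; apply: hlo.
- by rewrite rhoE2; apply: hhi.
rewrite rhoB; exact: (wedge_act a s (@hlo b) (@hhi b)).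
Qed.

Lemma rho_zero m v i : (forall k, dgs k = i -> v k = 0) ->
  forall k, dgs k = i -> rho m v k = 0.
Proof.
move=> h; elim/K_ind => [J x|b a x|b a x|b a s] e;
  rewrite (rhoY, rhoE1, rhoE2, rhoB); apply: big1 => t _; rewrite h ?mulr0 //.
Qed.

Lemma rho_scale m (v v' : K -> A) (t : Isharp R -> A) k :
  (forall k, v' k = t (dgs k) * v k) -> rho m v' k = t (dgs k) * rho m v k.
Proof.
by move=> h; elim/K_ind: k => [J x|b a x|b a x|b a s];
  rewrite !(rhoY, rhoE1, rhoE2, rhoB) mulr_sumr; apply: eq_bigr => z _; rewrite h mulrCA.
Qed.

Lemma rho_inv m m' (v : K -> A) k :
  (forall S T, #|S| = #|T| ->
     \sum_(U : {set 'I_4} | #|U| == #|S|) m' S U * m U T = (S == T)%:R) ->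
  rho m' (rho m v) k = v k.
Proof.
move=> h; elim/K_ind: k => [J x|b a x|b a x|b a s].
- rewrite rhoY; under eq_bigr do rewrite rhoY.
  by apply: (@sum_inv A _ (fun x y => m (val x) (val y)) (fun x y => m' (val x) (val y))
    (fun x => v (kY x))) => y z; apply: sum_ksub_inv.
- rewrite rhoE1; under eq_bigr do rewrite rhoE1.
  by apply: (@sum_inv A _ (@mX b m a) (@mX b m' a) (fun x => v (kE1 x))) => y z;
    apply: sum_ksub_inv.
- rewrite rhoE2; under eq_bigr do rewrite rhoE2.
  by apply: (@sum_inv A _ (@mX b m a) (@mX b m' a) (fun x => v (kE2 x))) => y z;
    apply: sum_ksub_inv.
rewrite rhoB; under eq_bigr do rewrite rhoB.
apply: (@sum_inv A _ (tact (@mX b m)) (tact (@mX b m')) (fun s => v (kB a s))) => y z.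
by apply: tact_inv => a' x x'; apply: sum_ksub_inv.
Qed.

End Coordinates.

Lemma scal_neq0 (F : fieldType) (c : {set 'I_4} -> F) i :
  (forall J, c J != 0) -> scal c i != 0.
Proof.
move=> h; case: i => [J|[b [[a|a]|x]]]; try exact: h.
by apply/prodf_neq0 => a _; apply: mulf_neq0; apply: h.
Qed.

Lemma sharp_morph (A B : comNzRingType) (f : {rmorphism A -> B}) w k :
  f (sharp w k) = sharp (fun I S => f (w I S)) k.
Proof. by elim/K_ind: k => // b a s; apply: wedge_morph. Qed.

Lemma rho_morph (A B : comNzRingType) (f : {rmorphism A -> B}) m v k :
  f (rho m v k) = rho (fun S T => f (m S T)) (fun k => f (v k)) k.
Proof.
elim/K_ind: k => [J x|b a x|b a x|b a s]; rewrite !(rhoY, rhoE1, rhoE2, rhoB) rmorph_sum;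
  apply: eq_bigr => z _; rewrite rmorphM //.
by rewrite tact_morph.
Qed.

End Sharp.

(** * The orbit of complete tetrahedra *)

Definition pl (A : comNzRingType) (g : 'M[A]_4) I S : A := minor g S I.

Lemma minor_cols (A : comNzRingType) (g : 'M[A]_4) (d : 'I_4 -> A) S I : #|S| = #|I| ->
  minor (\matrix_(i, j) (d j * g i j)) S I = \prod_(j in I) d j * minor g S I.
Proof.
move=> e; rewrite /minor /nminor -big_enum /= (big_nth ord0) -cardE -e big_mkord.
pose D : 'rV_#|S| := \row_x d (nth ord0 (enum I) x).
transitivity (\det (diag_mx D *m (\matrix_(x < #|S|, y < #|S|)
    g (nth ord0 (enum S) y) (nth ord0 (enum I) x)))).
  by congr (\det _); apply/matrixP => x y; rewrite mul_diag_mx !mxE.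
by rewrite det_mulmx det_diag; congr (_ * _); apply: eq_bigr => x _; rewrite mxE.
Qed.

Definition affine_frame (A : comNzRingType) (x : 'I_3 -> 'I_4 -> A) : 'M[A]_4 :=
  \matrix_(r, c) if unlift o0 r is Some r' then x r' c else 1.

Section Orbit.
Variables (R : realType) (C : numFieldType).
Local Notation K := (Ksharp R).
Local Notation deg := (@degsharp R).
Implicit Types (b : hface R) (g h : 'M[C]_4) (v y : {ffun K -> C})
  (V : {ffun K -> dual C}) (F : {mpoly C[#|K|]}).

Definition tetra_vec g : {ffun K -> C} := [ffun k => sharp (pl g) k].

Definition orbit : set {ffun K -> C} :=
  [set v | exists2 g, g \in unitmx & v = tetra_vec g]%classic.

Lemma rho_minor h g (k : K) : rho (minor h) (sharp (pl g)) k = sharp (pl (h *m g)) k :> C.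
Proof. by apply/esym/rho_sharp => J S e; apply: minorM. Qed.

Definition ksub_of n S (h : #|S| == n) : ksub n := Sub S h.

Lemma edge_of_card b (a : edge_of b) : #|hi (val a)| == level (val a).
Proof. by rewrite /level; have [-> _ _ _ _] := edge_props (val a). Qed.

Definition lo_index b (a : edge_of b) : X_ a := ksub_of (eqxx _).
Definition hi_index b (a : edge_of b) : X_ a := ksub_of (edge_of_card a).

Lemma edge_of_neq b (a : edge_of b) : lo (val a) != hi (val a).
Proof. exact: adj_neq (edge_adj _). Qed.

Let w1 := pl (1%:M : 'M[C]_4).

Lemma frame_diag S : w1 S S = 1.
Proof. by rewrite /w1 /pl minor1 ?eqxx. Qed.
Lemma frame_off S T : #|T| = #|S| -> S != T -> w1 S T = 0.
Proof. by move=> e ne; rewrite /w1 /pl minor1 // eq_sym (negPf ne). Qed.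

Lemma frame_lo b (a : edge_of b) : wlo w1 (lo_index a) = 1.
Proof. exact: frame_diag. Qed.
Lemma frame_hi b (a : edge_of b) : whi w1 (hi_index a) = 1.
Proof. exact: frame_diag. Qed.
Lemma frame_lohi b (a : edge_of b) : wlo w1 (hi_index a) = 0.
Proof. exact: frame_off (card_lo (hi_index a)) (edge_of_neq a). Qed.

(** At the coordinate tetrahedron every factor has a coordinate equal to 1. *)
Lemma frame_point i : exists2 k : K, dgs k = i & sharp w1 k != 0.
Proof.
case: i => [J|[b [[a|a]|[]]]].
- by exists (kY R (ksub_of (eqxx #|val J|))); rewrite // [sharp _ _]frame_diag oner_neq0.
- by exists (kE1 (lo_index a)); rewrite // [sharp _ _]frame_lo oner_neq0.
- by exists (kE2 (hi_index a)); rewrite // [sharp _ _]frame_hi oner_neq0.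
have [a _] := hface_edge b.
pose s : sindex b := [ffun a' => (lo_index a', hi_index a')].
have sE : sharp w1 (kB a s) = 1.
  exact: (wedge_one (@frame_lo b) (@frame_hi b) (frame_lohi a)).
by exists (kB a s); [reflexivity|rewrite sE oner_neq0].
Qed.

Lemma minor_inv h : h \in unitmx -> forall S T, #|S| = #|T| ->
  \sum_(U : {set 'I_4} | #|U| == #|S|) minor (invmx h) S U * minor h U T = (S == T)%:R.
Proof. by move=> hu S T e; rewrite e -minorM // mulVmx // minor1. Qed.

Lemma orbit_point : (orbit `<=` is_point deg)%classic.
Proof.
move=> _ [g gu ->] i; apply: contrapT => no.
have z (k : K) : dgs k = i -> sharp (pl g) k = 0.
  move=> e; apply/eqP/negPn/negP => nz; apply: no; exists k; last by rewrite ffunE.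
  by rewrite degsharpE e.
have [k e] := frame_point i.
by rewrite /w1 -(mulVmx gu) -rho_minor (rho_zero _ z) // eqxx.
Qed.

Local Notation cone := (multicone deg orbit).

Lemma coneE y : cone y <-> exists g t, [/\ g \in unitmx, forall i, t i != 0 &
  forall k, y k = t (dgs k) * sharp (pl g) k].
Proof.
split=> [[_ [t [[g gu ->] t0 ->]]]|[g [t [gu t0 h]]]].
  by exists g, t; split=> // k; rewrite (rescaleE (@degsharpE R)) ffunE.
exists (tetra_vec g), t; split=> //; first by exists g.
by apply/ffunP => k; rewrite h (rescaleE (@degsharpE R)) ffunE.
Qed.

(** The general linear group acts linearly on the coordinates. *)
Definition act h (v : {ffun K -> C}) : {ffun K -> C} := [ffun k => rho (minor h) v k].

Lemma act_cone h y : h \in unitmx -> cone y -> cone (act h y).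
Proof.
move=> hu /coneE [g [t [gu t0 yE]]]; apply/coneE; exists (h *m g), t; split; first by rewrite unitmx_mul hu.
  exact: t0.
by move=> k; rewrite ffunE (rho_scale _ _ yE) rho_minor.
Qed.

Definition act_poly h (k : K) : {mpoly C[#|K|]} :=
  rho (fun S T => (minor h S T)%:MP) (fun k => pX C k) k.

Lemma pev_act h y k : pev y (act_poly h k) = act h y k.
Proof.
rewrite /act_poly rho_morph ffunE; congr (rho _ _ _); last first.
  by apply/funext => l; rewrite pevX.
by apply/funext => S; apply/funext => T; rewrite pevC.
Qed.

Definition dual_act h (V : {ffun K -> dual C}) : {ffun K -> dual C} :=
  [ffun k => rho (fun S T => inj (minor h S T)) V k].

Lemma dev_act h V k : dev V (act_poly h k) = dual_act h V k.
Proof.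
rewrite /act_poly rho_morph ffunE; congr (rho _ _ _); last first.
  by apply/funext => l; rewrite devX.
by apply/funext => S; apply/funext => T; rewrite devC.
Qed.

Lemma act_pullback h F : exists G : {mpoly C[#|K|]},
  (forall y, pev y G = pev (act h y) F) /\ (forall V, dev V G = dev (dual_act h V) F).
Proof.
have [G [G1 G2]] := compose_pol (act_poly h) F; exists G; split=> [y|V].
  by rewrite G1; congr (pev _ _); apply/ffunP => k; rewrite ffunE pev_act.
by rewrite G2; congr (dev _ _); apply/ffunP => k; rewrite ffunE dev_act.
Qed.

Lemma dual_act_point h V : h \in unitmx -> dual_point deg orbit V ->
  dual_point deg orbit (dual_act h V).
Proof.
move=> hu dV F IF; have [G [G1 G2]] := act_pullback h F; rewrite -G2; apply: dV => y cy.
by rewrite pevE G1; apply: IF; apply: act_cone.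
Qed.

Lemma act_closure h v : h \in unitmx -> mpclosure deg orbit v ->
  mpclosure deg orbit (act h v).
Proof.
move=> hu [pv cv]; split=> [i|F IF].
  apply: contrapT => no.
  have z (k : K) : dgs k = i -> act h v k = 0.
    move=> e; apply/eqP/negPn/negP => nz; apply: no; exists k => //.
    by rewrite degsharpE e.
  have [k e nz] := pv i; have e' : dgs k = i by move: e; rewrite degsharpE => -[].
  have := rho_zero (minor (invmx h)) z e'.
  rewrite (_ : rho _ _ k = v k) => [v0|]; first by rewrite v0 eqxx in nz.
  rewrite -[RHS](rho_inv v k (minor_inv hu)); congr (rho _ _ _).
  by apply/funext => l; rewrite ffunE.
have [G [G1 _]] := act_pullback h F; rewrite pevE -G1; apply: cv => y cy.
by rewrite pevE G1; apply: IF; apply: act_cone.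
Qed.

Lemma dual_act_inv h V : h \in unitmx -> dual_act (invmx h) (dual_act h V) = V.
Proof.
move=> hu; apply/ffunP => k; rewrite ffunE.
have -> : (dual_act h V : K -> dual C) = rho (fun S T => inj (minor h S T)) V.
  by apply/funext => l; rewrite ffunE.
apply: rho_inv => S T e; rewrite -(rmorph_nat (@inj C)) -(minor_inv hu e).
by rewrite [RHS]rmorph_sum; apply: eq_bigr => U _; rewrite rmorphM.
Qed.

Lemma std_dual_act h V v : (forall k, std (V k) = v k) ->
  forall k, std (dual_act h V k) = act h v k.
Proof.
move=> lV k; rewrite !ffunE (rho_morph (@std C)); congr (rho _ _ _).
by apply/funext => l; rewrite /= lV.
Qed.

(** * Parameters for the orbit *)

Local Notation d := #|{: 'I_3 * 'I_4}|.
Implicit Types (x : {ffun 'I_d -> C}).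

Definition frame_at x : 'M[C]_4 := affine_frame (fun r c => x (enum_rank (r, c))).
Definition universal_frame : 'M[{mpoly C[#|'I_d|]}]_4 :=
  affine_frame (fun r c => pX C (enum_rank (r, c))).
Definition frame_coord (k : K) : {mpoly C[#|'I_d|]} := sharp (pl universal_frame) k.

Lemma pev_frame x : map_mx (pev x) universal_frame = frame_at x.
Proof.
by apply/matrixP => r c; rewrite !mxE; case: unlift => [r'|]; rewrite ?pevX ?rmorph1.
Qed.

Lemma frame_pt x : polpt frame_coord x = tetra_vec (frame_at x).
Proof.
apply/ffunP => k; rewrite !ffunE pevE sharp_morph; congr (sharp _ _).
by apply/funext => J; apply/funext => S; rewrite /pl map_minor pev_frame.
Qed.

Lemma frame_det x : mpeval (\det universal_frame) x = \det (frame_at x).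
Proof. by rewrite pevE -det_map_mx pev_frame. Qed.

Lemma scale_to_frame g : (forall c, g o0 c != 0) ->
  exists x, g = \matrix_(i, j) (g o0 j * frame_at x i j).
Proof.
move=> g0; exists [ffun i => g (lift o0 (enum_val i).1) (enum_val i).2 / g o0 (enum_val i).2].
apply/matrixP => i j; rewrite !mxE; case: unliftP => [r ->|->]; last by rewrite mulr1.
by rewrite ffunE enum_rankK /= mulrC divfK.
Qed.

Lemma frame_dense : (vanishing_ideal (multicone deg
    (polpt frame_coord @` [set x | mpeval (\det universal_frame) x != 0]))
  `<=` vanishing_ideal cone)%classic.
Proof.
move=> F IF y /coneE [g [t [gu t0 yE]]].
have -> : y = [ffun k => t (dgs k) * sharp (pl g) k] by apply/ffunP => k; rewrite ffunE.
have [G hG] := pol_comp (fun k : K => (t (dgs k))%:MP * sharp (pl (gen16 C)) k) F.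
have GE z : mpeval G z = mpeval F [ffun k => t (dgs k) * sharp (pl (mat16 z)) k].
  rewrite hG; congr mpeval; apply/ffunP => k; rewrite !ffunE pevE rmorphM pevC sharp_morph.
  congr (_ * sharp _ _).
  by apply/funext => J; apply/funext => S; rewrite /pl map_minor pev_gen16.
apply/eqP/negPn/negP => nz.
have nz' : mpeval G (vec16 g) != 0 by rewrite GE vec16K.
pose Q := \det (gen16 C) * \prod_(c : 'I_4) pX C ((o0, c) : 'I_4 * 'I_4).
have QE z : mpeval Q z != 0 -> mat16 z \in unitmx /\ forall c, mat16 z o0 c != 0.
  rewrite pevE rmorphM -det_map_mx pev_gen16 mulf_eq0 negb_or unitmxE unitfE => /andP [-> h].
  split=> // c; move: h; rewrite rmorph_prod => /prodf_neq0 /(_ c isT).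
  by rewrite -[pev _ _]/(pev z _) pevX mxE.
have [g1 g1u g1r] := regular_exists C.
have Q1 : mpeval Q (vec16 g1) != 0.
  rewrite pevE rmorphM -det_map_mx pev_gen16 vec16K mulf_neq0 -?unitfE -?unitmxE //.
  rewrite unitfE rmorph_prod; apply/prodf_neq0 => c _.
  by rewrite -[pev _ _]/(pev (vec16 g1) _) pevX ffunE /= reg1.
have [z [Gz /QE [zu z0]]] := mul_nonzero nz' Q1.
have [x gx] := scale_to_frame z0; set gz := mat16 z in zu z0 gx GE Gz.
have xu : \det (frame_at x) != 0.
  move: zu; rewrite unitmxE unitfE gx (_ : \matrix_(i, j) _ =
    frame_at x *m diag_mx (\row_j gz o0 j)); first by rewrite det_mulmx mulf_eq0 negb_or => /andP [].
  by apply/matrixP => i j; rewrite mul_mx_diag !mxE mulrC.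
have dz J : \prod_(j in J) gz o0 j != 0 by apply/prodf_neq0.
have plE J S : proper_set J -> #|S| = #|J| -> pl gz J S = \prod_(j in J) gz o0 j * pl (frame_at x) J S.
  by move=> _ e; rewrite {1}/pl {1}gx minor_cols.
move: Gz; rewrite GE IF ?eqxx //.
exists (tetra_vec (frame_at x)), (fun i => t i * scal (fun J => \prod_(j in J) gz o0 j) i).
split.
- by exists x; [rewrite /mkset frame_det|apply: frame_pt].
- by move=> i; rewrite mulf_neq0 ?scal_neq0.
apply/ffunP => k; rewrite ffunE (sharp_scale k plE) (rescaleE (@degsharpE R)) ffunE.
exact: mulrA.
Qed.

Definition set1_psub (c : 'I_4) : psub := Sub [set c]%SET (set_proper (cards1 c) isT).

Lemma card_set1_psub (c r : 'I_4) : #|[set r]%SET| == #|val (set1_psub c)|.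
Proof. by rewrite cards1 eq_sym; apply/eqP; apply: cards1. Qed.

Definition set1_ksub (c r : 'I_4) : ksub #|val (set1_psub c)| := ksub_of (card_set1_psub c r).

Definition frame_kk (i : 'I_d) : K := kY R (set1_ksub (enum_val i).2 (lift o0 (enum_val i).1)).
Definition frame_kk' (i : 'I_d) : K := kY R (set1_ksub (enum_val i).2 o0).

Lemma frame_entry x c r : tetra_vec (frame_at x) (kY R (set1_ksub c r)) = frame_at x r c.
Proof. by rewrite ffunE /= /pl minor_set1 ?cards1 // enum_set1 nminor1. Qed.

Lemma frame_coordE x i : polpt frame_coord x (frame_kk i) =
  x i * polpt frame_coord x (frame_kk' i) /\ polpt frame_coord x (frame_kk' i) != 0.
Proof.
rewrite frame_pt !frame_entry !mxE unlift_none liftK mulr1 oner_neq0.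
by rewrite -surjective_pairing enum_valK.
Qed.

Lemma frame_exists : exists x, mpeval (\det universal_frame) x != 0.
Proof.
have [g gu rg] := regular_exists C; have [x gx] := scale_to_frame (reg1 rg).
exists x; rewrite frame_det; move: gu; rewrite unitmxE unitfE {1}gx.
rewrite (_ : \matrix_(i, j) _ = frame_at x *m diag_mx (\row_j g o0 j)).
  by rewrite det_mulmx mulf_eq0 negb_or => /andP [].
by apply/matrixP => i j; rewrite mul_mx_diag !mxE mulrC.
Qed.

Lemma frame_orbit x : mpeval (\det universal_frame) x != 0 -> cone (polpt frame_coord x).
Proof.
move=> Hx; rewrite frame_pt; apply: sub_multicone; exists (frame_at x) => //.
by rewrite unitmxE unitfE -frame_det.
Qed.

End Orbit.

(** * Pencils in affine coordinates *)

(** In the affine Pluecker coordinates om, the members of a pencil run through a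
    line; eta is its direction, normalized by its slope coordinate. *)
Definition eta (A : comNzRingType) (om : {set 'I_4} -> {set 'I_4} -> A) I J S : A :=
  let U := I :|: J in let N := I :&: J in
  match #|I| with
  | 1 => if o0 \in S then 0 else if o1 \in S then 1 else
         if o2 \in S then om U [set o0; o2]%SET else om U [set o0; o3]%SET
  | 2 => let t := om U [set o0; o1; o3]%SET in
         if o0 \in S then if o1 \in S then 0 else if o2 \in S then 1 else t
         else if o1 \in S then if o2 \in S then om N [set o1]%SET else om N [set o1]%SET * t
         else om N [set o2]%SET * t - om N [set o3]%SET
  | _ => if o3 \notin S then 0 else if o2 \notin S then 1 else
         if o1 \notin S then om N [set o0; o2]%SET else om N [set o1; o2]%SET
  end.

Lemma pencil_step (F : fieldType) (N1 N2 D1 D2 k e x : F) : D1 != 0 -> D2 != 0 ->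
  k * e = x -> x = N2 * D1 - N1 * D2 -> N2 / D2 = N1 / D1 + k / (D1 * D2) * e.
Proof.
move=> h1 h2 h3 h4; rewrite mulrAC h3 h4; by field; rewrite h1 h2.
Qed.

Lemma proper_card I : proper_set I -> (0 < #|I| < 4)%N.
Proof. by move=> /andP [n0 nT]; case: (card_proper n0 nT) => ->. Qed.

Lemma card_set_proper n I : #|I| = n -> (0 < n < 4)%N -> proper_set I.
Proof. exact: set_proper. Qed.

Section Omega.
Variable F : fieldType.
Variable g : 'M[F]_4.
Hypothesis rg : regular g.

Definition omega I S : F :=
  if proper_set I && (#|S| == #|I|) then minor g S I / den g I else 0.

Lemma omegaE I S : proper_set I -> #|S| = #|I| -> omega I S = minor g S I / den g I.
Proof. by move=> pI e; rewrite /omega pI e eqxx. Qed.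

Lemma den_neq0 I : proper_set I -> den g I != 0.
Proof. by case/andP => n0 nT; apply: rg. Qed.

Lemma omega_lead I : proper_set I -> omega I (I0 #|I|) = 1.
Proof. by move=> pI; rewrite omegaE ?card_I0 ?card_le4 // divff // den_neq0. Qed.

Lemma omega_aff I : proper_set I -> omega I (K0 #|I|) = aff_coord g I.
Proof. by move=> pI; rewrite omegaE ?card_K0 ?proper_card. Qed.

Lemma pl_omega I S : proper_set I -> #|S| = #|I| -> pl g I S = den g I * omega I S.
Proof. by move=> pI e; rewrite omegaE // mulrC divfK // den_neq0. Qed.

Lemma om1 i r : omega [set i]%SET [set r]%SET = g r i / g o0 i.
Proof.
rewrite omegaE ?cards1 //; last exact: card_set_proper (cards1 i) _.
by rewrite coord1 minor_set1 ?cards1 // enum_set1 nminor1.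
Qed.

Lemma om2 i j k l S : uniq [:: i; j; k; l] -> #|S| = 2%N ->
  omega [set i; j]%SET S = nminor 2 g (enum S) [:: i; j] / m2 g o0 o1 i j.
Proof.
move=> U c2; have cI := card_set_uniq2 U; have [|c [hc h]] := minor_set2 F (i := i) (j := j).
  by rewrite /= inE (uniq4_neq U).
rewrite omegaE ?cI ?c2 //; last exact: card_set_proper cI _.
rewrite /den cI !h ?card_I0 // enum_I0 //= nminor2 -mulf_div divff ?mul1r //.
exact: sq1_neq0.
Qed.

Lemma om3 i j k l S : uniq [:: i; j; k; l] -> #|S| = 3%N ->
  omega [set i; j; k]%SET S = nminor 3 g (enum S) [:: i; j; k] / m3 g o0 o1 o2 i j k.
Proof.
move=> U c2; have cI := card_set_uniq3 U.
have [|c [hc h]] := minor_set3 F (i := i) (j := j) (k := k).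
  by rewrite /= !inE !(uniq4_neq U).
rewrite omegaE ?cI ?c2 //; last exact: card_set_proper cI _.
rewrite /den cI !h ?card_I0 // enum_I0 //= nminor3 -mulf_div divff ?mul1r //.
exact: sq1_neq0.
Qed.

Lemma enum_set_o2 (r s : 'I_4) : (r < s)%N -> enum [set r; s]%SET = [:: r; s].
Proof.
by elim/all_o: r; elim/all_o: s => // _; rewrite enum_set4 /= !inE.
Qed.

Lemma om2o i j k l (r s : 'I_4) : uniq [:: i; j; k; l] -> (r < s)%N ->
  omega [set i; j]%SET [set r; s]%SET = m2 g r s i j / m2 g o0 o1 i j.
Proof.
move=> U lt; rewrite (om2 U) ?enum_set_o2 ?nminor2 // cards2.
by rewrite (_ : r != s) //; apply: contraTneq lt => ->; rewrite ltnn.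
Qed.

Lemma om3o i j k l (t : 'I_4) : uniq [:: i; j; k; l] -> (1 < t)%N ->
  omega [set i; j; k]%SET [set o0; o1; t]%SET = m3 g o0 o1 t i j k / m3 g o0 o1 o2 i j k.
Proof.
move=> U; elim/all_o: t => // _; rewrite (om3 U) ?cardE enum_set4 /= !inE //= nminor3 //.
Qed.

Lemma adj_setops1 (i j k l : 'I_4) : uniq [:: i; j; k; l] ->
  ([set i; j] :|: [set i; k] = [set i; j; k])%SET /\ ([set i; j] :&: [set i; k] = [set i])%SET.
Proof.
move=> U; split; apply/finset.setP => x; rewrite !inE;
  by case: (uniq4_mem x U) => ->; rewrite ?eqxx ?(uniq4_neq U).
Qed.

Lemma adj_setops2 (i j k l : 'I_4) : uniq [:: i; j; k; l] ->
  ([set i; j; k] :&: [set i; j; l] = [set i; j])%SET.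
Proof.
move=> U; apply/finset.setP => x; rewrite !inE;
  by case: (uniq4_mem x U) => ->; rewrite ?eqxx ?(uniq4_neq U).
Qed.

(** The pencil of lines, of planes through a line, or of the lines through a
    point in a plane *)
Lemma pencil I J S : proper_set I -> adj I J -> #|S| = #|I| ->
  omega J S = omega I S + (omega J (K0 #|I|) - omega I (K0 #|I|)) * eta omega I J S.
Proof.
move=> pI aIJ cS; have /andP [/eqP cIJ /eqP cI] := aIJ.
have pJ : proper_set J by apply: card_set_proper (esym cIJ) (proper_card pI).
have lt4 : (#|I| < 4)%N by case/andP: (proper_card pI).
rewrite {1}cIJ !omega_aff //; move: cS {pI pJ aIJ}; case: (adjP cIJ cI lt4) => i j k l U.
- rewrite cards1 => cS; have [r [_ [_ [_ [_ ->]]]]] := card1_set cS.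
  rewrite (diff1 rg U) /eta cards1 !om1 !inE /=.
  have [h1 h2 h3] := And3 (reg1 rg i) (reg1 rg j) (reg2 rg U).
  have m2E s : g s j * g o0 i - g s i * g o0 j = m2 g o0 s i j by rewrite /m2; ring.
  elim/all_o: r => /=.
  + by apply: (pencil_step h1 h2 (mulr0 _)); rewrite m2E /m2; ring.
  + by apply: (pencil_step h1 h2 (mulr1 _)); rewrite m2E.
  + apply: (pencil_step (x := m2 g o0 o2 i j) h1 h2); last by rewrite m2E.
    by rewrite (om2o U) // mulrC divfK.
  apply: (pencil_step (x := m2 g o0 o3 i j) h1 h2); last by rewrite m2E.
  by rewrite (om2o U) // mulrC divfK.
- rewrite (card_set_uniq2 U) => cS; have U' : uniq [:: i; k; j; l] by uniq4.
  rewrite (diff2 rg U) (om2 U cS) (om2 U' cS) /eta (card_set_uniq2 U).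
  have [-> ->] := adj_setops1 U; rewrite !om1 (om3o U) //.
  have [h1 h2] := conj (reg2 rg U) (reg2 rg U'); have [h3 h0] := conj (reg3 rg U) (reg1 rg i).
  move: cS; rewrite cardE enum_set4 /=.
  case: (o0 \in S); case: (o1 \in S); case: (o2 \in S); case: (o3 \in S) => //= _;
    rewrite !nminor2.
  + by apply: (pencil_step h1 h2 (mulr0 _)); rewrite /m2; ring.
  + by apply: (pencil_step h1 h2 (mulr1 _)); rewrite /m3 /m2; ring.
  + apply: (pencil_step (x := g o0 i * m3 g o0 o1 o3 i j k) h1 h2).
      by field.
    by rewrite /m3 /m2; ring.
  + apply: (pencil_step (x := g o1 i * m3 g o0 o1 o2 i j k) h1 h2).
      by field.
    by rewrite /m3 /m2; ring.
  + apply: (pencil_step (x := g o1 i * m3 g o0 o1 o3 i j k) h1 h2).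
      by field; rewrite h3 h0.
    by rewrite /m3 /m2; ring.
  apply: (pencil_step (x := g o2 i * m3 g o0 o1 o3 i j k - g o3 i * m3 g o0 o1 o2 i j k) h1 h2).
    by field; rewrite h3 h0.
  by rewrite /m3 /m2; ring.
rewrite (card_set_uniq3 U) => cS; have U' : uniq [:: i; j; l; k] by uniq4.
rewrite (diff3 rg U) (om3 U cS) (om3 U' cS) /eta (card_set_uniq3 U) (adj_setops2 U).
rewrite !(om2o U) //.
have [h1 h2] := conj (reg3 rg U) (reg3 rg U'); have h3 := reg2 rg U.
move: cS; rewrite cardE enum_set4 /=.
case: (o0 \in S); case: (o1 \in S); case: (o2 \in S); case: (o3 \in S) => //= _;
  rewrite !nminor3.
+ by apply: (pencil_step h1 h2 (mulr0 _)); rewrite /m3 /m2; ring.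
+ by apply: (pencil_step h1 h2 (mulr1 _)); rewrite /m4 /m3 /m2; ring.
+ apply: (pencil_step (x := m2 g o0 o2 i j * m4 g i j k l) h1 h2).
    by field.
  by rewrite /m4 /m3 /m2; ring.
apply: (pencil_step (x := m2 g o1 o2 i j * m4 g i j k l) h1 h2).
  by field.
by rewrite /m4 /m3 /m2; ring.
Qed.

(** A line through a known point, and a plane through a known line, are
    determined by their first coordinates. *)
Lemma incidence2 (i j k l : 'I_4) : uniq [:: i; j; k; l] ->
  let p r := omega [set i]%SET [set r]%SET in
  let q r s := omega [set i; j]%SET [set r; s]%SET in
  [/\ q o1 o2 = p o1 * q o0 o2 - p o2, q o1 o3 = p o1 * q o0 o3 - p o3 &
      q o2 o3 = p o2 * q o0 o3 - p o3 * q o0 o2].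
Proof.
move=> U p q; rewrite /p /q !(om2o U) // !om1.
have [h1 h0] := conj (reg2 rg U) (reg1 rg i).
by split; rewrite /m2 in h1 *; field; rewrite h0 h1.
Qed.

Lemma incidence3 (i j k l : 'I_4) : uniq [:: i; j; k; l] ->
  let q r s := omega [set i; j]%SET [set r; s]%SET in
  let t r s u := omega [set i; j; k]%SET [set r; s; u]%SET in
  t o0 o2 o3 = q o0 o2 * t o0 o1 o3 - q o0 o3 /\ t o1 o2 o3 = q o1 o2 * t o0 o1 o3 - q o1 o3.
Proof.
move=> U q t; rewrite /q /t !(om2o U) // (om3o U) //.
rewrite !(om3 U) ?cardE !enum_set4 /= !inE //= !nminor3.
have [h1 h2] := conj (reg3 rg U) (reg2 rg U).
have e1 : m3 g o0 o2 o3 i j k * m2 g o0 o1 i j = m2 g o0 o2 i j * m3 g o0 o1 o3 i j k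
  - m2 g o0 o3 i j * m3 g o0 o1 o2 i j k by rewrite /m3 /m2; ring.
have e2 : m3 g o1 o2 o3 i j k * m2 g o0 o1 i j = m2 g o1 o2 i j * m3 g o0 o1 o3 i j k
  - m2 g o1 o3 i j * m3 g o0 o1 o2 i j k by rewrite /m3 /m2; ring.
split; apply: (mulIf h2).
  by rewrite mulrAC e1; field; rewrite h1 h2.
by rewrite mulrAC e2; field; rewrite h1 h2.
Qed.

End Omega.

(** * The standard charts *)

Definition wedge_along (A : comNzRingType) (E : finType) (X_ : E -> finType)
    (p q e : forall a : E, X_ a -> A) (a : E) (s : {dffun forall a : E, (X_ a * X_ a)%type}) : A :=
  (p a (s a).1 * e a (s a).2 - p a (s a).2 * e a (s a).1) *
    \prod_(a' | a' != a) (p a' (s a').1 * q a' (s a').2).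

Lemma wedge_along_morph (A B : comNzRingType) (f : {rmorphism A -> B}) (E : finType)
    (X_ : E -> finType) (p q e : forall a : E, X_ a -> A) a s :
  f (wedge_along p q e a s) = wedge_along (fun a x => f (p a x)) (fun a x => f (q a x))
    (fun a x => f (e a x)) a s.
Proof.
rewrite rmorphM rmorphB !rmorphM rmorph_prod; congr (_ * _).
by apply: eq_bigr => a' _; rewrite rmorphM.
Qed.

(* The coordinates of a wedge in terms of one of them, along a direction e *)
Lemma wedge_direction (A : comNzRingType) (E : finType) (X_ : E -> finType)
    (p q : forall a : E, X_ a -> A) (x : A) (e : forall a, X_ a -> A)
    (l n : forall a, X_ a) (a : E) (s s0 : {dffun forall a : E, (X_ a * X_ a)%type}) :
  (forall z, q a z = p a z + x * e a z) ->
  (forall a, p a (l a) = 1) -> (forall a, q a (l a) = 1) -> q a (n a) - p a (n a) = x ->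
  s0 = [ffun a' => (l a', if a' == a then n a' else l a')] ->
  wedge p q a s0 = x /\
  wedge p q a s = x * wedge_along p q e a s.
Proof.
move=> qE pl ql nx ->; split; rewrite wedgeE.
  rewrite !ffunE eqxx /= pl ql mul1r mulr1 nx big1 ?mulr1 // => a' ne.
  by rewrite !ffunE (negPf ne) /= pl ql mulr1.
by rewrite /wedge_along !qE mulrA; congr (_ * _); ring.
Qed.

Lemma cross_eq (A : comNzRingType) (l x z u w : A) :
  u = l * x -> w = l * z -> x * w = z * u.
Proof. by move=> -> ->; ring. Qed.

Section Chart.
Variable R : realType.
Local Notation K := (Ksharp R).
Implicit Types (b : hface R).

Lemma card_lead b (a : edge_of b) : #|I0 (level (val a))| == level (val a).
Proof. by rewrite card_I0 //; apply: card_le4. Qed.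
Lemma card_next b (a : edge_of b) : #|K0 (level (val a))| == level (val a).
Proof. by rewrite card_K0 //; apply: edge_card. Qed.

Definition lead_index b (a : edge_of b) : X_ a := ksub_of (card_lead a).
Definition next_index b (a : edge_of b) : X_ a := ksub_of (card_next a).

Definition slope_index b (a : edge_of b) : sindex b :=
  [ffun a' => (lead_index a', if a' == a then next_index a' else lead_index a')].

Definition kslope b (a : edge_of b) : K := kB a (slope_index a).

Section Values.
Variable A : comNzRingType.
Implicit Types (V : K -> A).

Definition om V J S : A :=
  if insub J : option psub is Some J' then
    if insub S : option (ksub #|val J'|) is Some S' then V (kY R S') else 0
  else 0.

Lemma omY V (x : psub) (z : ksub #|val x|) : om V (val x) (val z) = V (kY R z).
Proof. by rewrite /om !valK. Qed.

Definition slope V I J : A := om V J (K0 #|I|) - om V I (K0 #|I|).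

Definition direction V b (a : edge_of b) (z : X_ a) : A :=
  eta (om V) (lo (val a)) (hi (val a)) (val z).

(** The equations of the standard charts *)
Definition chart_rel V : Prop :=
  [/\ forall b (a : edge_of b) (z : X_ a),
        V (kE1 z) = wlo (om V) z /\ V (kE2 z) = whi (om V) z,
      forall I J S, proper_set I -> adj I J -> #|S| = #|I| ->
        om V J S = om V I S + slope V I J * eta (om V) I J S,
      forall b (a : edge_of b) s, V (kB a s) = V (kslope a) *
        wedge_along (@wlo R A b (om V)) (@whi R A b (om V)) (@direction V b) a s,
      forall b (a a' : edge_of b),
        slope V (lo (val a)) (hi (val a)) * V (kslope a') =
        slope V (lo (val a')) (hi (val a')) * V (kslope a) &
      let p r := om V [set o0]%SET [set r]%SET in
      let q r s := om V [set o0; o1]%SET [set r; s]%SET in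
      let t r s u := om V [set o0; o1; o2]%SET [set r; s; u]%SET in
      [/\ q o1 o2 = p o1 * q o0 o2 - p o2, q o1 o3 = p o1 * q o0 o3 - p o3,
          q o2 o3 = p o2 * q o0 o3 - p o3 * q o0 o2,
          t o0 o2 o3 = q o0 o2 * t o0 o1 o3 - q o0 o3 &
          t o1 o2 o3 = q o1 o2 * t o0 o1 o3 - q o1 o3]].

End Values.

Lemma om_morph (A B : comNzRingType) (f : {rmorphism A -> B}) V J S :
  f (om V J S) = om (fun k => f (V k)) J S.
Proof. by rewrite /om; case: insub => [J'|]; [case: insub => [S'|]|]; rewrite ?rmorph0. Qed.

Lemma eta_morph (A B : comNzRingType) (f : {rmorphism A -> B}) w I J S :
  f (eta w I J S) = eta (fun I S => f (w I S)) I J S.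
Proof.
rewrite /eta; case: #|I| => [|[|[|n]]]; case: (o0 \in S); case: (o1 \in S);
  case: (o2 \in S); case: (o3 \in S) => //=; by rewrite ?(rmorphM, rmorphB, rmorph0, rmorph1).
Qed.

Lemma chart_rel_transfer (P A B : comNzRingType) (T : Type) (V : K -> P)
    (e : {rmorphism P -> A}) (f : T -> {rmorphism P -> B}) :
  (forall F G, (forall t, f t F = f t G) -> e F = e G) ->
  (forall t, chart_rel (fun k => f t (V k))) -> chart_rel (fun k => e (V k)).
Proof.
move=> ef h.
have omE (D : comNzRingType) (i : {rmorphism P -> D}) :
    om (fun k => i (V k)) = fun J S => i (om V J S).
  by apply/funext => J; apply/funext => S; rewrite om_morph.
have etaE (D : comNzRingType) (i : {rmorphism P -> D}) I J S :
    eta (fun J S => i (om V J S)) I J S = i (eta (om V) I J S) by rewrite eta_morph.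
have slE (D : comNzRingType) (i : {rmorphism P -> D}) I J :
    slope (fun k => i (V k)) I J = i (slope V I J) by rewrite /slope omE rmorphB.
have waE (D : comNzRingType) (i : {rmorphism P -> D}) b (a : edge_of b) s :
    wedge_along (@wlo R D b (om (fun k => i (V k)))) (@whi R D b (om (fun k => i (V k))))
      (@direction D (fun k => i (V k)) b) a s =
    i (wedge_along (@wlo R P b (om V)) (@whi R P b (om V)) (@direction P V b) a s).
  rewrite wedge_along_morph omE; congr (wedge_along _ _ _ a s).
  apply: functional_extensionality_dep => a'; apply/funext => z.
  by rewrite /direction omE etaE.
have tr1 x J S : (forall t, f t x = om (fun k => f t (V k)) J S) ->
    e x = om (fun k => e (V k)) J S.
  by move=> hx; rewrite omE; apply: ef => t; rewrite hx omE.
have tr4 I J I' J' x z : (forall t, slope (fun k => f t (V k)) I J * f t x =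
      slope (fun k => f t (V k)) I' J' * f t z) ->
    slope (fun k => e (V k)) I J * e x = slope (fun k => e (V k)) I' J' * e z.
  move=> hx; rewrite !slE -!rmorphM; apply: ef => t; rewrite !rmorphM -!slE; exact: hx.
have tr5 x y z w : (forall t, f t x = f t y * f t z - f t w) -> e x = e y * e z - e w.
  by move=> hx; rewrite -rmorphM -rmorphB; apply: ef => t; rewrite rmorphB rmorphM.
have tr6 x y z w w' : (forall t, f t x = f t y * f t z - f t w * f t w') ->
    e x = e y * e z - e w * e w'.
  by move=> hx; rewrite -!rmorphM -rmorphB; apply: ef => t; rewrite rmorphB !rmorphM.
split.
- move=> b a z; split; apply: tr1 => t; case: (h t) => h1 _ _ _ _; [exact: (h1 b a z).1|].
  exact: (h1 b a z).2.
- move=> I J S pI aIJ cS; rewrite slE omE etaE -rmorphM -rmorphD; apply: ef => t.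
  rewrite rmorphD rmorphM -etaE -slE; case: (h t) => _ h2 _ _ _.
  by have := h2 I J S pI aIJ cS; rewrite omE.
- move=> b a s; rewrite waE -rmorphM; apply: ef => t; rewrite rmorphM -waE.
  by case: (h t) => _ _ h3 _ _; apply: h3.
- by move=> b a a'; apply: tr4 => t; case: (h t) => _ _ _ h4 _; apply: h4.
have h5 t : _ := let: And5 _ _ _ _ h5 := h t in h5.
move: h5 => /=; rewrite omE => h5.
split; [apply: tr5|apply: tr5|apply: tr6|apply: tr5|apply: tr5] => t;
  move: (h5 t); rewrite omE; by case.
Qed.

(** On a chart whose normalized coordinates include the leading Pluecker
    coordinates, a point is given by its affine Pluecker coordinates and by one
    scalar for each exceptional projective space. *)
Lemma chart_rel_omega (F : fieldType) (g : 'M[F]_4) (lam : hface R -> F) (y : K -> F) :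
  regular g ->
  (forall k, y k = (if k is inr (existT b (inr _)) then lam b else 1) * sharp (omega g) k) ->
  chart_rel y /\
  (forall b (a : edge_of b), y (kslope a) =
    lam b * (aff_coord g (hi (val a)) - aff_coord g (lo (val a)))).
Proof.
move=> rg yE.
have omy : om y = omega g.
  apply/funext => J; apply/funext => S; rewrite /om.
  case: insubP => [J' pJ JE|nJ]; last by rewrite /omega /proper_set (negPf nJ).
  case: insubP => [S' cS SE|nS]; last by rewrite /omega -JE (negPf nS) andbF.
  by rewrite yE mul1r -JE -SE.
have cross b (a : edge_of b) s : wedge (@wlo R F b (omega g)) (@whi R F b (omega g)) a (slope_index a) =
    slope y (lo (val a)) (hi (val a)) /\
  wedge (@wlo R F b (omega g)) (@whi R F b (omega g)) a s =
    slope y (lo (val a)) (hi (val a)) *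
    wedge_along (@wlo R F b (omega g)) (@whi R F b (omega g)) (@direction _ y b) a s.
  apply: (@wedge_direction _ _ _ _ _ _ (@direction _ y b) (@lead_index b) (@next_index b)).
  - move=> z; rewrite /slope /direction omy; apply: pencil => //; last exact: card_lo.
      exact: (vertex_proper a).2.
    exact: edge_adj.
  - by move=> a'; apply: omega_lead => //; apply: (vertex_proper a').2.
  - move=> a'; have pr := (vertex_proper a').1.
    have vE : val (lead_index a') = I0 #|hi (val a')| by rewrite -(card_hi (lead_index a')) (card_lo (lead_index a')).
    by rewrite /whi vE; apply: omega_lead.
  - by rewrite /slope omy.
  - by [].
have slE b (a : edge_of b) : y (kslope a) = lam b * slope y (lo (val a)) (hi (val a)).
  by rewrite yE /= (cross b a (slope_index a)).1.
split; last first.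
  move=> b a; rewrite slE /slope omy (omega_aff g (vertex_proper a).2).
  have e : #|lo (val a)| = #|hi (val a)| by rewrite -(card_lo (lead_index a)) (card_hi (lead_index a)).
  by rewrite e (omega_aff g (vertex_proper a).1).
split.
- by move=> b a z; rewrite !yE omy !mul1r.
- by move=> I J S pI aIJ cS; rewrite /slope omy; apply: pencil.
- move=> b a s; rewrite omy slE -mulrA yE; congr (_ * _); exact: (cross b a s).2.
- by move=> b a a'; apply: cross_eq (slE b a) (slE b a').
have U : uniq [:: o0; o1; o2; o3] by [].
by rewrite omy; have [h1 h2 h3] := incidence2 rg U; have [h4 h5] := incidence3 rg U; split.
Qed.

End Chart.

(** * Constant coordinates *)

Section Constant.
Variable C : fieldType.
Local Notation D := (dual C).
Implicit Types (z w : D).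

Definition const z : Prop := eps z = 0.

Lemma const0 : const 0. Proof. by []. Qed.
Lemma const1 : const 1. Proof. by []. Qed.
Lemma constD z w : const z -> const w -> const (z + w).
Proof. by rewrite /const epsD => -> ->; rewrite addr0. Qed.
Lemma constB z w : const z -> const w -> const (z - w).
Proof. by rewrite /const epsD epsN => -> ->; rewrite subr0. Qed.
Lemma constM z w : const z -> const w -> const (z * w).
Proof. by rewrite /const epsM => -> ->; rewrite mulr0 mul0r addr0. Qed.
Lemma const_prod (E : finType) (P : pred E) (f : E -> D) :
  (forall a, const (f a)) -> const (\prod_(a | P a) f a).
Proof. by move=> h; elim/big_rec: _ => [//|a x _]; apply: constM. Qed.

Lemma const_cancel z w : std z != 0 -> const z -> const (w * z) -> const w.
Proof.
by rewrite /const epsM => nz -> /eqP; rewrite mulr0 add0r mulf_eq0 (negPf nz) orbF => /eqP.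
Qed.

(** The position of one flag and the slopes of the edges determine all the
    faces of a tetrahedron. *)
Section Propagation.
Variable w : {set 'I_4} -> {set 'I_4} -> D.
Hypothesis w_card : forall J S, #|S| <> #|J| -> w J S = 0.
Hypothesis slopes : forall I J, proper_set I -> adj I J -> const (w J (K0 #|I|) - w I (K0 #|I|)).
Hypothesis w_pencil : forall I J S, proper_set I -> adj I J -> #|S| = #|I| ->
  w J S = w I S + (w J (K0 #|I|) - w I (K0 #|I|)) * eta w I J S.

Definition const_face J : Prop := forall S, const (w J S).

Lemma propagate I J : proper_set I -> adj I J -> const_face I ->
  (forall S, const (eta w I J S)) -> const_face J.
Proof.
move=> pI aIJ cI ce S; have [e|ne] := eqVneq #|S| #|J|; last by rewrite w_card //; apply/eqP.
have /andP [/eqP cIJ _] := aIJ.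
by rewrite (w_pencil pI aIJ (etrans e (esym cIJ))); apply: constD => //; apply: constM => //; apply: slopes.
Qed.

Lemma adj_uniq1 (i j k l : 'I_4) : uniq [:: i; j; k; l] -> adj [set i] [set j].
Proof.
move=> U; rewrite /adj !cards1 (_ : _ :&: _ = finset.set0) ?cards0 //.
by apply/finset.setP => x; rewrite !inE; case: eqP => // ->; rewrite (uniq4_neq U).
Qed.

Lemma adj_uniq2 (i j k l : 'I_4) : uniq [:: i; j; k; l] -> adj [set i; j] [set i; k].
Proof.
move=> U; have U' : uniq [:: i; k; j; l] by uniq4.
by rewrite /adj (card_set_uniq2 U) (card_set_uniq2 U') (adj_setops1 U).2 cards1.
Qed.

Lemma adj_uniq3 (i j k l : 'I_4) : uniq [:: i; j; k; l] -> adj [set i; j; k] [set i; j; l].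
Proof.
move=> U; have U' : uniq [:: i; j; l; k] by uniq4.
by rewrite /adj (card_set_uniq3 U) (card_set_uniq3 U') (adj_setops2 U) (card_set_uniq2 U).
Qed.

Lemma propagate1 (i j k l : 'I_4) : uniq [:: i; j; k; l] ->
  const_face [set i] -> const_face [set i; j] -> const_face [set j].
Proof.
move=> U c1 c2; apply: (propagate (card_set_proper (cards1 i) isT) (adj_uniq1 U) c1) => S.
by rewrite /eta cards1; case: ifP => _; [|case: ifP => _; [|case: ifP => _]]; try apply: c2.
Qed.

Lemma propagate2 (i j k l : 'I_4) : uniq [:: i; j; k; l] ->
  const_face [set i; j] -> const_face [set i] -> const_face [set i; j; k] ->
  const_face [set i; k].
Proof.
move=> U c1 c2 c3; have cI := card_set_uniq2 U.
apply: (propagate (card_set_proper cI isT) (adj_uniq2 U) c1) => S.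
rewrite /eta cI (adj_setops1 U).1 (adj_setops1 U).2.
case: (o0 \in S); case: (o1 \in S); case: (o2 \in S) => //=;
  by [apply: c2|apply: c3|apply: constM; [apply: c2|apply: c3]|
      apply: constB; [apply: constM; [apply: c2|apply: c3]|apply: c2]].
Qed.

Lemma propagate3 (i j k l : 'I_4) : uniq [:: i; j; k; l] ->
  const_face [set i; j; k] -> const_face [set i; j] -> const_face [set i; j; l].
Proof.
move=> U c1 c2; have cI := card_set_uniq3 U.
apply: (propagate (card_set_proper cI isT) (adj_uniq3 U) c1) => S.
by rewrite /eta cI (adj_setops2 U); case: ifP => _; [|case: ifP => _; [|case: ifP => _]];
  try apply: c2.
Qed.

Lemma set3C (i j k : 'I_4) : [set i; j; k]%SET = [set j; i; k]%SET.
Proof. by rewrite [[set i; j]%SET]finset.setUC. Qed.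
Lemma set3CA (i j k : 'I_4) : [set i; j; k]%SET = [set i; k; j]%SET.
Proof. by rewrite -finset.setUA [([set j] :|: _)%SET]finset.setUC finset.setUA. Qed.

Lemma const_faces : const_face [set o0] -> const_face [set o0; o1] ->
  const_face [set o0; o1; o2] -> forall J, proper_set J -> const_face J.
Proof.
move=> c0 c01 c012.
have c013 : const_face [set o0; o1; o3] by apply: (@propagate3 o0 o1 o2 o3).
have c02 : const_face [set o0; o2] by apply: (@propagate2 o0 o1 o2 o3).
have c03 : const_face [set o0; o3] by apply: (@propagate2 o0 o1 o3 o2).
have c023 : const_face [set o0; o2; o3] by apply: (@propagate3 o0 o2 o1 o3); rewrite // set3CA.
have c1 : const_face [set o1] by apply: (@propagate1 o0 o1 o2 o3).
have c2 : const_face [set o2] by apply: (@propagate1 o0 o2 o1 o3).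
have c3 : const_face [set o3] by apply: (@propagate1 o0 o3 o1 o2).
have c12 : const_face [set o1; o2].
  by apply: (@propagate2 o1 o0 o2 o3); rewrite // ?(set3C o1 o0) // finset.setUC.
have c13 : const_face [set o1; o3].
  by apply: (@propagate2 o1 o0 o3 o2); rewrite // ?(set3C o1 o0) // finset.setUC.
have c23 : const_face [set o2; o3].
  by apply: (@propagate2 o2 o0 o3 o1); rewrite // ?(set3C o2 o0) // finset.setUC.
have c123 : const_face [set o1; o2; o3].
  by apply: (@propagate3 o1 o2 o0 o3); rewrite // set3CA (set3C o1 o0).
move=> J /andP [n0 nT]; case: (card_proper n0 nT) => cJ.
- by have [i [_ [_ [_ [_ ->]]]]] := card1_set cJ; elim/all_o: i.
- have [i [j [k [l [U ->]]]]] := card2_set cJ.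
  by elim/all_o: i U; elim/all_o: j => //; rewrite finset.setUC.
have [i [j [k [l [U ->]]]]] := card3_set cJ; rewrite -(setC_uniq1 U).
elim/all_o: l {U}.
- by rewrite (@setC_uniq1 o1 o2 o3 o0).
- by rewrite (@setC_uniq1 o0 o2 o3 o1).
- by rewrite (@setC_uniq1 o0 o1 o3 o2).
by rewrite (@setC_uniq1 o0 o1 o2 o3).
Qed.

End Propagation.
End Constant.

Lemma dual_point_inj (C : numFieldType) (K I : finType) (deg : K -> option I) M v :
  zclosure (multicone deg M) v -> dual_point deg M [ffun k => inj (v k) : dual C].
Proof.
move=> cv F IF; apply: dual_eqP.
  rewrite std_dev (_ : [ffun _ => _] = v); first exact: cv.
  by apply/ffunP => k; rewrite !ffunE.
have -> : [ffun k => inj (v k)] = dvec v [ffun=> 0] by apply/ffunP => k; rewrite !ffunE.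
by rewrite eps_dev big1 // => i _; rewrite ffunE mulr0.
Qed.

(** * Tangent vectors on a standard chart *)

Lemma slope_cancel (C : fieldType) (s s' z z' : dual C) (w w' : C) :
  s * z' = s' * z -> z' * inj w = z * inj w' -> std z != 0 -> w != 0 -> const s -> const s'.
Proof.
move=> h1 h2 nz nw cs.
have : z * (s' * inj w - s * inj w') = 0.
  rewrite mulrBr mulrA [z * s']mulrC -h1 -mulrA h2 mulrCA; exact: subrr.
move/(dual_cancel nz)/eqP; rewrite subr_eq0 => /eqP h3.
by apply: (@const_cancel C (inj w)) => //; rewrite h3; apply: constM.
Qed.

Lemma const_wedge_along (C : fieldType) (E : finType) (X_ : E -> finType)
    (p q e : forall a : E, X_ a -> dual C) a s :
  (forall a x, const (p a x)) -> (forall a x, const (q a x)) ->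
  (forall a x, const (e a x)) -> const (wedge_along p q e a s).
Proof.
move=> hp hq he; apply: constM; first by apply: constB; apply: constM.
by apply: const_prod => a'; apply: constM.
Qed.

Lemma const_eta (C : fieldType) (w : {set 'I_4} -> {set 'I_4} -> dual C) I J S :
  (forall I S, const (w I S)) -> const (eta w I J S).
Proof.
move=> h; rewrite /eta; case: #|I| => [|[|[|n]]]; case: (o0 \in S); case: (o1 \in S);
  case: (o2 \in S); case: (o3 \in S) => //=; by do ?[apply: constB|apply: constM].
Qed.

Lemma lead_sets : [/\ I0 1 = [set o0]%SET, I0 2 = [set o0; o1]%SET
  & I0 3 = [set o0; o1; o2]%SET].
Proof. by split; apply/finset.setP => x; rewrite !inE; elim/all_o: x. Qed.

Lemma const_base (C : fieldType) (w : {set 'I_4} -> {set 'I_4} -> dual C) :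
  (forall J S, #|S| <> #|J| -> w J S = 0) ->
  (forall J, proper_set J -> w J (I0 #|J|) = 1) ->
  let p r := w [set o0]%SET [set r]%SET in
  let q r s := w [set o0; o1]%SET [set r; s]%SET in
  let t r s u := w [set o0; o1; o2]%SET [set r; s; u]%SET in
  [/\ q o1 o2 = p o1 * q o0 o2 - p o2, q o1 o3 = p o1 * q o0 o3 - p o3,
      q o2 o3 = p o2 * q o0 o3 - p o3 * q o0 o2,
      t o0 o2 o3 = q o0 o2 * t o0 o1 o3 - q o0 o3 &
      t o1 o2 o3 = q o1 o2 * t o0 o1 o3 - q o1 o3] ->
  const (p o1) -> const (p o2) -> const (p o3) -> const (q o0 o2) -> const (q o0 o3) ->
  const (t o0 o1 o3) ->
  [/\ const_face w [set o0]%SET, const_face w [set o0; o1]%SET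
    & const_face w [set o0; o1; o2]%SET].
Proof.
move=> hc hl p q t [i1 i2 i3 i4 i5] p1 p2 p3 q2 q3 t3.
have [l1 l2 l3] := lead_sets.
have U : uniq [:: o0; o1; o2; o3] by [].
have c1 : #|[set o0]%SET| = 1%N by rewrite cards1.
have [c2 c3] := conj (card_set_uniq2 U) (card_set_uniq3 U).
have p0 : p o0 = 1 by have := hl _ (card_set_proper c1 isT); rewrite c1 l1.
have q1 : q o0 o1 = 1 by have := hl _ (card_set_proper c2 isT); rewrite c2 l2.
have t2 : t o0 o1 o2 = 1 by have := hl _ (card_set_proper c3 isT); rewrite c3 l3.
have q12 : const (q o1 o2) by rewrite i1; apply: constB => //; apply: constM.
have q13 : const (q o1 o3) by rewrite i2; apply: constB => //; apply: constM.
have q23 : const (q o2 o3) by rewrite i3; apply: constB; apply: constM.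
split=> S.
- have [e|/eqP ne] := eqVneq #|S| 1%N; last by rewrite hc ?c1.
  have [r [_ [_ [_ [_ ->]]]]] := card1_set e.
  by elim/all_o: r => //; rewrite -/(p _) p0.
- have [e|/eqP ne] := eqVneq #|S| 2%N; last by rewrite hc ?c2.
  have [i [j [k [l [V ->]]]]] := card2_set e; rewrite -/(q _ _).
  have q01 : const (q o0 o1) by rewrite q1.
  have qC r s : q r s = q s r by rewrite /q [[set r; s]%SET]finset.setUC.
  by elim/all_o: i V; elim/all_o: j => // _; first [by []|by rewrite qC].
have [e|/eqP ne] := eqVneq #|S| 3%N; last by rewrite hc ?c3.
have [i [j [k [l [V ->]]]]] := card3_set e; rewrite -(setC_uniq1 V).
elim/all_o: l {V}.
- by rewrite (@setC_uniq1 o1 o2 o3 o0) // -/(t _ _ _) i5; apply: constB => //; apply: constM.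
- by rewrite (@setC_uniq1 o0 o2 o3 o1) // -/(t _ _ _) i4; apply: constB => //; apply: constM.
- by rewrite (@setC_uniq1 o0 o1 o3 o2).
by rewrite (@setC_uniq1 o0 o1 o2 o3) // -/(t _ _ _) t2.
Qed.

Section ChartTangent.
Variables (R : realType) (C : numFieldType).
Local Notation K := (Ksharp R).
Local Notation deg := (@degsharp R).
Local Notation orb := (@orbit R C).
Local Notation pol := {mpoly C[#|K|]}.
Implicit Types (b : hface R) (y : {ffun K -> C}) (V : {ffun K -> dual C}).

Lemma card_leadY (J : psub) : #|I0 #|val J| | == #|val J|.
Proof. by rewrite card_I0 // card_le4. Qed.

Definition leadY (J : psub) : ksub #|val J| := ksub_of (card_leadY J).

Definition slopes (A : Type) (V : K -> A) : {ffun Kcore R -> A} :=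
  [ffun k => V (kslope (tagged k))].

Variable c : Isharp R -> K.
Hypothesis dgc : forall i, dgs (c i) = i.
Hypothesis cY : forall J : psub, c (inl J) = kY R (leadY J).
Hypothesis cE1 : forall b (a : edge_of b),
  c (inr (Tagged (@Ifib R) (inl (inl a)))) = kE1 (lead_index a).
Hypothesis cE2 : forall b (a : edge_of b),
  c (inr (Tagged (@Ifib R) (inl (inr a)))) = kE2 (lead_index a).

Lemma normalized_chart y : normalized deg orb c y ->
  chart_rel y /\ multicone (@degcore R) (@grads R C) (slopes y).
Proof.
move=> [/coneE [g [t [gu t0 yE]]] y1].
have rg : regular g.
  move=> J n0 nT; have pJ : proper_set J by rewrite /proper_set n0.
  have := y1 (inl (Sub J pJ)); rewrite yE cY; apply: contra_eq_neq => z.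
  have -> : sharp (pl g) (kY R (leadY (Sub J pJ))) = 0 by exact: z.
  by rewrite mulr0 eq_sym oner_neq0.
have yO k : y k = t (dgs k) * scal (den g) (dgs k) * sharp (omega g) k.
  rewrite yE -mulrA; congr (_ * _); apply: sharp_scale => J S pJ e.
  exact: pl_omega.
have one i : sharp (omega g) (c i) = 1 -> t i * scal (den g) i = 1.
  by move=> h; rewrite -(y1 i) yO h mulr1 dgc.
pose lam b := t (inr (Tagged (@Ifib R) (inr tt : Ifib b)))
  * scal (den g) (inr (Tagged (@Ifib R) (inr tt : Ifib b))).
have yL k : y k = (if k is inr (existT b (inr _)) then lam b else 1) * sharp (omega g) k.
  rewrite yO; elim/K_ind: k => [J x|b a x|b a x|b a s] //; congr (_ * _); apply: one.
  - by rewrite cY; apply: omega_lead => //; apply: (valP J).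
  - by rewrite cE1; apply: omega_lead => //; apply: (vertex_proper a).2.
  rewrite cE2; have e : val (lead_index a) = I0 #|hi (val a)|.
    by rewrite -(card_hi (lead_index a)) (card_lo (lead_index a)).
  by rewrite [sharp _ _]/(omega g (hi (val a)) (val (lead_index a))) e;
    apply: omega_lead => //; apply: (vertex_proper a).1.
have [crel sl] := chart_rel_omega rg yL; split=> //.
exists (grad R g), lam; split; first by exists g.
  move=> b; apply/negP => /eqP l0; have := y1 (inr (Tagged (@Ifib R) (inr tt : Ifib b))).
  move: (dgc (inr (Tagged (@Ifib R) (inr tt : Ifib b)))).
  move: (c _) => k; rewrite yO => ->; rewrite -/(lam b) l0 mul0r => /eqP.
  by rewrite eq_sym oner_eq0.
by apply/ffunP => -[b a]; rewrite !ffunE /= sl.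
Qed.

Variable v : {ffun K -> C}.
Hypothesis vS : mpclosure deg orb v.
Hypothesis v0 : forall i, v (c i) != 0.

Definition normal (V : {ffun K -> dual C}) : {ffun K -> dual C} :=
  [ffun k => V k * dinv (V (c (dgs k)))].

Section DualPoint.
Variable V : {ffun K -> dual C}.
Hypothesis lV : forall k, std (V k) = v k.
Hypothesis dV : dual_point deg orb V.

Lemma normal_eq (F G : pol) : (forall y, normalized deg orb c y -> pev y F = pev y G) ->
  dev (normal V) F = dev (normal V) G.
Proof.
move=> h; apply/eqP; rewrite -subr_eq0 -rmorphB; apply/eqP.
apply: (dual_point_normalize (@degsharpE R) dgc dV) => [i|y ny]; first by rewrite lV.
by rewrite pevE rmorphB h // subrr.
Qed.

Lemma normal_rel : chart_rel (normal V).
Proof.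
have -> : (normal V : K -> dual C) = fun k => dev (normal V) (pX C k).
  by apply/funext => k; rewrite devX.
apply: (@chart_rel_transfer R pol (dual C) C {y | normalized deg orb c y} (fun k => pX C k)
  (dev (normal V)) (fun z => pev (sval z))) => [F G h|[y ny]].
  by apply: normal_eq => y ny; apply: (h (exist _ y ny)).
have -> : (fun k => pev (sval (exist _ y ny)) (pX C k)) = y.
  by apply/funext => k; rewrite pevX.
by have [] := normalized_chart ny.
Qed.

Lemma normal_one i : normal V (c i) = 1.
Proof. by rewrite ffunE dgc mul_dinv // lV. Qed.

Lemma normal_core : dual_point (@degcore R) (@grads R C) (slopes (normal V)).
Proof.
move=> F IF; have [G [G1 G2]] := compose_pol (fun k : Kcore R => pX C (kslope (tagged k))) F.
have -> : slopes (normal V) =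
    [ffun k : Kcore R => dev (normal V) (pX C (kslope (tagged k)))].
  by apply/ffunP => k; rewrite !ffunE devX !ffunE.
rewrite -G2 -(rmorph0 (dev (normal V))); apply: normal_eq => y ny; rewrite rmorph0 G1.
have [_ h] := normalized_chart ny; rewrite -pevE; apply: IF.
have -> : [ffun k : Kcore R => pev y (pX C (kslope (tagged k)))] = slopes y by
  apply/ffunP => k; rewrite !ffunE pevX.
exact: h.
Qed.

End DualPoint.

Definition vn : {ffun K -> C} := [ffun k => v k / v (c (dgs k))].

Lemma std_normal V : (forall k, std (V k) = v k) -> forall k, std (normal V k) = vn k.
Proof. by move=> lV k; rewrite !ffunE stdM /= !lV. Qed.

Let V0 : {ffun K -> dual C} := [ffun k => inj (v k)].
Let lV0 k : std (V0 k) = v k. Proof. by rewrite ffunE. Qed.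
Let dV0 : dual_point deg orb V0. Proof. by apply: dual_point_inj; case: vS. Qed.

Lemma blow_coord b : exists (a : edge_of b) (s : sindex b),
  c (inr (Tagged (@Ifib R) (inr tt : Ifib b))) = kB a s.
Proof.
move: (dgc (inr (Tagged (@Ifib R) (inr tt : Ifib b)))); move: (c _) => k.
pose exceptional (i : Isharp R) : bool :=
  if i is inr x then if tagged x is inr _ then true else false else false.
elim/K_ind: k => [J x|b' a x|b' a x|b' a s] e.
- by have := congr1 exceptional e.
- by have := congr1 exceptional e.
- by have := congr1 exceptional e.
have e' : b' = b := congr1 (fun i : Isharp R => if i is inr x then tag x else b) e.
by move: a s {e}; rewrite e' => a s; exists a, s.
Qed.

Lemma slope_point b : exists a : edge_of b, vn (kslope a) != 0.
Proof.
have [a [s e]] := blow_coord b; exists a; apply/negP => /eqP z.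
have [_ _ /(_ b a s) h _ _] := normal_rel lV0 dV0.
have := normal_one lV0 (inr (Tagged (@Ifib R) (inr tt : Ifib b))); rewrite e h.
move/(congr1 (@std C)); rewrite stdM (std_normal lV0) z mul0r => /eqP.
by rewrite eq_sym oner_eq0.
Qed.

Lemma slopes_point : is_point (@degcore R) (slopes vn).
Proof.
move=> b; have [a nz] := slope_point b; exists (Tagged (@edge_of R) a) => //.
by rewrite [slopes _ _]ffunE.
Qed.

Lemma slopes_closure : zclosure (multicone (@degcore R) (@grads R C)) (slopes vn).
Proof.
move=> F IF; have := normal_core lV0 dV0 IF; move/(congr1 (@std C)); rewrite std_dev.
rewrite (_ : [ffun _ => _] = slopes vn); first by move=> ->.
apply/ffunP => k; rewrite [LHS]ffunE [slopes _ k]ffunE [RHS]ffunE; exact: std_normal.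
Qed.

(** Twelve functions: three for the tangent space of the core, the three slopes
    which measure the size of the tetrahedron in each rank, and the coordinates
    of one flag. *)
Lemma chart_functionals : exists P : 'I_3 * 'I_4 -> pol,
  forall V, (forall k, std (V k) = v k) -> dual_point deg orb V ->
  (forall i, const (dev (normal V) (P i))) -> forall k, const (normal V k).
Proof.
have [P hP] := core_tangent slopes_point slopes_closure.
have pull (i : 'I_3) : exists G : pol, forall V : {ffun K -> dual C},
    dev V G = dev (slopes V) (P i).
  have [G [_ G2]] := compose_pol (fun k : Kcore R => pX C (kslope (tagged k))) (P i).
  exists G => V; rewrite G2; congr (dev _ _); apply/ffunP => k.
  by rewrite !ffunE devX.
have [Q hQ] := choice pull.
have size_edge (i : 'I_3) : exists k : Kcore R, val (tag k) = simplex i.+1 /\ vn (kslope (tagged k)) != 0.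
  have [b eb] : exists b : hface R, val b = simplex i.+1.
    by apply: hface_simplex; case: i => [[|[|[|]]]].
  by have [a nz] := slope_point b; exists (Tagged (@edge_of R) a).
have [kz hz] := choice size_edge.
pose flag (i : 'I_3) (j : bool) : {set 'I_4} * {set 'I_4} :=
  if j then nth ([set o0], [set o3])%SET [:: ([set o0], [set o1]); ([set o0], [set o2])]%SET i
  else nth ([set o0; o1; o2], [set o0; o1; o3])%SET
    [:: ([set o0; o1], [set o0; o2]); ([set o0; o1], [set o0; o3])]%SET i.
pose flag_poly i j : pol := om (fun k => pX C k) (flag i j).1 (flag i j).2.
pose slope_poly (i : 'I_3) : pol := let a := val (tagged (kz i)) in
  slope (fun k => pX C k) (lo a) (hi a).
exists (fun i : 'I_3 * 'I_4 => nth (Q i.1) [:: slope_poly i.1; flag_poly i.1 true; flag_poly i.1 false] i.2).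
move=> V lV dV hV.
have flag_const i j : const (om (normal V) (flag i j).1 (flag i j).2).
  have -> : (normal V : K -> dual C) = fun k => dev (normal V) (pX C k).
    by apply/funext => k; rewrite devX.
  rewrite -om_morph; case: j.
    exact: (hV (i, @Ordinal 4 1 isT)).
  exact: (hV (i, @Ordinal 4 2 isT)).
have slope_const i : const (slope (normal V) (lo (val (tagged (kz i)))) (hi (val (tagged (kz i))))).
  have -> : (normal V : K -> dual C) = fun k => dev (normal V) (pX C k).
    by apply/funext => k; rewrite devX.
  rewrite /slope -!om_morph -rmorphB; exact: (hV (i, @Ordinal 4 0 isT)).
have prop b (a a' : edge_of b) : normal V (kslope a) * inj (vn (kslope a')) =
    normal V (kslope a') * inj (vn (kslope a)).
  have := hP (slopes (normal V)) _ (normal_core lV dV) _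
    (Tagged (@edge_of R) a) (Tagged (@edge_of R) a') erefl.
  rewrite ![slopes _ _]ffunE; apply=> [k|j].
    by rewrite ![slopes _ _]ffunE; apply: std_normal.
  by rewrite -hQ; apply: (hV (j, @Ordinal 4 3 isT)).
have [rKE rP rB rM rI] := normal_rel lV dV.
have slope_edge i (e : edge_of (tag (kz i))) :
    const (slope (normal V) (lo (val e)) (hi (val e))).
  have [_ nz] := hz i; apply: (slope_cancel (rM _ (tagged (kz i)) e) (prop _ _ _) _ nz) => //.
  by rewrite std_normal.
have slopes_const I J : proper_set I -> adj I J -> const (slope (normal V) I J).
  move=> pI aIJ; have /andP [/eqP cIJ _] := aIJ; have /andP [I0 I4] := proper_card pI.
  have lt3 : (#|I|.-1 < 3)%N by rewrite -ltnS prednK.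
  have eb : val (tag (kz (Ordinal lt3))) = simplex #|I|.
    by rewrite (hz (Ordinal lt3)).1; congr simplex; apply: prednK.
  have [||e he _] := @edge_ex R (tag (kz (Ordinal lt3))) I J aIJ.
  - by rewrite eb in_simplex.
  - by rewrite eb in_simplex -cIJ.
  have := slope_edge _ e; case: he => -[-> ->] //.
  by rewrite /slope cIJ /const !epsD !epsN => /eqP; rewrite subr_eq0 => /eqP ->; rewrite subrr.
have om_card J S : #|S| <> #|J| -> om (normal V) J S = 0.
  move=> ne; rewrite /om; case: insubP => // J' _ JE; case: insubP => // S' /eqP cS _.
  by case: ne; rewrite cS JE.
have om_lead J : proper_set J -> om (normal V) J (I0 #|J|) = 1.
  move=> pJ; rewrite -(normal_one lV (inl (Sub J pJ))) cY -omY.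
  by congr (om _ _ _).
have faces : forall J, proper_set J -> const_face (om (normal V)) J.
  have [f1 f2 f3] : [/\ const_face (om (normal V)) [set o0]%SET,
      const_face (om (normal V)) [set o0; o1]%SET & const_face (om (normal V)) [set o0; o1; o2]%SET].
    apply: (const_base om_card om_lead rI).
  - exact: (flag_const (@Ordinal 3 0 isT) true).
  - exact: (flag_const (@Ordinal 3 1 isT) true).
  - exact: (flag_const (@Ordinal 3 2 isT) true).
  - exact: (flag_const (@Ordinal 3 0 isT) false).
  - exact: (flag_const (@Ordinal 3 1 isT) false).
  - exact: (flag_const (@Ordinal 3 2 isT) false).
  exact: (const_faces om_card slopes_const rP f1 f2 f3).
have om_const J S : const (om (normal V) J S).
  have [pJ|nJ] := boolP (proper_set J); first exact: faces.
  by rewrite /om insubN.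
have along_const b (a : edge_of b) s : const (wedge_along (@wlo R _ b (om (normal V)))
    (@whi R _ b (om (normal V))) (@direction R _ (normal V) b) a s).
  apply: const_wedge_along => a' z; [exact: om_const|exact: om_const|exact: const_eta].
elim/K_ind => [J x|b a x|b a x|b a s].
- by rewrite -omY.
- by rewrite (rKE b a x).1; apply: om_const.
- by rewrite (rKE b a x).2; apply: om_const.
rewrite (rB b a s); apply: constM => //.
have [a0 [s0 e]] := blow_coord b.
have one : normal V (kslope a0) * _ = 1 := etrans (esym (rB b a0 s0))
  (etrans (congr1 (normal V) (esym e)) (normal_one lV _)).
have [c0 nz] : const (normal V (kslope a0)) /\ vn (kslope a0) != 0.
  split; last first.
    apply/negP => /eqP z; have := congr1 (@std C) one.
    by rewrite stdM (std_normal lV) z mul0r => /eqP; rewrite eq_sym oner_eq0.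
  apply: const_cancel (along_const b a0 s0) _; last by rewrite one.
  apply/negP => /eqP z; have := congr1 (@std C) one.
  by rewrite stdM z mulr0 => /eqP; rewrite eq_sym oner_eq0.
have : const (normal V (kslope a) * inj (vn (kslope a0))).
  by rewrite prop; apply: constM.
by apply: const_cancel.
Qed.

End ChartTangent.

(** * The closure of the orbit is nonsingular *)

Section OrbitClosure.
Variables (R : realType) (C : numFieldType).
Local Notation K := (Ksharp R).
Local Notation deg := (@degsharp R).
Local Notation orb := (@orbit R C).
Local Notation cone := (multicone deg orb).
Local Notation pol := {mpoly C[#|K|]}.
Implicit Types (b : hface R) (v y : {ffun K -> C}) (V : {ffun K -> dual C}).

Lemma point_coord v i : is_point deg v -> exists2 k, dgs k = i & v k != 0.
Proof.
by move=> /(_ i) [k e nz]; exists k => //; move: e; rewrite degsharpE => -[].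
Qed.

(** A general translate of a point is transverse to the flag at infinity. *)
Lemma transverse_translate v : is_point deg v ->
  exists2 h, h \in unitmx & forall J : psub, act h v (kY R (leadY J)) != 0.
Proof.
move=> pv.
have [|h hu hI] := @generic_frame C
    (fun J T => if proper_set J then om v J T else (T == J)%:R).
  move=> J; have [pJ|nJ] := boolP (proper_set J); last by exists J; rewrite ?eqxx ?oner_neq0.
  have [k e nz] := point_coord (inl (Sub J pJ : psub)) pv.
  elim/K_ind: k e nz => [x z|b a x|b a x|b a s] // [e] nz.
  have xJ : val x = J by rewrite e.
  exists (val z); first by rewrite -xJ; apply/eqP/(valP z).
  by rewrite -xJ omY.
exists h => // J; have := hI (val J); have pJ : proper_set (val J) by apply: (valP J).
rewrite pJ -(sum_ksub #|val J| (fun T => minor h (I0 #|val J|) T * om v (val J) T)).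
rewrite ffunE rhoY; congr (_ != _); apply: eq_bigr => T _; by rewrite omY.
Qed.

Lemma cone_om y g (t : Isharp R -> C) J : (forall k, y k = t (dgs k) * sharp (pl g) k) ->
  proper_set J -> exists t', forall S, #|S| = #|J| -> om y J S = t' * pl g J S.
Proof.
move=> yE pJ; exists (t (inl (Sub J pJ : psub))) => S /eqP cS.
have := omY y (Sub S cS : ksub #|val (Sub J pJ : psub)|); rewrite yE; exact.
Qed.

Lemma closure_mul v (F1 F2 G1 G2 : pol) : zclosure cone v ->
  (forall y, cone y -> pev y F1 * pev y F2 = pev y G1 * pev y G2) ->
  pev v F1 * pev v F2 = pev v G1 * pev v G2.
Proof.
move=> cv h; apply/eqP; rewrite -subr_eq0 -!rmorphM -rmorphB; apply/eqP/cv => y cy.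
by rewrite pevE rmorphB !rmorphM h // subrr.
Qed.

Lemma om_pev v J S : pev v (om (fun k => pX C k) J S) = om v J S.
Proof. by rewrite om_morph; congr (om _ _ _); apply/funext => k; rewrite pevX. Qed.

(* The two subspaces of an edge are those of the tetrahedron *)
Lemma closure_edge v J (T : Type) (kE : T -> K) (f : T -> {set 'I_4}) :
  zclosure cone v -> proper_set J -> (forall x, #|f x| = #|J|) ->
  (forall g x, sharp (pl g) (kE x) = pl g J (f x) :> C) ->
  (forall x x', dgs (kE x) = dgs (kE x')) ->
  forall x x', v (kE x') * om v J (f x) = v (kE x) * om v J (f x').
Proof.
move=> cv pJ cf sE dE x x'; rewrite -!om_pev -(pevX v (kE x)) -(pevX v (kE x')).
apply: (closure_mul cv) => y /coneE [g [t [_ _ yE]]]; have [t' h1] := cone_om yE pJ.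
by rewrite !pevX !om_pev !h1 // !yE !sE (dE x x'); ring.
Qed.

Lemma closure_lead v J (T : Type) (kE : T -> K) (f : T -> {set 'I_4}) x0 :
  zclosure cone v -> proper_set J -> (forall x, #|f x| = #|J|) ->
  (forall g x, sharp (pl g) (kE x) = pl g J (f x) :> C) ->
  (forall x x', dgs (kE x) = dgs (kE x')) ->
  om v J (I0 #|J|) != 0 -> f x0 = I0 #|J| -> (exists x, v (kE x) != 0) -> v (kE x0) != 0.
Proof.
move=> cv pJ cf sE dE nl f0 [x nz]; have := closure_edge cv pJ cf sE dE x x0.
rewrite f0 => e; apply: contraTneq isT => z.
by move: e; rewrite z mul0r => /esym/eqP; rewrite mulf_eq0 (negPf nz) (negPf nl).
Qed.

Lemma lead_edges v : mpclosure deg orb v ->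
  (forall J : psub, v (kY R (leadY J)) != 0) ->
  forall b (a : edge_of b), v (kE1 (lead_index a)) != 0 /\ v (kE2 (lead_index a)) != 0.
Proof.
move=> [pv cv] v0 b a.
have omv J : proper_set J -> om v J (I0 #|J|) != 0.
  move=> pJ; have := v0 (Sub J pJ : psub); rewrite -omY; exact.
have cH : #|hi (val a)| = level (val a) := eqP (edge_of_card a).
have cl : I0 (level (val a)) = I0 #|hi (val a)| by rewrite cH.
split.
  have [k e nz] := point_coord (inr (Tagged (@Ifib R) (inl (inl a) : Ifib b))) pv.
  exact: (closure_lead (kE := @kE1 R b a) (f := val) (x0 := lead_index a) cv (vertex_proper a).2
    (@card_lo R b a) (fun g x => erefl) (fun x x' => erefl) (omv _ (vertex_proper a).2)
    erefl (kE1_of (P := fun k => v k != 0) e nz)).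
have [k e nz] := point_coord (inr (Tagged (@Ifib R) (inl (inr a) : Ifib b))) pv.
exact: (closure_lead (kE := @kE2 R b a) (f := val) (x0 := lead_index a) cv (vertex_proper a).1
  (@card_hi R b a) (fun g x => erefl) (fun x x' => erefl) (omv _ (vertex_proper a).1)
  cl (kE2_of (P := fun k => v k != 0) e nz)).
Qed.

Definition proportional V v : Prop :=
  forall k k' : K, dgs k = dgs k' -> V k * inj (v k') = V k' * inj (v k).

Lemma chart_tangent v : mpclosure deg orb v ->
  (forall J : psub, v (kY R (leadY J)) != 0) ->
  exists (Q : 'I_3 * 'I_4 -> pol) (c : Isharp R -> K), forall V,
    (forall k, std (V k) = v k) -> dual_point deg orb V ->
    (forall i, const (dev V (Q i))) -> forall k, V k = V (c (dgs k)) * inj (v k / v (c (dgs k))).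
Proof.
move=> vS v0; have le := lead_edges vS v0; have [pv cv] := vS.
have blow b : exists k : K, dgs k = inr (Tagged (@Ifib R) (inr tt : Ifib b)) /\ v k != 0.
  by have [k e nz] := point_coord (inr (Tagged (@Ifib R) (inr tt : Ifib b))) pv; exists k.
have [kb hkb] := choice blow.
pose c (i : Isharp R) : K := match i with
  | inl J => kY R (leadY J)
  | inr x => match tagged x with
    | inl (inl a) => kE1 (lead_index a)
    | inl (inr a) => kE2 (lead_index a)
    | inr _ => kb (tag x)
    end
  end.
have dgc i : dgs (c i) = i.
  by case: i => [J|[b [[a|a]|[]]]] //=; have [] := hkb b.
have vc i : v (c i) != 0.
  case: i => [J|[b [[a|a]|[]]]] //=; [exact: (le b a).1|exact: (le b a).2|].
  by have [] := hkb b.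
have [P hP] := chart_functionals dgc (fun J : psub => erefl) (fun b a => erefl) (fun b a => erefl) vS vc.
have clear_den (i : 'I_3 * 'I_4) : exists G : pol, forall V, (forall k, std (V k) = v k) ->
    const (dev V G) -> const (dev (normal c V) (P i)).
  have [N [G [_ hG]]] := homogenize (@dgs R) c (P i - (pev (vn c v) (P i))%:MP).
  exists G => V lV; have Vc j : std (V (c j)) != 0 by rewrite lV.
  rewrite (hG V Vc) -/(normal c V) mulrC => h.
  have s0 : std (dev (normal c V) (P i - (pev (vn c v) (P i))%:MP)) = 0.
    by rewrite rmorphB stdD stdN devC (std_pev _ (std_normal c lV)) subrr.
  have : const (dev (normal c V) (P i - (pev (vn c v) (P i))%:MP)).
    have sd : std (dev V (chart_den C c)) != 0.
      by rewrite std_dev; apply/chart_den_neq0 => j; rewrite ffunE lV.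
    have sdN : std (dev V (chart_den C c) ^+ N) != 0 by rewrite rmorphXn expf_neq0.
    by move: h; rewrite /const epsM s0 mul0r add0r => /eqP; rewrite mulf_eq0 (negPf sdN) orbF => /eqP.
  by rewrite /const rmorphB epsD epsN devC /= subr0.
have [Q hQ] := choice clear_den; exists Q, c => V lV dV hV k.
have ck : const (normal c V k) by apply: (hP V lV dV) => i; apply: hQ.
have sk := std_normal c lV k.
have -> : inj (v k / v (c (dgs k))) = normal c V k.
  by apply: dual_eqP; rewrite ?ck // sk ffunE.
rewrite ffunE mulrCA mul_dinv ?mulr1 // lV; exact: vc.
Qed.

Lemma orbit_tangent v : mpclosure deg orb v ->
  exists Q : 'I_3 * 'I_4 -> pol, forall V, (forall k, std (V k) = v k) ->
    dual_point deg orb V -> (forall i, const (dev V (Q i))) -> proportional V v.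
Proof.
move=> vS; have [pv _] := vS; have [h hu htr] := transverse_translate pv.
have [Q [c hQ]] := chart_tangent (act_closure hu vS) htr.
have pull (i : 'I_3 * 'I_4) : exists G : pol, forall V, dev V G = dev (dual_act h V) (Q i).
  by have [G [_ hG]] := act_pullback h (Q i); exists G.
have [Q' hQ'] := choice pull; exists Q' => V lV dV hV.
have WE := hQ (dual_act h V) (std_dual_act h lV) (dual_act_point hu dV)
  (fun i => etrans (congr1 (@eps C) (esym (hQ' i V))) (hV i)).
pose t i : dual C := dual_act h V (c i).
pose sg := rho (minor (invmx h)) (fun k => act h v k / act h v (c (dgs k))).
have VE k : V k = t (dgs k) * inj (sg k).
  rewrite -{1}(dual_act_inv V hu) ffunE (rho_scale _ _ (t := t) WE) -/(t _); congr (_ * _).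
  by rewrite -rho_morph.
have vE k : v k = std (t (dgs k)) * sg k by rewrite -lV VE stdM.
by move=> k k' e; rewrite !VE !vE !rmorphM e; ring.
Qed.

Theorem orbit_nonsingular : nonsingular_variety deg (mpclosure deg orb).
Proof.
have [x0 Hx0] := @frame_exists C.
apply: (@nonsingular_variety_closure _ _ _ _ (@dgs R) (@degsharpE R) _ _
  (@frame_coord R C) (\det (@universal_frame C)) x0 (@frame_kk R) (@frame_kk' R)) => //.
- exact: orbit_point.
- exact: frame_orbit.
- exact: frame_dense.
- by move=> x _ i; apply: frame_coordE.
move=> v vS; have [Q hQ] := orbit_tangent vS.
have [B hB] := functionals_matrix v (fun i : 'I_#|{: 'I_3 * 'I_4}| => Q (enum_val i)); exists B => V lV dV VB.
have cQ i : const (dev V (Q i)) by rewrite -(enum_rankK i) /const (hB V lV) VB mxE.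
exact: (hQ V lV dV cQ).
Qed.

End OrbitClosure.

(** * The complete space of tetrahedra *)

Section Complete.
Variable R : realType.
Local Notation C := R[i].
Local Notation tetra := ({set 'I_4} -> {vspace 'cV[C]_4}).
Implicit Types (p : tetra) (b : hface R).

Lemma coordsharpE p (k : Ksharp R) :
  coordsharp p k = sharp (fun I S => plucker (p I) S) k.
Proof.
elim/K_ind: k => [J x|b a x|b a x|b a s]; rewrite ffunE.
- by rewrite /= ffunE.
- by [].
- by [].
by rewrite sharpB wedgeE.
Qed.

Lemma coordsharp_gsp (g : 'M[C]_4) : g \in unitmx -> exists t : Isharp R -> C,
  (forall i, t i != 0) /\ coordsharp (gsp g) = rescale (@degsharp R) t (tetra_vec R g).
Proof.
move=> gu; have ex (I : {set 'I_4}) : exists c : C, c != 0 /\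
    forall S : {set 'I_4}, #|S| = #|I| -> plucker (gsp g I) S = c * minor g S I.
  by have [c c0 h] := plucker_gsp I gu; exists c.
have [c hc] := choice ex; exists (scal c); split.
  by move=> i; apply: scal_neq0 => J; have [] := hc J.
apply/ffunP => k; rewrite coordsharpE (rescaleE (@degsharpE R)) [tetra_vec _ _ _]ffunE.
by apply: sharp_scale => J S _ e; have [_ ->] := hc J.
Qed.

Lemma multicone_coordsharp :
  multicone (@degsharp R) (@coordsharp R @` @Xo R)%classic =
  multicone (@degsharp R) (@orbit R C).
Proof.
apply/seteqP; split; apply: (subset_trans _ (@multiconeM _ _ _ _ _)); apply: multiconeS.
  move=> _ [p /XoP [g gu ->] <-]; have [t [t0 ->]] := coordsharp_gsp gu.
  by exists (tetra_vec R g), t; split=> //; exists g.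
move=> _ [g gu ->]; have [t [t0 e]] := coordsharp_gsp gu.
exists (coordsharp (gsp g)), (fun i => (t i)^-1); split.
- by exists (gsp g) => //; apply/XoP; exists g.
- by move=> i; rewrite invr_eq0.
by apply/ffunP => k; rewrite e !(rescaleE (@degsharpE R)) mulKf.
Qed.

Lemma gsp_in_E g b : g \in unitmx -> (@E R b `\` @D R b)%classic (u b (gsp g)).
Proof.
move=> gu; have Xg : X (gsp g).
  split=> [I|]; first exact: dim_gsp.
  apply: sub_mpclosure => [_ [q Xq <-]|]; first exact: coordY_point.
  by apply: sub_multicone; exists (gsp g) => //; apply/XoP; exists g.
split.
  split=> // a; split; split; rewrite /= ?dim_gsp //.
  - by apply: gspS; apply: finset.subsetIl.
  - by apply: gspS; apply: finset.subsetUl.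
  - by apply: gspS; apply: finset.subsetIr.
  - by apply: gspS; apply: finset.subsetUr.
  exact/eqP/edge_of_card.
move=> [_ h]; have [a _] := hface_edge b.
by have /eqP := edge_of_neq a; apply; apply: (gsp_inj gu); apply: (h a).
Qed.

(** The closure of the image of the open orbit in the product of all the
    coordinate spaces lies in the fibre product of the blowups. *)
Lemma closure_in_Esharp :
  (mpclosure (@degsharp R) (@coordsharp R @` @Xo R) `<=` @Esharp R)%classic.
Proof.
move=> v [pv cv]; split=> // b; split.
  move=> [J|x].
    have [k e nz] := point_coord (inl J) pv; case: k e nz => [y|y] // [e] nz.
    by exists (inl y); rewrite ?ffunE //= e.
  have [k e nz] := point_coord (inr (Tagged (@Ifib R) x)) pv.
  case: k e nz => [y|[b' y]] e nz.
    by have := congr1 (fun i : Isharp R => if i is inr _ then true else false) e.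
  have e' : b' = b := congr1 (fun i : Isharp R => if i is inr x then tag x else b) e.
  move: y e nz; rewrite e' => y e nz; exists (inr y); last by rewrite ffunE.
  have E : degfib y = x := Tagged_inj e.
  by rewrite /= E.
move=> F IF; have [G hG] := pol_comp (fun k : KB b => match k with
  | inl x => pX C (inl x : Ksharp R) | inr x => pX C (kfib x) end) F.
have GE (w : {ffun Ksharp R -> C}) : mpeval G w = mpeval F (proj_blowup b w).
  by rewrite hG; congr mpeval; apply/ffunP => -[x|x]; rewrite !ffunE pevE pevX.
rewrite -GE; apply: cv => _ [_ [t [[p Xp <-] t0 ->]]]; rewrite GE; apply: IF.
have [g gu pE] := (XoP p).1 Xp.
exists (coordB (u b p)), (fun i => match i with
  | inl J => t (inl J) | inr x => t (inr (Tagged (@Ifib R) x)) end); split.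
- by exists (u b p) => //; rewrite pE; apply: gsp_in_E.
- by case=> [J|x]; apply: t0.
by apply/ffunP => -[x|x]; rewrite !ffunE.
Qed.

Lemma Xtilde_closure : @Xtilde R = mpclosure (@degsharp R) (@orbit R C).
Proof.
have -> : mpclosure (@degsharp R) (@orbit R C) =
    mpclosure (@degsharp R) (@coordsharp R @` @Xo R)%classic.
  by rewrite /mpclosure multicone_coordsharp.
apply/seteqP; split=> [v []//|v cv]; split=> //; exact: closure_in_Esharp.
Qed.

End Complete.

Theorem theorem7p6 (R : realType) :
  nonsingular_variety (@degcore R) (@core R) /\
  nonsingular_variety (@degsharp R) (@Xtilde R).
Proof.
split; first exact: core_nonsingular.
rewrite Xtilde_closure; exact: orbit_nonsingular.
Qed.
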